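(* There is a hereditary graph class $\mathcal{C}$ such that FO model checking on $\mathcal{C}$ is FPT, $\mathcal{C}$ has unbounded twin-width, and every graph in $\mathcal{C}$ can be realised as the intersection graph of a family of segments of each of the following types: (1) (possibly degenerate) axis-parallel unit segments; (2) axis-parallel segments in general position whose lengths take only two values (these two values may depend on the graph $G\in\mathcal{C}$); (3) axis-parallel segments in general position with lengths in $[1,1+\epsilon]$, for any fixed $\epsilon>0$; (4) unit segments in general position, even when the segments are restricted to be either vertical, or horizontal rotated by $+\epsilon$, or horizontal rotated by $-\epsilon$ (for any fixed $\epsilon > 0$).
   Context: The intersection graph of a family of segments has the segments as vertices, two adjacent iff they intersect (in case (1), intersections between two horizontal or two vertical segments also count as edges, i.e. the family is allowed to be degenerate). A class is hereditary if closed under induced subgraphs. Twin-width: in a graph $G$, vertex sets $X,Y$ are non-homogeneous if there are both an edge and a non-edge between them. For a partition $\mathcal{P}$ of $V(G)$, the error graph has the parts as vertices, two distinct parts adjacent iff non-homogeneous; the error degree is its maximum degree. A contraction sequence is a sequence of partitions from the partition into singletons to $\{V(G)\}$, each obtained from the previous by merging two parts; its width is the maximum error degree along it; $\mathsf{tww}(G)$ is the minimum width of a contraction sequence. Unbounded twin-width means $\sup_{G\in\mathcal{C}}\mathsf{tww}(G)=\infty$. FO model checking on $\mathcal{C}$: given $G\in\mathcal{C}$ and a first-order sentence $\phi$ over the language of graphs, decide $G\models\phi$; it is FPT if solvable in time $f(|\phi|)\cdot|G|^{O(1)}$ for a computable $f$.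
   Formalization: In (4), ε is restricted to 0 < ε < π/2: at ε = π/2 all three directions are vertical, so segments in general position are pairwise disjoint and the claim fails; other angles that are not multiples of π/2 give the same directions as one in this range. *)

(* Defs.v *)
From HB Require Import structures.
From mathcomp Require Import all_boot all_order all_algebra.
From mathcomp Require Import reals trigo.

Set Implicit Arguments.
Unset Strict Implicit.
Unset Printing Implicit Defensive.
Import Order.TTheory GRing.Theory Num.Theory.

(* Vertices are numbered, so that a graph can be fed to a machine.  Every finite
   simple graph is isomorphic to one of these, and hereditary classes (below)
   are closed under isomorphism, hence under renumbering. *)
Record sgraph := SGraph {
  nv : nat;
  adj : rel 'I_nv;
  adj_sym : symmetric adj;
  adj_irr : irreflexive adj }.

Definition induced_subgraph (H G : sgraph) : Prop :=
  exists2 h : 'I_(nv H) -> 'I_(nv G),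
    injective h & forall x y, adj (h x) (h y) = adj x y.

Definition hereditary (C : sgraph -> Prop) : Prop :=
  forall G H, C G -> induced_subgraph H G -> C H.

Section TwinWidth.
Variable G : sgraph.
Local Notation V := 'I_(nv G).

Definition nonhomogeneous (X Y : {set V}) : bool :=
  [exists x in X, exists y in Y, adj x y] &&
  [exists x in X, exists y in Y, ~~ adj x y].

Definition error_degree (P : {set {set V}}) : nat :=
  \max_(X in P) #|[set Y in P | (Y != X) && nonhomogeneous X Y]|.

Definition singletons : {set {set V}} := [set [set x] | x : V].

Definition merge_two (P Q : {set {set V}}) : bool :=
  [exists X in P, exists Y in P,
     (X != Y) && (Q == (X :|: Y) |: (P :\ X :\ Y))].

(* [s] lists the partitions that come after the partition into singletons. *)
Definition contraction_sequence (s : seq {set {set V}}) : bool :=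
  path merge_two singletons s && (last singletons s == [set [set: V]]).

Definition contraction_width (s : seq {set {set V}}) : nat :=
  \max_(P <- singletons :: s) error_degree P.

Definition is_tww (w : nat) : Prop :=
  (exists2 s, contraction_sequence s & contraction_width s = w) /\
  (forall s, contraction_sequence s -> w <= contraction_width s).

End TwinWidth.

Definition unbounded_tww (C : sgraph -> Prop) : Prop :=
  forall k, exists G w, [/\ C G, is_tww G w & k < w].

(* [fo m] is the type of formulas with free variables among 'I_m, as de Bruijn
   indices: a quantifier binds index 0 and shifts the others up by one. *)
Inductive fo : nat -> Type :=
| FEq m of 'I_m & 'I_m : fo m
| FAdj m of 'I_m & 'I_m : fo m
| FNot m of fo m : fo m
| FAnd m of fo m & fo m : fo m
| FOr m of fo m & fo m : fo m
| FEx m of fo m.+1 : fo m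
| FAll m of fo m.+1 : fo m.

Definition sentence := fo 0.

Fixpoint sat (G : sgraph) m (phi : fo m) : m.-tuple 'I_(nv G) -> bool :=
  match phi with
  | FEq _ i j => fun v => tnth v i == tnth v j
  | FAdj _ i j => fun v => adj (tnth v i) (tnth v j)
  | FNot _ p => fun v => ~~ sat p v
  | FAnd _ p q => fun v => sat p v && sat q v
  | FOr _ p q => fun v => sat p v || sat q v
  | FEx _ p => fun v => [exists x, sat p (cons_tuple x v)]
  | FAll _ p => fun v => [forall x, sat p (cons_tuple x v)]
  end.

Definition models (G : sgraph) (phi : sentence) : bool :=
  sat phi ([tuple] : 0.-tuple 'I_(nv G)).

Fixpoint fo_size m (phi : fo m) : nat :=
  match phi with
  | FEq _ _ _ => 1
  | FAdj _ _ _ => 1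
  | FNot _ p => (fo_size p).+1
  | FAnd _ p q => (fo_size p + fo_size q).+1
  | FOr _ p q => (fo_size p + fo_size q).+1
  | FEx _ p => (fo_size p).+1
  | FAll _ p => (fo_size p).+1
  end.

(* Random access machines with uniform cost.  Without multiplication the largest
   bit length in use grows by at most one per step, up to constants of the
   program, so running times are polynomially related to those of Turing
   machines. *)
Inductive instr :=
| IConst (r k : nat)
| IAdd (r s t : nat)
| ISub (r s t : nat)
| IHalf (r s : nat)
| ILoad (r s : nat)
| IStore (r s : nat)
| IJump (l : nat)
| IJzero (r l : nat).

Definition program := seq instr.

Record config := Config { pc : nat; reg : nat -> nat; mem : nat -> nat }.

Definition upd (f : nat -> nat) (a v : nat) : nat -> nat :=
  fun b => if b == a then v else f b.

Definition exec_instr (i : instr) (c : config) : config :=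
  let: Config p g m := c in
  match i with
  | IConst r k => Config p.+1 (upd g r k) m
  | IAdd r s t => Config p.+1 (upd g r (g s + g t)) m
  | ISub r s t => Config p.+1 (upd g r (g s - g t)) m
  | IHalf r s => Config p.+1 (upd g r (g s)./2) m
  | ILoad r s => Config p.+1 (upd g r (m (g s))) m
  | IStore r s => Config p.+1 g (upd m (g r) (g s))
  | IJump l => Config l g m
  | IJzero r l => Config (if g r == 0 then l else p.+1) g m
  end.

(* A machine halts when the program counter leaves the program. *)
Definition halted (P : program) (c : config) : bool := size P <= pc c.

Definition step (P : program) (c : config) : config :=
  if halted P c then c else exec_instr (nth (IJump 0) P (pc c)) c.

(* The input word is stored in memory from cell 0 on, and its length in
   register 0; the output is read from register 0. *)
Definition initial (w : seq nat) : config :=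
  Config 0 (fun r => if r == 0 then size w else 0) (nth 0 w).

Definition computes_within (P : program) (w : seq nat) (out t : nat) : Prop :=
  let c := iter t (step P) (initial w) in halted P c /\ reg c 0 = out.

Definition computable (f : nat -> nat) : Prop :=
  exists P, forall k, exists t, computes_within P [:: k] (f k) t.

Definition encode_graph (G : sgraph) : seq nat :=
  nv G :: [seq nat_of_bool (adj i j) | i <- enum 'I_(nv G), j <- enum 'I_(nv G)].

Fixpoint encode_fo m (phi : fo m) : seq nat :=
  match phi with
  | FEq _ i j => [:: 0; val i; val j]
  | FAdj _ i j => [:: 1; val i; val j]
  | FNot _ p => 2 :: encode_fo p
  | FAnd _ p q => 3 :: encode_fo p ++ encode_fo q
  | FOr _ p q => 4 :: encode_fo p ++ encode_fo q
  | FEx _ p => 5 :: encode_fo p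
  | FAll _ p => 6 :: encode_fo p
  end.

(* The base is |V(G)| + 1 rather than |V(G)|: this only matters for the graph
   without vertices, the factor 2^c being absorbed in f otherwise. *)
Definition fo_model_checking_fpt (C : sgraph -> Prop) : Prop :=
  exists (P : program) (f : nat -> nat) (c : nat),
    computable f /\
    forall (G : sgraph) (phi : sentence), C G ->
      computes_within P (encode_graph G ++ encode_fo phi)
        (nat_of_bool (models G phi)) (f (fo_size phi) * (nv G).+1 ^ c).

Section Segments.
Local Open Scope ring_scope.
Variable R : realType.

Definition point := (R * R)%type.

Definition segment := (point * point)%type.

Definition on_segment (s : segment) (z : point) : Prop :=
  exists2 t : R, 0 <= t <= 1 &
    z = ((1 - t) * s.1.1 + t * s.2.1, (1 - t) * s.1.2 + t * s.2.2).

Definition intersect (s1 s2 : segment) : Prop :=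
  exists2 z, on_segment s1 z & on_segment s2 z.

Definition seg_length (s : segment) : R :=
  Num.sqrt ((s.2.1 - s.1.1) ^+ 2 + (s.2.2 - s.1.2) ^+ 2).

Definition horizontal (s : segment) : Prop := s.1.2 = s.2.2.
Definition vertical (s : segment) : Prop := s.1.1 = s.2.1.
Definition axis_parallel (s : segment) : Prop := horizontal s \/ vertical s.

(* Parallel to the image of the x-axis under the rotation of angle theta; the
   endpoints are in no particular order, so r may be negative. *)
Definition horizontal_rotated (theta : R) (s : segment) : Prop :=
  exists r : R, s.2.1 - s.1.1 = r * cos theta /\ s.2.2 - s.1.2 = r * sin theta.

Definition on_line (s : segment) (z : point) : Prop :=
  (s.2.1 - s.1.1) * (z.2 - s.1.2) = (s.2.2 - s.1.2) * (z.1 - s.1.1).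

(* Segments of a family in general position: no two on a common line, no
   endpoint of one on another, and no three through a common point.  In
   particular, parallel segments do not intersect. *)
Definition general_position (I : finType) (s : I -> segment) : Prop :=
  [/\ forall i j, i != j ->
        ~ (on_line (s i) (s j).1 /\ on_line (s i) (s j).2),
      forall i j, i != j ->
        ~ on_segment (s i) (s j).1 /\ ~ on_segment (s i) (s j).2 &
      forall i j k z, i != j -> j != k -> i != k ->
        ~ [/\ on_segment (s i) z, on_segment (s j) z & on_segment (s k) z]].

Definition realises (G : sgraph) (s : 'I_(nv G) -> segment) : Prop :=
  forall i j, adj i j <-> i != j /\ intersect (s i) (s j).

Definition unit_axis_parallel_graph (G : sgraph) : Prop :=
  exists s : 'I_(nv G) -> segment,
    realises s /\ forall i, axis_parallel (s i) /\ seg_length (s i) = 1.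

Definition two_lengths_axis_parallel_graph (G : sgraph) : Prop :=
  exists (l1 l2 : R) (s : 'I_(nv G) -> segment),
    [/\ 0 < l1, 0 < l2, realises s, general_position s &
        forall i, axis_parallel (s i) /\
                  (seg_length (s i) = l1 \/ seg_length (s i) = l2)].

Definition almost_unit_axis_parallel_graph (eps : R) (G : sgraph) : Prop :=
  exists s : 'I_(nv G) -> segment,
    [/\ realises s, general_position s &
        forall i, axis_parallel (s i) /\ 1 <= seg_length (s i) <= 1 + eps].

(* Meant for 0 < eps < pi / 2: at eps = pi / 2 the three directions coincide. *)
Definition unit_three_directions_graph (eps : R) (G : sgraph) : Prop :=
  exists s : 'I_(nv G) -> segment,
    [/\ realises s, general_position s &
        forall i, seg_length (s i) = 1 /\
          [\/ vertical (s i), horizontal_rotated eps (s i)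
            | horizontal_rotated (- eps) (s i)]].

End Segments.

(* Main.v *)
(** The class consists of the induced subgraphs of the following grids.  There are
    [t] left vertices, [t] right vertices and [t ^ 2] wires; the wire [(s, s')] is
    a path with [l + 1] vertices, the first of which is adjacent to the left
    vertices [j >= s] and the last to the right vertices [j >= s'].

    Twin-width: at the first time when two left (or two right) vertices are merged,
    the part containing them sees the starts of [t] wires inhomogeneously, so most
    of these starts lie in few parts; following the wires, many of their ends lie
    in a common part, which is inhomogeneous to many right vertices, still unmerged.
    With [t] exponential in [l] this forces a large error degree.

    Model checking: if [l] is at least [2 ^ (q + 1)], a sentence of rank [q] cannot
    tell which start is connected to which end, so the wires may be rewired to be
    consecutive blocks of a word over ten letters, from which the graph is read off.
    The program guesses six vertices that determine the two half graphs, computes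
    the word, checks that the graph is a rewiring of it, and shortens the word to
    one of bounded length with the same type, on which the sentence is evaluated.
    If no guess succeeds then [l] is small, and the graph has bounded size.

    Segments: the orders of the wires at both ends are encoded by small shifts of
    the segments, and each wire is a row of unit segments, a staircase or a
    zigzag. *)
Require Import Defs.
From mathcomp Require Import all_boot.
From mathcomp Require Import zify.
From Stdlib Require Import Classical ClassicalEpsilon FunctionalExtensionality.
Set Implicit Arguments.
Unset Strict Implicit.
Unset Printing Implicit Defensive.

(** * A compiler for random access machines *)

(** Deleting vertices may break wires, so the word cannot follow the whole grid: only wires with
    both ends present and active in the half graphs are rewired, while fragments get a place of
    their own. The program does not trust its guess. It accepts one only after a check from which
    equivalence with the word follows for an arbitrary graph; the grid structure serves only to
    prove that some guess passes. The threshold [2 ^ (q + 1)] comes from a game in which the place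
    where two wires are exchanged is kept at distance at least [2 ^ r] from all pebbles while [r]
    rounds remain. In the class, the width [tk k] of a grid is tied to its wire length [lk k]; this
    is why short wires force a bounded graph. Types of words are never written down: a table of
    equality of types for pairs of factors suffices. Since the running time concerns a concrete
    machine, the program is written in a small language of bounded sums and loops; its compiler is
    verified once, with a cost polynomial in the largest loop bound. *)

Inductive exp :=
| EVar (x : nat)
| ECst (k : nat)
| EAdd (a b : exp)
| ESub (a b : exp)
| EGet (T : nat) (i : exp)
| ESum (x : nat) (b a : exp).

Inductive stm :=
| SSkip
| SSet (T : nat) (i a : exp)
| SSeq (s s' : stm)
| SIf (c : exp) (s s' : stm)
| SFor (x : nat) (b : exp) (s : stm).

Definition store := nat -> nat -> nat.

Definition setst (st : store) T i v : store :=
  fun T' i' => if (T' == T) && (i' == i) then v else st T' i'.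

Fixpoint ev (env : nat -> nat) (st : store) (e : exp) : nat :=
  match e with
  | EVar x => env x
  | ECst k => k
  | EAdd a b => ev env st a + ev env st b
  | ESub a b => ev env st a - ev env st b
  | EGet T i => st T (ev env st i)
  | ESum x b a => \sum_(0 <= v < ev env st b) ev (upd env x v) st a
  end.

Fixpoint exec (env : nat -> nat) (st : store) (s : stm) : store :=
  match s with
  | SSkip => st
  | SSet T i a => setst st T (ev env st i) (ev env st a)
  | SSeq s s' => exec env (exec env st s) s'
  | SIf c s s' => if 0 < ev env st c then exec env st s else exec env st s'
  | SFor x b s => iteri (ev env st b) (fun v st' => exec (upd env x v) st' s) st
  end.

(** All bounds of sums met during the evaluation are at most [B]. The running time will be
    polynomial in such a [B], with a degree that depends on the code only. *)
Fixpoint bnde (B : nat) (env : nat -> nat) (st : store) (e : exp) : Prop :=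
  match e with
  | EVar _ => True
  | ECst _ => True
  | EAdd a b => bnde B env st a /\ bnde B env st b
  | ESub a b => bnde B env st a /\ bnde B env st b
  | EGet _ i => bnde B env st i
  | ESum x b a => [/\ bnde B env st b, ev env st b <= B &
      forall v, v < ev env st b -> bnde B (upd env x v) st a]
  end.

Fixpoint bnds (B : nat) (env : nat -> nat) (st : store) (s : stm) : Prop :=
  match s with
  | SSkip => True
  | SSet _ i a => bnde B env st i /\ bnde B env st a
  | SSeq s s' => bnds B env st s /\ bnds B env (exec env st s) s'
  | SIf c s s' => bnde B env st c /\
      (if 0 < ev env st c then bnds B env st s else bnds B env st s')
  | SFor x b s => [/\ bnde B env st b, ev env st b <= B &
      forall v, v < ev env st b ->
        bnds B (upd env x v)
          (iteri v (fun v st' => exec (upd env x v) st' s) st) s]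
  end.

(** Cell [i] of table [T] lives at address [32 * i + T]; a power of two lets the address be computed
    by doublings. *)
Definition ntab := 32.

Fixpoint wfe (e : exp) : bool :=
  match e with
  | EVar _ => true
  | ECst _ => true
  | EAdd a b => wfe a && wfe b
  | ESub a b => wfe a && wfe b
  | EGet T i => (T < ntab) && wfe i
  | ESum _ b a => wfe b && wfe a
  end.

Fixpoint wfs (s : stm) : bool :=
  match s with
  | SSkip => true
  | SSet T i a => [&& T < ntab, wfe i & wfe a]
  | SSeq s s' => wfs s && wfs s'
  | SIf c s s' => [&& wfe c, wfs s & wfs s']
  | SFor _ b s => wfe b && wfs s
  end.

Definition times32 d : seq instr :=
  [:: IAdd d d d; IAdd d d d; IAdd d d d; IAdd d d d; IAdd d d d].

(* The value of the expression is left in register [d]; registers below [d] are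
   preserved, and [rho] tells in which of them each variable lives. *)
Fixpoint cexp (rho : nat -> nat) (d o : nat) (e : exp) : seq instr :=
  match e with
  | EVar x => [:: IConst d 0; IAdd d d (rho x)]
  | ECst k => [:: IConst d k]
  | EAdd a b =>
      let ca := cexp rho d o a in
      ca ++ cexp rho d.+1 (o + size ca) b ++ [:: IAdd d d d.+1]
  | ESub a b =>
      let ca := cexp rho d o a in
      ca ++ cexp rho d.+1 (o + size ca) b ++ [:: ISub d d d.+1]
  | EGet T i =>
      cexp rho d o i ++ times32 d ++ [:: IConst d.+1 T; IAdd d d d.+1; ILoad d d]
  | ESum x b a =>
      let cb := cexp rho d.+1 o b in
      let l := (o + size cb).+2 in
      let ca := cexp (upd rho x d.+2) d.+3 l.+2 a in
      cb ++ [:: IConst d 0; IConst d.+2 0; ISub d.+3 d.+1 d.+2;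
                IJzero d.+3 (l.+2 + size ca).+4] ++
      ca ++ [:: IAdd d d d.+3; IConst d.+3 1; IAdd d.+2 d.+2 d.+3; IJump l]
  end.

Fixpoint cstm (rho : nat -> nat) (d o : nat) (s : stm) : seq instr :=
  match s with
  | SSkip => [::]
  | SSet T i a =>
      let ci := cexp rho d o i ++ times32 d ++ [:: IConst d.+1 T; IAdd d d d.+1] in
      ci ++ cexp rho d.+1 (o + size ci) a ++ [:: IStore d d.+1]
  | SSeq s s' =>
      let cs := cstm rho d o s in cs ++ cstm rho d (o + size cs) s'
  | SIf c s s' =>
      let cc := cexp rho d o c in
      let cs := cstm rho d (o + size cc).+1 s in
      let l := ((o + size cc).+1 + size cs).+1 in
      let cs' := cstm rho d l s' in
      cc ++ [:: IJzero d l] ++ cs ++ [:: IJump (l + size cs')] ++ cs'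
  | SFor x b s =>
      let cb := cexp rho d o b in
      let l := (o + size cb).+1 in
      let cs := cstm (upd rho x d.+1) d.+2 l.+2 s in
      cb ++ [:: IConst d.+1 0; ISub d.+2 d d.+1;
                IJzero d.+2 (l.+2 + size cs).+3] ++
      cs ++ [:: IConst d.+2 1; IAdd d.+1 d.+1 d.+2; IJump l]
  end.

(** Used both as coefficient and as exponent: the cost is at most [ke e * B.+1 ^ ke e], a shape that
    is stable under sums and bounded loops. *)
Fixpoint ke (e : exp) : nat :=
  match e with
  | EVar _ => 2
  | ECst _ => 1
  | EAdd a b => ke a + ke b + 1
  | ESub a b => ke a + ke b + 1
  | EGet _ i => ke i + 8
  | ESum _ b a => ke b + ke a + 12
  end.

Fixpoint ks (s : stm) : nat :=
  match s with
  | SSkip => 0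
  | SSet _ i a => ke i + ke a + 8
  | SSeq s s' => ks s + ks s'
  | SIf c s s' => ke c + ks s + ks s' + 2
  | SFor _ b s => ke b + ks s + 9
  end.

Lemma polyW k k' X : 0 < X -> k <= k' -> k * X ^ k <= k' * X ^ k'.
Proof. by move=> X0 kk; apply: leq_mul => //; apply: leq_pexp2l. Qed.

Lemma polyD n1 n2 k1 k2 c X : 0 < X ->
  n1 <= k1 * X ^ k1 -> n2 <= k2 * X ^ k2 ->
  n1 + n2 + c <= (k1 + k2 + c) * X ^ (k1 + k2 + c).
Proof.
move=> X0 h1 h2.
have e1 : X ^ k1 <= X ^ (k1 + k2 + c) by apply: leq_pexp2l => //; lia.
have e2 : X ^ k2 <= X ^ (k1 + k2 + c) by apply: leq_pexp2l => //; lia.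
have e3 : 0 < X ^ (k1 + k2 + c) by rewrite expn_gt0 X0.
rewrite !mulnDl; apply: leq_add; first apply: leq_add.
- by apply: leq_trans h1 _; rewrite leq_mul2l e1 orbT.
- by apply: leq_trans h2 _; rewrite leq_mul2l e2 orbT.
- by rewrite leq_pmulr.
Qed.

(** The cost of a loop with [b] rounds: the factor [b] is absorbed by one more power of [X]. *)
Lemma polyM b n k c X : b < X -> n <= b * (k * X ^ k + c) ->
  n <= (k + c) * X ^ (k + c).+1.
Proof.
move=> bX h; apply: (leq_trans h); rewrite expnS mulnCA.
apply: leq_mul; first exact: ltnW.
have e1 : X ^ k <= X ^ (k + c) by apply: leq_pexp2l; lia.
have e3 : 0 < X ^ (k + c) by rewrite expn_gt0; lia.
by rewrite mulnDl leq_add ?leq_mul2l ?e1 ?orbT ?leq_pmulr.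
Qed.

Definition code_at (P : program) (o : nat) (c : seq instr) : Prop :=
  forall i, i < size c -> o + i < size P /\
    nth (IJump 0) P (o + i) = nth (IJump 0) c i.

Lemma code_atl P o c c' : code_at P o (c ++ c') -> code_at P o c.
Proof.
move=> h i hi; have := h i; rewrite size_cat nth_cat hi; apply.
exact: ltn_addr.
Qed.

Lemma code_atr P o c c' : code_at P o (c ++ c') -> code_at P (o + size c) c'.
Proof.
move=> h i hi; have [|h1 h2] := h (size c + i); first by rewrite size_cat ltn_add2l.
by move: h1 h2; rewrite nth_cat (_ : (_ + i < size c) = false) ?addKn ?addnA //; lia.
Qed.

Lemma code_at_cons P o i c :
  code_at P o (i :: c) ->
  [/\ o < size P, nth (IJump 0) P o = i & code_at P o.+1 c].
Proof.
move=> h; have [//|] := h 0; rewrite addn0 => oP /= ->; split=> // j hj.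
by have := h j.+1; rewrite addnS addSn; apply.
Qed.

Definition reach (P : program) (n : nat) (c c' : config) : Prop :=
  iter n (step P) c = c'.

Lemma reach_trans P n1 n2 c1 c2 c3 :
  reach P n1 c1 c2 -> reach P n2 c2 c3 -> reach P (n1 + n2) c1 c3.
Proof. by rewrite /reach addnC iterD => -> ->. Qed.

Lemma reach0 P c : reach P 0 c c. Proof. by []. Qed.

Lemma reach_step P p g m i n c : p < size P -> nth (IJump 0) P p = i ->
  reach P n (exec_instr i (Config p g m)) c -> reach P n.+1 (Config p g m) c.
Proof.
move=> hp hi; rewrite /reach iterSr.
by have -> : step P (Config p g m) = exec_instr i (Config p g m)
  by rewrite /step /halted leqNgt hp hi.
Qed.

Lemma upd_same f a v : upd f a v a = v. Proof. by rewrite /upd eqxx. Qed.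
Lemma upd_other f a v b : b != a -> upd f a v b = f b.
Proof. by rewrite /upd => /negbTE ->. Qed.

Definition memr (m : nat -> nat) (st : store) : Prop :=
  forall T i, T < ntab -> m (ntab * i + T) = st T i.

(** Variables live below [d], and the code for an expression writes only from [d] on, so it cannot
    disturb them. *)
Definition envr (rho env g : nat -> nat) (d : nat) : Prop :=
  forall x, rho x < d /\ g (rho x) = env x.

Lemma envrW rho env g g' d d' : envr rho env g d -> d <= d' ->
  (forall r, r < d -> g' r = g r) -> envr rho env g' d'.
Proof.
move=> h dd hg x; have [h1 h2] := h x; split; first exact: leq_trans dd.
by rewrite hg.
Qed.

Lemma envr_upd rho env g d x r v : envr rho env g d -> d <= r -> g r = v ->
  envr (upd rho x r) (upd env x v) g r.+1.
Proof.
move=> h dr gr y; rewrite /upd; case: eqP => // _; have [h1 h2] := h y.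
by split=> //; lia.
Qed.

Ltac one := match goal with H : code_at _ _ (_ :: _) |- _ =>
  case/code_at_cons: H => ? ? H; apply: reach_step; [eassumption|eassumption|] end.
Ltac updlia := by rewrite /upd; do ?(case: eqP => // ?; try lia).

Lemma reach_times32 P o d g m : code_at P o (times32 d) ->
  exists g', [/\ reach P 5 (Config o g m) (Config (o + 5) g' m),
    g' d = 32 * g d & forall r, r != d -> g' r = g r].
Proof.
move=> h; eexists; split.
- rewrite /times32 in h; do 5 one => /=.
  rewrite !addnS addn0; exact: reach0.
- by rewrite !upd_same; lia.
- by move=> r hr; rewrite !upd_other.
Qed.

(** Induction on the expression. For a sum, register [d] holds the partial sum, [d.+1] the bound and
    [d.+2] the counter; the body is compiled from [d.+3] on. *)
Lemma cexpP P e : forall rho d o env st g m,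
  wfe e -> code_at P o (cexp rho d o e) -> envr rho env g d -> memr m st ->
  exists n g',
  [/\ reach P n (Config o g m) (Config (o + size (cexp rho d o e)) g' m),
      g' d = ev env st e, forall r, r < d -> g' r = g r &
      forall B, bnde B env st e -> n <= ke e * B.+1 ^ ke e].
Proof.
elim: e => [x|k|a iha b ihb|a iha b ihb|T i ihi|x b ihb a iha] rho d o env st g m /=.
- move=> _ h he _; exists 2; eexists; split.
  + by do 2 one => /=; rewrite addn2; exact: reach0.
  + have [h1 h2] := he x; rewrite upd_same upd_same upd_other ?h2 //.
    by rewrite neq_ltn h1.
  + by move=> r hr; rewrite !upd_other // neq_ltn hr.
  + by move=> B _; rewrite leq_pmulr // expn_gt0.
- move=> _ h he _; exists 1; eexists; split.
  + by one; rewrite addn1; exact: reach0.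
  + by rewrite upd_same.
  + by move=> r hr; rewrite !upd_other // neq_ltn hr.
  + by move=> B _; rewrite mul1n expn_gt0.
- case/andP=> wa wb h he hm.
  have [n1 [g1 [r1 v1 p1 b1]]] := iha rho d o env st g m wa (code_atl h) he hm.
  move/code_atr: h => h.
  have he1 : envr rho env g1 d.+1 by apply: envrW he _ p1.
  have [n2 [g2 [r2 v2 p2 b2]]] := ihb rho d.+1 _ env st g1 m wb (code_atl h) he1 hm.
  move/code_atr: h => h.
  exists (n1 + (n2 + 1)); eexists; split.
  + apply: reach_trans r1 _; apply: reach_trans r2 _; one => /=.
    by rewrite !size_cat /= addn1 !addnS !addnA; exact: reach0.
  + by rewrite upd_same v2 p2 // v1.
  + by move=> r hr; rewrite upd_other ?p2 ?p1 // ?neq_ltn ?hr // ltnW.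
  + by move=> B [/b1 h1 /b2 h2]; rewrite addnA; apply: polyD.
- case/andP=> wa wb h he hm.
  have [n1 [g1 [r1 v1 p1 b1]]] := iha rho d o env st g m wa (code_atl h) he hm.
  move/code_atr: h => h.
  have he1 : envr rho env g1 d.+1 by apply: envrW he _ p1.
  have [n2 [g2 [r2 v2 p2 b2]]] := ihb rho d.+1 _ env st g1 m wb (code_atl h) he1 hm.
  move/code_atr: h => h.
  exists (n1 + (n2 + 1)); eexists; split.
  + apply: reach_trans r1 _; apply: reach_trans r2 _; one => /=.
    by rewrite !size_cat /= addn1 !addnS !addnA; exact: reach0.
  + by rewrite upd_same v2 p2 // v1.
  + by move=> r hr; rewrite upd_other ?p2 ?p1 // ?neq_ltn ?hr // ltnW.
  + by move=> B [/b1 h1 /b2 h2]; rewrite addnA; apply: polyD.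
- case/andP=> wT wi h he hm.
  have [n1 [g1 [r1 v1 p1 b1]]] := ihi rho d o env st g m wi (code_atl h) he hm.
  move/code_atr: h => h.
  rewrite -[_ :: _]/(times32 d ++ [:: IConst d.+1 T; IAdd d d d.+1; ILoad d d]) in h.
  have [g2 [r2 v2 p2]] := reach_times32 g1 m (code_atl h).
  move/code_atr: h => h.
  exists (n1 + (5 + 3)); eexists; split.
  + apply: reach_trans r1 _; apply: reach_trans r2 _; do 3 one => /=.
    by rewrite size_cat /= !addnS !addn0; exact: reach0.
  + rewrite !upd_same upd_other; last by rewrite neq_ltn ltnSn.
    by rewrite v2 v1 hm.
  + move=> r hr; have ne : r != d by rewrite neq_ltn hr.
    by rewrite !upd_other ?p2 ?p1 // neq_ltn ltnS ltnW.
  + move=> B /b1 h1.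
    by have := @polyD n1 0 (ke i) 0 8 B.+1 isT h1 isT; rewrite !addn0.
- case/andP=> wb wa.
  set cb := cexp rho d.+1 o b; set l := (o + size cb).+2.
  set ca := cexp (upd rho x d.+2) d.+3 l.+2 a => h he hm.
  have [n1 [g1 [r1 v1 p1 b1]]] := ihb rho d.+1 o env st g m wb (code_atl h)
    (envrW he (leqnSn d) (fun _ _ => erefl)) hm.
  move/code_atr: h => h.
  pose bb := ev env st b.
  have [g2 [r2 q2]] : exists g2,
    reach P 2 (Config (o + size cb) g1 m) (Config l g2 m) /\
    [/\ g2 d = 0, g2 d.+1 = bb, g2 d.+2 = 0 & forall r, r < d -> g2 r = g r].
    move: (h) => h'; eexists; split.
      by do 2 one; exact: reach0.
    split.
    - by rewrite upd_other ?upd_same // neq_ltn; lia.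
    - by rewrite !upd_other ?v1 // neq_ltn; lia.
    - by rewrite upd_same.
    - by move=> r hr; rewrite !upd_other ?p1 // ?neq_ltn; lia.
  have hl : code_at P l ([:: ISub d.+3 d.+1 d.+2;
                IJzero d.+3 (l.+2 + size ca).+4] ++
      ca ++ [:: IAdd d d d.+3; IConst d.+3 1; IAdd d.+2 d.+2 d.+3; IJump l]).
    have := @code_atr _ _ [:: IConst d 0; IConst d.+2 0] _ h.
    by rewrite /= addn2.
  (* Invariant after [v] rounds; a round costs 6 steps besides the body. *)
  have loop v : v <= bb -> exists n g3,
    [/\ reach P n (Config l g2 m) (Config l g3 m),
       [/\ g3 d = \sum_(0 <= i < v) ev (upd env x i) st a, g3 d.+1 = bb,
          g3 d.+2 = v & forall r, r < d -> g3 r = g r] &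
       forall B, (forall i, i < bb -> bnde B (upd env x i) st a) ->
         n <= v * (ke a * B.+1 ^ ke a + 6)].
    elim: v => [_|v ih vb].
      exists 0, g2; split=> //; case: q2 => q1 q2' q3 q4; split=> //.
      by rewrite big_geq.
    have [n [g3 [r3 [s1 s2 s3 s4] b3]]] := ih (ltnW vb).
    move: (code_atl hl) => h'.
    move/code_atr: (hl) => h2.
    have [g4 [r4 q4]] : exists g4, reach P 2 (Config l g3 m) (Config l.+2 g4 m) /\
       (forall r, r != d.+3 -> g4 r = g3 r).
      eexists; split.
        one; one => /=; rewrite upd_same s2 s3 subn_eq0 leqNgt vb /=.
        exact: reach0.
      by move=> r hr; rewrite upd_other.
    have q4' r : r < d.+3 -> g4 r = g3 r by move=> hr; apply: q4; rewrite neq_ltn hr.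
    have he4 : envr (upd rho x d.+2) (upd env x v) g4 d.+3.
      apply: (@envr_upd _ _ _ d); last by rewrite q4'.
        by apply: envrW he _ _ => // r hr; rewrite q4' ?s4 //; lia.
      by lia.
    rewrite addn2 in h2.
    have [n5 [g5 [r5 v5 p5 b5]]] :=
      iha (upd rho x d.+2) d.+3 l.+2 (upd env x v) st g4 m wa (code_atl h2) he4 hm.
    move/code_atr: h2 => h2.
    exists (n + (2 + (n5 + 4))); eexists; split.
    + apply: reach_trans r3 _; apply: reach_trans r4 _; apply: reach_trans r5 _.
      by do 4 one; exact: reach0.
    + split.
      * rewrite upd_other; last by rewrite neq_ltn; lia.
        rewrite upd_other; last by rewrite neq_ltn; lia.
        by rewrite upd_same v5 p5 ?q4' ?s1 ?big_nat_recr //; lia.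
      * rewrite !upd_other; try by rewrite neq_ltn; lia.
        by rewrite p5 ?q4' ?s2 //; lia.
      * rewrite upd_same upd_same upd_other; last by rewrite neq_ltn; lia.
        rewrite upd_other; last by rewrite neq_ltn; lia.
        by rewrite p5 ?q4' ?s3 ?addn1 //; lia.
      * move=> r hr; rewrite !upd_other; try by rewrite neq_ltn; lia.
        by rewrite p5 ?q4' ?s4 //; lia.
    + move=> B hB; have h1 := b3 B hB; have h3 := b5 B (hB v vb).
      rewrite mulSn; lia.
  have [n [g3 [r3 [s1 s2 s3 s4] b3]]] := loop bb (leqnn _).
  move: (code_atl hl) => h'.
  exists (n1 + (2 + (n + 2))); eexists; split.
  + apply: reach_trans r1 _; apply: reach_trans r2 _; apply: reach_trans r3 _.
    one; one => /=; rewrite upd_same s2 s3 subnn eqxx.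
    rewrite (_ : o + _ = (l.+2 + size ca).+4); first exact: reach0.
    by rewrite size_cat /= size_cat /= /l; lia.
  + by rewrite upd_other ?s1 // neq_ltn; lia.
  + by move=> r hr; rewrite upd_other ?s4 // neq_ltn; lia.
  + move=> B [/b1 h1 h2 h3]; have h4 := b3 B h3.
    have h5 := polyM (leq_ltn_trans h2 (ltnSn B)) h4.
    have h6 : n <= (ke a + 6).+1 * B.+1 ^ (ke a + 6).+1.
      by apply: leq_trans h5 _; rewrite leq_mul2r leqnSn orbT.
    have := @polyD n1 n (ke b) (ke a + 6).+1 4 B.+1 isT h1 h6.
    have -> : n1 + (2 + (n + 2)) = n1 + n + 4 by lia.
    by move=> h7; apply: leq_trans h7 _; apply: polyW => //; lia.
Qed.

Lemma memr_set m st T i v : T < ntab -> memr m st ->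
  memr (upd m (ntab * i + T) v) (setst st T i v).
Proof.
move=> hT hm T' i' hT'; rewrite /upd /setst -hm //.
have -> : (ntab * i' + T' == ntab * i + T) = (T' == T) && (i' == i).
  rewrite /ntab in hT hT' *; lia.
by [].
Qed.

Lemma cstmP P s : forall rho d o env st g m,
  wfs s -> code_at P o (cstm rho d o s) -> envr rho env g d -> memr m st ->
  exists n g' m',
  [/\ reach P n (Config o g m) (Config (o + size (cstm rho d o s)) g' m'),
      memr m' (exec env st s), forall r, r < d -> g' r = g r &
      forall B, bnds B env st s -> n <= ks s * B.+1 ^ ks s].
Proof.
elim: s => [|T i a|s ihs s' ihs'|c s ihs s' ihs'|x b s ihs] rho d o env st g m /=.
- by move=> _ _ he hm; exists 0, g, m; split=> //; rewrite addn0.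
- case/and3P=> wT wi wa.
  pose ci := cexp rho d o i ++ times32 d ++ [:: IConst d.+1 T; IAdd d d d.+1].
  move=> h0 he hm.
  have h : code_at P o (cexp rho d o i ++ times32 d ++ [:: IConst d.+1 T; IAdd d d d.+1]
    ++ cexp rho d.+1 (o + size ci) a ++ [:: IStore d d.+1]).
    by move: h0; rewrite -[_ :: _]/(times32 d ++ [:: IConst d.+1 T; IAdd d d d.+1]) -!catA.
  have [n1 [g1 [r1 v1 p1 b1]]] := cexpP wi (code_atl h) he hm.
  move/code_atr: h => h.
  have [g2 [r2 v2 p2]] := reach_times32 g1 m (code_atl h).
  move/code_atr: h => h.
  set o3 := _ + size (times32 d) in h.
  have p2' r : r < d -> g2 r = g r by move=> hr; rewrite p2 ?p1 // neq_ltn hr.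
  have [g3 [r3 v3 p3]] : exists g3, [/\ reach P 2 (Config o3 g2 m) (Config (o3 + 2) g3 m),
     g3 d = ntab * ev env st i + T & forall r, r < d -> g3 r = g r].
    move: (code_atl h) => h'; eexists; split.
    + by do 2 one => /=; rewrite addn2; exact: reach0.
    + rewrite upd_same upd_same upd_other; last by rewrite neq_ltn; lia.
      by rewrite v2 v1.
    + by move=> r hr; rewrite !upd_other ?p2' // neq_ltn; lia.
  move/code_atr: h => h.
  have he3 : envr rho env g3 d.+1 by apply: envrW he _ p3.
  have eo : o + size ci = o3 + 2 by rewrite /o3 /ci size_cat /=; lia.
  rewrite eo in h.
  have [n4 [g4 [r4 v4 p4 b4]]] := cexpP wa (code_atl h) he3 hm.
  move/code_atr: h => h.
  exists (n1 + (5 + (2 + (n4 + 1)))); eexists; eexists; split.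
  + apply: reach_trans r1 _; apply: reach_trans r2 _; apply: reach_trans r3 _.
    apply: reach_trans r4 _; one => /=.
    rewrite -[_ ++ _ :: _]/ci eo size_cat addnA eo size_cat addnA addn1.
    exact: reach0.
  + by rewrite v4 p4 // v3; apply: memr_set.
  + by move=> r hr; rewrite p4 ?p3 // ltnW.
  + move=> B [/b1 h1 /b4 h4].
    have := @polyD n1 n4 (ke i) (ke a) 8 B.+1 isT h1 h4.
    by rewrite (_ : n1 + n4 + 8 = n1 + (5 + (2 + (n4 + 1)))) //; lia.
- case/andP=> ws ws' h he hm.
  have [n1 [g1 [m1 [r1 v1 p1 b1]]]] := ihs _ _ _ _ _ _ _ ws (code_atl h) he hm.
  move/code_atr: h => h.
  have he1 : envr rho env g1 d by apply: envrW he _ p1.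
  have [n2 [g2 [m2 [r2 v2 p2 b2]]]] := ihs' _ _ _ _ _ _ _ ws' h he1 v1.
  exists (n1 + n2), g2, m2; split=> //.
  + by apply: reach_trans r1 _; rewrite size_cat addnA.
  + by move=> r hr; rewrite p2 ?p1.
  + move=> B [/b1 h1 /b2 h2].
    by have := @polyD n1 n2 _ _ 0 B.+1 isT h1 h2; rewrite !addn0.
- case/and3P=> wc ws ws' h he hm.
  set cc := cexp rho d o c in h *.
  set cs := cstm rho d (o + size cc).+1 s in h *.
  set l := ((o + size cc).+1 + size cs).+1 in h *.
  set cs' := cstm rho d l s' in h *.
  have [n1 [g1 [r1 v1 p1 b1]]] := cexpP wc (code_atl h) he hm.
  move/code_atr: h; rewrite -/cc => h.
  have he1 : envr rho env g1 d by apply: envrW he _ p1.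
  have h' := h; case/code_at_cons: h' => hi1 hi2 h'.
  case: ltnP => hc.
  + have [n2 [g2 [m2 [r2 v2 p2 b2]]]] := ihs _ _ _ _ _ _ _ ws (code_atl h') he1 hm.
    move/code_atr: h'; rewrite -/cs => h'.
    exists (n1 + (1 + (n2 + 1))), g2, m2; split=> //.
    * apply: reach_trans r1 _; apply: (@reach_trans _ 1 _ _ (Config (o + size cc).+1 g1 m)).
        by apply: reach_step hi1 hi2 _; rewrite /= v1 eqn0Ngt hc; exact: reach0.
      apply: reach_trans r2 _; one => /=.
      rewrite (_ : o + _ = l + size cs'); first exact: reach0.
      rewrite size_cat /= size_cat /= /l; lia.
    * by move=> r hr; rewrite p2 ?p1.
    * move=> B [/b1 h1 /b2 h2].
      have := @polyD n1 n2 _ _ 2 B.+1 isT h1 h2.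
      rewrite (_ : n1 + n2 + 2 = n1 + (1 + (n2 + 1))); last by lia.
      by move/leq_trans; apply; apply: polyW; lia.
  + move/code_atr: h'; rewrite -/cs => /code_at_cons [_ _ h'].
    have [n2 [g2 [m2 [r2 v2 p2 b2]]]] := ihs' _ _ _ _ _ _ _ ws' h' he1 hm.
    exists (n1 + (1 + n2)), g2, m2; split=> //.
    * apply: reach_trans r1 _; apply: (@reach_trans _ 1 _ _ (Config l g1 m)).
        apply: reach_step hi1 hi2 _; rewrite /= v1.
        by move: hc; rewrite leqn0 => ->; exact: reach0.
      rewrite (_ : o + _ = l + size cs'); first exact: r2.
      rewrite size_cat /= size_cat /= /l; lia.
    * by move=> r hr; rewrite p2 ?p1.
    * move=> B [/b1 h1 /b2 h2].
      have := @polyD n1 n2 _ _ 1 B.+1 isT h1 h2.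
      rewrite (_ : n1 + n2 + 1 = n1 + (1 + n2)); last by lia.
      by move/leq_trans; apply; apply: polyW; lia.
- case/andP=> wb ws.
  set cb := cexp rho d o b; set l := (o + size cb).+1.
  set cs := cstm (upd rho x d.+1) d.+2 l.+2 s => h he hm.
  have [n1 [g1 [r1 v1 p1 b1]]] := cexpP wb (code_atl h) he hm.
  move/code_atr: h; rewrite -/cb => h.
  pose bb := ev env st b.
  have [g2 [r2 q2]] : exists g2,
    reach P 1 (Config (o + size cb) g1 m) (Config l g2 m) /\
    [/\ g2 d = bb, g2 d.+1 = 0 & forall r, r < d -> g2 r = g r].
    move: (h) => h'; eexists; split.
      by one; exact: reach0.
    split.
    - by rewrite upd_other ?v1 // neq_ltn; lia.
    - by rewrite upd_same.
    - by move=> r hr; rewrite !upd_other ?p1 // ?neq_ltn; lia.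
  have hl : code_at P l ([:: ISub d.+2 d d.+1;
                IJzero d.+2 (l.+2 + size cs).+3] ++
      cs ++ [:: IConst d.+2 1; IAdd d.+1 d.+1 d.+2; IJump l]).
    have := @code_atr _ _ [:: IConst d.+1 0] _ h.
    by rewrite /= addn1.
  pose stv v := iteri v (fun v st' => exec (upd env x v) st' s) st.
  have loop v : v <= bb -> exists n g3 m3,
    [/\ reach P n (Config l g2 m) (Config l g3 m3), memr m3 (stv v),
       [/\ g3 d = bb, g3 d.+1 = v & forall r, r < d -> g3 r = g r] &
       forall B, (forall i, i < bb -> bnds B (upd env x i) (stv i) s) ->
         n <= v * (ks s * B.+1 ^ ks s + 5)].
    elim: v => [_|v ih vb]; first by exists 0, g2, m; split.
    have [n [g3 [m3 [r3 hm3 [s2 s3 s4] b3]]]] := ih (ltnW vb).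
    move: (code_atl hl) => h'.
    move/code_atr: (hl) => h2.
    have [g4 [r4 q4]] : exists g4, reach P 2 (Config l g3 m3) (Config l.+2 g4 m3) /\
       (forall r, r != d.+2 -> g4 r = g3 r).
      eexists; split.
        one; one => /=; rewrite upd_same s2 s3 subn_eq0 leqNgt vb /=.
        exact: reach0.
      by move=> r hr; rewrite upd_other.
    have q4' r : r < d.+2 -> g4 r = g3 r by move=> hr; apply: q4; rewrite neq_ltn hr.
    have he4 : envr (upd rho x d.+1) (upd env x v) g4 d.+2.
      apply: (@envr_upd _ _ _ d); last by rewrite q4'.
        by apply: envrW he _ _ => // r hr; rewrite q4' ?s4 //; lia.
      by lia.
    rewrite addn2 in h2.
    have [n5 [g5 [m5 [r5 v5 p5 b5]]]] := ihs _ _ _ _ _ _ _ ws (code_atl h2) he4 hm3.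
    move/code_atr: h2 => h2.
    exists (n + (2 + (n5 + 3))); eexists; exists m5; split.
    + apply: reach_trans r3 _; apply: reach_trans r4 _; apply: reach_trans r5 _.
      by do 3 one; exact: reach0.
    + exact: v5.
    + split.
      * rewrite !upd_other; try by rewrite neq_ltn; lia.
        by rewrite p5 ?q4' ?s2 //; lia.
      * rewrite upd_same upd_same upd_other; last by rewrite neq_ltn; lia.
        by rewrite p5 ?q4' ?s3 ?addn1 //; lia.
      * move=> r hr; rewrite !upd_other; try by rewrite neq_ltn; lia.
        by rewrite p5 ?q4' ?s4 //; lia.
    + move=> B hB; have h1 := b3 B hB; have h3 := b5 B (hB v vb).
      rewrite mulSn; lia.
  have [n [g3 [m3 [r3 hm3 [s2 s3 s4] b3]]]] := loop bb (leqnn _).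
  move: (code_atl hl) => h'.
  exists (n1 + (1 + (n + 2))); eexists; exists m3; split.
  + apply: reach_trans r1 _; apply: reach_trans r2 _; apply: reach_trans r3 _.
    one; one => /=; rewrite upd_same s2 s3 subnn eqxx.
    rewrite (_ : o + _ = (l.+2 + size cs).+3); first exact: reach0.
    by rewrite size_cat /= size_cat /= /l; lia.
  + exact: hm3.
  + by move=> r hr; rewrite upd_other ?s4 // neq_ltn; lia.
  + move=> B [/b1 h1 h2 h3]; have h4 := b3 B h3.
    have h5 := polyM (leq_ltn_trans h2 (ltnSn B)) h4.
    have h6 : n <= (ks s + 5).+1 * B.+1 ^ (ks s + 5).+1.
      by apply: leq_trans h5 _; rewrite leq_mul2r leqnSn orbT.
    have := @polyD n1 n (ke b) (ks s + 5).+1 3 B.+1 isT h1 h6.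
    have -> : n1 + (1 + (n + 2)) = n1 + n + 3 by lia.
    by have -> : ke b + (ks s + 5).+1 + 3 = (ke b + ks s + 9) by lia.
Qed.

(* Moves input cell [i] to address [32 i], from the last cell down, so that no
   cell is overwritten before it is read. *)
Definition prologue : seq instr :=
  [:: IConst 1 1; IAdd 2 0 5; IJzero 2 12; ISub 2 2 1; ILoad 3 2; IAdd 4 2 2;
      IAdd 4 4 4; IAdd 4 4 4; IAdd 4 4 4; IAdd 4 4 4; IStore 4 3; IJump 2;
      IStore 1 0; IConst 0 0].

(** Also the address of cell 0 of this table, from which the answer is loaded. *)
Definition out_tab := 2.

Definition program_of (s : stm) : program :=
  prologue ++ cstm (fun _ => 0) 1 14 s ++ [:: IConst 1 out_tab; ILoad 0 1].

(** The length of the input ends up at address 1, which is cell 0 of table 1. Register 0 is cleared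
    because the compiled code reads it for every unbound variable. Nothing is claimed about other
    tables, where parts of the input may be left over. *)
Lemma prologueP P w : code_at P 0 prologue -> exists n g m,
  [/\ reach P n (initial w) (Config 14 g m), g 0 = 0,
      forall i, m (ntab * i) = nth 0 w i, m 1 = size w &
      n <= 10 * size w + 5].
Proof.
move=> h.
have [g0 [r0 q0]] : exists g0, reach P 2 (initial w) (Config 2 g0 (nth 0 w)) /\
   [/\ g0 0 = size w, g0 1 = 1 & g0 2 = size w].
  move: (h) => h'; rewrite /prologue in h'; eexists; split.
    by do 2 one; exact: reach0.
  by split=> //=; rewrite /upd /= addn0.
(* After [v] rounds the last [v] cells have been moved. The earlier ones are intact, since a cell
   never moves to a smaller address, and beyond the input both sides are 0. *)
have loop v : v <= size w -> exists g m,
  [/\ reach P (10 * v) (Config 2 g0 (nth 0 w)) (Config 2 g m),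
     [/\ g 0 = size w, g 1 = 1 & g 2 = size w - v],
     forall i, i < size w - v -> m i = nth 0 w i,
     forall i, size w - v <= i < size w -> m (ntab * i) = nth 0 w i &
     forall i, size w <= i -> m (ntab * i) = nth 0 w i].
  elim: v => [_|v ih vb].
    exists g0, (nth 0 w); rewrite subn0; split.
    - by rewrite muln0.
    - exact: q0.
    - by [].
    - by move=> i; lia.
    - by move=> i hi; rewrite !nth_default // /ntab; lia.
  have [g [m [r1 [a0 a1 a2] c1 c2 c3]]] := ih (ltnW vb).
  move: (@code_atr P 0 [:: IConst 1 1; IAdd 2 0 5]
    (drop 2 prologue) h) => h'; rewrite /= add0n in h'.
  eexists; eexists; split.
  - rewrite mulnS addnC; apply: reach_trans r1 _.
    one; rewrite /= a2 subn_eq0 leqNgt vb /=.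
    by do 9 one => /=; exact: reach0.
  - split=> //=; first by rewrite /upd /= a2 a1; lia.
  - move=> i hi; rewrite /upd /= a2 a1 ifF; first by apply: c1; lia.
    by apply/eqP; lia.
  - move=> i hi; rewrite /upd /= a2 a1; case: eqP => [e|ne].
      by rewrite c1; [congr (nth 0 w _); rewrite /ntab in e; lia | lia].
    by apply: c2; rewrite /ntab in ne *; lia.
  - move=> i hi; rewrite /upd /= a2 a1 ifF; first exact: c3.
    by apply/eqP; rewrite /ntab; lia.
have [g [m [r1 [a0 a1 a2] c1 c2 c3]]] := loop _ (leqnn _).
rewrite subnn in a2 c2.
move: (@code_atr P 0 [:: IConst 1 1; IAdd 2 0 5]
    (drop 2 prologue) h) => h'; rewrite /= add0n in h'.
move: (@code_atr P 0 (take 12 prologue)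
    (drop 12 prologue) h) => h2; rewrite /= add0n in h2.
eexists; eexists; eexists; split.
- apply: reach_trans r0 _; apply: reach_trans r1 _.
  apply: (@reach_trans _ 1 2 _ (Config 12 g m)).
    case/code_at_cons: h' => hi1 hi2 h'.
    by apply: reach_step hi1 hi2 _; rewrite /= a2; exact: reach0.
  by case/code_at_cons: h2 => ? ? h2; apply: reach_step; [eassumption|eassumption|];
     case/code_at_cons: h2 => ? ? h2; apply: reach_step; [eassumption|eassumption|];
     exact: reach0.
- by [].
- move=> i; rewrite /upd a1 ifF; last by rewrite /ntab; lia.
  by case: (ltnP i (size w)) => hi; [apply: c2|apply: c3].
- by rewrite /upd a1 eqxx.
- lia.
Qed.

(** A halted machine idles, so the output is still there at any time after [n]; this allows the
    halting time to be replaced by a rough upper bound. *)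
Theorem program_ofP s : wfs s -> forall w, exists st n,
  [/\ forall i, st 0 i = nth 0 w i, st 1 0 = size w,
      (forall t, n <= t ->
         computes_within (program_of s) w (exec (fun _ => 0) st s out_tab 0) t) &
      forall B, bnds B (fun _ => 0) st s ->
        n <= 10 * size w + 7 + ks s * B.+1 ^ ks s].
Proof.
move=> ws w; set P := program_of s.
have h : code_at P 0 P by move=> i hi; rewrite add0n.
have [n0 [g0 [m0 [r0 z0 c0 c1 b0]]]] := prologueP w (code_atl h).
move/code_atr: h => /= h.
pose st : store := fun T i => m0 (ntab * i + T).
have he : envr (fun _ => 0) (fun _ => 0) g0 1 by move=> x; rewrite z0.
have hm : memr m0 st by [].
have [n1 [g1 [m1 [r1 v1 p1 b1]]]] := cstmP ws (code_atl h) he hm.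
move/code_atr: h => h.
exists st, (n0 + (n1 + 2)); split.
- by move=> i; rewrite /st addn0 c0.
- by rewrite /st muln0 c1.
- move=> t ht.
  have [c' [r' hc' rc']] : exists c', [/\ reach P (n0 + (n1 + 2)) (initial w) c',
      halted P c' & reg c' 0 = exec (fun _ => 0) st s out_tab 0].
    eexists; split.
    + apply: reach_trans r0 _; apply: reach_trans r1 _.
      by do 2 one => /=; exact: reach0.
    + by rewrite /halted /P /program_of !size_cat /= !addnS !addn0.
    + by rewrite /= upd_same upd_same -(v1 out_tab 0).
  have fix_c k : iter k (step P) c' = c'.
    by elim: k => //= k ->; rewrite /step hc'.
  rewrite /computes_within -(subnK ht) iterD r' fix_c.
  by split.
- move=> B /b1 h1; lia.
Qed.

(** * Booleans and bounded quantifiers as arithmetic expressions *)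

Definition eNot a := ESub (ECst 1) a.
(** Every nonzero value counts as true; the double negation normalises it to 1. The other
    connectives also return 0 or 1, which makes sums of them cardinalities. *)
Definition eB a := eNot (eNot a).
Definition eAnd a b := eNot (EAdd (eNot a) (eNot b)).
Definition eOr a b := eB (EAdd a b).
Definition eLt a b := eNot (ESub (EAdd a (ECst 1)) b).
Definition eLe a b := eNot (ESub a b).
Definition eEq a b := eNot (EAdd (ESub a b) (ESub b a)).
Definition eEx x b p := eB (ESum x b p).
Definition eAll x b p := eNot (ESum x b (eNot p)).

(* Variable 99 is never read. *)
Definition eMul b a := ESum 99 b a.
(** A sum with at most one term replaces a branch. *)
Definition eWhen c a := eMul (eB c) a.
Definition bc k := EGet 1 (ECst k).

Lemma evAdd env st a b : ev env st (EAdd a b) = ev env st a + ev env st b.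
Proof. by []. Qed.
Lemma evSub env st a b : ev env st (ESub a b) = ev env st a - ev env st b.
Proof. by []. Qed.
Lemma evGet env st T i : ev env st (EGet T i) = st T (ev env st i).
Proof. by []. Qed.
Lemma evVar env st x : ev env st (EVar x) = env x.
Proof. by []. Qed.
Lemma evCst env st k : ev env st (ECst k) = k.
Proof. by []. Qed.
Lemma evSum env st x b a :
  ev env st (ESum x b a) = \sum_(0 <= v < ev env st b) ev (upd env x v) st a.
Proof. by []. Qed.
Lemma exec_set env st T i a :
  exec env st (SSet T i a) = setst st T (ev env st i) (ev env st a).
Proof. by []. Qed.
Lemma exec_seq env st s s' :
  exec env st (SSeq s s') = exec env (exec env st s) s'.
Proof. by []. Qed.
Lemma evbc env st k : ev env st (bc k) = st 1 k.
Proof. by []. Qed.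

Definition tt env st e : bool := 0 < ev env st e.

Lemma ttNot env st a : tt env st (eNot a) = ~~ tt env st a.
Proof. by rewrite /tt /=; case: (ev _ _ a). Qed.
Lemma ttB env st a : tt env st (eB a) = tt env st a.
Proof. by rewrite !ttNot negbK. Qed.
Lemma ttAnd env st a b : tt env st (eAnd a b) = tt env st a && tt env st b.
Proof. by rewrite ttNot /tt /=; case: (ev _ _ a) => [|?]; case: (ev _ _ b). Qed.
Lemma ttOr env st a b : tt env st (eOr a b) = tt env st a || tt env st b.
Proof. by rewrite ttB /tt /= addn_gt0. Qed.
Lemma ttLt env st a b : tt env st (eLt a b) = (ev env st a < ev env st b).
Proof. by rewrite /tt /=; lia. Qed.
Lemma ttLe env st a b : tt env st (eLe a b) = (ev env st a <= ev env st b).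
Proof. by rewrite /tt /=; lia. Qed.
Lemma ttEq env st a b : tt env st (eEq a b) = (ev env st a == ev env st b).
Proof. by rewrite /tt /=; lia. Qed.

Lemma iotaS_rcons n : iota 0 n.+1 = rcons (iota 0 n) n.
Proof. by rewrite -addn1 iotaD cats1. Qed.

Lemma sum_has n (F : nat -> nat) :
  (0 < \sum_(0 <= v < n) F v) = has (fun v => 0 < F v) (iota 0 n).
Proof.
elim: n => [|n ih]; first by rewrite big_geq.
by rewrite big_nat_recr // addn_gt0 ih iotaS_rcons has_rcons orbC.
Qed.

Lemma ttEx env st x b p : tt env st (eEx x b p) =
  has (fun v => tt (upd env x v) st p) (iota 0 (ev env st b)).
Proof. by rewrite ttB /tt /= sum_has. Qed.

Lemma ttAll env st x b p : tt env st (eAll x b p) =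
  all (fun v => tt (upd env x v) st p) (iota 0 (ev env st b)).
Proof.
rewrite ttNot /tt /= sum_has -all_predC; apply: eq_all => v /=.
by case: (ev _ _ p).
Qed.

Lemma ev01 env st a : ev env st (eNot a) = tt env st (eNot a).
Proof. by rewrite ttNot /tt /=; case: (ev _ _ a). Qed.

Lemma evMul env st b a :
  ev env st (eMul b a) = \sum_(0 <= v < ev env st b) ev (upd env 99 v) st a.
Proof. by []. Qed.

(** * Dependence on tables and variables, and control of loop bounds *)

Fixpoint rd (T : nat) (e : exp) : bool :=
  match e with
  | EVar _ => false
  | ECst _ => false
  | EAdd a b => rd T a || rd T b
  | ESub a b => rd T a || rd T b
  | EGet T' i => (T' == T) || rd T i
  | ESum _ b a => rd T b || rd T a
  end.

Fixpoint vr (x : nat) (e : exp) : bool :=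
  match e with
  | EVar y => x == y
  | ECst _ => false
  | EAdd a b => vr x a || vr x b
  | ESub a b => vr x a || vr x b
  | EGet _ i => vr x i
  | ESum y b a => vr x b || (x != y) && vr x a
  end.

Lemma ev_ext e : forall env env' st st',
  (forall x, vr x e -> env x = env' x) ->
  (forall T i, rd T e -> st T i = st' T i) -> ev env st e = ev env' st' e.
Proof.
elim: e => [x|k|a iha b ihb|a iha b ihb|T i ihi|x b ihb a iha] env env' st st' /= h h'.
- by apply: h.
- by [].
- by rewrite (iha _ env' _ st') 1?(ihb _ env' _ st') // => ? *;
    [apply: h|apply: h'|apply: h|apply: h']; apply/orP; eauto.
- by rewrite (iha _ env' _ st') 1?(ihb _ env' _ st') // => ? *;
    [apply: h|apply: h'|apply: h|apply: h']; apply/orP; eauto.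
- rewrite (ihi _ env' _ st') // => [|T' i' hT].
    by rewrite h' // eqxx.
  by rewrite h' // hT orbT.
- rewrite (ihb _ env' _ st') // => [|y hy|T i hT].
  + apply: eq_bigr => v _; apply: iha => [y hy|T i hT].
      rewrite /upd; case: eqP => // /eqP ne.
      by apply: h; rewrite ne hy orbT.
    by rewrite h' // hT orbT.
  + by rewrite h // hy.
  + by rewrite h' // hT.
Qed.

Lemma evMulE env st b a : ~~ vr 99 a ->
  ev env st (eMul b a) = ev env st b * ev env st a.
Proof.
move=> h; rewrite evMul.
rewrite (eq_bigr (fun _ => ev env st a)) => [|v _]; first by rewrite sum_nat_const_nat subn0.
apply: ev_ext => // x hx; rewrite /upd; case: eqP => // e.
by rewrite e in hx; rewrite hx in h.
Qed.

Lemma evWhen env st c a : ~~ vr 99 a ->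
  ev env st (eWhen c a) = if tt env st c then ev env st a else 0.
Proof. by move=> h; rewrite evMulE // ev01 ttB; case: tt; rewrite ?mul1n. Qed.

(** A sufficient condition for [bnde]: a sum runs up to a cell of table 1 listed in [cs], or up to a
    negation, whose value is at most 1. It is decidable, so for the concrete program it is checked
    by computation. *)
Fixpoint simpe (cs : pred nat) (e : exp) : bool :=
  match e with
  | EVar _ => true
  | ECst _ => true
  | EAdd a b => simpe cs a && simpe cs b
  | ESub a b => simpe cs a && simpe cs b
  | EGet _ i => simpe cs i
  | ESum _ b a => simpe cs a &&
      match b with
      | EGet 1 (ECst k) => cs k
      | ESub (ECst 1) b' => simpe cs b'
      | _ => false
      end
  end.

Fixpoint simps (cs : pred nat) (s : stm) : bool :=
  match s with
  | SSkip => true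
  | SSet T i a => [&& T != 1, simpe cs i & simpe cs a]
  | SSeq s s' => simps cs s && simps cs s'
  | SIf c s s' => [&& simpe cs c, simps cs s & simps cs s']
  | SFor _ b s => simps cs s &&
      match b with EGet 1 (ECst k) => cs k | _ => false end
  end.

Lemma simpe_bnd cs B e : forall env st, simpe cs e -> 0 < B ->
  (forall k, cs k -> st 1 k <= B) -> bnde B env st e.
Proof.
elim: e => [x|k|a iha b ihb|a iha b ihb|T i ihi|x b ihb a iha] env st //=.
- by case/andP=> ha hb B0 h; split; [apply: iha|apply: ihb].
- by case/andP=> ha hb B0 h; split; [apply: iha|apply: ihb].
- by move=> *; apply: ihi.
- case/andP=> ha hb B0 h.
  have hs : simpe cs b /\ ev env st b <= B.
    case: b hb {ihb} => // [[] // [|[|]] //= b hb|[|[|]] // [] // k /= hk].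
      by split=> //; lia.
    by split=> //; apply: h.
  by split; [apply: ihb => //; case: hs|case: hs|move=> v _; apply: iha].
Qed.

Lemma simps_keep cs s : forall env st k, simps cs s -> exec env st s 1 k = st 1 k.
Proof.
elim: s => [|T i a|s ihs s' ihs'|c s ihs s' ihs'|x b s ihs] env st k //=.
- by case/andP=> h _; rewrite /setst eq_sym (negbTE h).
- by case/andP=> h h'; rewrite ihs' // ihs.
- by case/and3P=> _ h h'; case: ifP => _; [apply: ihs|apply: ihs'].
- case/andP=> h _; elim: (ev env st b) => //= n ih; by rewrite ihs.
Qed.

Lemma simps_bnd cs B s : forall env st, simps cs s -> 0 < B ->
  (forall k, cs k -> st 1 k <= B) -> bnds B env st s.
Proof.
elim: s => [|T i a|s ihs s' ihs'|c s ihs s' ihs'|x b s ihs] env st //=.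
- by case/and3P=> _ hi ha B0 h; split; apply: (simpe_bnd (cs := cs)).
- case/andP=> h h' B0 hB; split; first exact: ihs.
  by apply: ihs' => // k hk; rewrite (simps_keep _ _ _ h) hB.
- case/and3P=> hc h h' B0 hB; split; first exact: (simpe_bnd (cs := cs)).
  by case: ifP => _; [apply: ihs|apply: ihs'].
- case/andP=> h hb B0 hB.
  have hs : bnde B env st b /\ ev env st b <= B.
    by case: b hb => // [[|[|]] // [] // k /= hk]; split=> //; apply: hB.
  case: hs => h1 h2; split=> // v hv; apply: ihs => // k hk.
  have -> : iteri v (fun v0 st' => exec (upd env x v0) st' s) st 1 k = st 1 k.
    by elim: v {hv} => //= v ih; rewrite (simps_keep _ _ _ h).
  exact: hB.
Qed.

Lemma for_ind (Q : nat -> store -> Prop) env st x b s :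
  Q 0 st ->
  (forall v st', v < ev env st b -> Q v st' -> Q v.+1 (exec (upd env x v) st' s)) ->
  Q (ev env st b) (exec env st (SFor x b s)).
Proof.
move=> h0 hS /=.
have: forall m, m <= ev env st b ->
  Q m (iteri m (fun v st' => exec (upd env x v) st' s) st).
  by elim=> //= m ih hm; apply: hS => //; apply: ih; exact: ltnW.
by apply.
Qed.

(** * Filling tables by nested loops *)

Definition nest (xs : seq nat) (b : exp) (s : stm) : stm :=
  foldr (fun x s => SFor x b s) s xs.

Fixpoint updl (env : nat -> nat) (xs vs : seq nat) : nat -> nat :=
  match xs, vs with
  | x :: xs, v :: vs => updl (upd env x v) xs vs
  | _, _ => env
  end.

Definition below n k (vs : seq nat) : Prop :=
  size vs = k /\ all (fun v => v < n) vs.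

(** The order of the writes is irrelevant: index and value do not read [T], so both can be evaluated
    in the initial store, and a written cell holds the value for some tuple that has it as index.
    For an injective index this determines the table. *)
Lemma nestP T k i a st0 xs : T != 1 -> ~~ rd T i -> ~~ rd T a ->
  forall env st, (forall T' j, T' != T -> st T' j = st0 T' j) ->
  let st' := exec env st (nest xs (bc k) (SSet T i a)) in
  let idx vs := ev (updl env xs vs) st0 i in
  (forall T' j, T' != T -> st' T' j = st0 T' j) /\
  (forall j,
    (exists2 vs, below (st0 1 k) (size xs) vs &
       j = idx vs /\ st' T j = ev (updl env xs vs) st0 a) \/
    ((forall vs, below (st0 1 k) (size xs) vs -> j <> idx vs) /\ st' T j = st T j)).
Proof.
move=> T1 ri ra; elim: xs => [|x xs ih] env st hst.
  have ext e : ~~ rd T e -> ev env st e = ev env st0 e.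
    move=> h; apply: ev_ext => // T' j hT'; apply: hst.
    by apply/eqP => E; rewrite E in hT'; rewrite hT' in h.
  rewrite /= !ext //; split=> [T' j h|j].
    by rewrite /setst (negbTE h) /= hst.
  rewrite /setst eqxx /=; case: eqP => [->|ne]; first by left; exists [::].
  by right; split=> // -[|//] _.
cbv zeta.
have eb : ev env st (bc k) = st0 1 k by rewrite /= hst // eq_sym.
set n := st0 1 k in eb *.
pose Q m st' :=
  (forall T' j, T' != T -> st' T' j = st0 T' j) /\
  (forall j,
    (exists v vs, [/\ v < m, below n (size xs) vs,
        j = ev (updl (upd env x v) xs vs) st0 i &
        st' T j = ev (updl (upd env x v) xs vs) st0 a]) \/
    ((forall v vs, v < m -> below n (size xs) vs ->
        j <> ev (updl (upd env x v) xs vs) st0 i) /\ st' T j = st T j)).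
have [h1 h2] : Q n (exec env st (nest (x :: xs) (bc k) (SSet T i a))).
  rewrite -eb; apply: for_ind.
    by split=> // j; right; split.
  rewrite eb => v st1 hv [q1 q2].
  have [p1 p2] := ih (upd env x v) st1 q1; split=> // j.
  have [[vs hvs [e1 e2]]|[ne e2]] := p2 j.
    by left; exists v, vs; split.
  rewrite e2; have [[v' [vs [h1 h2 h3 h4]]]|[h1 h2]] := q2 j.
    by left; exists v', vs; split=> //; exact: ltnW.
  right; split=> // v' vs; rewrite ltnS leq_eqVlt => /orP[/eqP->|]; last exact: h1.
  exact: ne.
split=> // j; have [[v [vs [hv hvs e1 e2]]]|[h3 h4]] := h2 j.
  left; exists (v :: vs) => //; split; first by case: hvs => /= ->.
  by case: hvs => /= _ ->; rewrite hv.
right; split=> // -[|v vs] [] //= [hs] /andP[hv hvs]; exact: h3.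
Qed.

Section Fill.
Variables (T k : nat) (a : exp) (env : nat -> nat) (st : store).
Hypotheses (T1 : T != 1) (ra : ~~ rd T a).
Let n := st 1 k.

Lemma fill1P x : let st' := exec env st (nest [:: x] (bc k) (SSet T (EVar x) a)) in
  (forall T' j, T' != T -> st' T' j = st T' j) /\
  (forall v, v < n -> st' T v = ev (upd env x v) st a).
Proof.
have [h1 h2] := @nestP T k (EVar x) a st [:: x] T1 isT ra env st (fun _ _ _ => erefl).
split=> // v hv; have [[[|w [|? ?]] [] //= _]|[/(_ [:: v]) h _]] := h2 v.
  by rewrite /upd eqxx => _ [-> ->].
exfalso; apply: h; first by split; rewrite //= andbT.
by rewrite /= upd_same.
Qed.

Definition ix2 x y := EAdd (eMul (bc k) (EVar x)) (EVar y).

Lemma fill2P x y : x != y -> x != 99 ->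
  let st' := exec env st (nest [:: x; y] (bc k) (SSet T (ix2 x y) a)) in
  (forall T' j, T' != T -> st' T' j = st T' j) /\
  (forall v w, v < n -> w < n ->
     st' T (n * v + w) = ev (upd (upd env x v) y w) st a).
Proof.
move=> xy x99.
have ri : ~~ rd T (ix2 x y) by rewrite /ix2 /= !orbF eq_sym.
have E v w : ev (upd (upd env x v) y w) st (ix2 x y) = n * v + w.
  rewrite /ix2 evAdd evMulE; last by rewrite /= eq_sym.
  by rewrite !evVar evbc upd_same upd_other // upd_same.
have [h1 h2] := @nestP T k (ix2 x y) a st [:: x; y] T1 ri ra env st (fun _ _ _ => erefl).
split=> // v w hv hw; have [[vs hvs [e0 ->]]|[/(_ [:: v; w]) h _]] := h2 (n * v + w).
  case: vs hvs e0 => [|v' [|w' [|? ?]]] [] // _ /= /and3P[hv' hw' _] e0.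
  have e : n * v + w = n * v' + w' by rewrite e0; exact: E.
  have [-> ->] // : v = v' /\ w = w'.
  have e1 : (n * v + w) %/ n = (n * v' + w') %/ n by rewrite e.
  have e2 : (n * v + w) %% n = (n * v' + w') %% n by rewrite e.
  move: e1 e2; rewrite ![n * _]mulnC !divnMDl ?(leq_ltn_trans _ hv) // !divn_small // !modnMDl.
  by rewrite !modn_small // !addn0.
exfalso; apply: h; first by split; rewrite //= hv hw.
by rewrite -E.
Qed.

End Fill.

(** * Evaluation of formulas *)

Definition vcons (x : nat) (v : nat -> nat) : nat -> nat :=
  fun i => if i is i'.+1 then v i' else x.

(** Satisfaction over the numbers below [N], with an arbitrary relation and total assignments, so
    that graphs, words and tables can be compared without changing types. *)
Fixpoint satn (N : nat) (a : nat -> nat -> bool) m (phi : fo m) : (nat -> nat) -> bool :=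
  match phi with
  | FEq _ i j => fun v => v i == v j
  | FAdj _ i j => fun v => a (v i) (v j)
  | FNot _ p => fun v => ~~ satn N a p v
  | FAnd _ p q => fun v => satn N a p v && satn N a q v
  | FOr _ p q => fun v => satn N a p v || satn N a q v
  | FEx _ p => fun v => has (fun x => satn N a p (vcons x v)) (iota 0 N)
  | FAll _ p => fun v => all (fun x => satn N a p (vcons x v)) (iota 0 N)
  end.

Lemma satn_ext N a m (phi : fo m) : forall v v',
  (forall i, i < m -> v i = v' i) -> satn N a phi v = satn N a phi v'.
Proof.
elim: phi => {m} [m i j|m i j|m p ih|m p ihp q ihq|m p ihp q ihq|m p ih|m p ih] v v' h /=.
- by rewrite !h.
- by rewrite !h.
- by rewrite (ih v v').
- by rewrite (ihp v v') // (ihq v v').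
- by rewrite (ihp v v') // (ihq v v').
- apply: eq_has => x; apply: ih => -[|i] //= hi; exact: h.
- apply: eq_all => x; apply: ih => -[|i] //= hi; exact: h.
Qed.

Definition adjn (G : sgraph) (i j : nat) : bool :=
  if insub i is Some x then if insub j is Some y then @adj G x y else false else false.

Lemma adjnE (G : sgraph) (x y : 'I_(nv G)) : adjn G x y = adj x y.
Proof. by rewrite /adjn !valK. Qed.

Lemma sat_satn G m (phi : fo m) : forall v : m.-tuple 'I_(nv G),
  sat phi v = satn (nv G) (adjn G) phi (fun i => nth 0 [seq val x | x <- v] i).
Proof.
have nthv k (u : k.-tuple 'I_(nv G)) (i : 'I_k) :
    nth 0 [seq val x | x <- u] i = tnth u i.
  by rewrite (nth_map (tnth u i)) ?size_tuple // -tnth_nth.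
elim: phi => {m} [m i j|m i j|m p ih|m p ihp q ihq|m p ihp q ihq|m p ih|m p ih] v.
- by rewrite /= !nthv.
- by rewrite /= !nthv adjnE.
- by rewrite /= ih.
- by rewrite /= ihp ihq.
- by rewrite /= ihp ihq.
- rewrite /=; apply/existsP/hasP => [[x hx]|[x]].
    exists (val x); first by rewrite mem_iota /=.
    by move: hx; rewrite ih /=; congr is_true; apply: satn_ext => -[].
  rewrite mem_iota /= add0n => hx h; exists (Ordinal hx); rewrite ih /=.
  by move: h; congr is_true; apply: satn_ext => -[].
- rewrite /=; apply/forallP/allP => [h x|h x].
    rewrite mem_iota /= add0n => hx; have := h (Ordinal hx); rewrite ih /=.
    by congr is_true; apply: satn_ext => -[].
  have := h (val x); rewrite mem_iota /= ih => /(_ (ltn_ord x)).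
  by congr is_true; apply: satn_ext => -[].
Qed.

(* Bound cells of table 1: 3 = length of the formula, 5 = N, 6 = N + 1,
   7 = (N + 1) ^ length, 9 = (N + 1) ^ (length - 1).  An assignment of all the
   variables is a number below cell 7, read in base N + 1 from the least digit. *)
Definition cE := bc 3.
Definition cN := bc 5.
Definition cB := bc 6.
Definition cW := bc 7.
Definition cW1 := bc 9.

Definition qt i e := EGet 5 (EAdd (eMul cW i) e).
Definition dig i e := ESub (qt i e) (eMul cB (qt (EAdd i (ECst 1)) e)).
Definition fml p := EGet 0 (EAdd (EGet 2 (ECst 1)) p).

(** The machine has no division: a quotient is found by counting the positive multiples of the base
    that fit, see [divn_count]. *)
Definition qt_stm : stm :=
  SSeq (SFor 1 cW (SSet 5 (EVar 1) (EVar 1)))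
    (SFor 0 cE (SFor 1 cW
      (SSet 5 (EAdd (eMul cW (EAdd (EVar 0) (ECst 1))) (EVar 1))
        (ESum 2 cW (eLe (eMul cB (EAdd (EVar 2) (ECst 1)))
                        (qt (EVar 0) (EVar 1))))))).

Definition pos_e := ESub (ESub cE (ECst 1)) (EVar 0).
Definition len_at p := EGet 7 p.
Definition tb p e := EGet 6 (EAdd (eMul cW p) e).

Definition arg1 := EAdd pos_e (ECst 1).
Definition arg2 := EAdd arg1 (len_at arg1).

Definition len_val : exp :=
  EAdd (eWhen (eLt (fml pos_e) (ECst 2)) (ECst 3))
  (EAdd (eWhen (eAnd (eLt (ECst 1) (fml pos_e))
                     (eNot (eOr (eEq (fml pos_e) (ECst 3)) (eEq (fml pos_e) (ECst 4)))))
               (EAdd (ECst 1) (len_at arg1)))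
        (eWhen (eOr (eEq (fml pos_e) (ECst 3)) (eEq (fml pos_e) (ECst 4)))
               (EAdd (ECst 1) (EAdd (len_at arg1) (len_at arg2))))).

Definition dig1 := dig (fml arg1) (EVar 1).
Definition dig2 := dig (fml (EAdd pos_e (ECst 2))) (EVar 1).
(** Prepends the value of the new variable as lowest digit and drops the top digit, so that the code
    of the assignment stays below [B ^ E]. *)
Definition cons_code : exp :=
  EAdd (EVar 2) (eMul cB (ESub (EVar 1)
    (eMul cW1 (qt (ESub cE (ECst 1)) (EVar 1))))).

Definition tb_case k v := eWhen (eEq (fml pos_e) (ECst k)) v.

Definition tb_val : exp :=
  EAdd (tb_case 0 (eEq dig1 dig2))
  (EAdd (tb_case 1 (EGet 4 (EAdd (eMul cB dig1) dig2)))
  (EAdd (tb_case 2 (eNot (tb arg1 (EVar 1))))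
  (EAdd (tb_case 3 (eAnd (tb arg1 (EVar 1)) (tb arg2 (EVar 1))))
  (EAdd (tb_case 4 (eOr (tb arg1 (EVar 1)) (tb arg2 (EVar 1))))
  (EAdd (tb_case 5 (eEx 2 cN (tb arg1 cons_code)))
        (tb_case 6 (eAll 2 cN (tb arg1 cons_code)))))))).

Definition tb_stm : stm :=
  SFor 0 cE (SSeq (SSet 7 pos_e len_val)
    (SFor 1 cW (SSet 6 (EAdd (eMul cW pos_e) (EVar 1)) tb_val))).

Definition eval_stm : stm :=
  SSeq qt_stm (SSeq tb_stm (SSet 2 (ECst 0) (EGet 6 (ECst 0)))).

Lemma divn_count z B W : 0 < B -> z < W ->
  \sum_(0 <= y < W) (B * y.+1 <= z) = z %/ B.
Proof.
move=> B0 zW.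
have : z %/ B <= W by apply: leq_trans (leq_div _ _) (ltnW zW).
move=> hq; rewrite (big_cat_nat (n := z %/ B)) //=.
rewrite (@eq_big_nat _ _ _ 0 _ _ (fun _ => 1)) => [|y /andP[_ hy]]; last first.
  by rewrite mulnC -leq_divRL // hy.
rewrite (@eq_big_nat _ _ _ (z %/ B) _ _ (fun _ => 0)) => [|y /andP[hy _]]; last first.
  by rewrite mulnC -leq_divRL // leqNgt ltnS hy.
by rewrite !sum_nat_const_nat !muln0 !muln1 !addn0 subn0.
Qed.

Lemma subn_div z d : z - d * (z %/ d) = z %% d.
Proof. by rewrite {1}(divn_eq z d) mulnC addKn. Qed.

Definition dg B e i := (e %/ B ^ i) %% B.

Lemma dg_cons B M x e i : x < B -> i < M ->
  dg B (x + B * (e %% B ^ M.-1)) i = vcons x (dg B e) i.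
Proof.
move=> xB iM; have B0 : 0 < B by lia.
rewrite /dg; case: i iM => [|i] iM /=.
  by rewrite expn0 divn1 addnC mulnC modnMDl modn_small.
have -> : (x + B * (e %% B ^ M.-1)) %/ B ^ i.+1 = (e %% B ^ M.-1) %/ B ^ i.
  by rewrite expnS divnMA addnC mulnC divnMDl // (divn_small xB) addn0.
have [k ->] : exists k, M.-1 = k.+1 + i by exists (M.-1 - i.+1); lia.
by rewrite expnD -modn_divl modn_dvdm // expnS dvdn_mulr.
Qed.

Lemma size_encode_gt0 m (phi : fo m) : 0 < size (encode_fo phi).
Proof. by case: phi. Qed.

Section Eval.
Variables (N E : nat) (a : nat -> nat -> bool).
Let B := N.+1.
Let W := B ^ E.

Definition cells_ok (st : store) : Prop :=
  [/\ st 1 3 = E, st 1 5 = N, st 1 6 = B, st 1 7 = W & st 1 9 = B ^ E.-1].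

Definition keeps (Ts : pred nat) (st st' : store) : Prop :=
  forall T j, ~~ Ts T -> st' T j = st T j.

Lemma cells_keep (Ts : pred nat) st st' : ~~ Ts 1 -> keeps Ts st st' ->
  cells_ok st -> cells_ok st'.
Proof. by move=> h k [*]; split; rewrite k. Qed.

Lemma qtP env st : cells_ok st ->
  keeps (pred1 5) st (exec env st qt_stm) /\
  forall i e, i <= E -> e < W -> exec env st qt_stm 5 (W * i + e) = e %/ B ^ i.
Proof.
move=> hc.
pose st1 := exec env st (nest [:: 1] cW (SSet 5 (EVar 1) (EVar 1))).
have [k1 v1] := @fill1P 5 7 (EVar 1) env st isT isT 1.
have hc1 : cells_ok st1 by apply: (@cells_keep (pred1 5)) hc => // T j; exact: k1.
have [c3 _ c6 c7 _] := hc1.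
pose Q m st' := keeps (pred1 5) st st' /\
  forall i e, i <= m -> e < W -> st' 5 (W * i + e) = e %/ B ^ i.
suff: Q E (exec env st1 (SFor 0 cE (SFor 1 cW
      (SSet 5 (EAdd (eMul cW (EAdd (EVar 0) (ECst 1))) (EVar 1))
        (ESum 2 cW (eLe (eMul cB (EAdd (EVar 2) (ECst 1)))
                        (qt (EVar 0) (EVar 1)))))))) by [].
rewrite -{1}c3 -[st1 1 3]/(ev env st1 cE); apply: for_ind.
  split; first by move=> T j hT; apply: k1.
  move=> i e; rewrite leqn0 => /eqP-> he; rewrite muln0 add0n expn0 divn1.
  by rewrite /st1 v1 ?evVar ?upd_same //; case: hc => _ _ _ -> _.
rewrite evbc c3 => m st2 hm [k2 v2].
have hc2 : cells_ok st2 by apply: (@cells_keep (pred1 5)) hc.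
have [d3 _ d6 d7 _] := hc2.
pose R e st' := keeps (pred1 5) st st' /\
  (forall i e', i <= m -> e' < W -> st' 5 (W * i + e') = e' %/ B ^ i) /\
  (forall e', e' < e -> st' 5 (W * m.+1 + e') = e' %/ B ^ m.+1).
have [r1 [r2 r3]] : R W (exec (upd env 0 m) st2 (SFor 1 cW
      (SSet 5 (EAdd (eMul cW (EAdd (EVar 0) (ECst 1))) (EVar 1))
        (ESum 2 cW (eLe (eMul cB (EAdd (EVar 2) (ECst 1)))
                        (qt (EVar 0) (EVar 1))))))).
  rewrite -{1}d7 -[st2 1 7]/(ev (upd env 0 m) st2 cW); apply: for_ind; first by split.
  rewrite evbc d7 => e st3 he [k3 [v3 u3]].
  have hc3 : cells_ok st3 by apply: (@cells_keep (pred1 5)) hc.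
  have [_ _ f6 f7 _] := hc3.
  have Ei : ev (upd (upd env 0 m) 1 e) st3 (EAdd (eMul cW (EAdd (EVar 0) (ECst 1))) (EVar 1))
    = W * m.+1 + e by rewrite evAdd evMulE // evbc f7 /= addn1.
  have Ea : ev (upd (upd env 0 m) 1 e) st3 (ESum 2 cW (eLe (eMul cB (EAdd (EVar 2) (ECst 1)))
                        (qt (EVar 0) (EVar 1)))) = e %/ B ^ m.+1.
    rewrite evSum evbc f7.
    have Eq x : ev (upd (upd (upd env 0 m) 1 e) 2 x) st3 (qt (EVar 0) (EVar 1)) = e %/ B ^ m.
      rewrite /qt evGet evAdd evMulE // evbc f7 !evVar /upd /=; exact: v3.
    rewrite (eq_bigr (fun y => (B * y.+1 <= e %/ B ^ m) : nat)) => [|y _].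
      rewrite divn_count //; last by apply: leq_ltn_trans (leq_div _ _) he.
      by rewrite -divnMA -expnSr.
    by rewrite ev01 ttLe Eq evMulE // evbc f6 /= addn1.
  rewrite exec_set Ei Ea.
  split=> [T j hT|]; first by rewrite /setst (negbTE (hT : T != 5)) /= k3.
  split=> [i e' hi he'|e' he'].
    rewrite /setst eqxx /= ifF; first exact: v3.
    apply/eqP => eq; suff : W * m.+1 <= W * m.+1 + e /\ W * i + e' < W * m.+1 by lia.
    have := leq_mul (leqnn W) (hi : i < m.+1); rewrite mulnS; lia.
  rewrite /setst eqxx /= eqn_add2l; case: eqP => [->//|ne].
  by apply: u3; lia.
split=> // i e; rewrite leq_eqVlt => /orP[/eqP->|] he; first exact: r3.
by apply: r2; rewrite -ltnS.
Qed.

Variable F : nat -> nat.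

Definition at_pos p (c : seq nat) : Prop :=
  p + size c <= E /\ forall i, i < size c -> F (p + i) = nth 0 c i.

Lemma at_pos_cat p c c' : at_pos p (c ++ c') -> at_pos p c /\ at_pos (p + size c) c'.
Proof.
case; rewrite size_cat => h1 h2; split; split; try lia.
  by move=> i hi; rewrite h2 ?nth_cat ?hi //; lia.
move=> i hi; rewrite -addnA h2; last lia.
by rewrite nth_cat ifF ?addKn //; lia.
Qed.

Lemma at_pos_cons p x c : at_pos p (x :: c) -> F p = x /\ at_pos p.+1 c.
Proof.
move=> h; have [h1 h2] := @at_pos_cat p [:: x] c h; rewrite addn1 in h2; split=> //.
by case: h1 => _ /(_ 0 isT); rewrite addn0.
Qed.

(** The inequality provides a digit for each free variable. It is inherited by subformulas, since a
    quantifier adds one variable but takes one cell. *)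
Definition good (st : store) p : Prop :=
  forall m (phi : fo m), at_pos p (encode_fo phi) -> m + size (encode_fo phi) <= E ->
    st 7 p = size (encode_fo phi) /\
    forall e, e < W -> st 6 (W * p + e) = satn N a phi (dg B e).

(* The tables below are filled from the end of the formula, as if a subformula
   started at every cell; what is computed elsewhere is never used. *)
Definition fits (st : store) : Prop :=
  [/\ cells_ok st, forall i, st 0 (st 2 1 + i) = F i,
      forall x y, x < B -> y < B -> st 4 (B * x + y) = a x y &
      forall i e, i <= E -> e < W -> st 5 (W * i + e) = e %/ B ^ i].

Lemma fits_keep st st' : keeps (fun T => (T == 6) || (T == 7)) st st' ->
  fits st -> fits st'.
Proof.
move=> k [h1 h2 h3 h4]; split.
- by apply: (@cells_keep _ st st' _ k h1).
- by move=> i; rewrite !k // h2.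
- by move=> x y hx hy; rewrite k // h3.
- by move=> i e hi he; rewrite k // h4.
Qed.

Section Row.
Variables (env : nat -> nat) (t : nat) (tE : t < E).
Hypothesis env0 : env 0 = t.
Let p := E - 1 - t.

Lemma ev_pos st : cells_ok st -> ev env st pos_e = p.
Proof. by case=> h3 _ _ _ _; rewrite /= env0 h3. Qed.

Lemma ev_fml st e : fits st -> ev env st (fml e) = F (ev env st e).
Proof. by case=> _ h _ _; rewrite -h. Qed.

Lemma len_valP st : fits st -> ev env st len_val =
  if F p < 2 then 3 else if (F p == 3) || (F p == 4)
  then 1 + (st 7 p.+1 + st 7 (p.+1 + st 7 p.+1)) else 1 + st 7 p.+1.
Proof.
move=> h; have [hc _ _ _] := h.
have E1 : ev env st arg1 = p.+1 by rewrite /arg1 evAdd ev_pos // addn1.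
have l1 : ev env st (EAdd (ECst 1) (len_at arg1)) = 1 + st 7 p.+1.
  by rewrite evAdd /len_at evGet E1.
have l2 : ev env st (EAdd (ECst 1) (EAdd (len_at arg1) (len_at arg2))) =
    1 + (st 7 p.+1 + st 7 (p.+1 + st 7 p.+1)).
  by rewrite evAdd (evAdd _ _ (len_at _)) /len_at !evGet E1 /arg2 evAdd evGet E1.
rewrite /len_val evAdd [X in _ + X]evAdd !evWhen // l1 l2.
rewrite ttAnd ttNot !ttOr !ttLt !ttEq ev_fml // ev_pos // !evCst.
case: ltnP => h2; last by case: (_ || _) => /=; rewrite ?add0n ?addn0.
by have -> : (F p == 3) || (F p == 4) = false by lia.
Qed.

(** The summands of [tb_val] are guarded by the head symbol, so only one of them counts; it refers
    to rows further right, which are already correct. *)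
Lemma tb_valP st : fits st -> (forall p', p < p' -> p' < E -> good st p') ->
  env 1 < W -> forall m (phi : fo m), at_pos p (encode_fo phi) ->
  m + size (encode_fo phi) <= E ->
  ev env st tb_val = satn N a phi (dg B (env 1)).
Proof.
move=> h hg he m phi hp hm.
have [hc hF hM hQ] := h; have [h3 h5 h6 h7 h9] := hc.
have E1 : ev env st arg1 = p.+1 by rewrite /arg1 evAdd ev_pos // addn1.
have Eqt env' i e : vr 99 i = false -> ev env' st i <= E -> ev env' st e < W ->
    ev env' st (qt i e) = ev env' st e %/ B ^ ev env' st i.
  by move=> v99 hi he'; rewrite /qt evGet evAdd evMulE ?v99 // evbc h7 hQ.
have vA i : vr 99 i = false -> vr 99 (EAdd i (ECst 1)) = false by move=> /= ->.
have Edig i : vr 99 i = false -> ev env st i < E ->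
    ev env st (dig i (EVar 1)) = dg B (env 1) (ev env st i).
  move=> v99 hi; rewrite /dig evSub evMulE //.
  rewrite (Eqt env i) ?(Eqt env _ _ (vA i v99)) //; try by rewrite ?evAdd ?evCst ?addn1 // ltnW.
  rewrite evVar evbc h6 evAdd evCst addn1 /dg expnSr divnMA.
  by rewrite subn_div.
have Etb env' i e : vr 99 i = false -> ev env' st (tb i e) =
    st 6 (W * ev env' st i + ev env' st e).
  by move=> v99; rewrite /tb evGet evAdd evMulE ?v99 // evbc h7.
have ttb env' i e : vr 99 i = false -> tt env' st (tb i e) =
    (0 < st 6 (W * ev env' st i + ev env' st e)) by move=> v99; rewrite /tt Etb.
have Ef : ev env st (fml pos_e) = F p by rewrite ev_fml // ev_pos.
have Ecase k v : ~~ vr 99 v -> ev env st (tb_case k v) =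
    if F p == k then ev env st v else 0.
  by move=> v99; rewrite evWhen // ttEq Ef.
have ED (x y : exp) : ev env st (EAdd x y) = ev env st x + ev env st y by [].
pose upx x := upd env 2 x.
have Ecc x : x < N -> let c := ev (upx x) st cons_code in
   c < W /\ forall i, i < E -> dg B c i = vcons x (dg B (env 1)) i.
  move=> hx c.
  have Ec : c = x + B * (env 1 %% B ^ E.-1).
    rewrite /c /cons_code evAdd evMulE // evbc h6 evSub evMulE // evbc h9.
    rewrite Eqt //; last by rewrite evSub evbc h3 evCst; lia.
    rewrite !evVar evSub evbc evCst /upx /upd /= h3 subn1.
    by rewrite subn_div.
  have hxB : x < B by rewrite /B ltnS ltnW.
  split=> [|i hi]; last by rewrite Ec dg_cons.
  rewrite Ec.
  have hm1 : env 1 %% B ^ E.-1 < B ^ E.-1 by rewrite ltn_mod expn_gt0.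
  have -> : W = B * B ^ E.-1 by rewrite /W -expnS prednK //; lia.
  by have := leq_mul (leqnn B) hm1; rewrite mulnS; lia.
have Etv : ev env st tb_val =
  nth 0 [:: ev env st (eEq dig1 dig2); ev env st (EGet 4 (EAdd (eMul cB dig1) dig2));
    ev env st (eNot (tb arg1 (EVar 1)));
    ev env st (eAnd (tb arg1 (EVar 1)) (tb arg2 (EVar 1)));
    ev env st (eOr (tb arg1 (EVar 1)) (tb arg2 (EVar 1)));
    ev env st (eEx 2 cN (tb arg1 cons_code)); ev env st (eAll 2 cN (tb arg1 cons_code))]
    (F p).
  rewrite /tb_val !ED !Ecase //.
  case: (F p) => [|[|[|[|[|[|[|k]]]]]]]; rewrite ?eqxx ?add0n ?addn0 //.
  by rewrite [RHS]/= nth_nil.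
have IH k (q : fo k) p' : p < p' -> at_pos p' (encode_fo q) ->
    k + size (encode_fo q) <= E -> st 7 p' = size (encode_fo q) /\
    forall e, e < W -> st 6 (W * p' + e) = satn N a q (dg B e).
  move=> pp hq hk; have q0 := size_encode_gt0 q.
  by apply: hg => //; case: hq => hq _; lia.
rewrite Etv {Etv}.
case: phi hp hm => {m} [m i j|m i j|m q|m q1 q2|m q1 q2|m q|m q].
- move=> hp hm; have hl := hm; rewrite /= in hl.
  have [-> /at_pos_cons [fi /at_pos_cons [fj _]]] := at_pos_cons hp.
  rewrite -[nth _ _ _]/(ev env st (eEq dig1 dig2)) ev01 ttEq.
  have i1 : ev env st (fml arg1) = i by rewrite ev_fml // E1.
  have i2 : ev env st (fml (EAdd pos_e (ECst 2))) = j.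
    by rewrite ev_fml // evAdd ev_pos // addn2.
  have [hi hj] := (ltn_ord i, ltn_ord j).
  rewrite /dig1 /dig2 !Edig ?i1 ?i2 //; lia.
- move=> hp hm; have hl := hm; rewrite /= in hl.
  have [-> /at_pos_cons [fi /at_pos_cons [fj _]]] := at_pos_cons hp.
  rewrite -[nth _ _ _]/(ev env st (EGet 4 (EAdd (eMul cB dig1) dig2))).
  have i1 : ev env st (fml arg1) = i by rewrite ev_fml // E1.
  have i2 : ev env st (fml (EAdd pos_e (ECst 2))) = j.
    by rewrite ev_fml // evAdd ev_pos // addn2.
  have [hi hj] := (ltn_ord i, ltn_ord j).
  rewrite evGet evAdd evMulE // evbc h6 /dig1 /dig2 !Edig ?i1 ?i2 //; try lia.
  by rewrite hM // ltn_mod.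
- move=> hp hm; rewrite /= in hp hm; have [-> hq] := at_pos_cons hp.
  rewrite -[nth _ _ _]/(ev env st (eNot (tb arg1 (EVar 1)))) ev01 ttNot ttb // E1.
  have [_ ->] // := IH _ _ _ (ltnSn p) hq ltac:(lia).
  by rewrite evVar lt0b.
- move=> hp hm; rewrite /= in hp hm; have [-> /at_pos_cat [hq1 hq2]] := at_pos_cons hp.
  rewrite size_cat in hm.
  have [l1 s1] := IH _ _ _ (ltnSn p) hq1 ltac:(lia).
  rewrite -[nth _ _ _]/(ev env st (eAnd (tb arg1 (EVar 1)) (tb arg2 (EVar 1)))).
  rewrite ev01 ttAnd !ttb // E1.
  have -> : ev env st arg2 = p.+1 + size (encode_fo q1).
    by rewrite /arg2 /len_at evAdd evGet E1 l1.
  have [_ s2] := IH _ _ _ (leq_addr _ _) hq2 ltac:(lia).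
  by rewrite !evVar s1 // s2 // !lt0b.
- move=> hp hm; rewrite /= in hp hm; have [-> /at_pos_cat [hq1 hq2]] := at_pos_cons hp.
  rewrite size_cat in hm.
  have [l1 s1] := IH _ _ _ (ltnSn p) hq1 ltac:(lia).
  rewrite -[nth _ _ _]/(ev env st (eOr (tb arg1 (EVar 1)) (tb arg2 (EVar 1)))).
  rewrite ev01 ttOr !ttb // E1.
  have -> : ev env st arg2 = p.+1 + size (encode_fo q1).
    by rewrite /arg2 /len_at evAdd evGet E1 l1.
  have [_ s2] := IH _ _ _ (leq_addr _ _) hq2 ltac:(lia).
  by rewrite !evVar s1 // s2 // !lt0b.
- move=> hp hm; rewrite /= in hp hm; have [-> hq] := at_pos_cons hp.
  rewrite -[nth _ _ _]/(ev env st (eEx 2 cN (tb arg1 cons_code))) ev01 ttEx evbc h5.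
  congr nat_of_bool; apply: eq_in_has => x; rewrite mem_iota /= add0n => hx.
  have [c1 c2] := Ecc x hx; rewrite ttb // -/(upx x).
  have -> : ev (upx x) st arg1 = p.+1 by [].
  have [_ ->] // := IH _ _ _ (ltnSn p) hq ltac:(lia).
  rewrite lt0b; apply: satn_ext => i hi; apply: c2; lia.
- move=> hp hm; rewrite /= in hp hm; have [-> hq] := at_pos_cons hp.
  rewrite -[nth _ _ _]/(ev env st (eAll 2 cN (tb arg1 cons_code))) ev01 ttAll evbc h5.
  congr nat_of_bool; apply: eq_in_all => x; rewrite mem_iota /= add0n => hx.
  have [c1 c2] := Ecc x hx; rewrite ttb // -/(upx x).
  have -> : ev (upx x) st arg1 = p.+1 by [].
  have [_ ->] // := IH _ _ _ (ltnSn p) hq ltac:(lia).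
  rewrite lt0b; apply: satn_ext => i hi; apply: c2; lia.
Qed.

End Row.

Lemma good_ext st st' p : st' 7 p = st 7 p ->
  (forall e, e < W -> st' 6 (W * p + e) = st 6 (W * p + e)) -> good st p -> good st' p.
Proof.
move=> h7 h6 h m phi hp hm; have [g1 g2] := h m phi hp hm.
by rewrite h7; split=> // e he; rewrite h6 // g2.
Qed.

Lemma row_neq p p' e e' : p < p' -> e < W -> W * p' + e' <> W * p + e.
Proof. by move=> pp he; have := leq_mul (leqnn W) pp; rewrite mulnS; lia. Qed.

Lemma tbP env st : fits st -> let st' := exec env st tb_stm in
  fits st' /\ forall p, p < E -> good st' p.
Proof.
move=> hf st'; have [hc _ _ _] := hf; have [h3 _ _ _ _] := hc.
pose Q t s := fits s /\ forall p, E - t <= p -> p < E -> good s p.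
suff : Q E st' by case=> q1 q2; split=> // p; apply: q2; rewrite subnn.
suff : Q (ev env st cE) st' by rewrite evbc h3.
apply: for_ind; first by split=> // p; lia.
rewrite evbc h3 => t s1 tE [f1 g1].
set env1 := upd env 0 t; pose p := E - 1 - t.
have [hc1 _ _ _] := f1.
have env1P s e : cells_ok s -> ev (upd env1 1 e) s pos_e = p by exact: (@ev_pos (upd env1 1 e) t erefl).
have Ep : ev env1 s1 pos_e = p by exact: (@ev_pos env1 t erefl).
rewrite exec_seq exec_set Ep (@len_valP env1 t tE erefl s1 f1).
set lv := (if _ then _ else _).
set s2 := setst _ _ _ _.
have s2E T j : (T == 7) && (j == p) = false -> s2 T j = s1 T j.
  by rewrite /s2 /setst => ->.
have f2 : fits s2.
  apply: fits_keep f1 => T j; rewrite negb_or => /andP[_ h]; apply: s2E.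
  by rewrite (negbTE h).
have [hc2 _ _ _] := f2; have [_ _ _ c7 _] := hc2.
have pE : p < E by rewrite /p; lia.
(* Invariant of the inner loop: rows further right are untouched, and the first [e] entries of row
   [p] are correct. *)
pose R e s := [/\ forall T j, T != 6 -> s T j = s2 T j,
  forall p' e', p < p' -> s 6 (W * p' + e') = s2 6 (W * p' + e') &
  forall e', e' < e -> forall m (phi : fo m), at_pos p (encode_fo phi) ->
     m + size (encode_fo phi) <= E -> s 6 (W * p + e') = satn N a phi (dg B e')].
have gR e s : R e s -> forall p', p < p' -> p' < E -> good s p'.
  case=> r1 r2 _ p' pp pE'; apply: good_ext (g1 p' _ pE'); last by rewrite /p in pp; lia.
    by rewrite r1 // s2E //; apply/eqP; lia.
  by move=> e' _; rewrite r2 // s2E.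
have fR e s : R e s -> fits s.
  case=> r1 _ _; apply: fits_keep f2 => T j; rewrite negb_or => /andP[h _]; exact: r1.
set s3 := exec _ _ _.
have R3 : R W s3.
  rewrite -c7 -[s2 1 7]/(ev env1 s2 cW) /s3; apply: for_ind; first by split.
  rewrite evbc c7 => e s he hR; have [r1 r2 r3] := hR.
  have hfs := fR _ _ hR; have [hcs _ _ _] := hfs; have [_ _ _ d7 _] := hcs.
  rewrite exec_set.
  have -> : ev (upd env1 1 e) s (EAdd (eMul cW pos_e) (EVar 1)) = W * p + e.
    by rewrite evAdd evMulE // evbc d7 env1P.
  split.
  - by move=> T j h; rewrite /setst (negbTE h) /= r1.
  - move=> p' e' pp; rewrite /setst eqxx /= ifF ?r2 //.
    by apply/eqP; exact: row_neq.
  - move=> e' he' m phi hp hm; rewrite /setst eqxx /= eqn_add2l.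
    case: eqP => [->|ne]; last by apply: r3 => //; lia.
    exact: (@tb_valP (upd env1 1 e) t tE erefl s hfs (gR _ _ hR) he m phi hp hm).
split; first exact: fR R3.
move=> p' h1 h2; case: (ltnP p p') => pp; first exact: (gR _ _ R3).
have {h1 h2 pp} -> : p' = p by rewrite /p in pp *; lia.
have [r1 r2 r3] := R3 => m phi hp hm; split; last by move=> e he; apply: r3.
rewrite r1 // /s2 /setst !eqxx /= /lv.
have IH k (q : fo k) p1 : p < p1 -> at_pos p1 (encode_fo q) ->
    k + size (encode_fo q) <= E -> s1 7 p1 = size (encode_fo q).
  move=> pp hq hk; have q0 := size_encode_gt0 q.
  have gp : good s1 p1 by apply: g1; case: hq => hq _; rewrite /p in pp; lia.
  by have [-> _] := gp _ _ hq hk.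
rewrite -/p; case: phi hp hm => {m} [m i j|m i j|m q|m q1 q2|m q1 q2|m q|m q] hp hm /=;
  rewrite /= in hp hm; have [-> hq] //= := at_pos_cons hp.
- by rewrite (IH _ q) //; lia.
- move: hq => /at_pos_cat [hq1 hq2]; rewrite size_cat in hm *.
  by rewrite (IH _ q1) 1?(IH _ q2) //; lia.
- move: hq => /at_pos_cat [hq1 hq2]; rewrite size_cat in hm *.
  by rewrite (IH _ q1) 1?(IH _ q2) //; lia.
- by rewrite (IH _ q) //; lia.
- by rewrite (IH _ q) //; lia.
Qed.

End Eval.

Theorem evalP N (a : nat -> nat -> bool) (phi : sentence) env st :
  let E := size (encode_fo phi) in
  cells_ok N E st ->
  (forall i, i < E -> st 0 (st 2 1 + i) = nth 0 (encode_fo phi) i) ->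
  (forall x y, x <= N -> y <= N -> st 4 (N.+1 * x + y) = a x y) ->
  forall v, exec env st eval_stm 2 0 = satn N a phi v.
Proof.
move=> E hc hF hM v; rewrite /eval_stm !exec_seq.
have [k1 q1] := @qtP N E env st hc.
set st1 := exec env st qt_stm in k1 q1 *.
pose F i := st 0 (st 2 1 + i).
have f1 : fits N E a F st1.
  split=> //; first by apply: (@cells_keep _ _ (pred1 5) st).
    by move=> i; rewrite !k1.
  by move=> x y hx hy; rewrite k1 // hM.
have [_ /(_ 0) g] := tbP env f1.
have E0 : 0 < E := size_encode_gt0 phi.
have [||_] := g E0 0 phi.
- by split=> // i hi; rewrite add0n; exact: hF.
- by [].
move=> /(_ 0); rewrite expn_gt0 => /(_ isT); rewrite muln0 addn0 => h.
rewrite exec_set evGet !evCst h /setst !eqxx.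
by congr nat_of_bool; apply: satn_ext.
Qed.

(** * Types of words *)

Section BackAndForth.
Variables (N N' : nat) (a a' : nat -> nat -> bool).
Variable I : nat -> seq nat -> seq nat -> Prop.
Hypothesis I_atom : forall r v v', I r v v' -> forall i j, i < size v -> j < size v ->
  (nth 0 v i == nth 0 v j) = (nth 0 v' i == nth 0 v' j) /\
  a (nth 0 v i) (nth 0 v j) = a' (nth 0 v' i) (nth 0 v' j).
Hypothesis I_forth : forall r v v', I r.+1 v v' -> forall x, x < N ->
  exists2 x', x' < N' & I r (x :: v) (x' :: v').
Hypothesis I_back : forall r v v', I r.+1 v v' -> forall x', x' < N' ->
  exists2 x, x < N & I r (x :: v) (x' :: v').

Fixpoint qrank m (phi : fo m) : nat :=
  match phi with
  | FEq _ _ _ => 0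
  | FAdj _ _ _ => 0
  | FNot _ p => qrank p
  | FAnd _ p q => maxn (qrank p) (qrank q)
  | FOr _ p q => maxn (qrank p) (qrank q)
  | FEx _ p => (qrank p).+1
  | FAll _ p => (qrank p).+1
  end.

Lemma vcons_nth x v : vcons x (nth 0 v) =1 nth 0 (x :: v).
Proof. by case. Qed.

(** The argument of Ehrenfeucht and Fraïssé: [I r] relates positions from which the duplicator
    survives [r] more rounds. *)
Lemma bf_sat m (phi : fo m) : forall r v v', I r v v' -> size v = m -> qrank phi <= r ->
  satn N a phi (nth 0 v) = satn N' a' phi (nth 0 v').
Proof.
elim: phi => {m} [m i j|m i j|m p ih|m p ihp q ihq|m p ihp q ihq|m p ih|m p ih]
  r v v' h sv /=.
- by move=> _; have [->] := I_atom h (i := i) (j := j) ltac:(by rewrite sv) ltac:(by rewrite sv).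
- by move=> _; have [_ ->] := I_atom h (i := i) (j := j) ltac:(by rewrite sv) ltac:(by rewrite sv).
- by move=> hr; rewrite (ih r v v').
- by rewrite geq_max => /andP[h1 h2]; rewrite (ihp r v v') // (ihq r v v').
- by rewrite geq_max => /andP[h1 h2]; rewrite (ihp r v v') // (ihq r v v').
- case: r h => // r h hr; apply/hasP/hasP => -[x]; rewrite mem_iota /= add0n => hx hs.
    have [x' hx' hI] := I_forth h hx; exists x'; first by rewrite mem_iota.
    move: hs; rewrite (satn_ext _ _ _ (fun i _ => vcons_nth x v i)).
    rewrite (satn_ext _ _ _ (fun i _ => vcons_nth x' v' i)).
    by rewrite (ih r _ (x' :: v')) //= sv.
  have [x' hx' hI] := I_back h hx; exists x'; first by rewrite mem_iota.
  move: hs; rewrite (satn_ext _ _ _ (fun i _ => vcons_nth x v' i)).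
  rewrite (satn_ext _ _ _ (fun i _ => vcons_nth x' v i)).
  by rewrite -(ih r (x' :: v)) //= sv.
- case: r h => // r h hr; apply/allP/allP => hs x; rewrite mem_iota /= add0n => hx.
    have [x' hx' hI] := I_back h hx.
    rewrite (satn_ext _ _ _ (fun i _ => vcons_nth x v' i)).
    have := hs x'; rewrite mem_iota => /(_ hx').
    rewrite (satn_ext _ _ _ (fun i _ => vcons_nth x' v i)).
    by rewrite (ih r _ (x :: v')) //= sv.
  have [x' hx' hI] := I_forth h hx.
  rewrite (satn_ext _ _ _ (fun i _ => vcons_nth x v i)).
  have := hs x'; rewrite mem_iota => /(_ hx').
  rewrite (satn_ext _ _ _ (fun i _ => vcons_nth x' v' i)).
  by rewrite -(ih r (x :: v)) //= sv.
Qed.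

End BackAndForth.

(** Allows the program to use the length of the formula in place of its rank. *)
Lemma qrank_size m (phi : fo m) : qrank phi <= size (encode_fo phi).
Proof.
elim: phi => {m} //= [m p ih|m p ihp q ihq|m p ihp q ihq]; rewrite ?size_cat; lia.
Qed.

(** * Words, the graphs that they describe, and their types *)

Notation letter := 'I_10.

(* A letter is 2 c + b, where the class c is 0 for an inner vertex of a path,
   1 and 2 for the two sides of the left half graph, 3 and 4 for those of the
   right one, and b tells whether the vertex is joined to the previous one. *)
Definition gam1 (w : seq nat) p p' : bool :=
  [&& p < p', p' < size w &
   [|| ((nth 0 w p)./2 == 1) && ((nth 0 w p')./2 == 2),
       ((nth 0 w p)./2 == 3) && ((nth 0 w p')./2 == 4) |
       (p' == p.+1) && odd (nth 0 w p')]].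

Definition gam w p p' : bool := gam1 w p p' || gam1 w p' p.

Lemma gamC w p p' : gam w p p' = gam w p' p.
Proof. by rewrite /gam orbC. Qed.

Fixpoint Ty (r : nat) : finType :=
  match r with
  | 0 => bool
  | r'.+1 => {set (Ty r' * letter * Ty r')}
  end.

(** Rank 0 records only whether the word is empty. For the factor between two pebbles this tells
    whether they are consecutive, which is the only information on it that adjacency uses. *)
Fixpoint tp (r : nat) (w : seq letter) : Ty r :=
  match r return Ty r with
  | 0 => size w != 0
  | r'.+1 => [set (tp r' (take i w), nth ord0 w i, tp r' (drop i.+1 w)) | i : 'I_(size w)]
  end.

Lemma tpS_in r w i : i < size w ->
  (tp r (take i w), nth ord0 w i, tp r (drop i.+1 w)) \in tp r.+1 w.
Proof. by move=> hi; apply/imsetP; exists (Ordinal hi). Qed.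

Lemma tpS_sub r w w' : tp r.+1 w \subset tp r.+1 w' <->
  forall i, i < size w -> exists2 i', i' < size w' &
    [/\ tp r (take i w) = tp r (take i' w'), nth ord0 w i = nth ord0 w' i' &
        tp r (drop i.+1 w) = tp r (drop i'.+1 w')].
Proof.
split=> [h i hi|h].
  have /(subsetP h) /imsetP [i' _ [e1 e2 e3]] := tpS_in r hi.
  by exists i' => //; split.
apply/subsetP => x /imsetP [i _ ->]; have [i' hi' [e1 e2 e3]] := h i (ltn_ord i).
by have := tpS_in r hi'; rewrite -e1 -e2 -e3.
Qed.

Lemma tpS_eq r w w' : tp r.+1 w = tp r.+1 w' -> forall i, i < size w ->
  exists2 i', i' < size w' &
    [/\ tp r (take i w) = tp r (take i' w'), nth ord0 w i = nth ord0 w' i' &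
        tp r (drop i.+1 w) = tp r (drop i'.+1 w')].
Proof. by move=> e; apply/tpS_sub; rewrite e. Qed.

Lemma tp_eqS r w w' :
  (forall i, i < size w -> exists2 i', i' < size w' &
    [/\ tp r (take i w) = tp r (take i' w'), nth ord0 w i = nth ord0 w' i' &
        tp r (drop i.+1 w) = tp r (drop i'.+1 w')]) ->
  (forall i, i < size w' -> exists2 i', i' < size w &
    [/\ tp r (take i w') = tp r (take i' w), nth ord0 w' i = nth ord0 w i' &
        tp r (drop i.+1 w') = tp r (drop i'.+1 w)]) ->
  tp r.+1 w = tp r.+1 w'.
Proof. by move=> h h'; apply/eqP; rewrite eqEsubset; apply/andP; split; apply/tpS_sub. Qed.

Lemma tp_down r : forall w w', tp r.+1 w = tp r.+1 w' -> tp r w = tp r w'.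
Proof.
elim: r => [|r ih] w w' e.
  have e1 := tpS_eq e; have e2 := tpS_eq (esym e).
  rewrite /=; case: w w' e1 e2 {e} => [|x w] [|x' w'] //= e1 e2.
    by have [] := e2 0 isT.
  by have [] := e1 0 isT.
apply: tp_eqS => i hi.
  by have [i' hi' [/ih h1 h2 /ih h3]] := tpS_eq e hi; exists i'.
by have [i' hi' [/ih h1 h2 /ih h3]] := tpS_eq (esym e) hi; exists i'.
Qed.

Lemma tp0 r w w' : tp r w = tp r w' -> (size w == 0) = (size w' == 0).
Proof.
elim: r => [|r ih]; last by move/tp_down; exact: ih.
by rewrite /=; case: (size w); case: (size w').
Qed.

(** Types form a right congruence, so a word keeps its type when the piece between two prefixes of
    equal type is cut out. *)
Lemma tp_rcons r c : forall w w', tp r w = tp r w' -> tp r (rcons w c) = tp r (rcons w' c).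
Proof.
elim: r => [|r ih] w w' e; first by rewrite /= !size_rcons.
have aux u u' : tp r.+1 u = tp r.+1 u' -> forall i, i < size (rcons u c) ->
  exists2 i', i' < size (rcons u' c) &
    [/\ tp r (take i (rcons u c)) = tp r (take i' (rcons u' c)),
        nth ord0 (rcons u c) i = nth ord0 (rcons u' c) i' &
        tp r (drop i.+1 (rcons u c)) = tp r (drop i'.+1 (rcons u' c))].
  move=> eu i; rewrite !size_rcons ltnS leq_eqVlt => /orP[/eqP->|hi].
    exists (size u') => //; rewrite -!cats1 !take_size_cat // !nth_cat !ltnn !subnn.
    by rewrite !drop_oversize ?size_cat ?addn1 //; split=> //; apply: tp_down.
  have [i' hi' [h1 h2 h3]] := tpS_eq eu hi; exists i'; first exact: ltnW.
  rewrite -!cats1 !takel_cat 1?ltnW // !nth_cat hi hi' !drop_cat.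
  have eT (s : seq letter) j : j < size s -> (if j.+1 < size s then drop j.+1 s ++ [:: c]
      else drop (j.+1 - size s) [:: c]) = rcons (drop j.+1 s) c.
    move=> hj; case: ltnP => h; first by rewrite cats1.
    by rewrite (_ : j.+1 - size s = 0) ?drop0 ?drop_oversize //; lia.
  by rewrite !eT //; split=> //; apply: ih.
by apply: tp_eqS; apply: aux.
Qed.

Definition fac (w : seq letter) i j := take (j - i) (drop i w).

Lemma size_fac w i j : j <= size w -> size (fac w i j) = j - i.
Proof. by move=> h; rewrite size_take size_drop; case: ltnP; lia. Qed.

Lemma fac_split w i j m : i + m < j -> j <= size w ->
  [/\ take m (fac w i j) = fac w i (i + m),
      nth ord0 (fac w i j) m = nth ord0 w (i + m) &
      drop m.+1 (fac w i j) = fac w (i + m).+1 j].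
Proof.
move=> h1 h2; split.
- by rewrite /fac take_takel ?addKn //; lia.
- by rewrite nth_take ?nth_drop //; lia.
- rewrite /fac (_ : j - i = (j - (i + m).+1) + m.+1); last by lia.
  by rewrite -take_drop drop_drop; congr (take _ (drop _ _)); lia.
Qed.

Section Chain.
Variables w w' : seq letter.

(** A position of the game: the pebbles from left to right, with equal letters under them and
    factors of equal type between them. *)
Fixpoint chain r (b b' : nat) (L : seq (nat * nat)) : Prop :=
  match L with
  | [::] => tp r (fac w b (size w)) = tp r (fac w' b' (size w'))
  | (p, p') :: L => [/\ b <= p < size w, b' <= p' < size w',
      nth ord0 w p = nth ord0 w' p', tp r (fac w b p) = tp r (fac w' b' p') &
      chain r p.+1 p'.+1 L]
  end.

Lemma chain_down r L : forall b b', chain r.+1 b b' L -> chain r b b' L.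
Proof.
elim: L => [|[p p'] L ih] b b' /=; first exact: tp_down.
by case=> h1 h2 h3 /tp_down h4 /ih h5; split.
Qed.

Lemma fac_pick r b b' j j' x : j <= size w -> j' <= size w' ->
  tp r.+1 (fac w b j) = tp r.+1 (fac w' b' j') -> b <= x < j ->
  exists2 x', b' <= x' < j' & [/\ nth ord0 w x = nth ord0 w' x',
    tp r (fac w b x) = tp r (fac w' b' x') &
    tp r (fac w x.+1 j) = tp r (fac w' x'.+1 j')].
Proof.
move=> hj hj' e /andP[bx xj].
have hi : x - b < size (fac w b j) by rewrite size_fac //; lia.
have [i' hi' [h1 h2 h3]] := tpS_eq e hi.
rewrite size_fac // in hi'.
exists (b' + i'); first by lia.
have [e1 e2 e3] := @fac_split w b j (x - b) ltac:(lia) hj.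
have [f1 f2 f3] := @fac_split w' b' j' i' ltac:(lia) hj'.
by move: h1 h2 h3; rewrite e1 e2 e3 f1 f2 f3 subnKC.
Qed.

(** The new pebble lies in one of the factors, where equality of types supplies the answer at the
    price of one rank, or on an old pebble. *)
Lemma chain_insert r L : forall b b' x, chain r.+1 b b' L -> b <= x < size w ->
  exists x' L', [/\ b' <= x' < size w', chain r b b' L', (x, x') \in L' &
    {subset L <= L'}].
Proof.
elim: L => [|[p p'] L ih] b b' x.
  move=> /= e hx; have [x' hx' [h1 h2 h3]] := fac_pick (leqnn _) (leqnn _) e hx.
  by exists x', [:: (x, x')]; split=> //=; rewrite inE.
move=> /= [h1 h2 h3 h4 h5] /andP[bx xw].
case: (ltngtP x p) => xp.
- have [x' hx' [g1 g2 g3]] :=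
    @fac_pick r b b' p p' x ltac:(lia) ltac:(lia) h4 ltac:(lia).
  exists x', [:: (x, x'), (p, p') & L]; split; first by lia.
  + by split=> //; [lia|lia|split=> //; [lia|lia|exact: chain_down]].
  + by rewrite inE eqxx.
  + by move=> y hy; rewrite inE hy orbT.
- have [x' [L' [g1 g2 g3 g4]]] := ih p.+1 p'.+1 x h5 ltac:(lia).
  exists x', ((p, p') :: L'); split; first by lia.
  + by split=> //; apply: tp_down.
  + by rewrite inE g3 orbT.
  + by move=> y; rewrite !inE => /orP[->//|/g4 ->]; rewrite orbT.
- exists p', ((p, p') :: L); split=> //.
  + by split=> //; [apply: tp_down|apply: chain_down].
  + by rewrite xp inE eqxx.
Qed.

Lemma chain_in r L : forall b b' p p', chain r b b' L -> (p, p') \in L ->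
  [/\ b <= p < size w, b' <= p' < size w', nth ord0 w p = nth ord0 w' p' &
      (p == b) = (p' == b')].
Proof.
elim: L => [|[q q'] L ih] b b' p p' //= [h1 h2 h3 h4 h5]; rewrite inE => /orP[/eqP[-> ->]|hp].
  split=> //; have := tp0 h4; rewrite !size_fac; lia.
by have [g1 g2 g3 g4] := ih _ _ _ _ h5 hp; split=> //; lia.
Qed.

Lemma chain_pair r L : forall b b' p p' q q', chain r b b' L -> (p, p') \in L ->
  (q, q') \in L -> (p < q) = (p' < q') /\ (q == p.+1) = (q' == p'.+1).
Proof.
elim: L => [|[s s'] L ih] b b' p p' q q' //= [h1 h2 h3 h4 h5].
rewrite !inE => /orP[/eqP[-> ->]|hp] /orP[/eqP[-> ->]|hq].
- by rewrite !ltnn; split=> //; lia.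
- by have [g1 g2 g3 g4] := chain_in h5 hq; split=> //; lia.
- by have [g1 g2 g3 g4] := chain_in h5 hp; split=> //; lia.
- exact: ih h5 hp hq.
Qed.

Lemma chain_gam r L b b' p p' q q' : chain r b b' L -> (p, p') \in L -> (q, q') \in L ->
  (p == q) = (p' == q') /\
  gam [seq val c | c <- w] p q = gam [seq val c | c <- w'] p' q'.
Proof.
move=> h hp hq.
have [p1 p2 p3 _] := chain_in h hp; have [q1 q2 q3 _] := chain_in h hq.
have [e1 e2] := chain_pair h hp hq; have [e3 e4] := chain_pair h hq hp.
split; first by lia.
rewrite /gam /gam1 !size_map !(nth_map ord0) /=; try lia.
by rewrite p3 q3 e1 e2 e3 e4 !(andP p1).2 !(andP p2).2 !(andP q1).2 !(andP q2).2.
Qed.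

End Chain.

Lemma chain_sym w w' r L : forall b b', chain w w' r b b' L ->
  chain w' w r b' b [seq (x.2, x.1) | x <- L].
Proof.
elim: L => [|[p p'] L ih] b b' /=; first by move=> ->.
by case=> h1 h2 h3 h4 /ih h5; split.
Qed.

(** Adjacency is defined without quantifiers from order, successor and letters, and a chain
    preserves all three. *)
Theorem word_equiv w w' q m (phi : fo m) v : tp q w = tp q w' -> m = 0 -> qrank phi <= q ->
  satn (size w) (gam [seq val c | c <- w]) phi v =
  satn (size w') (gam [seq val c | c <- w']) phi v.
Proof.
move=> e m0 hq.
pose I r (u u' : seq nat) := size u = size u' /\
  exists2 L, chain w w' r 0 0 L & forall i, i < size u -> (nth 0 u i, nth 0 u' i) \in L.
rewrite !(@satn_ext _ _ _ phi v (nth 0 [::])); try by rewrite m0.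
apply: (@bf_sat _ _ _ _ I _ _ _ _ _ q) => //.
- move=> r u u' [_ [L hL hu]] i j hi hj; exact: chain_gam hL (hu i hi) (hu j hj).
- move=> r u u' [su [L hL hu]] x hx.
  have [x' [L' [h1 h2 h3 h4]]] := chain_insert hL (x := x) hx.
  exists x'; first by lia.
  split; first by rewrite /= su.
  by exists L' => // -[|i] //= hi; apply: h4; apply: hu.
- move=> r u u' [su [L hL hu]] x hx.
  have [x' [L' [h1 h2 h3 h4]]] := chain_insert (chain_sym hL) (x := x) hx.
  exists x'; first by lia.
  split; first by rewrite /= su.
  exists [seq (x.2, x.1) | x <- L']; first exact: chain_sym.
  move=> [|i] /= hi; first by apply/mapP; exists (x, x').
  apply/mapP; exists (nth 0 u' i, nth 0 u i) => //; apply: h4; apply/mapP.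
  by exists (nth 0 u i, nth 0 u' i) => //; apply: hu.
- split=> //; exists [::] => //=.
  by rewrite /fac !subn0 !drop0 !take_size.
Qed.

(** * Exchanging the ends of long wires *)

Section Rewire.
Variables (n l : nat) (w : seq nat) (a : nat -> nat -> bool) (pos beta : nat -> nat).
Hypothesis sw : size w = n.
Hypothesis pos_lt : forall x, x < n -> pos x < n.
Hypothesis pos_inj : forall x y, x < n -> y < n -> pos x = pos y -> x = y.
Hypothesis pos_surj : forall p, p < n -> exists2 x, x < n & pos x = p.
Hypothesis a_irr : forall x, a x x = false.
Hypothesis a_sym : forall x y, a x y = a y x.
Hypothesis l2 : 1 < l.

(** The letter 7 is that of a right end joined to its predecessor. By the hypothesis [wire] it
    closes a block of a left end, with letter 2, and inner vertices, with letter 1. *)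
Definition wend e : bool := (e < n) && (nth 0 w e == 7).

Hypothesis wire : forall e, wend e ->
  [/\ l <= e, nth 0 w (e - l) = 2 & forall d, 0 < d < l -> nth 0 w (e - d) = 1].

(** The pairs on which the graph and the word may disagree: the position before an end, together
    with an end. *)
Definition special p p' : bool :=
  (nth 0 w p.+1 == 7) && (nth 0 w p' == 7) || (nth 0 w p'.+1 == 7) && (nth 0 w p == 7).

Hypothesis pat : forall x y, x < n -> y < n -> pos x < pos y ->
  ~~ special (pos x) (pos y) -> a x y = gam1 w (pos x) (pos y).
Hypothesis beta_end : forall e, wend e -> wend (beta e).
Hypothesis beta_inj : forall e e', wend e -> wend e' -> beta e = beta e' -> e = e'.
Hypothesis beta_surj : forall e, wend e -> exists2 e', wend e' & beta e' = e.
Hypothesis a_end : forall x y e, x < n -> y < n -> wend e -> pos x = e - 1 ->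
  nth 0 w (pos y) = 7 -> a x y = (pos y == beta e).

Lemma wend_letter e : wend e -> nth 0 w e = 7.
Proof. by case/andP=> _ /eqP. Qed.

Lemma wire_uniq e e' d d' : wend e -> wend e' -> 0 < d < l -> 0 < d' < l ->
  e - d = e' - d' -> e = e' /\ d = d'.
Proof.
move=> he he' hd hd' E.
have [le _ we] := wire he; have [le' _ we'] := wire he'.
have h7 := wend_letter he; have h7' := wend_letter he'.
case: (ltngtP d d') => dd.
- have := we' (d' - d) ltac:(lia); rewrite (_ : e' - (d' - d) = e) ?h7 //; lia.
- have := we (d - d') ltac:(lia); rewrite (_ : e - (d - d') = e') ?h7' //; lia.
- by split=> //; lia.
Qed.

Definition moved c p : Prop := exists e d, [/\ wend e, 0 < d <= c & p = e - d].

Lemma gam_wire e d p : wend e -> 0 < d < l -> gam w (e - d) p ->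
  p = e - d.+1 \/ p = e - d.-1.
Proof.
move=> he hd; have [le wl we] := wire he; have w1 := we d hd.
rewrite /gam /gam1 w1 => /orP[] /and3P[h1 h2] /or3P[] /andP[] // /eqP.
- by move=> -> _; right; lia.
- by move=> E _; left; lia.
Qed.

(* The positions at distance at most [c] before the end of a wire are moved to
   the wire that has this end in the graph. *)
Definition rel c x y : Prop :=
  (exists e d, [/\ wend e, 0 < d <= c, pos x = e - d & y = beta e - d]) \/
  (~ moved c (pos x) /\ y = pos x).

(** The cut lies between the distances [c] and [c + 1] from the ends, and a pebble on a wire must be
    [2 ^ r] away from it. Already for [r = 0] no pebble is at distance [c], so that the edge across
    the cut is never seen. *)
Definition free c r p : Prop :=
  forall e d, wend e -> 0 < d < l -> p = e - d -> d + 2 ^ r <= c \/ c + 2 ^ r <= d.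

Lemma gam_moved c e d p : c < l -> wend e -> 0 < d -> d < c -> ~ moved c p ->
  nth 0 w p != 7 -> gam w (e - d) p = false.
Proof.
move=> cl he hd dc nm n7; apply/negP => hg.
have [E|E] := @gam_wire e d p he ltac:(lia) hg.
  by apply: nm; exists e, d.+1; split=> //; lia.
case: d hd dc hg E => // -[_ _ _ E|d _ dc _ E]; last by apply: nm; exists e, d.+1; split=> //; lia.
by rewrite E subn0 wend_letter in n7.
Qed.

Lemma gam_moved7 e d p : wend e -> 0 < d < l -> nth 0 w p = 7 ->
  gam w (e - d) p = (d == 1) && (p == e).
Proof.
move=> he hd h7; have [le wl we] := wire he.
apply/idP/andP => [/(gam_wire he hd)[E|E]|[/eqP -> /eqP ->]].
- move: h7; rewrite E; case: (ltnP d.+1 l) => h; first by rewrite we //; lia.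
  by rewrite (_ : d.+1 = l) ?wl //; lia.
- case: d hd E => // -[_ E|d hd E]; first by rewrite E subn0.
  by move: h7; rewrite E we //=; lia.
- have e1 : (e - 1).+1 = e by lia.
  have en : e < n by case/andP: he.
  by rewrite /gam /gam1 e1 sw en eqxx (wend_letter he) leqnn /= !orbT.
Qed.

Lemma gam_wires e e' d d' : wend e -> wend e' -> 0 < d < l -> 0 < d' < l ->
  gam w (e - d) (e' - d') = (e == e') && ((d == d'.+1) || (d' == d.+1)).
Proof.
move=> he he' hd hd'; have [le wl we] := wire he; have [le' wl' we'] := wire he'.
have en : e < n by case/andP: he.
apply/idP/andP => [/(gam_wire he hd)[E|E]|[/eqP ee']].
- case: (ltnP d.+1 l) => h.
    have [-> ->] := @wire_uniq e' e d' d.+1 he' he hd' ltac:(lia) E.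
    by rewrite !eqxx orbT.
  have := we' d' hd'; rewrite E (_ : d.+1 = l) ?wl //; lia.
- case: d hd E => // -[hd E|d hd E].
    have := we' d' hd'; rewrite E subn0 wend_letter //.
  have [-> ->] := @wire_uniq e' e d' d.+1 he' he hd' ltac:(lia) E.
  by rewrite !eqxx.
- rewrite -ee' => hdd.
  have o1 : odd (nth 0 w (e - d)) by rewrite we.
  have o2 : odd (nth 0 w (e - d')) by rewrite we.
  rewrite /gam /gam1 sw o1 o2 !andbT; lia.
Qed.

Lemma a_gam x y : x < n -> y < n -> ~~ special (pos x) (pos y) ->
  a x y = gam w (pos x) (pos y).
Proof.
move=> hx hy hs; case: (ltngtP (pos x) (pos y)) => h.
- rewrite pat // /gam (_ : gam1 w (pos y) (pos x) = false) ?orbF //.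
  by rewrite /gam1 ltnNge ltnW.
- rewrite a_sym pat //; last by rewrite /special orbC.
  rewrite /gam (_ : gam1 w (pos x) (pos y) = false) //.
  by rewrite /gam1 ltnNge ltnW.
- by rewrite (pos_inj hx hy h) a_irr /gam /gam1 ltnn.
Qed.

Lemma not_special e d p : wend e -> 0 < d < l -> nth 0 w p != 7 ->
  ~~ special (e - d) p.
Proof.
move=> he hd h7; have [le wl we] := wire he.
by rewrite /special (negbTE h7) andbF we // andbF.
Qed.

(** Moving the last [c] inner vertices along with their end carries the disagreement from the last
    edge of each wire to the edge across the cut, which touches no pair of free pebbles. *)
Lemma rel_atom c x y x' y' : c < l -> x < n -> x' < n -> 0 < c ->
  rel c x y -> rel c x' y' -> free c 0 (pos x) -> free c 0 (pos x') ->
  (x == x') = (y == y') /\ a x x' = gam w y y'.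
Proof.
move=> cl hx hx' c0.
(* The mixed case: [u] is moved and [z] is not. *)
have MU u v v' z : u < n -> z < n -> (exists e d, [/\ wend e, 0 < d <= c, pos u = e - d & v = beta e - d]) ->
    (~ moved c (pos z) /\ v' = pos z) -> free c 0 (pos u) ->
    (u == z) = (v == v') /\ a u z = gam w v v'.
  move=> hu hz [e [d [he hd pu ->]]] [nm ->] fu.
  have hb := beta_end he.
  have [le wl we] := wire he; have [leb wlb web] := wire hb.
  have dc : d < c by have := fu e d he ltac:(lia) pu; rewrite expn0; lia.
  split.
    have -> : (u == z) = false.
      by apply/eqP => E; apply: nm; rewrite -E; exists e, d.
    by apply/esym/eqP => E; apply: nm; exists (beta e), d.
  case: (eqVneq (nth 0 w (pos z)) 7) => h7; last first.
    rewrite a_gam //; last by rewrite pu; apply: not_special => //; lia.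
    by rewrite pu !(@gam_moved c) //; lia.
  rewrite gam_moved7 //; last by lia.
  case: (eqVneq d 1) => [d1|d1] /=; first by rewrite (@a_end u z e) // pu d1.
  rewrite a_gam //; first by rewrite pu gam_moved7 ?(negbTE d1) //; lia.
  by rewrite pu /special (_ : (e - d).+1 = e - d.-1) ?we //=; lia.
move=> [M|U] [M'|U'] fx fx'.
- move: M M' => [e [d [he hd px ->]]] [e' [d' [he' hd' px' ->]]].
  have hb := beta_end he; have hb' := beta_end he'.
  have [_ _ we'] := wire he'.
  split.
    apply/eqP/eqP => E.
      have [-> ->] // : e = e' /\ d = d'.
      by apply: wire_uniq; rewrite -?px -?px' ?E //; lia.
    have [|||||/(beta_inj he he') ee dd] := @wire_uniq (beta e) (beta e') d d'; try lia; try done.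
    by apply: pos_inj => //; rewrite px px' ee dd.
  rewrite a_gam ?px ?px' //; last by apply: not_special => //; [lia|rewrite we' //; lia].
  rewrite !gam_wires //; try lia.
  by congr andb; apply/eqP/eqP => [->//|/(beta_inj he he')].
- by have [e1 e2] := MU x y y' x' hx hx' M U' fx.
- have [e1 e2] := MU x' y' y x hx' hx M' U fx'.
  by rewrite eq_sym e1 eq_sym a_sym e2 gamC.
- move: U U' => [nm ->] [nm' ->]; split.
    by apply/eqP/eqP => [->//|]; apply: pos_inj.
  apply: a_gam => //; apply/negP => /orP[] /andP[/eqP h _].
    apply: nm; exists (pos x).+1, 1; split; try lia.
    rewrite /wend h eqxx andbT -sw ltnNge; apply/negP => hn.
    by rewrite nth_default in h.
  apply: nm'; exists (pos x').+1, 1; split; try lia.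
  rewrite /wend h eqxx andbT -sw ltnNge; apply/negP => hn.
  by rewrite nth_default in h.
Qed.

Lemma rel_free c r x y : c < l -> rel c x y -> free c r y -> free c r (pos x).
Proof.
move=> cl [[e [d [he hd px ->]]]|[_ ->//]] fy e' d' he' hd' E.
have hb := beta_end he.
have [_ <-] : e = e' /\ d = d' by apply: wire_uniq => //; rewrite -?px //; lia.
by apply: (fy (beta e)) => //; lia.
Qed.

(** A pebble that is free at radius [2 ^ r.+1] is on the same side of the old cut and of the new
    one. *)
Lemma rel_shift c c' r x y : c < l -> c' + 2 ^ r <= l -> c <= c' + 2 ^ r -> c' <= c + 2 ^ r ->
  free c r.+1 (pos x) -> rel c x y -> rel c' x y /\ free c' r (pos x).
Proof.
have p2 : 2 ^ r.+1 = 2 ^ r + 2 ^ r by rewrite expnS mul2n addnn.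
have p0 : 0 < 2 ^ r by rewrite expn_gt0.
move=> h0 h1 h2 h3 fx hr; split; last first.
  by move=> e d he hd E; have := fx e d he hd E; rewrite p2; lia.
case: hr => [[e [d [he hd px ->]]]|[nm ->]].
  left; exists e, d; split=> //; have := fx e d he ltac:(lia) px; rewrite p2; lia.
right; split=> // -[e [d [he hd px]]].
have := fx e d he ltac:(lia) px; rewrite p2 => -[h|h]; last by lia.
by apply: nm; exists e, d; split=> //; lia.
Qed.

(** If the new pebble is on a wire, the cut moves by [2 ^ r] away from it; otherwise it stays. *)
Lemma choose_cut c r p : 2 ^ r.+1 <= c -> c + 2 ^ r.+1 <= l -> exists c',
  [/\ 2 ^ r <= c', c' + 2 ^ r <= l, c <= c' + 2 ^ r, c' <= c + 2 ^ r & free c' r p].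
Proof.
have p2 : 2 ^ r.+1 = 2 ^ r + 2 ^ r by rewrite expnS mul2n addnn.
have p0 : 0 < 2 ^ r by rewrite expn_gt0.
rewrite p2 => h1 h2.
case: (classic (exists e d, [/\ wend e, 0 < d < l & p = e - d])) => [[e [d [he hd E]]]|ne].
  exists (if d <= c then c + 2 ^ r else c - 2 ^ r).
  have hf c' : d + 2 ^ r <= c' \/ c' + 2 ^ r <= d -> free c' r p.
    move=> h e' d' he' hd' E'.
    by have [_ <-] : e = e' /\ d = d' by apply: wire_uniq => //; rewrite -E.
  by case: (leqP d c) => dc; split; try apply: hf; lia.
by exists c; split; try lia; move=> e d he hd E; case: ne; exists e, d.
Qed.

Lemma rel_total c x : exists y, rel c x y.
Proof.
case: (classic (moved c (pos x))) => [[e [d [he hd E]]]|nm].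
  by exists (beta e - d); left; exists e, d.
by exists (pos x); right.
Qed.

Lemma rel_lt c x y : c < l -> x < n -> rel c x y -> y < n.
Proof.
move=> cl hx [[e [d [he hd px ->]]]|[_ ->]]; last exact: pos_lt.
by case/andP: (beta_end he); lia.
Qed.

Lemma rel_onto c y : c < l -> y < n -> exists2 x, x < n & rel c x y.
Proof.
move=> cl hy; case: (classic (moved c y)) => [[e [d [he hd E]]]|nm].
  have [e' he' be] := beta_surj he.
  have [|x hx px] := @pos_surj (e' - d); first by case/andP: he'; lia.
  by exists x => //; left; exists e', d; rewrite be.
by have [x hx px] := pos_surj hy; exists x => //; right; rewrite px.
Qed.

(** The first cut is at distance [2 ^ q] from the ends; the hypothesis on [l] leaves the same room
    on its other side. *)
Theorem rewire_equiv q m (phi : fo m) v : m = 0 -> qrank phi <= q -> 2 ^ q.+1 <= l ->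
  satn n a phi v = satn n (gam w) phi v.
Proof.
move=> m0 hq hl.
pose I r (u u' : seq nat) := size u = size u' /\ exists c,
  [/\ 2 ^ r <= c, c + 2 ^ r <= l & forall i, i < size u ->
    [/\ nth 0 u i < n, rel c (nth 0 u i) (nth 0 u' i) & free c r (pos (nth 0 u i))]].
rewrite !(@satn_ext _ _ _ phi v (nth 0 [::])); try by rewrite m0.
have p0 r : 0 < 2 ^ r by rewrite expn_gt0.
apply: (@bf_sat _ _ _ _ I _ _ _ _ _ q) => //.
- move=> r u u' [su [c [h1 h2 h3]]] i j hi hj.
  have [ui ri fi] := h3 i hi; have [uj rj fj] := h3 j hj.
  have down p : free c r p -> free c 0 p.
    by move=> f e d he hd E; have := f e d he hd E; have := p0 r; rewrite expn0; lia.
  by apply: (rel_atom (c := c)) => //; [have := p0 r; lia|have := p0 r; lia|exact: down|exact: down].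
- move=> r u u' [su [c [h1 h2 h3]]] x hx.
  have [c' [g1 g2 g3 g4 g5]] := choose_cut (pos x) h1 h2.
  have cl : c' < l by have := p0 r; lia.
  have c0l : c < l by have := p0 r.+1; lia.
  have [y hy] := rel_total c' x; exists y; first exact: rel_lt hy.
  split; first by rewrite /= su.
  exists c'; split=> // -[|i] //= hi; have [ui ri fi] := h3 i hi.
  by have [k1 k2] := rel_shift c0l g2 g3 g4 fi ri.
- move=> r u u' [su [c [h1 h2 h3]]] y hy.
  have [c' [g1 g2 g3 g4 g5]] := choose_cut y h1 h2.
  have cl : c' < l by have := p0 r; lia.
  have c0l : c < l by have := p0 r.+1; lia.
  have [x hx hr] := rel_onto cl hy; exists x => //.
  split; first by rewrite /= su.
  exists c'; split=> // -[|i] //= hi; first by split=> //; exact: rel_free hr g5.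
  have [ui ri fi] := h3 i hi.
  by have [k1 k2] := rel_shift c0l g2 g3 g4 fi ri.
- split=> //; exists (2 ^ q); split=> //; by rewrite addnn -mul2n -expnS.
Qed.

End Rewire.

(** Equality of types at rank [r.+1] is expressed through equality at rank [r], so the program can
    iterate this recursion on a table without representing any type. *)
Lemma tp_facS r w i j i' j' : j <= size w -> j' <= size w ->
  (tp r.+1 (fac w i j) = tp r.+1 (fac w i' j')) <->
  (forall m, i <= m < j -> exists2 m', i' <= m' < j' &
     [/\ nth ord0 w m = nth ord0 w m', tp r (fac w i m) = tp r (fac w i' m') &
         tp r (fac w m.+1 j) = tp r (fac w m'.+1 j')]) /\
  (forall m, i' <= m < j' -> exists2 m', i <= m' < j &
     [/\ nth ord0 w m = nth ord0 w m', tp r (fac w i' m) = tp r (fac w i m') &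
         tp r (fac w m.+1 j') = tp r (fac w m'.+1 j)]).
Proof.
move=> hj hj'; split=> [e|[h h']].
  by split=> m hm; [exact: fac_pick hj hj' e hm|exact: fac_pick hj' hj (esym e) hm].
have aux k l k' l' : l <= size w -> l' <= size w ->
    (forall m, k <= m < l -> exists2 m', k' <= m' < l' &
     [/\ nth ord0 w m = nth ord0 w m', tp r (fac w k m) = tp r (fac w k' m') &
         tp r (fac w m.+1 l) = tp r (fac w m'.+1 l')]) ->
    forall m, m < size (fac w k l) -> exists2 m', m' < size (fac w k' l') &
    [/\ tp r (take m (fac w k l)) = tp r (take m' (fac w k' l')),
        nth ord0 (fac w k l) m = nth ord0 (fac w k' l') m' &
        tp r (drop m.+1 (fac w k l)) = tp r (drop m'.+1 (fac w k' l'))].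
  move=> hl hl' H m; rewrite size_fac // => hm.
  have [m' hm' [e1 e2 e3]] := H (k + m) ltac:(lia).
  exists (m' - k'); first by rewrite size_fac //; lia.
  have [f1 f2 f3] := @fac_split w k l m ltac:(lia) hl.
  have [g1 g2 g3] := @fac_split w k' l' (m' - k') ltac:(lia) hl'.
  by rewrite f1 f2 f3 g1 g2 g3 !subnKC //; lia.
by apply: tp_eqS; [apply: aux h|apply: aux h'].
Qed.

Lemma choice_nat (P : nat -> nat -> Prop) :
  (forall x, exists y, P x y) -> exists f, forall x, P x (f x).
Proof.
move=> h; exists (fun x => proj1_sig (constructive_indefinite_description _ (h x))) => x.
exact: (proj2_sig (constructive_indefinite_description _ (h x))).
Qed.

(** * Reading a word off a graph *)

Module Parsing.

Section Parse.
Variables (n : nat) (a : nat -> nat -> bool) (g0 g1 g2 g3 g4 g5 : nat).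

(** In the intended guess, [g0] is the left vertex of largest index and [g1] the wire start of
    smallest first index. They see all active vertices of the opposite side of the left half graph;
    [g1] also sees its neighbour [g2] on the wire, which is excluded. On the right, [g3], [g4] and
    [g5] play the same roles. *)
Definition cls x : nat :=
  if a g0 x then 1 else if a g1 x && (x != g2) then 2
  else if a g3 x then 3 else if a g4 x && (x != g5) then 4 else 0.

Definition core x y : bool :=
  [|| (cls x == 1) && (cls y == 2), (cls x == 2) && (cls y == 1),
      (cls x == 3) && (cls y == 4) | (cls x == 4) && (cls y == 3)].

(** What remains when the edges of the two half graphs are removed: for a grid, the edges along
    wires. *)
Definition pe x y : bool := a x y && ~~ core x y.

(* One plus the distance in the graph of [pe], or zero if it exceeds [t]. *)
Fixpoint ds t x y : nat :=
  match t with
  | 0 => x == y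
  | t'.+1 => if 0 < ds t' x y then ds t' x y
             else if has (fun z => (0 < ds t' x z) && pe z y) (iota 0 n) then t'.+2
             else 0
  end.

Definition dist := ds n.

Definition endv y : bool := \sum_(0 <= z < n) pe y z <= 1.

(** Among the ends of a path, a left end of a wire is preferred as head, then a right end; ties are
    broken by the vertex number. *)
Definition hk y : nat :=
  (if cls y == 1 then 0 else if cls y == 3 then 1 else 2) * n.+1 + y.

Definition ish x y : bool :=
  [&& 0 < dist x y, endv y &
      all (fun z => ((0 < dist x z) && endv z) ==> (hk y <= hk z)) (iota 0 n)].

Definition hd x : nat := \sum_(0 <= y < n) (if ish x y then y else 0).

Definition dep x : nat := dist x (hd x) - 1.

(** The rank in a half graph, even on the wire side and odd on the other: adjacency will mean that
    the first rank is smaller, and parity excludes ties. *)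
Definition kap x : nat :=
  if (cls x == 1) || (cls x == 3)
  then 2 * \sum_(0 <= v < n) ((cls v == (cls x).+1) && ~~ a x v)
  else (2 * \sum_(0 <= v < n) ((cls v == cls x) &&
          has (fun u => [&& (cls u).+1 == cls x, a u x & ~~ a u v]) (iota 0 n))).+1.

(** The ends of complete wires, those that connect the two half graphs. *)
Definition ful x : bool :=
  has (fun y => (0 < dist x y) &&
    ((cls x == 1) && (cls y == 3) || (cls x == 3) && (cls y == 1))) (iota 0 n).

Definition ltk u x : bool := (kap u < kap x) || (kap u == kap x) && (u < x).

(** The rank among complete wires at one side. The left end and the right end with the same rank
    need not belong to the same wire, but are put into the same block: this is the rewiring. *)
Definition blk x : nat :=
  \sum_(0 <= u < n) [&& ful u, (cls u == cls x) || ((cls u).+1 == cls x) & ltk u x].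

(** Exceeds all digits of a key. Ranks [kap] are at most [2 * n + 1] and get shifted by up to
    [2 * n + 4], which leaves [kbase - 1] free as a largest digit. *)
Definition kbase := 4 * n + 8.

(** Three digits in base [kbase]. A complete end has the largest middle digit, so it comes after the
    other heads with the same block number; its last digit is 0, so that both ends of a block share
    the prefix. Paths whose head is in no half graph come last. *)
Definition pfx h : nat :=
  kbase * (kbase * (if cls h == 0 then n.+1 else blk h) +
     (if ful h then kbase - 1 else if cls h == 0 then 0
      else if cls h <= 2 then (kap h).+1 else 2 * n + 4 + kap h)) +
  (if ful h then 0 else h).

(** A complete right end uses its own prefix instead of that of its wire. Its depth then places it
    directly after the wire of the left end with the same rank. *)
Definition key x : nat :=
  kbase * pfx (if ful x && (cls x == 3) then x else hd x) + dep x.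

Definition ps x : nat := \sum_(0 <= y < n) (key y < key x).

Definition lett x : nat := cls x + cls x + (0 < dep x).

Definition wl p : nat := \sum_(0 <= x < n) (if ps x == p then lett x else 0).

Definition spec x y : bool :=
  (wl (ps x).+1 == 7) && (wl (ps y) == 7) || (wl (ps y).+1 == 7) && (wl (ps x) == 7).

Definition pat x y : bool :=
  [|| (cls x == 1) && (cls y == 2), (cls x == 3) && (cls y == 4) |
      (ps y == (ps x).+1) && (0 < dep y)].

Definition chk1 : bool :=
  all (fun x => all (fun y => (x == y) || (key x != key y)) (iota 0 n)) (iota 0 n).

Definition chk2 : bool :=
  all (fun x => all (fun y => (ps x < ps y) && ~~ spec x y ==> (a x y == pat x y))
    (iota 0 n)) (iota 0 n).

(** Complete wires have a common length, at least [th]; if there are none, nothing is required. *)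
Definition chk3 th : bool :=
  all (fun e => wl e != 7) (iota 0 n) ||
  has (fun l => (th <= l) && all (fun e => (wl e == 7) ==>
    [&& l <= e, wl (e - l) == 2 &
        all (fun d => (0 < d) && (d < l) ==> (wl (e - d) == 1)) (iota 0 n)]) (iota 0 n))
    (iota 0 n).

(** Between the positions before an end and the ends, the graph is a perfect matching; it yields the
    permutation [beta]. *)
Definition chk4 : bool :=
  all (fun x => (wl (ps x).+1 == 7) ==>
    (\sum_(0 <= y < n) ((wl (ps y) == 7) && a x y) == 1)) (iota 0 n) &&
  all (fun x => (wl (ps x) == 7) ==>
    (\sum_(0 <= y < n) ((wl (ps y).+1 == 7) && a y x) == 1)) (iota 0 n).

Definition chk th : bool := [&& chk1, chk2, chk3 th & chk4].

Lemma all_iotaP (p : pred nat) m : reflect (forall x, x < m -> p x) (all p (iota 0 m)).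
Proof.
apply: (iffP allP) => h x; first by move=> hx; apply: h; rewrite mem_iota.
by rewrite mem_iota => /h.
Qed.

Lemma has_iotaP (p : pred nat) m :
  reflect (exists2 x, x < m & p x) (has p (iota 0 m)).
Proof.
apply: (iffP hasP) => -[x hx px]; exists x => //; first by rewrite mem_iota in hx.
by rewrite mem_iota.
Qed.

Lemma sum_nat_le m (p q : pred nat) : (forall x, x < m -> p x -> q x) ->
  \sum_(0 <= x < m) p x <= \sum_(0 <= x < m) q x.
Proof.
move=> h; rewrite !big_mkord; apply: leq_sum => x _.
by have := h x (ltn_ord x); case: (p x) => // /(_ isT) ->.
Qed.

Lemma sum_nat_lt m (p q : pred nat) y : (forall x, x < m -> p x -> q x) ->
  y < m -> q y -> ~~ p y ->
  \sum_(0 <= x < m) p x < \sum_(0 <= x < m) q x.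
Proof.
move=> h hy qy py; rewrite !big_mkord.
rewrite (bigD1 (Ordinal hy)) //= [X in _ < X](bigD1 (Ordinal hy)) //= qy (negbTE py).
rewrite add0n add1n ltnS; apply: leq_sum => x _.
by have := h x (ltn_ord x); case: (p x) => // /(_ isT) ->.
Qed.

Lemma sum_nat_one m (F : nat -> nat) (p : pred nat) y : y < m -> p y ->
  (forall x, x < m -> p x -> x = y) ->
  \sum_(0 <= x < m) (if p x then F x else 0) = F y.
Proof.
move=> hy py h; rewrite big_mkord (bigD1 (Ordinal hy)) //= py big1 ?addn0 // => x ne.
case: ifP => // px; case/eqP: ne; apply/val_inj => /=; exact: h.
Qed.

Lemma sum_nat_eq1 m (p : pred nat) : \sum_(0 <= x < m) p x = 1 ->
  exists y, [/\ y < m, p y & forall x, x < m -> p x -> x = y].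
Proof.
move=> h; have : 0 < \sum_(0 <= x < m) p x by rewrite h.
rewrite sum_has => /has_iotaP [y hy]; rewrite lt0b => py; exists y; split=> // x hx px.
apply/eqP; apply: contraT => ne; move: h; rewrite big_mkord.
have ne' : Ordinal hy != Ordinal hx by rewrite -val_eqE /= eq_sym.
by rewrite (bigD1 (Ordinal hx)) //= (bigD1 (Ordinal hy)) //= px py; lia.
Qed.

Lemma cls_le x : cls x <= 4.
Proof. by rewrite /cls; do 4 (case: ifP => // _). Qed.

Lemma lett_lt x : lett x < 10.
Proof. by have := cls_le x; rewrite /lett; case: (0 < dep x) => /=; lia. Qed.

Lemma lett_half x : (lett x)./2 = cls x.
Proof. by rewrite /lett; case: (0 < dep x) => /=; lia. Qed.

Lemma lett_odd x : odd (lett x) = (0 < dep x).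
Proof. by rewrite /lett; case: (0 < dep x) => /=; lia. Qed.

Lemma onto_of_inj (f : nat -> nat) : (forall x, x < n -> f x < n) ->
  (forall x y, x < n -> y < n -> f x = f y -> x = y) ->
  forall p, p < n -> exists2 x, x < n & f x = p.
Proof.
move=> f_lt f_inj p hp.
pose F (x : 'I_n) : 'I_n := Ordinal (f_lt x (ltn_ord x)).
have F_inj : injective F.
  move=> x y /(congr1 val) /= e; apply: val_inj.
  exact: f_inj (ltn_ord x) (ltn_ord y) e.
exists (invF F_inj (Ordinal hp)) => //.
by have := f_invF F_inj (Ordinal hp) => /(congr1 val).
Qed.

Lemma ps_lt x : x < n -> ps x < n.
Proof.
move=> hx; rewrite /ps; have := @sum_nat_lt n (fun y => key y < key x) predT x.
rewrite !ltnn sum_nat_const_nat muln1 subn0; exact.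
Qed.

Lemma ps_mono x y : x < n -> key x < key y -> ps x < ps y.
Proof.
move=> hx h; apply: (sum_nat_lt (y := x)) => //; last by rewrite ltnn.
by move=> z _ hz; apply: ltn_trans hz h.
Qed.

Section Keys.
Hypothesis key_inj : forall x y, x < n -> y < n -> key x = key y -> x = y.

Lemma ps_inj x y : x < n -> y < n -> ps x = ps y -> x = y.
Proof.
move=> hx hy e; apply: key_inj => //.
case: (ltngtP (key x) (key y)) => // h.
  by have := ps_mono hx h; rewrite e ltnn.
by have := ps_mono hy h; rewrite e ltnn.
Qed.

Lemma ps_ltE x y : x < n -> y < n -> (ps x < ps y) = (key x < key y).
Proof.
move=> hx hy; case: (ltngtP (key x) (key y)) => h; first exact: ps_mono.
  by rewrite ltnNge ltnW // ps_mono.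
by rewrite (key_inj hx hy h) ltnn.
Qed.

Lemma wl_ps x : x < n -> wl (ps x) = lett x.
Proof.
move=> hx; rewrite /wl (@sum_nat_one n lett (fun y => ps y == ps x) x) // => y hy /eqP.
exact: ps_inj.
Qed.

Lemma wl_out p : n <= p -> wl p = 0.
Proof.
move=> hp; rewrite /wl big_nat big1 // => x /andP[_ hx]; rewrite ifF //.
by apply/eqP; have := ps_lt hx; lia.
Qed.

Lemma wl_lt p : wl p < 10.
Proof.
case: (ltnP p n) => hp; last by rewrite wl_out.
by have [x hx <-] := onto_of_inj ps_lt ps_inj hp; rewrite wl_ps // lett_lt.
Qed.

End Keys.

Hypotheses (a_irr : forall x, a x x = false) (a_sym : forall x y, a x y = a y x).

Lemma chk1P : chk1 -> forall x y, x < n -> y < n -> key x = key y -> x = y.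
Proof.
move=> /all_iotaP h x y hx hy e; have /all_iotaP /(_ y hy) := h x hx.
by rewrite e eqxx orbF => /eqP.
Qed.

(** The check alone supplies the hypotheses of [rewire_equiv]. Nothing is assumed about the guess,
    and only symmetry and irreflexivity of the graph, so every accepted guess may be used. *)
Theorem parse_sound th q m (phi : fo m) v : chk th -> m = 0 -> qrank phi <= q ->
  2 ^ q.+1 <= th -> (forall p, wl p < 10) /\
  satn n a phi v = satn n (gam (mkseq wl n)) phi v.
Proof.
case/and4P=> /chk1P k1 /all_iotaP k2 k3 /andP[/all_iotaP k4 /all_iotaP k4'] m0 hq hth.
split; first by move=> p; exact: wl_lt.
set w := mkseq wl n.
have nw p : nth 0 w p = wl p.
  case: (ltnP p n) => hp; first by rewrite nth_mkseq.
  by rewrite nth_default ?size_mkseq // wl_out.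
have sw : size w = n by rewrite size_mkseq.
have surj := onto_of_inj ps_lt (ps_inj k1).
have [l [hl hw]] : exists l, 2 ^ q.+1 <= l /\ forall e, wend n w e ->
  [/\ l <= e, nth 0 w (e - l) = 2 & forall d, 0 < d < l -> nth 0 w (e - d) = 1].
  case/orP: k3 => [/all_iotaP k3|/has_iotaP [l hl /andP[thl /all_iotaP k3]]].
    (* There is no wire end, so any length will do. *)
    exists (2 ^ q.+1); split=> // e /andP[he]; rewrite nw => /eqP E.
    by have := k3 e he; rewrite E.
  exists l; split=> [|e /andP[he]]; first exact: leq_trans thl.
  rewrite nw => E; have := k3 e he; rewrite E => /and3P[h1 /eqP h2 /all_iotaP h3].
  split=> [//||d hd]; first by rewrite nw.
  by have := h3 d ltac:(lia); rewrite hd nw => /eqP.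
have l2 : 1 < l by apply: leq_trans hl; rewrite expnS; have := expn_gt0 2 q; lia.
have lastP e x : wend n w e -> x < n -> ps x = e - 1 -> wl (ps x).+1 = 7.
  move=> he hx px; have [le _ _] := hw e he.
  by rewrite px (_ : (e - 1).+1 = e) -?nw ?(wend_letter he) //; lia.
have bex e : exists b, wend n w e -> [/\ wend n w b &
    forall x y, x < n -> y < n -> ps x = e - 1 -> wl (ps y) = 7 -> a x y = (ps y == b)].
  case he : (wend n w e); last by exists 0.
  have [le _ _] := hw e he.
  have [|x0 hx0 px0] := surj (e - 1); first by case/andP: he; lia.
  have := k4 x0 hx0; rewrite (lastP e) //= => /eqP /sum_nat_eq1 [y0 [hy0 /andP[w7 axy] uy]].
  exists (ps y0) => _; split; first by rewrite /wend ps_lt //= nw.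
  move=> x y hx hy px wy; have ex : x = x0 by apply: (ps_inj k1) => //; rewrite px px0.
  rewrite ex; apply/idP/eqP => [ay|/(ps_inj k1 hy hy0) -> //].
  by rewrite (uy y hy) // wy eqxx.
have [beta hb] := choice_nat bex.
have b_inj e e' : wend n w e -> wend n w e' -> beta e = beta e' -> e = e'.
  move=> he he' E; have [eb h] := hb e he; have [eb' h'] := hb e' he'.
  have [le _ _] := hw e he; have [le' _ _] := hw e' he'.
  have [|x hx px] := surj (e - 1); first by case/andP: he; lia.
  have [|x' hx' px'] := surj (e' - 1); first by case/andP: he'; lia.
  have [|y hy py] := surj (beta e); first by case/andP: eb.
  have wy : wl (ps y) = 7 by rewrite py -nw (wend_letter eb).
  have := k4' y hy; rewrite wy /= => /eqP /sum_nat_eq1 [z [_ _ uz]].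
  have ex : x = z.
    by apply: uz => //; rewrite (lastP e) // (h x y) // py !eqxx.
  have ex' : x' = z.
    by apply: uz => //; rewrite (lastP e') // (h' x' y) // py E !eqxx.
  by have : e - 1 = e' - 1; [rewrite -px -px' ex ex'|lia].
apply: (@rewire_equiv n l w a ps beta _ _ _ _ _ _ _ _ _ _ _ _ _ q) => //.
- exact: ps_lt.
- exact: ps_inj.
- move=> x y hx hy lxy; rewrite /special !nw => ns.
  have /all_iotaP /(_ y hy) := k2 x hx; rewrite lxy /spec ns => /eqP ->.
  rewrite /pat /gam1 lxy sw ps_lt // !nw !(wl_ps k1) // !lett_half lett_odd /=.
  by [].
- by move=> e he; case: (hb e he).
- move=> e he; have [e0 h0 E] : exists2 e0, wend n w e0 & beta e0 = e.
    (* Extended by the identity, the injection [beta] becomes an injection of the finite set of all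
       positions, hence onto. *)
    pose f e := if wend n w e then beta e else e.
    have f_lt x : x < n -> f x < n.
      by rewrite /f; case: ifP => // hx _; case: (hb x hx) => /andP[].
    have f_inj x y : x < n -> y < n -> f x = f y -> x = y.
      rewrite /f; case: ifP => hx; case: ifP => hy _ _ //; first exact: b_inj.
        by move=> E; case: (hb x hx); rewrite E hy.
      by move=> E; case: (hb y hy); rewrite -E hx.
    have [|e0 _ he0] := onto_of_inj f_lt f_inj (p := e); first by case/andP: he.
    move: he0; rewrite /f; case: ifP => h E; first by exists e0.
    by rewrite E he in h.
  by exists e0.
- move=> x y e hx hy he px; rewrite nw => wy; by case: (hb e he) => _; apply.
Qed.

End Parse.

End Parsing.
Import Parsing.

(** * The check succeeds on subgraphs of grids *)

Lemma iota_argmin (P : pred nat) (F : nat -> nat) m x : x < m -> P x ->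
  exists y, [/\ y < m, P y & forall z, z < m -> P z -> F y <= F z].
Proof.
move=> hx px; pose D k := [exists z : 'I_m, P z && (F z == k)].
have exD : exists k, D k by exists (F x); apply/existsP; exists (Ordinal hx); rewrite /= px eqxx.
case: (ex_minnP exD) => k /existsP [y /andP[py /eqP fy]] hmin.
exists y; split=> // z hz pz; rewrite fy; apply: hmin; apply/existsP.
by exists (Ordinal hz); rewrite /= pz eqxx.
Qed.

Lemma rank_onto m (P : pred nat) (rk : nat -> nat) r :
  (forall x y, x < m -> y < m -> P x -> P y -> rk x = rk y -> x = y) ->
  (forall x, x < m -> P x -> rk x < \sum_(0 <= y < m) P y) ->
  r < \sum_(0 <= y < m) P y -> exists2 x, x < m & P x /\ rk x = r.
Proof.
move=> inj lt hr.
have sz : size (filter P (iota 0 m)) = \sum_(0 <= y < m) P y.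
  by rewrite size_filter -sum1_count big_mkcond /= /index_iota subn0.
have mem x : (x \in filter P (iota 0 m)) = P x && (x < m).
  by rewrite mem_filter mem_iota.
have [|||_ E] := @uniq_min_size _ [seq rk x | x <- filter P (iota 0 m)]
    (iota 0 (\sum_(0 <= y < m) P y)).
- rewrite map_inj_in_uniq ?filter_uniq ?iota_uniq // => x y.
  by rewrite !mem => /andP[h1 h2] /andP[h3 h4]; apply: inj.
- move=> k /mapP [x]; rewrite mem => /andP[px hx] ->; rewrite mem_iota; exact: lt.
- by rewrite size_iota size_map sz.
have : r \in iota 0 (\sum_(0 <= y < m) P y) by rewrite mem_iota.
by rewrite -E => /mapP [x]; rewrite mem => /andP[px hx] ->; exists x.
Qed.

Section Complete.
Variables (n l : nat) (a : nat -> nat -> bool) (kd p1 p2 p3 : nat -> nat).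
Hypothesis l2 : 1 < l.

(** Kind 0 is a left vertex and kind 1 a right vertex, both with index [p1]; kind 2 is a wire
    vertex, with the indices [p1] and [p2] of the wire and the depth [p3]. *)
Definition labadj x y : bool :=
  [|| [&& kd x == 0, kd y == 2, p3 y == 0 & p1 y <= p1 x],
      [&& kd x == 1, kd y == 2, p3 y == l & p2 y <= p1 x] |
      [&& kd x == 2, kd y == 2, p1 x == p1 y, p2 x == p2 y & p3 y == (p3 x).+1]].

Hypothesis aE : forall x y, x < n -> y < n -> a x y = labadj x y || labadj y x.
Hypothesis p3l : forall x, x < n -> kd x = 2 -> p3 x <= l.
Hypothesis lab_inj : forall x y, x < n -> y < n -> kd x = kd y -> p1 x = p1 y ->
  (kd x = 2 -> p2 x = p2 y /\ p3 x = p3 y) -> x = y.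

(** The active vertices: those that have kept a neighbour in the half graph. The good guess gives
    exactly these a nonzero class. *)
Definition inA x := [&& kd x == 2, p3 x == 0 &
  has (fun v => (kd v == 0) && (p1 x <= p1 v)) (iota 0 n)].
Definition inV x := (kd x == 0) &&
  has (fun u => [&& kd u == 2, p3 u == 0 & p1 u <= p1 x]) (iota 0 n).
Definition inB x := [&& kd x == 2, p3 x == l &
  has (fun v => (kd v == 1) && (p2 x <= p1 v)) (iota 0 n)].
Definition inU x := (kd x == 1) &&
  has (fun u => [&& kd u == 2, p3 u == l & p2 u <= p1 x]) (iota 0 n).

Variables g0 g1 g2 g3 g4 g5 : nat.
Hypothesis gA : forall x, x < n -> a g0 x = inA x.
Hypothesis gV : forall x, x < n -> a g1 x && (x != g2) = inV x.
Hypothesis gB : forall x, x < n -> a g3 x = inB x.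
Hypothesis gU : forall x, x < n -> a g4 x && (x != g5) = inU x.

Notation cls := (cls a g0 g1 g2 g3 g4 g5).
Notation pe := (pe a g0 g1 g2 g3 g4 g5).
Notation ds := (ds n a g0 g1 g2 g3 g4 g5).
Notation dist := (dist n a g0 g1 g2 g3 g4 g5).
Notation endv := (endv n a g0 g1 g2 g3 g4 g5).
Notation hk := (hk n a g0 g1 g2 g3 g4 g5).
Notation ish := (ish n a g0 g1 g2 g3 g4 g5).
Notation hd := (hd n a g0 g1 g2 g3 g4 g5).
Notation dep := (dep n a g0 g1 g2 g3 g4 g5).
Notation kap := (kap n a g0 g1 g2 g3 g4 g5).
Notation ful := (ful n a g0 g1 g2 g3 g4 g5).
Notation blk := (blk n a g0 g1 g2 g3 g4 g5).
Notation pfx := (pfx n a g0 g1 g2 g3 g4 g5).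
Notation key := (key n a g0 g1 g2 g3 g4 g5).
Notation ps := (ps n a g0 g1 g2 g3 g4 g5).
Notation wl := (wl n a g0 g1 g2 g3 g4 g5).
Notation lett := (lett n a g0 g1 g2 g3 g4 g5).
Notation ltk := (ltk n a g0 g1 g2 g3 g4 g5).

Lemma clsE x : x < n -> cls x =
  if inA x then 1 else if inV x then 2 else if inB x then 3 else if inU x then 4 else 0.
Proof. by move=> hx; rewrite /Parsing.cls gA // gV // gB // gU. Qed.

Lemma in_kd x : [/\ inA x -> kd x = 2 /\ p3 x = 0, inV x -> kd x = 0,
  inB x -> kd x = 2 /\ p3 x = l & inU x -> kd x = 1].
Proof.
by split; [case/and3P=> /eqP-> /eqP->|case/andP=> /eqP->|case/and3P=> /eqP-> /eqP->
  |case/andP=> /eqP->].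
Qed.

Lemma clsP x : x < n -> [/\ (cls x == 1) = inA x, (cls x == 2) = inV x,
  (cls x == 3) = inB x & (cls x == 4) = inU x].
Proof.
move=> hx; rewrite clsE //; have [hA hV hB hU] := in_kd x.
case eA: (inA x); case eV: (inV x); case eB: (inB x); case eU: (inU x) => //;
  rewrite ?eA ?eV ?eB ?eU in hA hV hB hU; move: hA hV hB hU l2; lia.
Qed.

Lemma cls1 x : x < n -> (cls x == 1) = inA x. Proof. by case/clsP. Qed.
Lemma cls2 x : x < n -> (cls x == 2) = inV x. Proof. by case/clsP. Qed.
Lemma cls3 x : x < n -> (cls x == 3) = inB x. Proof. by case/clsP. Qed.
Lemma cls4 x : x < n -> (cls x == 4) = inU x. Proof. by case/clsP. Qed.

Lemma cls_kd x : x < n -> [/\ cls x = 1 -> kd x = 2 /\ p3 x = 0, cls x = 2 -> kd x = 0,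
  cls x = 3 -> kd x = 2 /\ p3 x = l & cls x = 4 -> kd x = 1].
Proof.
move=> hx; have [hA hV hB hU] := in_kd x; have [c1 c2 c3 c4] := clsP hx.
by split=> /eqP; rewrite ?c1 ?c2 ?c3 ?c4.
Qed.

(** An edge of a half graph is itself the witness that both its ends are active, so [core] removes
    all such edges and no others. *)
Lemma peE x y : x < n -> y < n -> pe x y =
  [&& kd x == 2, kd y == 2, p1 x == p1 y, p2 x == p2 y &
      (p3 y == (p3 x).+1) || (p3 x == (p3 y).+1)].
Proof.
move=> hx hy; rewrite /Parsing.pe /core !cls1 // !cls2 // !cls3 // !cls4 // aE //.
have [hA hV hB hU] := in_kd x; have [hA' hV' hB' hU'] := in_kd y.
have fV u v : u < n -> v < n -> [&& kd u == 0, kd v == 2, p3 v == 0 & p1 v <= p1 u] ->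
    inV u && inA v.
  move=> hu hv /and4P[h1 h2 h3 h4]; rewrite /inV /inA h1 h2 h3 /=; apply/andP; split.
    by apply/has_iotaP; exists v => //; rewrite h2 h3 h4.
  by apply/has_iotaP; exists u => //; rewrite h1 h4.
have fU u v : u < n -> v < n -> [&& kd u == 1, kd v == 2, p3 v == l & p2 v <= p1 u] ->
    inU u && inB v.
  move=> hu hv /and4P[h1 h2 h3 h4]; rewrite /inU /inB h1 h2 h3 /=; apply/andP; split.
    by apply/has_iotaP; exists v => //; rewrite h2 h3 h4.
  by apply/has_iotaP; exists u => //; rewrite h1 h4.
apply/andP/idP => [[]|h].
  rewrite !negb_or => /orP[] /or3P[/fV|/fU|/and5P[h1 h2 h3 h4 h5]].
  - by move=> /(_ hx hy) /andP[-> ->]; rewrite !andbF.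
  - by move=> /(_ hx hy) /andP[-> ->]; rewrite !andbF.
  - by rewrite h1 h2 h3 h4 h5.
  - by move=> /(_ hy hx) /andP[-> ->]; rewrite /= ?andbF.
  - by move=> /(_ hy hx) /andP[-> ->]; rewrite /= ?andbF.
  - by rewrite h1 h2 eq_sym h3 eq_sym h4 h5 orbT.
case/and5P: h => /eqP h1 /eqP h2 /eqP h3 /eqP h4 h5.
split; last first.
  have -> : inV x = false by apply/negP => /hV; rewrite h1.
  have -> : inU x = false by apply/negP => /hU; rewrite h1.
  have -> : inV y = false by apply/negP => /hV'; rewrite h2.
  have -> : inU y = false by apply/negP => /hU'; rewrite h2.
  by rewrite !andbF.
by rewrite /labadj h1 h2 h3 h4 !eqxx /=.
Qed.

Definition onw x d := has (fun z => [&& kd z == 2, p1 z == p1 x, p2 z == p2 x &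
  p3 z == d]) (iota 0 n).

(** Membership in the same run: on one wire, with no vertex deleted in between. *)
Definition conn x y : bool := (x == y) ||
  [&& kd x == 2, kd y == 2, p1 x == p1 y, p2 x == p2 y &
   all (fun d => (minn (p3 x) (p3 y) <= d <= maxn (p3 x) (p3 y)) ==> onw x d) (iota 0 l.+1)].

Definition gap x y := (p3 x - p3 y) + (p3 y - p3 x).

Lemma onwP x d : onw x d <-> exists2 z, z < n &
  [/\ kd z = 2, p1 z = p1 x, p2 z = p2 x & p3 z = d].
Proof.
split=> [/has_iotaP [z hz /and4P[/eqP h1 /eqP h2 /eqP h3 /eqP h4]]|[z hz [h1 h2 h3 h4]]].
  by exists z.
by apply/has_iotaP; exists z => //; rewrite h1 h2 h3 h4 !eqxx.
Qed.

Lemma connP x y : x < n -> y < n -> conn x y <-> x = y \/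
  [/\ kd x = 2, kd y = 2, p1 x = p1 y, p2 x = p2 y &
   forall d, minn (p3 x) (p3 y) <= d <= maxn (p3 x) (p3 y) -> onw x d].
Proof.
move=> hx hy; split.
  case/orP=> [/eqP|/and5P[/eqP h1 /eqP h2 /eqP h3 /eqP h4 /all_iotaP h5]]; first by left.
  right; split=> // d hd; have dl : d < l.+1.
    by have := p3l hx h1; have := p3l hy h2; lia.
  by have := h5 d dl; rewrite hd.
case=> [->|[h1 h2 h3 h4 h5]]; first by rewrite /conn eqxx.
rewrite /conn h1 h2 h3 h4 !eqxx !andTb; apply/orP; right; apply/all_iotaP => d _.
by apply/implyP; exact: h5.
Qed.

Lemma onw_eq x y d : p1 x = p1 y -> p2 x = p2 y -> onw x d = onw y d.
Proof. by move=> h1 h2; rewrite /onw h1 h2. Qed.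

Lemma conn_refl x : conn x x. Proof. by rewrite /conn eqxx. Qed.

Lemma conn_sym x y : x < n -> y < n -> conn x y -> conn y x.
Proof.
move=> hx hy /(connP hx hy) h; apply/connP => //.
case: h => [->|[h1 h2 h3 h4 h5]]; [by left|right; split=> // d hd].
by rewrite (onw_eq _ (esym h3) (esym h4)); apply: h5; rewrite minnC maxnC.
Qed.

Lemma conn_trans x y z : x < n -> y < n -> z < n -> conn x y -> conn y z -> conn x z.
Proof.
move=> hx hy hz /(connP hx hy) h /(connP hy hz) h'; apply/connP => //.
case: h h' => [->//|[h1 h2 h3 h4 h5]] [<-|[q1 q2 q3 q4 q5]]; first by right; split.
right; split; try congruence.
move=> d hd; case: (boolP (minn (p3 x) (p3 y) <= d <= maxn (p3 x) (p3 y))) => [/h5//|hd'].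
by rewrite (onw_eq _ h3 h4); apply: q5; lia.
Qed.

Lemma pe_sym x y : x < n -> y < n -> pe x y = pe y x.
Proof.
move=> hx hy; rewrite !peE // orbC.
by rewrite [p1 x == _]eq_sym [p2 x == _]eq_sym; case: (kd x == 2); case: (kd y == 2).
Qed.

Lemma pe_conn x y : x < n -> y < n -> pe x y -> conn x y /\ gap x y = 1.
Proof.
move=> hx hy; rewrite peE // => /and5P[/eqP h1 /eqP h2 /eqP h3 /eqP h4 h5].
split; last by rewrite /gap; lia.
apply/connP => //; right; split=> // d hd; apply/onwP.
by have [e|e] : d = p3 x \/ d = p3 y by [lia]; [exists x|exists y].
Qed.

Lemma conn_step x y : x < n -> y < n -> conn x y -> x != y -> exists2 z, z < n &
  [/\ conn x z, pe z y, gap x y = (gap x z).+1 &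
      (p3 x <= p3 z < p3 y \/ p3 y < p3 z <= p3 x)].
Proof.
move=> hx hy hc ne; have [e|[h1 h2 h3 h4 h5]] := (connP hx hy).1 hc.
  by rewrite e eqxx in ne.
have np : p3 x <> p3 y by move=> e; case/eqP: ne; apply: lab_inj => //; congruence.
pose d := if p3 x < p3 y then (p3 y).-1 else (p3 y).+1.
have /onwP [z hz [k1 k2 k3 k4]] : onw x d by apply: h5; rewrite /d; case: ltnP; lia.
exists z => //; split.
- apply/connP => //; right; split; try congruence; move=> e he; apply: h5.
  by move: he; rewrite k4 /d; case: ltnP; lia.
- rewrite peE // k1 h2 k2 k3 h3 h4 !eqxx /= k4 /d; case: ltnP; lia.
- by rewrite /gap k4 /d; case: ltnP; lia.
- by rewrite k4 /d; case: ltnP; lia.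
Qed.

Lemma conn_gap0 x y : x < n -> y < n -> conn x y -> gap x y = 0 -> x = y.
Proof.
move=> hx hy /(connP hx hy) [//|[h1 h2 h3 h4 h5]] gz; apply: lab_inj => //; first congruence.
by move=> _; split=> //; move: gz; rewrite /gap; lia.
Qed.

Lemma dsE t x y : x < n -> y < n ->
  ds t x y = if conn x y && (gap x y <= t) then (gap x y).+1 else 0.
Proof.
move=> hx; elim: t y => [|t ih] y hy /=.
  case: eqP => [->|ne]; first by rewrite conn_refl /gap subnn.
  by case: ifP => // /andP[hc]; rewrite leqn0 => /eqP /(conn_gap0 hx hy hc).
rewrite ih //; case hcg: (conn x y && (gap x y <= t)) => /=.
  by case/andP: hcg => -> h; rewrite leqW.
have -> : has (fun z => (0 < ds t x z) && pe z y) (iota 0 n) =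
    conn x y && (gap x y <= t.+1).
  apply/has_iotaP/andP => [[z hz]|[hc hg]].
    rewrite ih //; case: ifP => // /andP[hc hg] /= hp.
    have [c1 e1] := pe_conn hz hy hp.
    by split; [exact: conn_trans hc c1|move: e1 hg; rewrite /gap; lia].
  have ne : x != y.
    by apply/eqP => e; move: hcg; rewrite e conn_refl /gap subnn.
  have [z hz [c1 hp e1 _]] := conn_step hx hy hc ne; exists z => //.
  by rewrite ih // c1 /= hp andbT ifT //; lia.
case: ifP => // /andP[hc hg]; congr _.+1; move: hcg; rewrite hc /=; lia.
Qed.

(** The depths in between belong to distinct vertices; hence [n] rounds of [ds] explore a whole
    run. *)
Lemma gap_lt x y : x < n -> y < n -> conn x y -> gap x y < n.
Proof.
move=> hx hy /(connP hx hy) [->|[h1 h2 h3 h4 h5]]; first by rewrite /gap subnn; lia.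
pose lo := minn (p3 x) (p3 y).
have sub : {subset iota lo (gap x y).+1 <= [seq p3 z | z <- iota 0 n]}.
  move=> d; rewrite mem_iota => hd.
  have /onwP [z hz [_ _ _ e]] : onw x d by apply: h5; rewrite /lo /gap in hd; lia.
  by apply/mapP; exists z => //; rewrite mem_iota.
by have := uniq_leq_size (iota_uniq _ _) sub; rewrite size_iota size_map size_iota.
Qed.

Lemma distE x y : x < n -> y < n -> dist x y = if conn x y then (gap x y).+1 else 0.
Proof.
move=> hx hy; rewrite /Parsing.dist dsE //; case hc: (conn x y) => //=.
by rewrite ltnW ?gap_lt.
Qed.

Lemma dist_gt0 x y : x < n -> y < n -> (0 < dist x y) = conn x y.
Proof. by move=> hx hy; rewrite distE //; case: ifP. Qed.

Lemma sum_le1 (p : pred nat) :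
  (forall x y, x < n -> y < n -> p x -> p y -> x = y) -> \sum_(0 <= x < n) p x <= 1.
Proof.
move=> h; case: (boolP (has p (iota 0 n))) => [/has_iotaP [y hy py]|/hasPn hn].
  have := @sum_nat_one n (fun _ => 1) p y hy py (fun x hx px => h x y hx hy px py).
  by move=> <-; apply: leq_sum => x _; case: (p x).
by rewrite big_nat big1 // => x /andP[_ hx]; rewrite (negbTE (hn x _)) // mem_iota.
Qed.

Lemma endv_uniq y z z' : y < n -> z < n -> z' < n -> endv y -> pe y z -> pe y z' -> z = z'.
Proof.
move=> hy hz hz' he h h'; apply/eqP; apply: contraTT he => ne.
rewrite /Parsing.endv -ltnNge big_mkord (bigD1 (Ordinal hz)) //=.
by rewrite (bigD1 (Ordinal hz')) /= -?val_eqE /= ?h ?h' // eq_sym.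
Qed.

(** A deepest vertex of the run can only have the neighbour above it. *)
Lemma run_end x : x < n -> exists2 y, y < n & conn x y && endv y.
Proof.
move=> hx; have [y [hy cy hmax]] := iota_argmin (fun y => l - p3 y) hx (conn_refl x).
exists y => //; rewrite cy /=; apply: sum_le1 => z z' hz hz' h h'.
have aux u : u < n -> pe y u -> [/\ kd u = 2, p1 u = p1 y, p2 u = p2 y & p3 y = (p3 u).+1].
  move=> hu hp; have [c _] := pe_conn hy hu hp.
  move: hp; rewrite peE // => /and5P[/eqP h1 /eqP h2 /eqP h3 /eqP h4 h5]; split=> //.
  have := hmax u hu (conn_trans hx hy hu cy c); have := p3l hy h1; have := p3l hu h2.
  by move: h5; lia.
have [k1 k2 k3 k4] := aux z hz h; have [m1 m2 m3 m4] := aux z' hz' h'.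
by apply: lab_inj => //; try congruence; move=> _; split; [congruence|lia].
Qed.

Lemma hdP x : x < n -> [/\ hd x < n, conn x (hd x), endv (hd x) &
  forall z, z < n -> conn x z -> endv z -> hk (hd x) <= hk z].
Proof.
move=> hx; have [y0 hy0 py0] := run_end hx.
have [y [hy /andP[cy ey] hmin]] :=
  @iota_argmin (fun y => conn x y && endv y) hk n y0 hy0 py0.
have hk_inj z : z < n -> hk z = hk y -> z = y.
  move=> hz e; have : hk z = hk y %[mod n.+1] by rewrite e.
  by rewrite /Parsing.hk !modnMDl !modn_small //; lia.
have iy : ish x y.
  rewrite /Parsing.ish dist_gt0 // cy ey /=; apply/all_iotaP => z hz.
  by rewrite dist_gt0 //; apply/implyP => /andP[c e]; apply: hmin; rewrite // c e.
have -> : hd x = y.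
  rewrite /Parsing.hd (@sum_nat_one n id (ish x) y) // => z hz /and3P[c e /all_iotaP h].
  rewrite dist_gt0 // in c; apply: hk_inj => //; apply/eqP; rewrite eqn_leq.
  have := h y hy; rewrite dist_gt0 // cy ey /= => ->.
  by rewrite hmin // c e.
by split=> // z hz c e; apply: hmin; rewrite // c e.
Qed.

Lemma hd_lt x : x < n -> hd x < n. Proof. by case/hdP. Qed.
Lemma hd_conn x : x < n -> conn x (hd x). Proof. by case/hdP. Qed.
Lemma hd_end x : x < n -> endv (hd x). Proof. by case/hdP. Qed.

Lemma depE x : x < n -> dep x = gap x (hd x).
Proof. by move=> hx; rewrite /Parsing.dep distE ?hd_lt // hd_conn // subn1. Qed.

Lemma conn_hd x y : x < n -> y < n -> conn x y -> hd x = hd y.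
Proof.
move=> hx hy c; have [h1 h2 h3 h4] := hdP hx; have [k1 k2 k3 k4] := hdP hy.
have e : hk (hd x) = hk (hd y).
  apply/eqP; rewrite eqn_leq h4 ?k4 //; first by apply: conn_trans h2 => //; exact: conn_sym.
  exact: conn_trans c k2.
have : hk (hd x) = hk (hd y) %[mod n.+1] by rewrite e.
by rewrite /Parsing.hk !modnMDl !modn_small //; lia.
Qed.

(* The head is an end of the run, so its whole run lies on one side of it. *)
Lemma end_side h x y : h < n -> x < n -> y < n -> endv h -> conn x h -> conn y h ->
  p3 x < p3 h -> p3 h < p3 y -> False.
Proof.
move=> hh hx hy he cx cy h1 h2.
have [|z hz [_ pz _ d1]] := conn_step hx hh cx; first by apply/eqP => e; rewrite e ltnn in h1.
have [|z' hz' [_ pz' _ d2]] := conn_step hy hh cy; first by apply/eqP => e; rewrite e ltnn in h2.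
have := @endv_uniq h z z' hh hz hz' he; rewrite !(pe_sym hh) // => /(_ pz pz') e.
by rewrite e in d1; lia.
Qed.

Lemma dep_inj x y : x < n -> y < n -> conn x y -> dep x = dep y -> x = y.
Proof.
move=> hx hy c; rewrite !depE // -(conn_hd hx hy c) => e; apply: conn_gap0 => //.
have hh := hd_lt hx.
have cy : conn y (hd x) by rewrite (conn_hd hx hy c) hd_conn.
have s1 := @end_side _ _ _ hh hx hy (hd_end hx) (hd_conn hx) cy.
have s2 := @end_side _ _ _ hh hy hx (hd_end hx) cy (hd_conn hx).
by move: e s1 s2; rewrite /gap; lia.
Qed.

Lemma pe_dep x y : x < n -> y < n -> pe x y -> dep y = (dep x).+1 \/ dep x = (dep y).+1.
Proof.
move=> hx hy hp; have [c g] := pe_conn hx hy hp.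
rewrite !depE // -(conn_hd hx hy c).
have hh := hd_lt hx.
have cy : conn y (hd x) by rewrite (conn_hd hx hy c) hd_conn.
have s1 := @end_side _ _ _ hh hx hy (hd_end hx) (hd_conn hx) cy.
have s2 := @end_side _ _ _ hh hy hx (hd_end hx) cy (hd_conn hx).
by move: g s1 s2; rewrite /gap; lia.
Qed.

Lemma dep_pred y : y < n -> 0 < dep y -> exists2 x, x < n &
  [/\ conn x y, pe x y & dep y = (dep x).+1].
Proof.
move=> hy d0; have hh := hd_lt hy.
have cy := conn_sym hy hh (hd_conn hy).
have ne : hd y != y by apply/eqP => e; move: d0; rewrite depE // e /gap subnn.
have [x hx [c hp g _]] := conn_step hh hy cy ne; exists x => //.
have [cx _] := pe_conn hx hy hp; split=> //.
rewrite !depE // (conn_hd hx hy cx).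
by move: g; rewrite /gap; lia.
Qed.

Lemma dep_pe x y : x < n -> y < n -> conn x y -> dep y = (dep x).+1 -> pe x y.
Proof.
move=> hx hy c e; have [|z hz [cz hp ez]] := @dep_pred y hy; first by rewrite e.
have <- // : z = x; apply: dep_inj => //; last by lia.
by apply: conn_trans cz _ => //; exact: conn_sym.
Qed.

Lemma conn_kd x y : x < n -> y < n -> kd y != 2 -> conn x y -> x = y.
Proof. by move=> hx hy h /(connP hx hy) [//|[_ h2]]; rewrite h2 in h. Qed.

Lemma end_of_depth u : u < n -> p3 u = 0 \/ p3 u = l -> endv u.
Proof.
move=> hu h; apply: sum_le1 => z z' hz hz'.
rewrite !peE // => /and5P[/eqP e1 /eqP e2 /eqP e3 /eqP e4 e5].
case/and5P=> /eqP f1 /eqP f2 /eqP f3 /eqP f4 f5.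
apply: lab_inj => //; try congruence; move=> _; split; first congruence.
by have := p3l hz e2; have := p3l hz' f2; move: e5 f5; lia.
Qed.

(** A left end takes precedence as head, and a run has only one vertex of depth 0. *)
Lemma hd_A x u : x < n -> u < n -> conn x u -> cls u = 1 -> hd x = u.
Proof.
move=> hx hu c c1; have [h1 h2 h3 h4] := hdP hx.
have [/(_ c1) [k2 d0] _ _ _] := cls_kd hu.
have := h4 u hu c (end_of_depth hu (or_introl d0)).
rewrite /Parsing.hk c1 eqxx mul0n add0n; case: eqP => c1'; last first.
  by case: ifP => _; lia.
move=> _; have [/(_ c1') [k2' d0'] _ _ _] := cls_kd h1.
apply: conn_gap0 => //; last by rewrite /gap d0 d0'.
by apply: conn_trans c => //; exact: conn_sym.
Qed.

Lemma hd_B x u : x < n -> u < n -> conn x u -> cls u = 3 ->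
  (forall z, z < n -> conn x z -> cls z != 1) -> hd x = u.
Proof.
move=> hx hu c c3 nA; have [h1 h2 h3 h4] := hdP hx.
have [_ _ /(_ c3) [k2 d0] _] := cls_kd hu.
have := h4 u hu c (end_of_depth hu (or_intror d0)).
rewrite /Parsing.hk c3 /= mul1n (negbTE (nA _ h1 h2)); case: eqP => c3'; last by lia.
move=> _; have [_ _ /(_ c3') [k2' d0'] _] := cls_kd h1.
apply: conn_gap0 => //; last by rewrite /gap d0 d0' subnn.
by apply: conn_trans c => //; exact: conn_sym.
Qed.

Lemma hd_single x : x < n -> kd x != 2 -> hd x = x.
Proof.
move=> hx h; have [h1 h2 h3 h4] := hdP hx.
by apply: conn_kd => //; exact: conn_sym.
Qed.

Lemma fulP x : x < n -> ful x <-> exists2 y, y < n & conn x y /\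
  (cls x = 1 /\ cls y = 3 \/ cls x = 3 /\ cls y = 1).
Proof.
move=> hx; split=> [/has_iotaP [y hy]|[y hy [c h]]].
  rewrite dist_gt0 // => /andP[c /orP[] /andP[/eqP h1 /eqP h2]]; exists y => //.
    by split=> //; left.
  by split=> //; right.
apply/has_iotaP; exists y => //; rewrite dist_gt0 // c /=.
by case: h => -[-> ->].
Qed.

Lemma hd_core x : x < n -> 0 < cls x -> ~~ (ful x && (cls x == 3)) -> hd x = x.
Proof.
move=> hx c0 nf; have [k1 k2 k3 k4] := cls_kd hx.
move: c0 (cls_le a g0 g1 g2 g3 g4 g5 x).
case e: (cls x) => [|[|[|[|[|k]]]]] // _ _.
- by apply: hd_A => //; exact: conn_refl.
- by apply: hd_single; rewrite // k2.
- apply: hd_B => // [|z hz c]; first exact: conn_refl.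
  apply/eqP => cz; move: nf; rewrite e eqxx andbT => /negP; apply.
  by apply/fulP => //; exists z => //; split=> //; right.
- by apply: hd_single; rewrite // k4.
Qed.

Lemma dep_core x : x < n -> 0 < cls x -> ~~ (ful x && (cls x == 3)) -> dep x = 0.
Proof. by move=> hx h1 h2; rewrite depE // hd_core // /gap subnn. Qed.

(** The exception to [hd_core]: on a complete wire the left end takes precedence, at distance
    [l]. *)
Lemma dep_fulB y : y < n -> ful y -> cls y = 3 ->
  [/\ cls (hd y) = 1, ful (hd y), dep y = l & conn (hd y) y].
Proof.
move=> hy /(fulP hy) [u hu [c [[h1 h2]|[h1 h2]]]] c3; first by rewrite h1 in c3.
have e : hd y = u by apply: hd_A.
have [_ _ /(_ c3) [_ d] _] := cls_kd hy; have [/(_ h2) [_ d'] _ _ _] := cls_kd hu.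
have c' := conn_sym hy hu c.
rewrite depE // e; split=> //; last by rewrite /gap d d'; lia.
by apply/fulP => //; exists y => //; split=> //; left.
Qed.

Definition side c x := (cls x == c) || (cls x == c.+1).

Lemma a_half c u v : c = 1 \/ c = 3 -> u < n -> v < n -> cls u = c -> cls v = c.+1 ->
  a u v = ((if c == 1 then p1 u else p2 u) <= p1 v).
Proof.
move=> hc hu hv cu cv; rewrite aE //.
have [k1 k2 k3 k4] := cls_kd hu; have [m1 m2 m3 m4] := cls_kd hv.
case: hc cu cv => -> cu cv; rewrite /labadj.
  have [-> ->] := k1 cu; have -> := m2 cv.
  by rewrite /= ?andbF ?orbF.
have [-> ->] := k3 cu; have -> := m4 cv.
by rewrite /= eqxx ?andbF ?orbF.
Qed.

Lemma kapE c u : c = 1 \/ c = 3 -> cls u = c ->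
  kap u = 2 * \sum_(0 <= v < n) ((cls v == c.+1) && ~~ a u v).
Proof. by move=> hc cu; rewrite /Parsing.kap cu; case: hc => ->. Qed.

Lemma kapE' c v : c = 1 \/ c = 3 -> cls v = c.+1 ->
  kap v = (2 * \sum_(0 <= w < n) ((cls w == c.+1) &&
          has (fun u => [&& cls u == c, a u v & ~~ a u w]) (iota 0 n))).+1.
Proof. by move=> hc cu; rewrite /Parsing.kap cu; case: hc => ->. Qed.

(** If [u] and [v] are not adjacent, each vertex counted for [v] is a non-neighbour of [u], because
    the neighbourhoods form a chain; and [v] is one more non-neighbour, so the count for [u] is
    strictly larger. *)
Lemma kapP c u v : c = 1 \/ c = 3 -> u < n -> v < n -> cls u = c -> cls v = c.+1 ->
  a u v = (kap u < kap v).
Proof.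
move=> hc hu hv cu cv; rewrite (kapE hc cu) (kapE' hc cv) ltnS leq_mul2l /=.
apply/idP/idP => [auv|].
  apply: sum_nat_le => w hw /andP[cw naw]; rewrite cw /=.
  by apply/has_iotaP; exists u => //; rewrite cu eqxx auv naw.
apply: contraLR => nauv; rewrite -ltnNge.
apply: (sum_nat_lt (y := v)) => // [w hw /andP[cw /has_iotaP [z hz /and3P[/eqP cz az naz]]]||].
- rewrite cw /=; move: az naz nauv.
  rewrite !(a_half hc) //; try exact/eqP; lia.
- by rewrite cv eqxx nauv.
- by rewrite negb_and; apply/orP; right; apply/has_iotaP => -[z _ /and3P[_ ->]].
Qed.

Lemma sum_nat_ub (p : pred nat) : \sum_(0 <= x < n) p x <= n.
Proof.
apply: leq_trans (_ : \sum_(0 <= x < n) true <= n); first exact: sum_nat_le.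
by rewrite sum_nat_const_nat muln1 subn0.
Qed.

Lemma kap_le x : kap x <= 2 * n + 1.
Proof.
by rewrite /Parsing.kap; case: ifP => _; [have := sum_nat_ub|have := sum_nat_ub] => h;
  match goal with |- context [\sum_(0 <= v < n) nat_of_bool (@?p v)] =>
    have := h p end; lia.
Qed.

Lemma kap_odd c u v : c = 1 \/ c = 3 -> cls u = c -> cls v = c.+1 -> kap u <> kap v.
Proof. by move=> hc cu cv; rewrite (kapE hc cu) (kapE' hc cv); lia. Qed.

Lemma ful_cls x : x < n -> ful x -> cls x = 1 \/ cls x = 3.
Proof. by move=> hx /(fulP hx) [y _ [_ [[-> _]|[-> _]]]]; [left|right]. Qed.

Lemma blk_term c u w : c = 1 \/ c = 3 -> w < n -> side c u ->
  (ful w && ((cls w == cls u) || ((cls w).+1 == cls u))) = ful w && (cls w == c).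
Proof.
move=> hc hw hs; case fw: (ful w) => //=; have := ful_cls hw fw.
by move: hs; rewrite /side; lia.
Qed.

Lemma blkE c u : c = 1 \/ c = 3 -> side c u ->
  blk u = \sum_(0 <= w < n) [&& ful w, cls w == c & ltk w u].
Proof.
move=> hc hs; rewrite /Parsing.blk big_nat [RHS]big_nat; apply: eq_bigr => w /andP[_ hw].
by rewrite andbA (blk_term hc hw hs) andbA.
Qed.

Lemma ltk_trans u v w : ltk u v -> ltk v w -> ltk u w.
Proof. rewrite /Parsing.ltk; lia. Qed.

Lemma blk_mono c x y : c = 1 \/ c = 3 -> side c x -> side c y -> kap x < kap y ->
  blk x <= blk y.
Proof.
move=> hc sx sy h; rewrite !(blkE hc) //; apply: sum_nat_le => w hw /and3P[-> ->].
by rewrite /Parsing.ltk; lia.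
Qed.

Lemma blk_lt c x y : c = 1 \/ c = 3 -> x < n -> cls x = c -> side c y -> ful x ->
  ltk x y -> blk x < blk y.
Proof.
move=> hc hx cx sy fx h; have sx : side c x by rewrite /side cx eqxx.
rewrite !(blkE hc) //; apply: (sum_nat_lt (y := x)) => //.
- by move=> w hw /and3P[-> ->] /ltk_trans; apply.
- by rewrite fx cx eqxx.
- by rewrite /Parsing.ltk; lia.
Qed.

Lemma blk_inj c x y : c = 1 \/ c = 3 -> x < n -> y < n -> cls x = c -> cls y = c ->
  ful x -> ful y -> blk x = blk y -> x = y.
Proof.
move=> hc hx hy cx cy fx fy e.
have sx : side c x by rewrite /side cx eqxx.
have sy : side c y by rewrite /side cy eqxx.
case: (boolP (ltk x y)) => [/(blk_lt hc hx cx sy fx)|h1]; first by lia.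
case: (boolP (ltk y x)) => [/(blk_lt hc hy cy sx fy)|h2]; first by lia.
by move: h1 h2; rewrite /Parsing.ltk; lia.
Qed.

Definition nful c := \sum_(0 <= w < n) (ful w && (cls w == c)).

Lemma blk_lt_nful c x : c = 1 \/ c = 3 -> x < n -> cls x = c -> ful x -> blk x < nful c.
Proof.
move=> hc hx cx fx; have sx : side c x by rewrite /side cx eqxx.
rewrite (blkE hc) //; apply: (sum_nat_lt (y := x)) => //.
- by move=> w hw /and3P[-> ->].
- by rewrite fx cx eqxx.
- by rewrite /Parsing.ltk; lia.
Qed.

Lemma sum_inj_le (P Q : pred nat) (f : nat -> nat) :
  (forall x, x < n -> P x -> f x < n /\ Q (f x)) ->
  (forall x y, x < n -> y < n -> P x -> P y -> f x = f y -> x = y) ->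
  \sum_(0 <= x < n) P x <= \sum_(0 <= x < n) Q x.
Proof.
move=> h1 h2.
have sz (R : pred nat) : size (filter R (iota 0 n)) = \sum_(0 <= y < n) R y.
  by rewrite size_filter -sum1_count big_mkcond /= /index_iota subn0.
have mem (R : pred nat) x : (x \in filter R (iota 0 n)) = R x && (x < n).
  by rewrite mem_filter mem_iota.
rewrite -!sz -(size_map f); apply: uniq_leq_size.
  rewrite map_inj_in_uniq ?filter_uniq ?iota_uniq // => x y.
  by rewrite !mem => /andP[px hx] /andP[py hy]; apply: h2.
move=> y /mapP [x]; rewrite mem => /andP[px hx] ->; rewrite mem.
by have [-> ->] := h1 x hx px.
Qed.

Lemma B_depth y : y < n -> cls y = 3 -> kd y = 2 /\ p3 y = l.
Proof. by move=> hy h; have [_ _ /(_ h)] := cls_kd hy. Qed.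
Lemma A_depth y : y < n -> cls y = 1 -> kd y = 2 /\ p3 y = 0.
Proof. by move=> hy h; have [/(_ h)] := cls_kd hy. Qed.

Lemma B_uniq y y' : y < n -> y' < n -> conn y y' -> cls y = 3 -> cls y' = 3 -> y = y'.
Proof.
move=> hy hy' c h h'; apply: conn_gap0 => //.
by have [_ e] := B_depth hy h; have [_ e'] := B_depth hy' h'; rewrite /gap e e' subnn.
Qed.

Lemma fulA_end u : u < n -> ful u -> cls u = 1 -> exists2 y, y < n &
  [/\ conn u y, cls y = 3 & ful y].
Proof.
move=> hu /(fulP hu) [y hy [c [[h1 h2]|[h1 h2]]]] c1; last by rewrite c1 in h1.
exists y => //; split=> //; apply/fulP => //; exists u => //; split; first exact: conn_sym.
by right.
Qed.

(** Complete wires match left and right ends one to one. Therefore the ranks on both sides fill the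
    same interval, and each end has a partner of equal rank on the other side. *)
Lemma nful_eq : nful 1 = nful 3.
Proof.
apply/eqP; rewrite eqn_leq; apply/andP; split.
  have [f hf] : exists f, forall u, (u < n /\ ful u && (cls u == 1)) ->
      f u < n /\ [/\ conn u (f u), cls (f u) = 3 & ful (f u)].
    apply: (@choice_nat (fun u y => (u < n /\ ful u && (cls u == 1)) ->
      y < n /\ [/\ conn u y, cls y = 3 & ful y])) => u.
    case: (classic (u < n /\ ful u && (cls u == 1))) => [[hu /andP[fu /eqP cu]]|h].
      by have [y hy h] := fulA_end hu fu cu; exists y.
    by exists 0.
  apply: (@sum_inj_le _ _ f) => [x hx px|x y hx hy px py e].
    by have [h1 [_ -> ->]] := hf x (conj hx px).
  have [h1 [c1 _ _]] := hf x (conj hx px); have [h2 [c2 _ _]] := hf y (conj hy py).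
  case/andP: px => _ /eqP cx; case/andP: py => _ /eqP cy.
  rewrite -(hd_A h1 hx (conn_sym hx h1 c1) cx).
  by rewrite e (hd_A h2 hy (conn_sym hy h2 c2) cy).
apply: (@sum_inj_le _ _ hd) => [x hx /andP[fx /eqP cx]|x y hx hy /andP[fx /eqP cx] /andP[fy /eqP cy] e].
  by have [-> -> _ _] := dep_fulB hx fx cx; split=> //; exact: hd_lt.
have [_ _ _ c1] := dep_fulB hx fx cx; have [_ _ _ c2] := dep_fulB hy fy cy.
apply: B_uniq => //; apply: conn_trans (hd_conn hx) _ => //; first exact: hd_lt.
by rewrite e.
Qed.

Lemma partnerB u : u < n -> ful u -> cls u = 1 ->
  exists2 y, y < n & [/\ ful y, cls y = 3 & blk y = blk u].
Proof.
move=> hu fu cu.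
have [|||y hy [/andP[fy /eqP cy] e]] :=
    @rank_onto n (fun w => ful w && (cls w == 3)) blk (blk u).
- move=> x y hx hy /andP[fx /eqP cx] /andP[fy /eqP cy].
  by apply: (@blk_inj 3) => //; right.
- by move=> x hx /andP[fx /eqP cx]; apply: (@blk_lt_nful 3) => //; right.
- by rewrite -[X in _ < X]nful_eq; apply: (@blk_lt_nful 1) => //; left.
by exists y.
Qed.

Lemma partnerA y : y < n -> ful y -> cls y = 3 ->
  exists2 u, u < n & [/\ ful u, cls u = 1 & blk u = blk y].
Proof.
move=> hu fu cu.
have [|||u hy [/andP[fy /eqP cy] e]] :=
    @rank_onto n (fun w => ful w && (cls w == 1)) blk (blk y).
- move=> x z hx hz /andP[fx /eqP cx] /andP[fz /eqP cz].
  by apply: (@blk_inj 1) => //; left.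
- by move=> x hx /andP[fx /eqP cx]; apply: (@blk_lt_nful 1) => //; left.
- by rewrite [X in _ < X]nful_eq; apply: (@blk_lt_nful 3) => //; right.
by exists u.
Qed.

Notation kb := (kbase n).
Definition sub h := if ful h then kb - 1 else if cls h == 0 then 0
      else if cls h <= 2 then (kap h).+1 else 2 * n + 4 + kap h.
Definition idx h := if ful h then 0 else h.
Definition bv h := if cls h == 0 then n.+1 else blk h.
Definition kx x := if ful x && (cls x == 3) then x else hd x.

Lemma keyE x : key x = kb * (kb * (kb * bv (kx x) + sub (kx x)) + idx (kx x)) + dep x.
Proof. by []. Qed.

Lemma sub_lt h : sub h < kb.
Proof.
have := kap_le h; rewrite /sub /kbase; case: ifP => _; first by lia.
by do 2 (case: ifP => _; first by lia); lia.
Qed.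

Lemma sub_ful h : sub h = kb - 1 -> ful h.
Proof.
have := kap_le h; rewrite /sub /kbase; case: ifP => // _.
by do 2 (case: ifP => _; first by lia); lia.
Qed.

Lemma idx_lt h : h < n -> idx h < kb.
Proof. by rewrite /idx /kbase; case: ifP => _; lia. Qed.

Lemma dep_lt x : x < n -> dep x < kb.
Proof.
move=> hx; rewrite depE //; have := gap_lt hx (hd_lt hx) (hd_conn hx); rewrite /kbase; lia.
Qed.

Lemma dep_le x : x < n -> cls (hd x) = 1 -> dep x <= l /\ dep x = p3 x.
Proof.
move=> hx h; have [k2 d0] := A_depth (hd_lt hx) h; rewrite depE // /gap d0 subn0 addn0.
split=> //; case: ((connP hx (hd_lt hx)).1 (hd_conn hx)) => [e|[k _ _ _ _]]; last exact: p3l.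
by rewrite e d0.
Qed.

Lemma lex_eq B x y r s : r < B -> s < B -> B * x + r = B * y + s -> x = y /\ r = s.
Proof.
move=> hr hs e; have B0 : 0 < B by lia.
have e1 : (B * x + r) %/ B = (B * y + s) %/ B by rewrite e.
move: e1; rewrite ![B * _]mulnC !divnMDl // !divn_small // !addn0 => e1.
by split=> //; move: e; rewrite e1; lia.
Qed.

Lemma lex_lt B x y r s : r < B -> x < y -> B * x + r < B * y + s.
Proof. by move=> hr h; have := leq_mul (leqnn B) h; rewrite mulnS; lia. Qed.

Lemma kx_lt x : x < n -> kx x < n.
Proof. by move=> hx; rewrite /kx; case: ifP => // _; exact: hd_lt. Qed.

(** All digits can be recovered. Inside the block of a complete wire, depth [l] belongs to the right
    end alone, since the vertices that stay with the left end have smaller depth. *)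
Lemma key_inj x y : x < n -> y < n -> key x = key y -> x = y.
Proof.
move=> hx hy; rewrite !keyE => e.
have [e1 ed] := lex_eq (dep_lt hx) (dep_lt hy) e.
have [e2 ei] := lex_eq (idx_lt (kx_lt hx)) (idx_lt (kx_lt hy)) e1.
have [eb es] := lex_eq (sub_lt _) (sub_lt _) e2.
have nonful z : z < n -> ful (kx z) = false -> kx z = hd z.
  by move=> hz; rewrite /kx; case: ifP => // /andP[->].
have same : kx x = hd x -> kx y = hd y -> hd x = hd y -> x = y.
  move=> kX kY ee; apply: dep_inj => //; apply: conn_trans (hd_conn hx) _ => //.
    exact: hd_lt.
  by rewrite ee; apply: conn_sym (hd_conn hy) => //; exact: hd_lt.
case fx: (ful (kx x)); last first.
  have fy : ful (kx y) = false.
    by apply/negP => fy; move/negP: fx; apply; apply: sub_ful; rewrite es /sub fy.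
  by apply: same; rewrite -?nonful //; move: ei; rewrite /idx fx fy.
have fy : ful (kx y) by apply: sub_ful; rewrite -es /sub fx.
have cz z : z < n -> ful (kx z) -> (kx z = z /\ cls z = 3 /\ dep z = l) \/
    [/\ kx z = hd z, cls (hd z) = 1 & dep z <> l].
  move=> hz; rewrite /kx; case: ifP => [/andP[fz /eqP c3] _|nf fh].
    by left; split=> //; split=> //; case: (dep_fulB hz fz c3).
  right; have [c1|c3] := ful_cls (hd_lt hz) fh; last first.
    have [h1 _ h3 h4] := dep_fulB (hd_lt hz) fh c3.
    have := conn_hd hz (hd_lt hz) (hd_conn hz) => e'.
    by rewrite -e' c3 in h1.
  split=> // dl; have [_ dp] := dep_le hz c1.
  have [y' hy' [c' c3' fy']] := fulA_end (hd_lt hz) fh c1.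
  have [_ d'] := B_depth hy' c3'.
  have ez : z = y'.
    apply: conn_gap0 => //; last by rewrite /gap d' -dp dl subnn.
    by apply: conn_trans (hd_conn hz) c' => //; exact: hd_lt.
  by move: nf; rewrite ez fy' c3'.
have bvE z : z < n -> ful (kx z) -> bv (kx z) = blk (kx z).
  by move=> hz fz; rewrite /bv; have [->|->] := ful_cls (kx_lt hz) fz.
rewrite !bvE // in eb.
case: (cz x hx fx) (cz y hy fy) => [[kX [cX dX]]|[kX cX dX]] [[kY [cY dY]]|[kY cY dY]].
- by rewrite kX kY in eb fx fy; apply: (@blk_inj 3) => //; right.
- by rewrite -ed dX in dY.
- by rewrite ed dY in dX.
- apply: same => //; rewrite kX kY in eb fx fy.
  by apply: (@blk_inj 1) => //; try exact: hd_lt; left.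
Qed.

(** A complete end [u] below [v] is itself counted in the block number of [v]. At equal block
    numbers the middle digit decides, in the order of [kap]. *)
Lemma key_half c u v : c = 1 \/ c = 3 -> u < n -> v < n -> cls u = c -> cls v = c.+1 ->
  a u v = (key u < key v) /\ (key u != key v).
Proof.
move=> hc hu hv cu cv; rewrite (kapP hc) // !keyE.
have su : side c u by rewrite /side cu eqxx.
have sv : side c v by rewrite /side cv eqxx orbT.
have fv : ful v = false by apply/negP => /(ful_cls hv); case: hc cv => -> ->; case.
have kv : kx v = v.
  by rewrite /kx fv /= hd_core ?fv // cv.
have ku : kx u = u.
  rewrite /kx; case: ifP => // /negbT nf; apply: hd_core => //.
  by rewrite cu; case: hc => ->.
rewrite ku kv.
have bu : bv u = blk u by rewrite /bv cu; case: hc => ->.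
have bvv : bv v = blk v by rewrite /bv cv; case: hc => ->.
have nk := kap_odd hc cu cv.
have subv : sub v < kb - 1.
  by rewrite ltn_neqAle; apply/andP; split; [apply/eqP => /sub_ful; rewrite fv|
    have := sub_lt v; lia].
have dlt x y r s r' s' i j : r < kb -> s < kb -> i < kb -> j < kb -> r' < kb -> s' < kb ->
   x < y \/ (x = y /\ r < s) ->
   kb * (kb * (kb * x + r) + i) + r' < kb * (kb * (kb * y + s) + j) + s'.
  move=> ? ? ? ? ? ? hxy; apply: lex_lt => //; apply: lex_lt => //.
  by case: hxy => [h|[-> h]]; [exact: lex_lt|rewrite ltn_add2l].
have dh := @dlt (bv u) (bv v) (sub u) (sub v) (dep u) (dep v) (idx u) (idx v)
  (sub_lt _) (sub_lt _) (idx_lt hu) (idx_lt hv) (dep_lt hu) (dep_lt hv).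
have dh' := @dlt (bv v) (bv u) (sub v) (sub u) (dep v) (dep u) (idx v) (idx u)
  (sub_lt _) (sub_lt _) (idx_lt hv) (idx_lt hu) (dep_lt hv) (dep_lt hu).
case: (ltngtP (kap u) (kap v)) => // hk'.
  suff /dh h : bv u < bv v \/ bv u = bv v /\ sub u < sub v by lia.
  rewrite bu bvv; case fu: (ful u).
    by left; apply: (blk_lt hc) => //; rewrite /Parsing.ltk hk'.
  have := blk_mono hc su sv hk'; rewrite leq_eqVlt => /orP[/eqP->|]; [right|by left].
  split=> //; rewrite /sub fu fv cu cv; case: hc => -> /=; lia.
suff /dh' h : bv v < bv u \/ bv v = bv u /\ sub v < sub u by lia.
rewrite bu bvv; have := blk_mono hc sv su hk'.
rewrite leq_eqVlt => /orP[/eqP->|]; [right|by left]; split=> //.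
case fu: (ful u); first by rewrite /sub fu.
by rewrite /sub fu fv cu cv; case: hc => -> /=; lia.
Qed.

Lemma sum_eq1 (p : pred nat) y : y < n -> p y -> (forall x, x < n -> p x -> x = y) ->
  \sum_(0 <= x < n) p x = 1.
Proof.
by move=> hy py h; rewrite -(@sum_nat_one n (fun _ => 1) p y).
Qed.

Lemma ps_next x y : x < n -> y < n -> key y = (key x).+1 -> ps y = (ps x).+1.
Proof.
move=> hx hy e; rewrite /Parsing.ps e.
rewrite [LHS](eq_big_nat _ _ (F2 := fun z => (key z < key x) + (z == x))).
  rewrite big_split /= (@sum_eq1 (fun z => z == x) x) ?eqxx ?addn1 // => z _ /eqP.
  by [].
move=> z /andP[_ hz]; rewrite ltnS leq_eqVlt.
case: (eqVneq z x) => [->|ne]; first by rewrite eqxx ltnn.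
rewrite addn0; case: eqP => // ek.
by case/eqP: ne; exact: key_inj.
Qed.

Lemma key_dep x y : x < n -> y < n -> kx x = kx y -> dep y = (dep x).+1 ->
  key y = (key x).+1.
Proof. by move=> hx hy e d; rewrite !keyE e d addnS. Qed.

Definition fulB x := ful x && (cls x == 3).

Lemma kxE x : fulB x = false -> kx x = hd x.
Proof. by rewrite /kx /fulB => ->. Qed.

Lemma ps_pred y : y < n -> fulB y = false -> 0 < dep y -> exists2 x, x < n &
  [/\ pe x y, fulB x = false & ps y = (ps x).+1].
Proof.
move=> hy fy d0; have [x hx [c hp d]] := dep_pred hy d0; exists x => //.
have fx : fulB x = false.
  apply/negP => /andP[fx /eqP cx]; have [h1 h2 h3 h4] := dep_fulB hx fx cx.
  have := conn_hd hx hy c => e; rewrite e in h1.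
  by have [dl _] := dep_le hy h1; lia.
split=> //; apply: ps_next => //; apply: key_dep => //.
by rewrite !kxE // (conn_hd hx hy c).
Qed.

Lemma lett7 y : y < n -> (lett y == 7) = fulB y.
Proof.
move=> hy; rewrite /Parsing.lett /fulB; apply/eqP/andP => [e|[fy /eqP cy]].
  have c3 : cls y = 3 by move: e; case: (0 < dep y) => /=; lia.
  have d0 : 0 < dep y by move: e; rewrite c3; case: (0 < dep y).
  split; last by rewrite c3.
  by apply: contraLR d0 => nf; rewrite dep_core // ?c3 // negb_and nf.
by have [_ _ -> _] := dep_fulB hy fy cy; rewrite cy; case: l l2.
Qed.

Lemma wl7 y : y < n -> (wl (ps y) == 7) = fulB y.
Proof. by move=> hy; rewrite (wl_ps key_inj) // lett7. Qed.

Lemma run_at u d : u < n -> ful u -> cls u = 1 -> d <= l -> exists2 x, x < n &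
  [/\ conn u x, hd x = u, dep x = d, p3 x = d & kd x = 2].
Proof.
move=> hu fu cu dl; have [y hy [c cy fy]] := fulA_end hu fu cu.
have [k2 d0] := A_depth hu cu; have [k2' dl'] := B_depth hy cy.
have [e|[h1 h2 h3 h4 h5]] := (connP hu hy).1 c; first by rewrite e cy in cu.
have /onwP [x hx [q1 q2 q3 q4]] : onw u d by apply: h5; lia.
have cx : conn u x.
  by apply/connP => //; right; split=> // e he; apply: h5; lia.
have ehd : hd x = u by apply: hd_A => //; exact: conn_sym.
exists x => //; split=> //; have [|_ ->] // := dep_le hx; by rewrite ehd.
Qed.

(** The last inner vertices of complete wires: the edge that follows them is the one that gets
    rewired. *)
Definition isl x := [/\ ful (hd x), cls (hd x) = 1 & dep x = l - 1].

Lemma isl_fulB x : x < n -> isl x -> fulB x = false /\ cls x = 0.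
Proof.
move=> hx [h1 h2 h3]; have [_ dp] := dep_le hx h2.
have [[k1 k2 k3 k4] d1] := (cls_kd hx, l2).
have kd2 : kd x = 2.
  by case: ((connP hx (hd_lt hx)).1 (hd_conn hx)) => [->|[]//]; case: (A_depth (hd_lt hx) h2).
have c0 : cls x = 0.
  have := cls_le a g0 g1 g2 g3 g4 g5 x.
  case e: (cls x) k1 k2 k3 k4 => [|[|[|[|[|k]]]]] // k1 k2 k3 k4 _; exfalso.
  - by have [//|_] := k1; lia.
  - by rewrite k2 in kd2.
  - by have [//|_] := k3; lia.
  - by rewrite k4 in kd2.
by rewrite /fulB c0 andbF.
Qed.

Lemma isl_next x : x < n -> isl x -> exists2 y, y < n & fulB y /\ ps y = (ps x).+1.
Proof.
move=> hx il; have [fx cx] := isl_fulB hx il; have [h1 h2 h3] := il.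
have [y hy [fy cy e]] := partnerB (hd_lt hx) h1 h2.
have fBy : fulB y by rewrite /fulB fy cy.
exists y => //; split=> //; apply: ps_next => //.
have [_ _ dy _] := dep_fulB hy fy cy.
rewrite !keyE (kxE fx) (_ : kx y = y); last by rewrite /kx fy cy.
by rewrite /bv /sub /idx fy h1 cy h2 e dy h3 -addnS; congr addn; have := l2; lia.
Qed.

(** Going back from a right end, the word runs through the wire of the partner of equal rank, not
    through that of the end itself. *)
Lemma fulB_prev y d : y < n -> fulB y -> 0 < d <= l -> exists2 x, x < n &
  [/\ ps y = ps x + d, ful (hd x), cls (hd x) = 1, dep x = l - d & p3 x = l - d].
Proof.
move=> hy fBy; have /andP[fy /eqP cy] := fBy.
have [u hu [fu cu e]] := partnerA hy fy cy.
elim: d => // -[_ _|d ih /andP[_ dl]].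
  have [x hx [c ehd dx px kx2]] := @run_at u (l - 1) hu fu cu ltac:(lia).
  have il : isl x by rewrite /isl ehd.
  exists x => //; rewrite ehd; split=> //.
  have [fx cx] := isl_fulB hx il; rewrite addn1; apply: ps_next => //.
  have [_ _ dy _] := dep_fulB hy fy cy.
  rewrite !keyE (kxE fx) ehd (_ : kx y = y); last by rewrite /kx fy cy.
  by rewrite /bv /sub /idx fy fu cy cu e dy dx -addnS; congr addn; have := l2; lia.
have [x hx [h1 h2 h3 h4 h5]] := ih ltac:(lia).
have fBx : fulB x = false.
  apply/negP => /andP[fx /eqP cx].
  by have [_ _ dd _] := dep_fulB hx fx cx; lia.
have [|z hz [hp fz e']] := ps_pred hx fBx; first by lia.
have [cz _] := pe_conn hz hx hp.
have ehd := conn_hd hz hx cz.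
exists z => //; rewrite ehd h1 e'; split=> //; try lia.
  have := pe_dep hz hx hp; rewrite h4 => -[|dd]; first by lia.
  have := ps_next hx hz; rewrite (key_dep hx hz) ?kxE // ?ehd // ?h4 // => /(_ erefl); lia.
have dz : dep z = l - d.+2.
  have := pe_dep hz hx hp; rewrite h4 => -[|dd]; first by lia.
  have := ps_next hx hz; rewrite (key_dep hx hz) ?kxE // ?ehd // ?h4 // => /(_ erefl); lia.
by have [|_ <-] // := dep_le hz; rewrite ehd.
Qed.

Lemma wl_next7 x : x < n -> (wl (ps x).+1 == 7) <-> isl x.
Proof.
move=> hx; split=> [h|il]; last first.
  by have [y hy [fy <-]] := isl_next hx il; rewrite wl7.
have pn : (ps x).+1 < n by rewrite ltnNge; apply/negP => /wl_out e; rewrite e in h.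
have [y hy py] := onto_of_inj (@ps_lt n a g0 g1 g2 g3 g4 g5) (ps_inj key_inj) pn.
rewrite -py wl7 // in h.
have [z hz [h1 h2 h3 h4 h5]] := @fulB_prev y 1 hy h ltac:(lia).
have <- // : z = x by apply: (ps_inj key_inj) => //; lia.
Qed.

Lemma pe_fulB x y : x < n -> y < n -> fulB y -> pe x y -> isl x.
Proof.
move=> hx hy /andP[fy /eqP cy] hp; have [h1 h2 h3 h4] := dep_fulB hy fy cy.
have [c _] := pe_conn hx hy hp; have e := conn_hd hx hy c.
rewrite /isl e; split=> //; have [|dx] := pe_dep hx hy hp; first by lia.
have [|dl _] := dep_le hx; first by rewrite e.
lia.
Qed.

Theorem parse_complete th : th <= l -> chk n a g0 g1 g2 g3 g4 g5 th.
Proof.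
move=> thl; apply/and4P; split.
- apply/all_iotaP => x hx; apply/all_iotaP => y hy.
  by case: eqP => // ne; apply/eqP => /(key_inj hx hy).
- apply/all_iotaP => x hx; apply/all_iotaP => y hy; apply/implyP => /andP[lxy].
  rewrite /spec !wl7 // => ns; apply/eqP.
  have klt : key x < key y by rewrite -(ps_ltE key_inj).
  have nsy : fulB y -> ps y <> (ps x).+1.
    by move=> fy e; move: ns; rewrite -e wl7 // fy.
  have dcore z : z < n -> 0 < cls z -> fulB z = false -> dep z = 0.
    by move=> hz c0 fz; apply: dep_core => //; rewrite -[_ && _]/(fulB z) fz.
  (* The wire side comes second here, so the order of the word says that there is no edge. *)
  have bw c : c = 1 \/ c = 3 -> cls x = c.+1 -> cls y = c -> a x y = pat n a g0 g1 g2 g3 g4 g5 x y.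
    move=> hc cx cy; have [h1 _] := key_half hc hy hx cy cx.
    rewrite /pat cx cy; have -> : a x y = false.
      rewrite aE // orbC -aE // h1 ltnNge ltnW //.
    have -> : (ps y == (ps x).+1) && (0 < dep y) = false.
      apply/negP => /andP[/eqP e d0]; case fy: (fulB y); first exact: nsy fy e.
      by rewrite dcore // ?cy in d0; case: hc => ->.
    by case: hc => ->.
  have fw c : c = 1 \/ c = 3 -> cls x = c -> cls y = c.+1 -> a x y = pat n a g0 g1 g2 g3 g4 g5 x y.
    move=> hc cx cy; have [h1 _] := key_half hc hx hy cx cy.
    by rewrite h1 klt /pat cx cy; case: hc => -> /=.
  case hcore: (core a g0 g1 g2 g3 g4 g5 x y).
    case/or4P: hcore => /andP[/eqP cx /eqP cy].
    + by apply: (fw 1) => //; left.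
    + by apply: (bw 1) => //; left.
    + by apply: (fw 3) => //; right.
    + by apply: (bw 3) => //; right.
  have -> : a x y = pe x y by rewrite /Parsing.pe hcore andbT.
  have -> : pat n a g0 g1 g2 g3 g4 g5 x y = (ps y == (ps x).+1) && (0 < dep y).
    by move/negbT: hcore; rewrite /pat /core !negb_or => /and4P[/negbTE-> _ /negbTE-> _].
  (* A path edge into a complete right end starts at the last inner vertex of its own wire; such a
     pair is special and was excluded. *)
  case fy: (fulB y).
    have -> : (ps y == (ps x).+1) = false by apply/eqP; exact: nsy.
    apply/negP => hp; move: ns; rewrite fy andbT negb_or => /andP[/negP h _]; apply: h.
    by apply/wl_next7 => //; exact: pe_fulB hp.
  case fx: (fulB x).
    have -> : pe x y = false.
      apply/negP => hp; move: ns; rewrite fx fy andbF andbT /= => /negP; apply.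
      by apply/wl_next7 => //; apply: pe_fulB fx _ => //; rewrite pe_sym.
    apply/esym/negP => /andP[/eqP e d0].
    have [z hz [_ fz e']] := ps_pred hy fy d0.
    have ez : z = x by apply: (ps_inj key_inj) => //; lia.
    by rewrite ez fx in fz.
  apply/idP/andP => [hp|[/eqP e d0]]; last first.
    have [z hz [hp fz e']] := ps_pred hy fy d0.
    by have <- // : z = x by apply: (ps_inj key_inj) => //; lia.
  have [c _] := pe_conn hx hy hp; have eh := conn_hd hx hy c.
  have ek : kx x = kx y by rewrite !kxE.
  have [d|d] := pe_dep hx hy hp; last first.
    by have := key_dep hy hx (esym ek) d; lia.
  by rewrite (ps_next hx hy (key_dep hx hy ek d)) eqxx d.
- rewrite /chk3; case h7: (all _ _) => //=; apply/has_iotaP; exists l.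
    move/negbT: h7; rewrite -has_predC => /has_iotaP [e he /=]; rewrite negbK => w7.
    have [y hy py] := onto_of_inj (@ps_lt n a g0 g1 g2 g3 g4 g5) (ps_inj key_inj) he.
    rewrite -py wl7 // in w7; case/andP: w7 => fy /eqP cy.
    have [h1 h2 h3 h4] := dep_fulB hy fy cy.
    by rewrite -h3 depE //; apply: gap_lt => //; [exact: hd_lt|exact: hd_conn].
  rewrite thl /=; apply/all_iotaP => e he; apply/implyP.
  have [y hy py] := onto_of_inj (@ps_lt n a g0 g1 g2 g3 g4 g5) (ps_inj key_inj) he.
  rewrite -py wl7 // => fy.
  have l0 : 0 < l by have := l2; lia.
  have lw d : 0 < d <= l -> wl (ps y - d) = if d == l then 2 else 1.
    move=> hd'; have [x hx [h1 h2 h3 h4 h5]] := fulB_prev hy fy hd'.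
    rewrite h1 addnK (wl_ps key_inj) // /Parsing.lett h4.
    have [_ dp] := dep_le hx h3.
    case: eqP => [dl|ndl].
      have ex : hd x = x.
        apply/esym; apply: conn_gap0 => //; [exact: hd_lt|exact: hd_conn|].
        by rewrite -depE // h4 dl subnn.
      by rewrite -ex h3 dl subnn.
    have c0 : cls x = 0.
      have [k1 k2 k3 k4] := cls_kd hx.
      have kd2 : kd x = 2.
        by case: ((connP hx (hd_lt hx)).1 (hd_conn hx)) => [->|[]//]; case: (A_depth (hd_lt hx) h3).
      have := cls_le a g0 g1 g2 g3 g4 g5 x.
      case e': (cls x) k1 k2 k3 k4 => [|[|[|[|[|k]]]]] // k1 k2 k3 k4 _; exfalso.
      + by have [//|_] := k1; lia.
      + by rewrite k2 in kd2.
      + by have [//|_] := k3; lia.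
      + by rewrite k4 in kd2.
    by rewrite c0 add0n; have -> : 0 < l - d by lia.
  apply/and3P; split.
  + by have [x hx [h1 _ _ _ _]] := @fulB_prev y l hy fy ltac:(lia); lia.
  + by rewrite lw ?eqxx //; lia.
  + apply/all_iotaP => d _; apply/implyP => hd'; rewrite lw; last by lia.
    by case/andP: hd' => _ h; rewrite (ltn_eqF h).
- apply/andP; split; apply/all_iotaP => x hx; apply/implyP.
    move/(wl_next7 hx) => il; have [fx cx] := isl_fulB hx il; have [h1 h2 h3] := il.
    have [y hy [c cy fy]] := fulA_end (hd_lt hx) h1 h2.
    have ehd : hd y = hd x by apply: hd_A => //; [exact: hd_lt|apply: conn_sym => //; exact: hd_lt].
    have cxy : conn x y by apply: conn_trans (hd_conn hx) c => //; exact: hd_lt.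
    have apeq z : z < n -> a x z = pe x z.
      by move=> hz; rewrite /Parsing.pe /core cx /= andbT.
    apply/eqP; apply: (sum_eq1 (y := y)) => //.
      rewrite wl7 // /fulB fy cy apeq //=; apply: dep_pe => //.
      by have [_ _ -> _] := dep_fulB hy fy cy; rewrite h3; have := l2; lia.
    move=> z hz /andP[]; rewrite wl7 // apeq // => /andP[fz /eqP cz] hp.
    have [c' _] := pe_conn hx hz hp.
    by apply: B_uniq => //; apply: conn_trans cxy => //; exact: conn_sym.
  rewrite wl7 // => fBx; have /andP[fx /eqP cx] := fBx.
  have [h1 h2 h3 h4] := dep_fulB hx fx cx.
  have l0 : 0 < l by have := l2; lia.
  have [z hz [cz pz dz]] := @dep_pred x hx ltac:(lia).
  have il := pe_fulB hz hx fBx pz.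
  apply/eqP; apply: (sum_eq1 (y := z)) => //.
    apply/andP; split; first exact/wl_next7.
    by move: pz; rewrite /Parsing.pe => /andP[].
  move=> y hy /andP[/(wl_next7 hy) ily ayx].
  have [fy cy] := isl_fulB hy ily.
  have pyx : pe y x by rewrite /Parsing.pe ayx /core cy.
  have [c _] := pe_conn hy hx pyx.
  apply: dep_inj => //; last by case: ily => _ _ ->; case: il => _ _ ->.
  by apply: conn_trans c _ => //; exact: conn_sym.
Qed.

End Complete.

(** * Existence of a good guess *)

Section Guess.
Variables (n : nat) (a : nat -> nat -> bool) (isV isA : pred nat) (pv pj : nat -> nat)
  (tl : nat -> nat -> bool).
Hypothesis a_out : forall x, a n x = false.
Hypothesis aV : forall x y, x < n -> y < n -> isV x -> a x y = isA y && (pv y <= pj x).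
Hypothesis aA : forall u y, u < n -> y < n -> isA u ->
  a u y = isV y && (pv u <= pj y) || tl u y.
Hypothesis tl_uniq : forall u y y', u < n -> y < n -> y' < n -> isA u ->
  tl u y -> tl u y' -> y = y'.
Hypothesis tl_V : forall u y, tl u y -> ~~ isV y.

(** An extreme vertex of each side sees all active vertices of the other. If the half graph has no
    edge, [n] serves for all three, since it is adjacent to nothing. *)
Lemma guess_side : exists g0 g1 g2, [/\ g0 <= n, g1 <= n, g2 <= n,
  forall x, x < n -> a g0 x = isA x && has (fun v => isV v && (pv x <= pj v)) (iota 0 n) &
  forall x, x < n -> a g1 x && (x != g2) =
    isV x && has (fun u => isA u && (pv u <= pj x)) (iota 0 n)].
Proof.
case: (boolP (has (fun v => isV v && has (fun u => isA u && (pv u <= pj v)) (iota 0 n))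
  (iota 0 n))) => [/has_iotaP [v0 hv0 /andP[V0 /has_iotaP [u0 hu0 /andP[A0 h0]]]]|/hasPn hn];
  last first.
  have none v u : v < n -> u < n -> isV v -> isA u -> (pv u <= pj v) = false.
    move=> hv hu Vv Au; apply/negP => h.
    have := hn v; rewrite mem_iota => /(_ hv); rewrite Vv => /hasPn /(_ u).
    by rewrite mem_iota => /(_ hu); rewrite Au h.
  exists n, n, n; split=> // x hx; rewrite a_out.
    case Ax: (isA x) => //=; apply/esym/negP => /has_iotaP [v hv /andP[Vv]].
    by rewrite (none v x).
  case Vx: (isV x) => //=; apply/esym/negP => /has_iotaP [u hu /andP[Au]].
  by rewrite (none x u).
pose K := \sum_(0 <= v < n) pj v.
have leK v : v < n -> pj v <= K.
  by move=> hv; rewrite /K big_mkord (bigD1 (Ordinal hv)) //= leq_addr.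
have [v [hv Vv vmax]] := iota_argmin (fun v => K - pj v) hv0 V0.
have {}vmax z : z < n -> isV z -> pj z <= pj v.
  by move=> hz Vz; have := vmax z hz Vz; have := leK z hz; have := leK v hv; lia.
have [u [hu Au umin]] := iota_argmin pv hu0 A0.
(* The next vertex on the wire of [u], or [n] if that vertex was deleted. *)
have [g2 [hg2 e2]] : exists g2, g2 <= n /\ forall y, y < n -> tl u y = (y == g2).
  case: (boolP (has (tl u) (iota 0 n))) => [/has_iotaP [z hz tz]|/hasPn hno].
    exists z; split; first exact: ltnW.
    move=> y hy; apply/idP/eqP => [ty|->//]; exact: tl_uniq ty tz.
  exists n; split=> // y hy; rewrite (negbTE (hno y _)) ?mem_iota //.
  by apply/esym/eqP; lia.
exists v, u, g2; split=> // [||x hx|x hx]; try exact: ltnW.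
  rewrite aV //; case Ax: (isA x) => //=; apply/idP/has_iotaP => [h|[z hz /andP[Vz h]]].
    by exists v => //; rewrite Vv h.
  exact: leq_trans h (vmax z hz Vz).
rewrite aA // e2 //; case: (eqVneq x g2) => [E|ne] /=.
  rewrite andbF; have /tl_V : tl u x by rewrite e2 // E.
  by case: (isV x).
rewrite orbF andbT; case Vx: (isV x) => //=; apply/idP/has_iotaP => [h|[z hz /andP[Az h]]].
  by exists u => //; rewrite Au h.
exact: leq_trans (umin z hz Az) h.
Qed.

End Guess.

Theorem guess_complete n l a kd p1 p2 p3 th : 1 < l -> th <= l ->
  (forall x y, x < n -> y < n -> a x y = labadj l kd p1 p2 p3 x y || labadj l kd p1 p2 p3 y x) ->
  (forall x, a n x = false) ->
  (forall x, x < n -> kd x = 2 -> p3 x <= l) ->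
  (forall x y, x < n -> y < n -> kd x = kd y -> p1 x = p1 y ->
    (kd x = 2 -> p2 x = p2 y /\ p3 x = p3 y) -> x = y) ->
  exists g0 g1 g2 g3 g4 g5, [/\ g0 <= n, g1 <= n & g2 <= n] /\
    [/\ g3 <= n, g4 <= n, g5 <= n & chk n a g0 g1 g2 g3 g4 g5 th].
Proof.
move=> l2 thl aE aout p3l inj.
pose tl d u y := [&& kd y == 2, p1 u == p1 y, p2 u == p2 y & p3 y == d].
have tlu d u y y' : u < n -> y < n -> y' < n -> tl d u y -> tl d u y' -> y = y'.
  move=> _ hy hy' /and4P[/eqP h1 /eqP h2 /eqP h3 /eqP h4] /and4P[/eqP k1 /eqP k2 /eqP k3 /eqP k4].
  by apply: inj => //; try congruence; split; congruence.
have [g0 [g1 [g2 [b0 b1 b2 hA hV]]]] := @guess_side n a (fun x => kd x == 0)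
  (fun x => (kd x == 2) && (p3 x == 0)) p1 p1 (tl 1) aout
  ltac:(by move=> x y hx hy /eqP h; rewrite aE // /labadj h /=; rewrite !andbF /= !orbF andbA)
  ltac:(by move=> u y hu hy /andP[/eqP h /eqP h']; rewrite aE // /labadj h h' /tl /= ;
     rewrite [p1 y == _]eq_sym [p2 y == _]eq_sym ; have := p3l y hy; case: (kd y) => [|[|[|k]]] //=; rewrite ?eqxx /= ?andbF ?orbF //= ?[0 == l]eq_sym ?(gtn_eqF (ltnW l2)) /= ?andbF ?orbF)
  ltac:(by move=> u y y' hu hy hy' _; exact: tlu)
  ltac:(by move=> u y /and4P[/eqP->]).
have [g3 [g4 [g5 [b3 b4 b5 hB hU]]]] := @guess_side n a (fun x => kd x == 1)
  (fun x => (kd x == 2) && (p3 x == l)) p2 p1 (tl l.-1) aout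
  ltac:(by move=> x y hx hy /eqP h; rewrite aE // /labadj h /=; rewrite !andbF /= !orbF andbA)
  ltac:(by move=> u y hu hy /andP[/eqP h /eqP h']; rewrite aE // /labadj h h' /tl /= ;
     rewrite [p1 y == _]eq_sym [p2 y == _]eq_sym ; have := p3l y hy; case: (kd y) => [|[|[|k]]] //=; rewrite ?eqxx /= ?andbF ?orbF //= ?(gtn_eqF (ltnW l2)) /= ?andbF ?orbF //; move=> /(_ erefl) hl; case: (p1 u == p1 y); case: (p2 u == p2 y) => //=; lia)
  ltac:(by move=> u y y' hu hy hy' _; exact: tlu)
  ltac:(by move=> u y /and4P[/eqP->]).
exists g0, g1, g2, g3, g4, g5; split=> //; split=> //.
apply: (@parse_complete n l a kd p1 p2 p3) => //.
- by move=> x hx; rewrite hA // /inA andbA.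
- by move=> x hx; rewrite hV // /inV; congr andb; apply: eq_has => u; rewrite andbA.
- by move=> x hx; rewrite hB // /inB andbA.
- by move=> x hx; rewrite hU // /inU; congr andb; apply: eq_has => u; rewrite andbA.
Qed.

(** * The model checking program *)

Definition eIf c p q := EAdd (eWhen c p) (eWhen (eNot c) q).

Lemma evIf env st c p q : ~~ vr 99 p -> ~~ vr 99 q ->
  ev env st (eIf c p q) = if tt env st c then ev env st p else ev env st q.
Proof.
by move=> hp hq; rewrite /eIf evAdd !evWhen // ttNot; case: tt; rewrite ?addn0.
Qed.

Lemma ev01_And env st a b : ev env st (eAnd a b) = tt env st (eAnd a b).
Proof. exact: ev01. Qed.
Lemma ev01_Or env st a b : ev env st (eOr a b) = tt env st (eOr a b).
Proof. exact: ev01. Qed.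
Lemma ev01_Lt env st a b : ev env st (eLt a b) = tt env st (eLt a b).
Proof. exact: ev01. Qed.
Lemma ev01_Le env st a b : ev env st (eLe a b) = tt env st (eLe a b).
Proof. exact: ev01. Qed.
Lemma ev01_Eq env st a b : ev env st (eEq a b) = tt env st (eEq a b).
Proof. exact: ev01. Qed.
Lemma ev01_Ex env st x b p : ev env st (eEx x b p) = tt env st (eEx x b p).
Proof. exact: ev01. Qed.
Lemma ev01_B env st a : ev env st (eB a) = tt env st (eB a).
Proof. exact: ev01. Qed.

Lemma exec_skip env st : exec env st SSkip = st.
Proof. by []. Qed.

Lemma exec_if env st c s s' : exec env st (SIf c s s') =
  if 0 < ev env st c then exec env st s else exec env st s'.
Proof. by []. Qed.

(** * Expressions for the tables of the parser *)

Definition eA x y := EGet 3 (EAdd (eMul (bc 2) (EVar x)) (EVar y)).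
Definition eD x y := EGet 9 (EAdd (eMul (bc 2) (EVar x)) (EVar y)).
Definition get1 T x := EGet T (EVar x).
Definition eIs k x := eEq (get1 22 x) (ECst k).
Definition eCore x y :=
  eOr (eAnd (eIs 1 x) (eIs 2 y)) (eOr (eAnd (eIs 2 x) (eIs 1 y))
  (eOr (eAnd (eIs 3 x) (eIs 4 y)) (eAnd (eIs 4 x) (eIs 3 y)))).
Definition ePe x y := eAnd (eA x y) (eNot (eCore x y)).
Definition eDbl e := EAdd e e.

Definition cls_e := eIf (eA 10 20) (ECst 1)
  (eIf (eAnd (eA 11 20) (eNot (eEq (EVar 20) (EVar 12)))) (ECst 2)
  (eIf (eA 13 20) (ECst 3)
  (eIf (eAnd (eA 14 20) (eNot (eEq (EVar 20) (EVar 15)))) (ECst 4) (ECst 0)))).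
Definition ds0_e := eEq (EVar 20) (EVar 21).
Definition ds_e := eIf (eD 20 21) (eD 20 21)
  (eWhen (eEx 22 (bc 1) (eAnd (eD 20 22) (ePe 22 21))) (EAdd (EVar 24) (ECst 2))).
Definition endv_e := eLe (ESum 21 (bc 1) (ePe 20 21)) (ECst 1).
Definition hk_e := EAdd (eIf (eIs 1 20) (ECst 0) (eIf (eIs 3 20) (bc 2) (eDbl (bc 2)))) (EVar 20).
Definition ish_e := eAnd (eD 20 21) (eAnd (get1 24 21)
  (eAll 22 (bc 1) (eOr (eNot (eAnd (eD 20 22) (get1 24 22))) (eLe (get1 25 21) (get1 25 22))))).
Definition hd_e := ESum 21 (bc 1) (eWhen ish_e (EVar 21)).
Definition dep_e := ESub (EGet 9 (EAdd (eMul (bc 2) (EVar 20)) (get1 11 20))) (ECst 1).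
Definition kap_e := eIf (eOr (eIs 1 20) (eIs 3 20))
  (eDbl (ESum 21 (bc 1) (eAnd (eEq (get1 22 21) (EAdd (get1 22 20) (ECst 1))) (eNot (eA 20 21)))))
  (EAdd (eDbl (ESum 21 (bc 1) (eAnd (eEq (get1 22 21) (get1 22 20))
     (eEx 22 (bc 1) (eAnd (eEq (EAdd (get1 22 22) (ECst 1)) (get1 22 20))
        (eAnd (eA 22 20) (eNot (eA 22 21)))))))) (ECst 1)).
Definition ful_e := eEx 21 (bc 1) (eAnd (eD 20 21)
  (eOr (eAnd (eIs 1 20) (eIs 3 21)) (eAnd (eIs 3 20) (eIs 1 21)))).
Definition blk_e := ESum 21 (bc 1) (eAnd (get1 14 21)
  (eAnd (eOr (eEq (get1 22 21) (get1 22 20)) (eEq (EAdd (get1 22 21) (ECst 1)) (get1 22 20)))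
   (eOr (eLt (get1 13 21) (get1 13 20))
        (eAnd (eEq (get1 13 21) (get1 13 20)) (eLt (EVar 21) (EVar 20)))))).
Definition pfx_e :=
  EAdd (eMul (bc 4) (EAdd (eMul (bc 4) (eIf (eIs 0 20) (bc 2) (get1 15 20)))
     (eIf (get1 14 20) (ESub (bc 4) (ECst 1)) (eIf (eIs 0 20) (ECst 0)
        (eIf (eLe (get1 22 20) (ECst 2)) (EAdd (get1 13 20) (ECst 1))
           (EAdd (EAdd (eDbl (bc 1)) (ECst 4)) (get1 13 20)))))))
  (eIf (get1 14 20) (ECst 0) (EVar 20)).
Definition key_e :=
  EAdd (eMul (bc 4) (EGet 23 (eIf (eAnd (get1 14 20) (eIs 3 20)) (EVar 20) (get1 11 20))))
  (get1 12 20).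
Definition ps_e := ESum 21 (bc 1) (eLt (get1 16 21) (get1 16 20)).
Definition wl_e := ESum 21 (bc 1) (eWhen (eEq (get1 17 21) (EVar 20))
  (EAdd (EAdd (get1 22 21) (get1 22 21)) (eB (get1 12 21)))).

Definition eW e := EGet 18 e.
Definition w7 e := eEq (eW e) (ECst 7).
Definition psx x := get1 17 x.
Definition psx1 x := EAdd (get1 17 x) (ECst 1).
Definition eImp p q := eOr (eNot p) q.
Definition spec_e := eOr (eAnd (w7 (psx1 20)) (w7 (psx 21))) (eAnd (w7 (psx1 21)) (w7 (psx 20))).
Definition pat_e := eOr (eAnd (eIs 1 20) (eIs 2 21)) (eOr (eAnd (eIs 3 20) (eIs 4 21))
  (eAnd (eEq (psx 21) (psx1 20)) (get1 12 21))).
Definition chk1_e := eAll 20 (bc 1) (eAll 21 (bc 1)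
  (eOr (eEq (EVar 20) (EVar 21)) (eNot (eEq (get1 16 20) (get1 16 21))))).
Definition eIff p q := eOr (eAnd p q) (eAnd (eNot p) (eNot q)).
Definition chk2_e := eAll 20 (bc 1) (eAll 21 (bc 1)
  (eImp (eAnd (eLt (psx 20) (psx 21)) (eNot spec_e)) (eIff (eA 20 21) pat_e))).
Definition chk3_e := eOr (eAll 20 (bc 1) (eNot (w7 (EVar 20))))
  (eEx 21 (bc 1) (eAnd (eLe (EGet 2 (ECst 3)) (EVar 21)) (eAll 20 (bc 1)
     (eImp (w7 (EVar 20)) (eAnd (eLe (EVar 21) (EVar 20))
        (eAnd (eEq (eW (ESub (EVar 20) (EVar 21))) (ECst 2))
          (eAll 22 (bc 1) (eImp (eAnd (eLt (ECst 0) (EVar 22)) (eLt (EVar 22) (EVar 21)))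
              (eEq (eW (ESub (EVar 20) (EVar 22))) (ECst 1))))))))))  .
Definition chk4_e := eAnd
  (eAll 20 (bc 1) (eImp (w7 (psx1 20))
     (eEq (ESum 21 (bc 1) (eAnd (w7 (psx 21)) (eA 20 21))) (ECst 1))))
  (eAll 20 (bc 1) (eImp (w7 (psx 20))
     (eEq (ESum 21 (bc 1) (eAnd (w7 (psx1 21)) (eA 21 20))) (ECst 1)))).
Definition chk_e := eAnd chk1_e (eAnd chk2_e (eAnd chk3_e chk4_e)).

Definition fill1 T k e := nest [:: 20] (bc k) (SSet T (EVar 20) e).
Definition fill2 T e := nest [:: 20; 21] (bc 2) (SSet T (ix2 2 20 21) e).

(** A round fills table 10 from table 9 and copies it back, because [nestP] forbids reading a table
    while it is filled. *)
Definition dist_s := SSeq (fill2 9 ds0_e)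
  (SFor 24 (bc 1) (SSeq (fill2 10 ds_e) (fill2 9 (EGet 10 (ix2 2 20 21))))).
Definition seqs := foldr SSeq SSkip.
Definition parse_s := seqs [:: fill1 22 1 cls_e; dist_s; fill1 24 1 endv_e; fill1 25 1 hk_e;
  fill1 11 1 hd_e; fill1 12 1 dep_e; fill1 13 1 kap_e; fill1 14 1 ful_e; fill1 15 1 blk_e;
  fill1 23 1 pfx_e; fill1 16 1 key_e; fill1 17 1 ps_e; fill1 18 2 wl_e;
  SSet 2 (ECst 2) chk_e].
(** Cell 2 of table 2 is the flag of success. Once it is set, the tables of the accepted guess are
    left alone. *)
Definition body_s := SIf (EGet 2 (ECst 2)) SSkip parse_s.
(** Each guess takes [n + 1] values; the last one, [n], stands for no vertex. *)
Definition search_s := nest [:: 10; 11; 12; 13; 14; 15] (bc 2) body_s.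

(* A list of facts on the contents of tables; the program writes each table only
   before any fact about it is recorded. *)
Fixpoint facts (st : store) (L : seq (nat * ((nat -> nat) -> Prop))) : Prop :=
  match L with [::] => True | (T, P) :: L => P (st T) /\ facts st L end.

Lemma facts_keep st st' T L : (forall T' j, T' != T -> st' T' j = st T' j) ->
  T \notin unzip1 L -> facts st L -> facts st' L.
Proof.
move=> k; elim: L => [|[T' P] L ih] //=; rewrite inE negb_or => /andP[h1 h2] [hP hL].
split; last exact: ih.
suff -> : st' T' = st T' by [].
by apply: functional_extensionality => j; rewrite k // eq_sym.
Qed.

Local Opaque eNot eB eAnd eOr eLt eLe eEq eEx eAll eMul eWhen eIf bc ix2.

(** * Correctness of the parser *)

Section Parse.
Variables (n : nat) (a : nat -> nat -> bool) (th : nat).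

(** Rows have length [n + 1] to admit the guess [n]. *)
Definition base : seq (nat * ((nat -> nat) -> Prop)) :=
  [:: (1, fun t => [/\ t 1 = n, t 2 = n.+1 & t 4 = kbase n]);
      (3, fun t => forall x y, x <= n -> y <= n -> t (n.+1 * x + y) = nat_of_bool (a x y))].

Lemma stage1 st env L T k b e f :
  facts st L -> st 1 k = b -> T != 1 -> T \notin unzip1 L -> ~~ rd T e ->
  (forall v, v < b -> ev (upd env 20 v) st e = f v) ->
  facts (exec env st (fill1 T k e)) ((T, fun t => forall v, v < b -> t v = f v) :: L).
Proof.
move=> hL hb T1 TL re h; have [k1 k2] := @fill1P T k e env st T1 re 20.
rewrite hb in k2; split; last exact: facts_keep k1 TL hL.
by move=> v hv; rewrite k2 // h.
Qed.

Variable env : nat -> nat.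
Notation g0 := (env 10). Notation g1 := (env 11). Notation g2 := (env 12).
Notation g3 := (env 13). Notation g4 := (env 14). Notation g5 := (env 15).
Hypothesis gn : [/\ g0 <= n, g1 <= n, g3 <= n & g4 <= n].
Notation "f *1" := (f n a g0 g1 g2 g3 g4 g5) (at level 2).
Notation cls' := (cls a g0 g1 g2 g3 g4 g5).

Lemma ttA env' st x y : facts st base -> x != 99 -> env' x <= n -> env' y <= n ->
  tt env' st (eA x y) = a (env' x) (env' y).
Proof.
move=> [[_ h2 _] [h3 _]] hx h h'.
rewrite /tt /eA ; rewrite evGet evAdd evMulE; last by rewrite /= eq_sym.
by rewrite evbc h2 !evVar h3 //; case: (a _ _).
Qed.

Definition tb1 T (f : nat -> nat) : nat * ((nat -> nat) -> Prop) :=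
  (T, fun t => forall v, v < n -> t v = f v).
Definition tb2 T (f : nat -> nat -> nat) : nat * ((nat -> nat) -> Prop) :=
  (T, fun t => forall v w, v < n -> w < n -> t (n.+1 * v + w) = f v w).

Lemma ttIs env' st k x : facts st [:: tb1 22 cls'] -> env' x < n ->
  tt env' st (eIs k x) = (cls' (env' x) == k).
Proof. by move=> /= [h _] hx; rewrite /eIs ttEq evGet evVar h. Qed.

Lemma ttPe env' st x y : facts st base -> facts st [:: tb1 22 cls'] -> x != 99 ->
  env' x < n -> env' y < n ->
  tt env' st (ePe x y) = pe a g0 g1 g2 g3 g4 g5 (env' x) (env' y).
Proof.
move=> hb hc x99 hx hy.
rewrite /ePe /pe ttAnd ttA ?(ltnW hx) ?(ltnW hy) // ttNot /core; congr (_ && ~~ _).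
by rewrite /eCore !(ttOr, ttAnd) !ttIs.
Qed.

Lemma evD f env' st x y : facts st base -> facts st [:: tb2 9 f] -> x != 99 ->
  env' x < n -> env' y < n -> ev env' st (eD x y) = f (env' x) (env' y).
Proof.
move=> [[_ h2 _] [h3 _]] [h9 _] x99 hx hy.
rewrite /eD evGet evAdd evMulE; last by rewrite /= eq_sym.
by rewrite evbc h2 !evVar h9.
Qed.

Lemma cls_eP st v : facts st base -> v < n -> ev (upd env 20 v) st cls_e = cls' v.
Proof.
move=> hb hv; have [h0 h1 h3 h4] := gn; have hv' := ltnW hv.
rewrite /cls_e /cls !evIf; try by vm_compute.
by rewrite !(ttAnd, ttNot, ttEq) !ttA.
Qed.

Notation cl := (tb1 22 cls').
Notation dst := (dist *1).
Notation endv' := (endv *1).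
Notation hk' := (hk *1).
Notation hd' := (hd *1).
Notation dep' := (dep *1).
Notation kap' := (kap *1).
Notation ful' := (ful *1).
Notation blk' := (blk *1).
Notation pfx' := (pfx *1).
Notation key' := (key *1).
Notation ps' := (ps *1).
Notation wl' := (wl *1).

Ltac ub := rewrite /upd /=.

Lemma stage2 st env' T e f L : facts st base -> facts st L -> T != 1 -> T \notin unzip1 L ->
  ~~ rd T e ->
  (forall v w, v < n -> w < n -> ev (upd (upd env' 20 v) 21 w) st e = f v w) ->
  facts (exec env' st (fill2 T e)) (tb2 T f :: L).
Proof.
move=> [[_ h2 _] _] hL T1 TL re h.
have [k1 k2] := @fill2P T 2 e env' st T1 re 20 21 isT isT.
split; last exact: facts_keep k1 TL hL.
by move=> v w hv hw; rewrite h2 in k2; rewrite k2 ?h //; exact: ltnW.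
Qed.

Lemma ds_eP st t v w : facts st base -> facts st [:: cl] ->
  facts st [:: tb2 9 (ds *1 t)] -> v < n -> w < n ->
  ev (upd (upd (upd env 24 t) 20 v) 21 w) st ds_e = ds *1 t.+1 v w.
Proof.
move=> hb hc hd hv hw; have [[b1 b2 _] _] := hb.
rewrite /ds_e evIf; try by vm_compute.
rewrite /tt !(evD hb hd) // evWhen; last by vm_compute.
rewrite [ds *1 t.+1 v w]/=; ub; case: ifP => // _.
rewrite ttEx evbc b1.
have E : {in iota 0 n, (fun z => tt (upd (upd (upd (upd env 24 t) 20 v) 21 w) 22 z) st
    (eAnd (eD 20 22) (ePe 22 21))) =1 fun z => (0 < ds *1 t v z) && pe a g0 g1 g2 g3 g4 g5 z w}.
  move=> z; rewrite mem_iota => /= hz.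
  by rewrite ttAnd ttPe // {1}/tt (evD hb hd).
rewrite (eq_in_has E); ub.
by case: ifP => // _; rewrite addn2.
Qed.

Lemma ix2_ev env' st x y : facts st base -> x != 99 ->
  ev env' st (ix2 2 x y) = n.+1 * env' x + env' y.
Proof.
move=> [[_ h _] _] hx.
Local Transparent ix2.
rewrite /ix2 evAdd evMulE; last by rewrite /= eq_sym.
by rewrite evbc h !evVar.
Qed.
Local Opaque ix2.

Lemma dist_sP st L : facts st (cl :: base ++ L) ->
  all (fun T => T \notin unzip1 (cl :: base ++ L)) [:: 9; 10] ->
  facts (exec env st dist_s) (tb2 9 dst :: cl :: base ++ L).
Proof.
set L' := base ++ L.
have sub st' : facts st' (cl :: L') -> facts st' base /\ facts st' [:: cl].
  by move=> [h1 [h2 [h3 _]]].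
move=> hL /and3P[h9 h10 _]; rewrite /dist_s exec_seq.
have [hb hc] := sub _ hL.
have f0 : facts (exec env st (fill2 9 ds0_e)) (tb2 9 (ds *1 0) :: cl :: L').
  apply: stage2 => // v w hv hw.
  by rewrite ev01_Eq ttEq !evVar.
set st1 := exec env st _ in f0 *.
have e1 : ev env st1 (bc 1) = n by case: f0 => _ [_ [[h _ _] _]]; rewrite evbc.
pose Q t st' := facts st' (tb2 9 (ds *1 t) :: cl :: L').
suff : Q (ev env st1 (bc 1)) (exec env st1 (SFor 24 (bc 1)
  (SSeq (fill2 10 ds_e) (fill2 9 (EGet 10 (ix2 2 20 21)))))) by rewrite e1.
apply: for_ind => // t st2 ht F.
rewrite exec_seq; have [F9 Fr] := F; have [hb2 hc2] := sub _ Fr.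
have F' : facts (exec (upd env 24 t) st2 (fill2 10 ds_e)) (tb2 10 (ds *1 t.+1) :: cl :: L').
  by apply: stage2 => // v w hv hw; exact: ds_eP.
have [F10 Fr'] := F'; have [hb3 hc3] := sub _ Fr'.
apply: stage2 => // v w hv hw.
by rewrite evGet ix2_ev // F10.
Qed.

Lemma endv_eP st v : facts st base -> facts st [:: cl] -> v < n ->
  ev (upd env 20 v) st endv_e = endv' v.
Proof.
move=> hb hc hv; have [[b1 b2 _] _] := hb.
rewrite /endv_e ev01_Le ttLe evSum evbc b1 evCst /endv; congr (nat_of_bool (_ <= _)).
rewrite !big_mkord; apply: eq_bigr => w _; rewrite ev01_And ttPe //; exact: ltn_ord.
Qed.

Lemma hk_eP st v : facts st base -> facts st [:: cl] -> v < n ->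
  ev (upd env 20 v) st hk_e = hk' v.
Proof.
move=> hb hc hv; have [[b1 b2 _] _] := hb.
rewrite /hk_e evAdd !evIf; try by vm_compute.
rewrite !ttIs // /eDbl !evAdd evbc b2 /hk; ub.
by case: ifP => // _; case: ifP => // _; rewrite ?mul1n ?mul2n -?addnn.
Qed.

Lemma hk_inj y z : y < n -> z < n -> hk' y = hk' z -> y = z.
Proof.
move=> hy hz; rewrite /hk; set p := (if _ then _ else _); set q := (if _ then _ else _) => e.
have E : (p * n.+1 + y) %% n.+1 = (q * n.+1 + z) %% n.+1 by rewrite e.
by move: E; rewrite !modnMDl !modn_small // ltnW.
Qed.

(** Holds for bad guesses too: heads are unique because [hk] is injective, and without a head the
    sum is 0. It ensures that tables are read inside their range. *)
Lemma hd_bound x : x < n -> hd' x < n.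
Proof.
move=> hx; rewrite /hd; case: (boolP (has (ish *1 x) (iota 0 n))) => [/has_iotaP [y hy iy]|no].
  rewrite (@sum_nat_one _ (fun z => z) (ish *1 x) y) // => z hz iz.
  case/and3P: iy => d1 e1 /all_iotaP h1; case/and3P: iz => d2 e2 /all_iotaP h2.
  apply: hk_inj => //; apply/eqP; rewrite eqn_leq.
  by have := h1 z hz; have := h2 y hy; rewrite d1 e1 d2 e2 /= => -> ->.
rewrite big_mkord big1 ?(leq_ltn_trans _ hx) // => i _.
by rewrite ifF //; apply: contraNF no => h; apply/has_iotaP; exists (val i); [exact: ltn_ord|exact: h].
Qed.

Lemma hd_eP st v : facts st base -> facts st [:: tb2 9 dst] ->
  facts st [:: tb1 24 (fun y => endv' y)] -> facts st [:: tb1 25 hk'] -> v < n ->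
  ev (upd env 20 v) st hd_e = hd' v.
Proof.
move=> hb hD [he _] [hh _] hv; have [[b1 b2 _] _] := hb.
rewrite /hd_e evSum evbc b1 /hd !big_mkord; apply: eq_bigr => -[y hy] _ /=.
rewrite evWhen; last by vm_compute.
suff -> : tt (upd (upd env 20 v) 21 y) st ish_e = ish *1 v y by [].
rewrite /ish_e !ttAnd ttAll evbc b1 /ish {1}/tt (evD hb hD) //.
have te env' x : env' x < n -> tt env' st (get1 24 x) = endv' (env' x).
  by move=> h; rewrite /tt /get1 evGet evVar he //; case: endv.
rewrite te //; congr [&& _, _ & _]; apply: eq_in_all => z; rewrite mem_iota /= => hz.
rewrite ttOr ttNot ttAnd {1}/tt (evD hb hD) // te // ttLe !evGet !evVar; ub.
by rewrite !hh // implybE.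
Qed.

Lemma dep_eP st v : facts st base -> facts st [:: tb2 9 dst] -> facts st [:: tb1 11 hd'] ->
  v < n -> ev (upd env 20 v) st dep_e = dep' v.
Proof.
move=> hb [hd _] [hh _] hv; have [[b1 b2 _] _] := hb.
rewrite /dep_e evSub evGet evAdd evMulE; last by vm_compute.
rewrite evbc b2 evGet !evVar; ub.
by rewrite hh // hd //; exact: hd_bound.
Qed.

Lemma kap_eP st v : facts st base -> facts st [:: cl] -> v < n ->
  ev (upd env 20 v) st kap_e = kap' v.
Proof.
move=> hb hc hv; have [[b1 b2 _] _] := hb; have [hc' _] := hc.
have E1 : ev (upd env 20 v) st (ESum 21 (bc 1)
     (eAnd (eEq (get1 22 21) (EAdd (get1 22 20) (ECst 1))) (eNot (eA 20 21)))) =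
     \sum_(0 <= i < n) ((cls' i == (cls' v).+1) && ~~ a v i).
  rewrite evSum evbc b1 !big_mkord; apply: eq_bigr => i _; have hi := ltn_ord i.
  rewrite ev01_And ttAnd (ttNot _ _ (eA _ _)) ttA ?(ltnW hi) ?(ltnW hv) //.
  by rewrite ttEq evAdd !evGet !evVar; ub; rewrite !hc' // addn1.
have E2 : ev (upd env 20 v) st (ESum 21 (bc 1) (eAnd (eEq (get1 22 21) (get1 22 20))
     (eEx 22 (bc 1) (eAnd (eEq (EAdd (get1 22 22) (ECst 1)) (get1 22 20))
        (eAnd (eA 22 20) (eNot (eA 22 21))))))) = \sum_(0 <= i < n) ((cls' i == cls' v) &&
          has (fun u => [&& (cls' u).+1 == cls' v, a u v & ~~ a u i]) (iota 0 n)).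
  rewrite evSum evbc b1 !big_mkord; apply: eq_bigr => i _; have hi := ltn_ord i.
  rewrite ev01_And ttAnd ttEq !evGet !evVar ttEx evbc b1.
  rewrite upd_same {1}/upd /= upd_same !hc' //.
  congr (nat_of_bool (_ && _)); apply: eq_in_has => u; rewrite mem_iota /= => hu.
  rewrite !ttAnd (ttNot _ _ (eA _ _)) !ttA ?(ltnW hi) ?(ltnW hv) ?(ltnW hu) //.
  by rewrite ttEq evAdd !evGet !evVar; ub; rewrite !hc' // addn1.
rewrite /kap_e evIf; try by vm_compute.
rewrite ttOr !ttIs ?upd_same // /kap /eDbl !evAdd E1 E2 evCst.
by case: ifP => _; rewrite ?addn1 mul2n -addnn.
Qed.

Lemma ful_eP st v : facts st base -> facts st [:: cl] -> facts st [:: tb2 9 dst] -> v < n ->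
  ev (upd env 20 v) st ful_e = ful' v.
Proof.
move=> hb hc hd hv; have [[b1 b2 _] _] := hb.
rewrite /ful_e ev01_Ex ttEx evbc b1 /ful; congr nat_of_bool; apply: eq_in_has => u.
rewrite mem_iota /= => hu; rewrite ttAnd {1}/tt (evD hb hd) //.
by rewrite !(ttOr, ttAnd) !ttIs.
Qed.

Lemma blk_eP st v : facts st base -> facts st [:: cl] -> facts st [:: tb1 13 kap'] ->
  facts st [:: tb1 14 (fun y => ful' y)] -> v < n ->
  ev (upd env 20 v) st blk_e = blk' v.
Proof.
move=> hb [hc _] [hk _] [hf _] hv; have [[b1 b2 _] _] := hb.
rewrite /blk_e evSum evbc b1 /blk !big_mkord; apply: eq_bigr => -[y hy] _ /=.
rewrite ev01_And !(ttAnd, ttOr) /ltk !(ttEq, ttLt) {1}/tt /get1 !(evGet, evAdd) !evVar evCst; ub.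
by rewrite !hc // !hk // hf // addn1; case: ful.
Qed.

Lemma pfx_eP st v : facts st base -> facts st [:: cl] -> facts st [:: tb1 13 kap'] ->
  facts st [:: tb1 14 (fun y => ful' y)] -> facts st [:: tb1 15 blk'] -> v < n ->
  ev (upd env 20 v) st pfx_e = pfx' v.
Proof.
move=> hb hc [hk _] [hf _] [hbk _] hv; have [[b1 b2 b4] _] := hb.
rewrite /pfx_e evAdd !evMulE; try by vm_compute.
rewrite evAdd !evMulE; try by vm_compute.
rewrite !evIf; try by vm_compute.
rewrite /eDbl !(ttIs _ hc) // ttLe !(evAdd, evSub) !evbc b1 b2 b4 {1 2}/tt /get1 !evGet !evVar !evCst; ub.
case: hc => hc _; rewrite hbk // hk // hc // hf // /pfx.
by case: ful => /=; case: (_ == 0) => //=; rewrite addn1 mul2n -addnn.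
Qed.

Lemma key_eP st v : facts st base -> facts st [:: cl] -> facts st [:: tb1 14 (fun y => ful' y)] ->
  facts st [:: tb1 11 hd'] -> facts st [:: tb1 12 dep'] -> facts st [:: tb1 23 pfx'] -> v < n ->
  ev (upd env 20 v) st key_e = key' v.
Proof.
move=> hb hc [hf _] [hh _] [hd _] [hp _] hv; have [[b1 b2 b4] _] := hb.
rewrite /key_e evAdd evMulE; last by vm_compute.
rewrite evGet evIf; try by vm_compute.
rewrite evbc b4 ttAnd ttIs // {1}/tt /get1 !evGet !evVar; ub.
rewrite hf // hh // hd // /key.
have -> : (0 < ful' v) = ful' v by case: ful.
by case: ifP => _; rewrite hp //; exact: hd_bound.
Qed.

Lemma ps_eP st v : facts st base -> facts st [:: tb1 16 key'] -> v < n ->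
  ev (upd env 20 v) st ps_e = ps' v.
Proof.
move=> hb [hk _] hv; have [[b1 b2 b4] _] := hb.
rewrite /ps_e evSum evbc b1 /ps !big_mkord; apply: eq_bigr => -[y hy] _ /=.
by rewrite ev01_Lt ttLt !evGet !evVar; ub; rewrite !hk.
Qed.

Lemma wl_eP st v : facts st base -> facts st [:: cl] -> facts st [:: tb1 12 dep'] ->
  facts st [:: tb1 17 ps'] -> ev (upd env 20 v) st wl_e = wl' v.
Proof.
move=> hb [hc _] [hd _] [hp _]; have [[b1 b2 b4] _] := hb.
rewrite /wl_e evSum evbc b1 /wl !big_mkord; apply: eq_bigr => -[y hy] _ /=.
rewrite evWhen; last by vm_compute.
rewrite ttEq !evAdd ev01_B ttB {1}/tt /get1 !evGet !evVar; ub.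
by rewrite hp // hc // hd.
Qed.

Lemma chk_eP st : facts st base -> facts st [:: cl] -> facts st [:: tb1 12 dep'] ->
  facts st [:: tb1 16 key'] -> facts st [:: tb1 17 ps'] ->
  facts st [:: (18, fun t => forall v, v < n.+1 -> t v = wl' v)] -> st 2 3 = th ->
  ev env st chk_e = chk *1 th.
Proof.
move=> hb hc [hd _] [hk _] [hp _] [hw _] hth; have [[b1 b2 b4] _] := hb.
have psn := @ps_lt n a g0 g1 g2 g3 g4 g5.
rewrite /chk_e ev01_And !ttAnd; congr nat_of_bool.
have ps1 env' x : env' x < n -> tt env' st (w7 (psx1 x)) = (wl' (ps' (env' x)).+1 == 7).
  move=> h; rewrite /w7 ttEq !(evGet, evAdd) evVar hp // addn1 hw // ltnS; exact: psn.
have ps0 env' x : env' x < n -> tt env' st (w7 (psx x)) = (wl' (ps' (env' x)) == 7).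
  move=> h; rewrite /w7 ttEq !evGet evVar hp // hw // ltnS ltnW //; exact: psn.
have wv env' x : env' x < n -> tt env' st (w7 (EVar x)) = (wl' (env' x) == 7).
  by move=> h; rewrite /w7 ttEq !evGet evVar hw // ltnS ltnW.
congr [&& _, _, _ & _].
- rewrite ttAll evbc b1; apply: eq_in_all => x; rewrite mem_iota /= => hx.
  rewrite ttAll evbc b1; apply: eq_in_all => y; rewrite mem_iota /= => hy.
  by rewrite ttOr ttNot !ttEq !evGet !evVar; ub; rewrite !hk.
- rewrite ttAll evbc b1; apply: eq_in_all => x; rewrite mem_iota /= => hx.
  rewrite ttAll evbc b1; apply: eq_in_all => y; rewrite mem_iota /= => hy.
  set e := upd _ _ _.
  have hs : tt e st spec_e = spec *1 x y.
    by rewrite /spec_e ttOr !ttAnd !ps1 // !ps0.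
  have ht : tt e st pat_e = pat *1 x y.
    rewrite /pat_e !ttOr !ttAnd !ttIs // ttEq /tt !(evGet, evAdd) !evVar evCst /e; ub.
    by rewrite !hp // hd // addn1.
  rewrite /eImp /eIff (ttOr _ _ (eNot (eAnd _ _))) (ttOr _ _ (eAnd _ _)) !ttAnd (ttNot _ _ (eA _ _)) (ttNot _ _ pat_e) (ttNot _ _ (eAnd _ _)).
  rewrite ttAnd (ttNot _ _ spec_e) hs ht ttLt ttA ?(ltnW hx) ?(ltnW hy) //.
  rewrite !evGet !evVar implybE /e; ub; rewrite !hp //.
  by case: (a x y); case: (pat *1 x y).
- rewrite ttOr ttAll ttEx !evbc b1; congr (_ || _).
    by apply: eq_in_all => x; rewrite mem_iota /= => hx; rewrite ttNot wv.
  apply: eq_in_has => l; rewrite mem_iota /= => hl.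
  rewrite ttAnd ttLe evGet evCst hth evVar ttAll evbc b1; congr (_ && _).
  apply: eq_in_all => e; rewrite mem_iota /= => he.
  rewrite /eImp ttOr ttNot wv // !ttAnd ttLe ttAll ttEq evbc b1 !evGet evSub !evVar evCst; ub.
  rewrite hw ?implybE; last by rewrite ltnS; apply: leq_trans (leq_subr _ _) (ltnW he).
  congr (_ || [&& _, _ & _]); apply: eq_in_all => d; rewrite mem_iota /= => hd'.
  rewrite ttOr ttNot ttAnd !ttLt ttEq !evGet evSub !evVar !evCst; ub.
  by rewrite hw ?implybE // ltnS; apply: leq_trans (leq_subr _ _) (ltnW he).
- congr (_ && _).
    rewrite ttAll evbc b1; apply: eq_in_all => x; rewrite mem_iota /= => hx.
    rewrite /eImp ttOr ttNot ps1 // ttEq evSum evbc b1 evCst implybE.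
    congr (_ || (_ == _)); rewrite !big_mkord; apply: eq_bigr => -[y hy] _ /=.
    by rewrite ev01_And ttAnd ps0 // ttA ?(ltnW hx) ?(ltnW hy).
  rewrite ttAll evbc b1; apply: eq_in_all => x; rewrite mem_iota /= => hx.
  rewrite /eImp ttOr ttNot ps0 // ttEq evSum evbc b1 evCst implybE.
  congr (_ || (_ == _)); rewrite !big_mkord; apply: eq_bigr => -[y hy] _ /=.
  by rewrite ev01_And ttAnd ps1 // ttA ?(ltnW hx) ?(ltnW hy).
Qed.

(** The tables are recorded in the order of their dependence, and a fact is dropped when nothing
    later refers to it. *)
Lemma parse_sP st : facts st base -> st 2 3 = th ->
  let st' := exec env st parse_s in
  [/\ facts st' (base ++ [:: (0, fun t => forall j, t j = st 0 j)]),
      st' 2 2 = chk *1 th, (forall j, j != 2 -> st' 2 j = st 2 j) &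
      forall p, p <= n -> st' 18 p = wl' p].
Proof.
move=> hb hth.
pose L0 := base ++ [:: (0, fun t => forall j, t j = st 0 j); (2, fun t : nat -> nat => forall j, t j = st 2 j)].
have F0 : facts st L0 by case: hb => h1 [h2 _]; split=> //; split.
have bs st' : facts st' L0 -> facts st' base by move=> /= [h1 [h2 _]].
have n1 st' : facts st' L0 -> st' 1 1 = n by move=> /= [[]].
have F1 : facts (exec env st (fill1 22 1 cls_e)) (cl :: L0).
  apply: stage1 => //; [apply: n1; exact: F0|by move=> v hv; exact: cls_eP].
set st1 := exec env st _ in F1.
have F2 := @dist_sP st1 [:: (0, fun t => forall j, t j = st 0 j); (2, fun t : nat -> nat => forall j, t j = st 2 j)] F1 isT.
rewrite -/L0 in F2; set st2 := exec env st1 _ in F2.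
have F3 : facts (exec env st2 (fill1 24 1 endv_e)) (tb1 24 (fun y => endv' y) :: tb2 9 dst :: cl :: L0).
  have [d9 [c22 r]] := F2.
  apply: stage1 => //; [apply: n1; exact: r|move=> v hv; apply: endv_eP => //; apply: bs; exact: r].
set st3 := exec env st2 _ in F3.
have F4 : facts (exec env st3 (fill1 25 1 hk_e))
    (tb1 25 hk' :: tb1 24 (fun y => endv' y) :: tb2 9 dst :: cl :: L0).
  have [e24 [d9 [c22 r]]] := F3.
  apply: stage1 => //; [apply: n1; exact: r|move=> v hv; apply: hk_eP => //; apply: bs; exact: r].
set st4 := exec env st3 _ in F4.
have F5 : facts (exec env st4 (fill1 11 1 hd_e)) (tb1 11 hd' :: tb2 9 dst :: cl :: L0).
  have [h25 [e24 [d9 [c22 r]]]] := F4.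
  apply: stage1 => //; [apply: n1; exact: r|move=> v hv; apply: hd_eP => //; apply: bs; exact: r].
set st5 := exec env st4 _ in F5.
have F6 : facts (exec env st5 (fill1 12 1 dep_e)) (tb1 12 dep' :: tb1 11 hd' :: tb2 9 dst :: cl :: L0).
  have [h11 [d9 [c22 r]]] := F5.
  apply: stage1 => //; [apply: n1; exact: r|move=> v hv; apply: dep_eP => //; apply: bs; exact: r].
set st6 := exec env st5 _ in F6.
have F7 : facts (exec env st6 (fill1 13 1 kap_e))
   (tb1 13 kap' :: tb1 12 dep' :: tb1 11 hd' :: tb2 9 dst :: cl :: L0).
  have [h12 [h11 [d9 [c22 r]]]] := F6.
  apply: stage1 => //; [apply: n1; exact: r|move=> v hv; apply: kap_eP => //; apply: bs; exact: r].
set st7 := exec env st6 _ in F7.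
have F8 : facts (exec env st7 (fill1 14 1 ful_e)) (tb1 14 (fun y => ful' y) ::
   tb1 13 kap' :: tb1 12 dep' :: tb1 11 hd' :: cl :: L0).
  have [h13 [h12 [h11 [d9 [c22 r]]]]] := F7.
  apply: stage1 => //; [apply: n1; exact: r|move=> v hv; apply: ful_eP => //; apply: bs; exact: r].
set st8 := exec env st7 _ in F8.
have F9 : facts (exec env st8 (fill1 15 1 blk_e)) (tb1 15 blk' :: tb1 14 (fun y => ful' y) ::
   tb1 13 kap' :: tb1 12 dep' :: tb1 11 hd' :: cl :: L0).
  have [h14 [h13 [h12 [h11 [c22 r]]]]] := F8.
  apply: stage1 => //; [apply: n1; exact: r|move=> v hv; apply: blk_eP => //; apply: bs; exact: r].
set st9 := exec env st8 _ in F9.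
have F10 : facts (exec env st9 (fill1 23 1 pfx_e)) (tb1 23 pfx' :: tb1 14 (fun y => ful' y) ::
   tb1 12 dep' :: tb1 11 hd' :: cl :: L0).
  have [h15 [h14 [h13 [h12 [h11 [c22 r]]]]]] := F9.
  apply: stage1 => //; [apply: n1; exact: r|move=> v hv; apply: pfx_eP => //; apply: bs; exact: r].
set st10 := exec env st9 _ in F10.
have F11 : facts (exec env st10 (fill1 16 1 key_e)) (tb1 16 key' :: tb1 12 dep' :: cl :: L0).
  have [h23 [h14 [h12 [h11 [c22 r]]]]] := F10.
  apply: stage1 => //; [apply: n1; exact: r|move=> v hv; apply: key_eP => //; apply: bs; exact: r].
set st11 := exec env st10 _ in F11.
have F12 : facts (exec env st11 (fill1 17 1 ps_e))
   (tb1 17 ps' :: tb1 16 key' :: tb1 12 dep' :: cl :: L0).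
  have [h16 [h12 [c22 r]]] := F11.
  apply: stage1 => //; [apply: n1; exact: r|move=> v hv; apply: ps_eP => //; apply: bs; exact: r].
set st12 := exec env st11 _ in F12.
have F13 : facts (exec env st12 (fill1 18 2 wl_e))
   ((18, fun t => forall v, v < n.+1 -> t v = wl' v) :: tb1 17 ps' :: tb1 16 key' ::
    tb1 12 dep' :: cl :: L0).
  have [h17 [h16 [h12 [c22 r]]]] := F12.
  apply: stage1 => //; [by case: r => -[]|move=> v hv; apply: wl_eP => //; apply: bs; exact: r].
set st13 := exec env st12 _ in F13.
have [h18 [h17 [h16 [h12 [c22 r]]]]] := F13.
have [s1 [s3 [s0 [s2 _]]]] := r.
have ce : ev env st13 chk_e = chk *1 th.
  by apply: chk_eP; [apply: bs; exact: r|split|split|split|split|split|rewrite s2].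
have -> : exec env st parse_s = exec env st13 (SSet 2 (ECst 2) chk_e).
  rewrite /parse_s /seqs; cbn [foldr].
  rewrite exec_seq -/st1 exec_seq -/st2 exec_seq -/st3 exec_seq -/st4 exec_seq -/st5.
  rewrite exec_seq -/st6 exec_seq -/st7 exec_seq -/st8 exec_seq -/st9 exec_seq -/st10.
  by rewrite exec_seq -/st11 exec_seq -/st12 exec_seq -/st13 exec_seq exec_skip.
rewrite exec_set ce.
split=> //.
- by move=> j hj; rewrite /setst /= (negbTE hj) s2.
Qed.

End Parse.

Local Opaque parse_s.

(** * Exhaustive search over the guesses *)

Section Search.
Variables (I : store -> Prop) (F : (nat -> nat) -> bool) (R : (nat -> nat) -> store -> Prop).
Variables (S : nat) (body : stm).
Hypothesis IS : forall st, I st -> st 1 2 = S.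

Definition found env xs st' : Prop :=
  exists2 vs, below S (size xs) vs & F (updl env xs vs) /\ R (updl env xs vs) st'.
(** Three outcomes: the flag was set before and the store is unchanged; some tuple satisfies [F] and
    [R] describes the store it left; or all tuples fail. *)
Definition search_spec env xs st st' : Prop :=
  [/\ I st', st 2 2 != 0 -> st' = st &
      st 2 2 = 0 -> (st' 2 2 = 1 /\ found env xs st') \/
        (st' 2 2 = 0 /\ forall vs, below S (size xs) vs -> ~~ F (updl env xs vs))].

Lemma nest_search (P : (nat -> nat) -> Prop) :
  (forall env st, P env -> I st -> search_spec env [::] st (exec env st body)) ->
  forall xs env st, (forall vs, below S (size xs) vs -> P (updl env xs vs)) -> I st ->
  search_spec env xs st (exec env st (nest xs (bc 2) body)).
Proof.
move=> hb; elim => [|x xs ih] env st hP hI; first by apply: hb => //; exact: (hP [::]).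
have eb : ev env st (bc 2) = S by rewrite evbc IS.
pose Q m st' := [/\ I st', st 2 2 != 0 -> st' = st &
      st 2 2 = 0 -> (st' 2 2 = 1 /\ found env (x :: xs) st') \/
        (st' 2 2 = 0 /\ forall v vs, v < m -> below S (size xs) vs ->
           ~~ F (updl (upd env x v) xs vs))].
have [q1 q2 q3] : Q (ev env st (bc 2)) (exec env st (SFor x (bc 2) (nest xs (bc 2) body))).
  apply: for_ind; first by split=> // ->; right.
  move=> v st' hv [i1 i2 i3]; rewrite eb in hv.
  have [|j1 j2 j3] := ih (upd env x v) st' _ i1.
    by move=> vs [h1 h2]; apply: (hP (v :: vs)); split; rewrite /= ?h1 ?hv.
  split=> //; first by move=> h; rewrite j2 i2.
  move=> h; case: (i3 h) => [[d f]|[d f]].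
    by left; rewrite j2 ?d.
  case: (j3 d) => [[d' [vs [b1 b2] f']]|[d' f']].
    by left; split=> //; exists (v :: vs) => //; split; rewrite /= ?b1 ?hv.
  right; split=> // v' vs; rewrite ltnS leq_eqVlt => /orP[/eqP ->|hv'] hvs; first exact: f'.
  exact: f.
split=> // /q3 [h|[d h]]; [by left|right; split=> // -[|v vs] [] //= [hs] /andP[hv hvs]].
by apply: h; rewrite ?eb.
Qed.
End Search.

Theorem searchP n a th env st : facts st (base n a) -> st 2 3 = th -> st 2 2 = 0 ->
  let st' := exec env st search_s in
  [/\ facts st' (base n a), (forall j, st' 0 j = st 0 j), (forall j, j != 2 -> st' 2 j = st 2 j) &
    (st' 2 2 = 1 /\ exists g0 g1 g2 g3 g4 g5, chk n a g0 g1 g2 g3 g4 g5 th /\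
        forall p, p <= n -> st' 18 p = wl n a g0 g1 g2 g3 g4 g5 p) \/
    (st' 2 2 = 0 /\ forall g0 g1 g2 g3 g4 g5, g0 <= n -> g1 <= n -> g2 <= n ->
       g3 <= n -> g4 <= n -> g5 <= n -> ~~ chk n a g0 g1 g2 g3 g4 g5 th)].
Proof.
move=> hb hth h0.
pose I st' := [/\ facts st' (base n a), (forall j, st' 0 j = st 0 j) &
  forall j, j != 2 -> st' 2 j = st 2 j].
pose F (e : nat -> nat) := chk n a (e 10) (e 11) (e 12) (e 13) (e 14) (e 15) th.
pose R (e : nat -> nat) (st' : store) := forall p, p <= n ->
  st' 18 p = wl n a (e 10) (e 11) (e 12) (e 13) (e 14) (e 15) p.
pose P (e : nat -> nat) := [/\ e 10 <= n, e 11 <= n, e 13 <= n & e 14 <= n].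
have IS st' : I st' -> st' 1 2 = n.+1 by case=> -[[]].
have hbody e st1 : P e -> I st1 -> search_spec I F R n.+1 e [::] st1 (exec e st1 body_s).
  move=> pe [i1 i2 i3]; rewrite /body_s exec_if exec_skip evGet evCst.
  case: ifP => [h|/negbT h].
    by split=> // h'; rewrite h' in h.
  rewrite -eqn0Ngt in h.
  have [|f1 f2 f3 f4] := @parse_sP n a th e pe st1 i1; first by rewrite i3.
  case: f1 => k1 [k2 [k3 _]].
  split.
  - by split=> [|j|j hj]; [split|rewrite k3|rewrite f3 ?i3].
  - by rewrite h.
  move=> _; case E: (F e); [left|right].
    by rewrite f2 -/(F e) E; split=> //; exists [::].
  by rewrite f2 -/(F e) E; split=> // -[|? ?] [] //= _ _; rewrite E.
have [||[i1 i2 i3] _ hs] := @nest_search I F R n.+1 body_s IS P hbody [:: 10; 11; 12; 13; 14; 15] env st.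
- move=> [|v0 [|v1 [|v2 [|v3 [|v4 [|v5 [|? ?]]]]]]] [] //= _.
  by move=> /and5P[h1 h2 h3 h4 /andP[h5 _]]; split.
- by split.
split=> //; case: (hs h0) => [[d [[|v0 [|v1 [|v2 [|v3 [|v4 [|v5 [|? ?]]]]]]] [] //= _ _ [f r]]]|[d f]].
  by left; split=> //; exists v0, v1, v2, v3, v4, v5.
right; split=> // v0 v1 v2 v3 v4 v5 b0 b1 b2 b3 b4 b5.
by apply: (f [:: v0; v1; v2; v3; v4; v5]); split; rewrite //= !ltnS b0 b1 b2 b3 b4 b5.
Qed.

Transparent eNot eB eAnd eOr eLt eLe eEq eEx eAll eMul eWhen eIf bc ix2.

(** * Equality of types of factors, and the shortened word *)

Definition ix4 a b c d :=
  EAdd (eMul (bc 2) (EAdd (eMul (bc 2) (EAdd (eMul (bc 2) a) b)) c)) d.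
Definition idx4 S a b c d := S * (S * (S * a + b) + c) + d.

Lemma ix4_ev env st a b c d : ~~ vr 99 a -> ~~ vr 99 b -> ~~ vr 99 c ->
  ev env st (ix4 a b c d) =
  idx4 (st 1 2) (ev env st a) (ev env st b) (ev env st c) (ev env st d).
Proof.
move=> ha hb hc; rewrite /ix4 /idx4 evAdd evMulE; last by rewrite /= (negbTE hc).
rewrite evAdd evMulE; last by rewrite /= (negbTE hb).
by rewrite evAdd evMulE.
Qed.

Lemma digit_inj S x y r s : r < S -> s < S -> S * x + r = S * y + s -> x = y /\ r = s.
Proof.
move=> hr hs e; have S0 : 0 < S by apply: leq_ltn_trans hr.
have e1 : (S * x + r) %/ S = (S * y + s) %/ S by rewrite e.
have e2 : (S * x + r) %% S = (S * y + s) %% S by rewrite e.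
move: e1 e2; rewrite ![S * _]mulnC !divnMDl // !divn_small // !addn0 !modnMDl.
by rewrite !modn_small.
Qed.

Lemma idx4_inj S a b c d a' b' c' d' : b < S -> c < S -> d < S -> b' < S -> c' < S -> d' < S ->
  idx4 S a b c d = idx4 S a' b' c' d' -> [/\ a = a', b = b', c = c' & d = d'].
Proof.
move=> hb hc hd hb' hc' hd' /digit_inj [] // /digit_inj [] // /digit_inj [] //.
Qed.

Definition fill4 T e :=
  nest [:: 20; 21; 22; 23] (bc 2) (SSet T (ix4 (EVar 20) (EVar 21) (EVar 22) (EVar 23)) e).

Definition tb4 n T (f : nat -> nat -> nat -> nat -> nat) : nat * ((nat -> nat) -> Prop) :=
  (T, fun t => forall a b c d, a <= n -> b <= n -> c <= n -> d <= n ->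
     t (idx4 n.+1 a b c d) = f a b c d).

Lemma stage4 n st env T e f L : st 1 2 = n.+1 -> facts st L -> T != 1 -> T \notin unzip1 L ->
  ~~ rd T e ->
  (forall a b c d, a <= n -> b <= n -> c <= n -> d <= n ->
    ev (upd (upd (upd (upd env 20 a) 21 b) 22 c) 23 d) st e = f a b c d) ->
  facts (exec env st (fill4 T e)) (tb4 n T f :: L).
Proof.
move=> h2 hL T1 TL re h.
have ri : ~~ rd T (ix4 (EVar 20) (EVar 21) (EVar 22) (EVar 23)).
  by rewrite /ix4 /= !orbF !(eq_sym 1) (negbTE T1).
have [k1 k2] := @nestP T 2 (ix4 (EVar 20) (EVar 21) (EVar 22) (EVar 23)) e st
  [:: 20; 21; 22; 23] T1 ri re env st (fun _ _ _ => erefl).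
have E a b c d : ev (updl env [:: 20; 21; 22; 23] [:: a; b; c; d]) st
    (ix4 (EVar 20) (EVar 21) (EVar 22) (EVar 23)) = idx4 n.+1 a b c d.
  by rewrite ix4_ev // h2.
split; last exact: facts_keep k1 TL hL.
move=> a b c d ha hb hc hd.
have [[vs hvs [e0 e1]]|[/(_ [:: a; b; c; d]) no _]] := k2 (idx4 n.+1 a b c d).
  rewrite h2 in hvs.
  case: vs hvs e0 e1 => [|a' [|b' [|c' [|d' [|? ?]]]]] [] // _ /=.
  rewrite !ltnS andbT => /and4P[ha' hb' hc' hd'] e0 e1.
  have [|||||||ea eb ec ed] := @idx4_inj n.+1 a b c d a' b' c' d'; rewrite ?ltnS //.
    by rewrite e0; exact: E.
  by subst a' b' c' d'; rewrite -h //; exact: e1.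
exfalso; apply: no; first by rewrite h2; split; rewrite //= !ltnS ha hb hc hd.
by rewrite E.
Qed.

Definition g4 T a b c d := EGet T (ix4 a b c d).
Definition V20 := EVar 20. Definition V21 := EVar 21.
Definition V22 := EVar 22. Definition V23 := EVar 23.
(** An entry compares the factors from [V20] to [V21] and from [V22] to [V23]. Rank 0 asks whether
    both or neither are nonempty; [e4_S] raises the rank by [tp_facS]. *)
Definition e4_0 := eEq (eLt V20 V21) (eLt V22 V23).
Definition e4_half a b c d :=
  eAll 24 (bc 1) (eOr (eNot (eAnd (eLe a (EVar 24)) (eLt (EVar 24) b)))
   (eEx 25 (bc 1) (eAnd (eAnd (eLe c (EVar 25)) (eLt (EVar 25) d))
     (eAnd (eEq (get1 18 24) (get1 18 25)) (eAnd (g4 19 a (EVar 24) c (EVar 25))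
        (g4 19 (EAdd (EVar 24) (ECst 1)) b (EAdd (EVar 25) (ECst 1)) d)))))).
Definition e4_S := eAnd (e4_half V20 V21 V22 V23) (e4_half V22 V23 V20 V21).
Definition e4_stm := SSeq (fill4 19 e4_0)
  (SFor 26 (bc 3) (SSeq (fill4 20 e4_S) (fill4 19 (g4 20 V20 V21 V22 V23)))).

Definition cell k := EGet 2 (ECst k).
Definition ek x := g4 19 (ECst 0) (cell 5) (ECst 0) (EVar x).
(** The last position whose prefix has the type of the current prefix; everything in between can be
    skipped. Exactly one term of the sum is not cut off. *)
Definition kj_e := ESum 21 (bc 2) (eWhen (eAnd (ek 21)
  (eAll 22 (bc 2) (eOr (eNot (eLt V21 V22)) (eNot (ek 22))))) V21).
(** Keeps one more letter. Cell 4 is the length of the shortened word so far, cell 5 the position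
    reached in the old one, and cell 6 tells that its end was reached. *)
Definition kbody := SIf (cell 6) SSkip (SSeq (SSet 2 (ECst 8) kj_e)
  (SIf (eLt (cell 8) (bc 1))
     (SSeq (SSet 21 (cell 4) (EGet 18 (cell 8)))
       (SSeq (SSet 2 (ECst 4) (EAdd (cell 4) (ECst 1)))
             (SSet 2 (ECst 5) (EAdd (cell 8) (ECst 1)))))
     (SSet 2 (ECst 6) (ECst 1)))).
Definition kernel_s := SSeq e4_stm
  (SSeq (SSet 2 (ECst 4) (ECst 0)) (SSeq (SSet 2 (ECst 5) (ECst 0))
    (SSeq (SSet 2 (ECst 6) (ECst 0)) (SFor 30 (bc 2) kbody)))).

Local Opaque eNot eB eAnd eOr eLt eLe eEq eEx eAll eMul eWhen eIf bc ix2 ix4 idx4.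

Section Kernel.
Variables (n E : nat) (w : seq letter).
Hypothesis sw : size w = n.

Definition kbase_facts : seq (nat * ((nat -> nat) -> Prop)) :=
  [:: (1, fun t => [/\ t 1 = n, t 2 = n.+1 & t 3 = E]);
      (18, fun t => forall p, p < n -> t p = val (nth ord0 w p))].

Definition ety r i j i' j' : nat := (tp r (fac w i j) == tp r (fac w i' j')).

Lemma halfP r env st a b c d :
  facts st (tb4 n 19 (ety r) :: kbase_facts) ->
  a \in [:: 20; 21; 22; 23] -> b \in [:: 20; 21; 22; 23] ->
  c \in [:: 20; 21; 22; 23] -> d \in [:: 20; 21; 22; 23] ->
  env a <= n -> env b <= n -> env c <= n -> env d <= n ->
  tt env st (e4_half (EVar a) (EVar b) (EVar c) (EVar d)) <->
  (forall m, env a <= m < env b -> exists2 m', env c <= m' < env d &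
     [/\ nth ord0 w m = nth ord0 w m', tp r (fac w (env a) m) = tp r (fac w (env c) m') &
         tp r (fac w m.+1 (env b)) = tp r (fac w m'.+1 (env d))]).
Proof.
move=> [h19 [[b1 b2 b3] [h18 _]]] ia ib ic id ha hb hc hd.
have up x e v k : x \in [:: 20; 21; 22; 23] -> k \notin [:: 20; 21; 22; 23] -> upd e k v x = e x.
  by move=> hx hk; rewrite upd_other //; apply: contraNneq hk => <-.
have n99 x : x \in [:: 20; 21; 22; 23] -> ~~ vr 99 (EVar x).
  by rewrite !inE => /or4P[] /eqP ->.
rewrite /e4_half ttAll evbc b1.
have inner m : m < n -> tt (upd env 24 m) st (eOr (eNot (eAnd (eLe (EVar a) (EVar 24)) (eLt (EVar 24) (EVar b))))
   (eEx 25 (bc 1) (eAnd (eAnd (eLe (EVar c) (EVar 25)) (eLt (EVar 25) (EVar d)))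
     (eAnd (eEq (get1 18 24) (get1 18 25)) (eAnd (g4 19 (EVar a) (EVar 24) (EVar c) (EVar 25))
        (g4 19 (EAdd (EVar 24) (ECst 1)) (EVar b) (EAdd (EVar 25) (ECst 1)) (EVar d))))))) =
   ((env a <= m < env b) ==> has (fun m' => [&& env c <= m' < env d,
      nth ord0 w m == nth ord0 w m', tp r (fac w (env a) m) == tp r (fac w (env c) m') &
      tp r (fac w m.+1 (env b)) == tp r (fac w m'.+1 (env d))]) (iota 0 n)).
  move=> hm; rewrite (ttOr _ _ (eNot _)) (ttNot _ _ (eAnd _ _)) ttAnd ttLe ttLt !evVar.
  rewrite !upd_same !up // implybE; case ab: (env a <= m < env b) => //=.
  rewrite ttEx evbc b1; apply: eq_in_has => m'; rewrite mem_iota /= => hm'.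
  rewrite !ttAnd ttLe ttLt ttEq !evVar !evGet !evVar !upd_same (@upd_other _ 25 _ 24) // upd_same !up //.
  rewrite !h18 //; congr (_ && _).
  rewrite (inj_eq val_inj); case: eqP => //= ew.
  rewrite /tt /g4 !evGet !ix4_ev //; try exact: n99.
  rewrite !evAdd !evVar !evCst !upd_same (@upd_other _ 25 _ 24) // upd_same !up // b2 !addn1.
  by rewrite !h19 ?(ltnW hm) ?(ltnW hm') // /ety; do 2!case: eqP.
rewrite (eq_in_all (a2 := fun m => (env a <= m < env b) ==> has (fun m' => [&& env c <= m' < env d,
      nth ord0 w m == nth ord0 w m', tp r (fac w (env a) m) == tp r (fac w (env c) m') &
      tp r (fac w m.+1 (env b)) == tp r (fac w m'.+1 (env d))]) (iota 0 n))); last first.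
  by move=> m; rewrite mem_iota /= => hm; exact: inner.
split=> [/all_iotaP h m hm|h].
  have hmn : m < n by case/andP: hm => _ h2; apply: leq_trans h2 hb.
  have := h m hmn; rewrite hm /= => /has_iotaP [m' hm' /and4P[h1 /eqP h2 /eqP h3 /eqP h4]].
  by exists m'.
apply/all_iotaP => m hm; apply/implyP => /h [m' h1 [h2 h3 h4]]; apply/has_iotaP; exists m'.
  by case/andP: h1 => _ h1; apply: leq_trans h1 hd.
by rewrite h1 h2 h3 h4 !eqxx.
Qed.

Lemma e4P env st L : facts st (kbase_facts ++ L) ->
  19 \notin unzip1 (kbase_facts ++ L) -> 20 \notin unzip1 (kbase_facts ++ L) ->
  facts (exec env st e4_stm) (tb4 n 19 (ety E) :: kbase_facts ++ L).
Proof.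
set L' := kbase_facts ++ L => hL h19 h20; rewrite /e4_stm exec_seq.
have c2 st' : facts st' L' -> st' 1 2 = n.+1 by case=> -[].
have c3 st' : facts st' L' -> st' 1 3 = E by case=> -[].
have sub st' f : facts st' (f :: L') -> facts st' (f :: kbase_facts).
  by case: f => T P [h1 [h2 [h3 _]]].
have F0 : facts (exec env st (fill4 19 e4_0)) (tb4 n 19 (ety 0) :: L').
  apply: stage4 => //; first exact: c2.
  move=> a b c d ha hb hc hd; rewrite /e4_0 ev01_Eq ttEq !ev01_Lt !ttLt !evVar /ety /=.
  rewrite !size_fac ?sw // -!lt0n !subn_gt0 /upd /=.
  by case: (a < b); case: (c < d).
set st1 := exec env st _ in F0 *.
pose Q r st' := facts st' (tb4 n 19 (ety r) :: L').
suff : Q (ev env st1 (bc 3)) (exec env st1 (SFor 26 (bc 3)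
    (SSeq (fill4 20 e4_S) (fill4 19 (g4 20 V20 V21 V22 V23))))).
  by rewrite evbc c3 //; case: F0.
apply: for_ind => // r st2 _ F; rewrite exec_seq; have [F19 Fr] := F.
have F1 : facts (exec (upd env 26 r) st2 (fill4 20 e4_S)) (tb4 n 20 (ety r.+1) :: L').
  apply: stage4 => //; first exact: c2.
  move=> a b c d ha hb hc hd; set e := upd _ 23 d.
  rewrite /e4_S ev01_And ttAnd /ety; congr nat_of_bool.
  have [H1 H1'] := @halfP r e st2 20 21 22 23 (sub _ _ F) isT isT isT isT ha hb hc hd.
  have [H2 H2'] := @halfP r e st2 22 23 20 21 (sub _ _ F) isT isT isT isT hc hd ha hb.
  have [T1 T2] := @tp_facS r w a b c d ltac:(by rewrite sw) ltac:(by rewrite sw).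
  apply/andP/eqP => [[k1 k2]|k].
    by apply: T2; split; [exact: H1 k1|exact: H2 k2].
  by have [k1 k2] := T1 k; split; [exact: H1'|exact: H2'].
set st3 := exec _ _ _ in F1 *; have [F20 Fr'] := F1.
apply: stage4 => //; first exact: c2.
move=> a b c d ha hb hc hd; rewrite /g4 evGet ix4_ev // (c2 _ Fr').
by rewrite F20.
Qed.

Notation tk i := (tp E (take i w)).

Lemma etyE i j : ety E 0 i 0 j = (tk i == tk j).
Proof. by rewrite /ety /fac !drop0 !subn0. Qed.

Definition lastj j := forall j', j < j' <= n -> tk j' <> tk j.

Lemma kjP env st i : facts st (tb4 n 19 (ety E) :: kbase_facts) -> st 2 5 = i -> i <= n ->
  exists j, [/\ ev env st kj_e = j, i <= j <= n, tk i = tk j & lastj j].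
Proof.
move=> [h19 [[b1 b2 b3] _]] h5 hi.
have te env' x : env' x <= n -> tt env' st (ek x) = (tk i == tk (env' x)).
  move=> h; rewrite /tt /ek /g4 evGet ix4_ev // b2 !evGet !evCst evVar h5 h19 // etyE.
  by case: eqP.
pose P j := (tk i == tk j) && all (fun j' => (j < j') ==> (tk i != tk j')) (iota 0 n.+1).
have iP : exists j, (j <= n) && (tk i == tk j) by exists i; rewrite hi eqxx.
have ub j : (j <= n) && (tk i == tk j) -> j <= n by case/andP.
case: (ex_maxnP iP ub) => j /andP[hj ej] jmax.
exists j; split=> //.
- rewrite /kj_e evSum evbc b2.
  rewrite (eq_big_nat _ _ (F2 := fun v => if P v then v else 0)); last first.
    move=> v /= hv; rewrite evWhen //; rewrite ttAnd te ?upd_same // ttAll evbc b2.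
    rewrite (eq_in_all (a2 := fun j' => (v < j') ==> (tk i != tk j'))) //.
    move=> j'; rewrite mem_iota /= add0n => hj'.
    rewrite (ttOr _ _ (eNot _)) (ttNot _ _ (eLt _ _)) (ttNot _ _ (ek _)) ttLt !evVar.
    by rewrite te ?upd_same // upd_other // upd_same implybE.
  have Pj : P j.
    rewrite /P ej; apply/all_iotaP => j' hj'; apply/implyP => h; apply/negP => h'.
    by have := jmax j'; rewrite h' -ltnS hj' => /(_ isT); rewrite leqNgt h.
  rewrite (@sum_nat_one _ (fun z => z) P j) // => z hz /andP[ez /all_iotaP lz].
  have := jmax z; rewrite ez -ltnS hz => /(_ isT) zj.
  apply/eqP; rewrite eqn_leq zj /= leqNgt; apply/negP => h.
  by have := lz j; rewrite ltnS hj h ej => /(_ isT).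
- by rewrite hj andbT; apply: jmax; rewrite hi eqxx.
- exact/eqP.
- move=> j' /andP[h1 h2] e; have := jmax j'; rewrite h2 e ej => /(_ isT).
  by rewrite leqNgt h1.
Qed.

(** [js] lists the positions of the kept letters. Each is the last one whose prefix has a given
    type, so these types are pairwise distinct, and this bounds the length. *)
Definition kinv v st js : Prop :=
  [/\ facts st (tb4 n 19 (ety E) :: kbase_facts),
      st 2 4 = size js /\ (forall p, p < size js -> st 21 p = val (nth ord0 w (nth 0 js p))),
      (forall j, j \in js -> j < n /\ lastj j) /\ uniq [seq tk j | j <- js],
      st 2 6 = 0 -> [/\ v = size js, st 2 5 <= n, size js <= st 2 5,
         (forall j, j \in js -> j < st 2 5) &
         tp E [seq nth ord0 w j | j <- js] = tk (st 2 5)] &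
      st 2 6 <> 0 -> tp E [seq nth ord0 w j | j <- js] = tp E w].

Definition kkeep (st st' : store) : Prop :=
  (forall T j, T \in [:: 0; 1; 3] -> st' T j = st T j) /\
  (forall j, j \notin [:: 4; 5; 6; 8] -> st' 2 j = st 2 j).

Lemma kkeep_trans st1 st2 st3 : kkeep st1 st2 -> kkeep st2 st3 -> kkeep st1 st3.
Proof. by move=> [h1 h2] [h3 h4]; split=> *; [rewrite h3 ?h1|rewrite h4 ?h2]. Qed.

Lemma kkeep_set st k v : k \in [:: 4; 5; 6; 8] -> kkeep st (setst st 2 k v).
Proof.
move=> hk; split=> [T j|j hj]; rewrite /setst.
  by rewrite !inE => /or3P[] /eqP ->.
by rewrite (_ : j == k = false) //; apply: contraNF hj => /eqP ->.
Qed.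

Lemma kkeep_set21 st p v : kkeep st (setst st 21 p v).
Proof. by split=> [T j|j _] //; rewrite !inE /setst => /or3P[] /eqP ->. Qed.

Lemma kbodyP env v st js : kinv v st js -> exists js', kinv v.+1 (exec env st kbody) js' /\
  kkeep st (exec env st kbody).
Proof.
move=> I; have [F [I1 I2] [I3 I4] I5 I6] := I; have [[b1 b2 b3] _] := F.2.
rewrite /kbody exec_if exec_skip /cell evGet evCst; case: ifP => [h6|/negbT].
  exists js; split=> //; split=> //; first by move=> h; rewrite h in h6.
rewrite -eqn0Ngt => /eqP h6; have [v0 i1 i2 i3 i4] := I5 h6.
have [j [ej /andP[ij jn] tj lj]] := @kjP env st (st 2 5) F erefl i1.
rewrite exec_seq exec_set ej evCst exec_if; set st1 := setst st 2 8 j.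
have -> : (0 < ev env st1 (eLt (EGet 2 (ECst 8)) (bc 1))) = (j < n).
  by rewrite -/(tt _ _ _) ttLt evGet evbc /st1 /setst /= b1.
case: ifP => hj.
  set st2 := exec _ _ _.
  have -> : st2 = setst (setst (setst st1 21 (size js) (val (nth ord0 w j))) 2 4 (size js).+1) 2 5 j.+1.
    rewrite /st2 !exec_seq !exec_set !evGet !evCst.
    have e4 : st1 2 4 = size js by rewrite /st1 /setst /= I1.
    have e8 : st1 2 8 = j by rewrite /st1 /setst /=.
    have e18 : st1 18 j = val (nth ord0 w j) by rewrite /st1 /setst /=; case: F => _ [_ [-> //]].
    by rewrite e4 e8 e18 !evAdd !evGet !evCst !addn1 /setst /= -/(setst _ _ _ _) e8 e4.
  exists (rcons js j); split; last first.
    apply: (kkeep_trans (st2 := st1)); first exact: kkeep_set.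
    apply: (kkeep_trans (st2 := setst st1 21 (size js) (val (nth ord0 w j)))); first exact: kkeep_set21.
    by eapply kkeep_trans; apply: kkeep_set.
  split.
  - by case: F => f1 [f2 [f3 _]].
  - split; first by rewrite /setst /= size_rcons.
    move=> p; rewrite size_rcons ltnS leq_eqVlt /st1 /setst /= => /orP[/eqP ->|hp].
      by rewrite eqxx nth_rcons ltnn eqxx.
    by rewrite (ltn_eqF hp) nth_rcons hp I2.
  - split=> [q|]; first by rewrite mem_rcons inE => /orP[/eqP ->|/I3].
    rewrite map_rcons rcons_uniq I4 andbT; apply/mapP => -[q hq e].
    have [_ lq] := I3 q hq; apply: (lq j) => //.
    by rewrite jn andbT; apply: leq_trans (i3 q hq) ij.
  - move=> _; rewrite /setst /=; split=> //.
    + by rewrite size_rcons v0.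
    + by rewrite size_rcons ltnS (leq_trans i2 ij).
    + move=> q; rewrite mem_rcons inE ltnS => /orP[/eqP -> //|/i3 hq].
      by apply: leq_trans (ltnW hq) ij.
    + rewrite map_rcons (take_nth ord0) ?sw //; apply: tp_rcons; by rewrite i4 tj.
  - by rewrite /st1 /setst /= h6.
have ejn : j = n by apply/eqP; rewrite eqn_leq jn leqNgt hj.
exists js; rewrite exec_set !evCst; split; last first.
  by apply: (kkeep_trans (st2 := st1)); apply: kkeep_set.
split=> //.
by move=> _; rewrite i4 tj ejn -sw take_size.
Qed.

(** A round that does not stop moves cell 5 forward, so [n + 1] rounds reach the end of the word. *)
Lemma kernelP env st : facts st kbase_facts -> let st' := exec env st kernel_s in
  (exists K, [/\ tp E K = tp E w, size K <= #|Ty E|, st' 2 4 = size K &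
      forall p, p < size K -> st' 21 p = val (nth ord0 K p)]) /\
  (forall T j, T \in [:: 0; 1; 3] -> st' T j = st T j) /\
  (forall j, j \notin [:: 4; 5; 6; 8] -> st' 2 j = st 2 j).
Proof.
move=> hb; rewrite /kernel_s !exec_seq.
pose L := [:: (0, fun t : nat -> nat => forall j, t j = st 0 j);
   (3, fun t : nat -> nat => forall j, t j = st 3 j); (2, fun t : nat -> nat => forall j, t j = st 2 j)].
have k1 : forall j, exec env st e4_stm 1 j = st 1 j.
  by move=> j; apply: (@simps_keep predT); vm_compute.
have F := @e4P env st L (_ : facts st (kbase_facts ++ L)) isT isT.
have [|h19 [f1 [f2 [f3 [f4 [f5 _]]]]]] := F; first by case: hb => h1 [h2 _].
set st1 := exec env st e4_stm in k1 h19 f1 f2 f3 f4 f5 *.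
rewrite !exec_set !evCst.
set st2 := setst _ 2 6 0.
have kk : kkeep st st2.
  split=> [T q|q]; rewrite !inE /st2 /setst /=.
    by case/or3P=> /eqP -> /=; rewrite ?f3 ?f4 ?k1.
  by case: eqP => // _; case: eqP => // _; case: eqP => // _ _; rewrite f5.
have I0 : kinv 0 st2 [::].
  by split=> // _; rewrite /st2 /setst /= ?take0.
have e2 : ev env st2 (bc 2) = n.+1 by rewrite evbc /st2 /setst /=; case: f1.
pose Q v st' := (exists js, kinv v st' js) /\ kkeep st st'.
have [[js [J1 [J2 J2'] [J3 J4] J5 J6]] kk'] :
    Q (ev env st2 (bc 2)) (exec env st2 (SFor 30 (bc 2) kbody)).
  apply: for_ind; first by split=> //; exists [::].
  move=> v st' _ [[js I] ks]; have [js' [I' ks']] := kbodyP (upd env 30 v) I.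
  by split; [exists js'|exact: kkeep_trans ks ks'].
split=> //; exists [seq nth ord0 w j | j <- js]; split.
- case: (eqVneq (exec env st2 (SFor 30 (bc 2) kbody) 2 6) 0) => [h|/eqP]; last exact: J6.
  have [h1 h2 h3 _ _] := J5 h; move: h1 h2 h3; rewrite e2 => <- h2 h3.
  by have := leq_trans h3 h2; rewrite ltnn.
- by rewrite size_map -(size_map (fun j => tk j)) -(card_uniqP J4) max_card.
- by rewrite size_map.
- by move=> p; rewrite size_map => hp; rewrite (nth_map 0) // J2'.
Qed.

End Kernel.

Transparent eNot eB eAnd eOr eLt eLe eEq eEx eAll eMul eWhen eIf bc ix2 ix4 idx4.

(** * The whole program *)

Definition setup1 := seqs [:: SSet 1 (ECst 1) (EGet 0 (ECst 0));
  SSet 1 (ECst 2) (EAdd (bc 1) (ECst 1));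
  SSet 1 (ECst 4) (EAdd (eDbl (eDbl (bc 1))) (ECst 8));
  SSet 2 (ECst 1) (EAdd (eMul (bc 1) (bc 1)) (ECst 1));
  SSet 1 (ECst 3) (ESub (bc 0) (cell 1))].

Lemma setup1P env st n E : st 0 0 = n -> st 1 0 = n * n + 1 + E ->
  let s1 := exec env st setup1 in
  [/\ [/\ s1 1 1 = n, s1 1 2 = n.+1, s1 1 3 = E & s1 1 4 = kbase n], s1 2 1 = n * n + 1,
      (forall j, s1 0 j = st 0 j) & forall B, n <= B -> bnds B env st setup1].
Proof.
move=> h0 h1; split.
- by rewrite /= /setst /= sum_nat_const_nat subn0 h0 h1 /kbase; split; lia.
- by rewrite /= /setst /= sum_nat_const_nat subn0 h0.
- by [].
- by move=> B hB; rewrite /= /setst /= h0; repeat split.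
Qed.

Definition adj_e := eWhen (eAnd (eLt V20 (bc 1)) (eLt V21 (bc 1)))
  (EGet 0 (EAdd (EAdd (eMul (bc 1) V20) V21) (ECst 1))).
(** Doubling produces the threshold [2 ^ E.+1] in cell 3 of table 2; the length [E] of the formula
    stands for its rank. *)
Definition setup2 := seqs [:: SSet 2 (ECst 2) (ECst 0); SSet 2 (ECst 3) (ECst 2);
  SFor 0 (bc 3) (SSet 2 (ECst 3) (EAdd (cell 3) (cell 3))); fill2 3 adj_e].

Lemma setup2P env st n E (a : nat -> nat -> bool) :
  [/\ st 1 1 = n, st 1 2 = n.+1, st 1 3 = E & st 1 4 = kbase n] ->
  (forall x y, x < n -> y < n -> st 0 (n * x + y + 1) = a x y) ->
  (forall x y, ~~ ((x < n) && (y < n)) -> a x y = false) ->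
  let s := exec env st setup2 in
  [/\ facts s (base n a), s 2 2 = 0, s 2 3 = 2 ^ E.+1, s 2 1 = st 2 1 &
      (forall j, s 0 j = st 0 j) /\ (forall j, s 1 j = st 1 j)].
Proof.
move=> [c1 c2 c3 c4] hin hout; rewrite /setup2 /seqs; cbn [foldr].
rewrite !exec_seq exec_skip !exec_set !evCst.
set s1 := setst _ 2 3 2.
pose Q v (s : store) := s 2 3 = 2 ^ v.+1 /\ forall T j, (T, j) != (2, 3) -> s T j = s1 T j.
have : Q (ev env s1 (bc 3)) (exec env s1 (SFor 0 (bc 3) (SSet 2 (ECst 3) (EAdd (cell 3) (cell 3))))).
  apply: for_ind; first by split.
  move=> v s _ [q1 q2]; split; rewrite exec_set evAdd !evGet !evCst /setst.
    by rewrite /= q1 addnn -mul2n -expnS.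
  by move=> T j; rewrite xpair_eqE => h; rewrite (negbTE h) q2 // xpair_eqE.
set s2 := exec env s1 _; rewrite evbc => -[q1 q2].
have e3 : s1 1 3 = E by rewrite /s1 /setst /=.
rewrite e3 in q1.
have d2 : s2 1 2 = n.+1 by rewrite q2 // /s1 /setst /=.
have d1 : s2 1 1 = n by rewrite q2 // /s1 /setst /=.
have [k1 k2] := @fill2P 3 2 adj_e env s2 isT isT 20 21 isT isT.
rewrite d2 in k2; rewrite -/(fill2 3 adj_e) in k1 k2.
set s := exec env s2 _ in k1 k2 *.
split.
- split; first by rewrite !k1 // !q2 // /s1 /setst /= c1 c2 c4.
  split=> // x y hx hy; rewrite k2 // /adj_e evWhen // ttAnd !ttLt !evVar evbc d1.
  rewrite !evGet !evAdd evMulE // !evVar evbc d1 evCst /upd /= q2 // /s1 /setst /=.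
  case: ifP => [/andP[h1 h2]|/negbT h]; first by rewrite hin.
  by rewrite hout.
- by rewrite k1 // q2.
- by rewrite k1 // q1.
- by rewrite k1 // q2.
- by split=> j; rewrite k1 // q2.
Qed.

(** If no guess was accepted, the graph itself is evaluated, and cell 4 receives its number of
    vertices. *)
Definition select_s := SIf (cell 2) kernel_s (SSet 2 (ECst 4) (bc 1)).
Definition rest1 := SSeq setup2 (SSeq search_s select_s).

(** The dimensions of the structure to be evaluated become loop bounds. They are written outside of
    all loops, between the parts to which the criterion [simps] applies. *)
Definition cellsA := SSeq (SSet 1 (ECst 5) (cell 4)) (SSet 1 (ECst 6) (EAdd (cell 4) (ECst 1))).
Definition pow_s := SSeq (SSet 2 (ECst 10) (ECst 1)) (SSeq (SSet 2 (ECst 11) (ECst 1))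
  (SFor 0 (bc 3) (SSeq (SSet 2 (ECst 10) (cell 11)) (SSet 2 (ECst 11) (eMul (bc 6) (cell 11)))))).
Definition cellsB := SSeq (SSet 1 (ECst 7) (cell 11)) (SSet 1 (ECst 9) (cell 10)).

(** Letters are below 10, so halves and parities are found by comparison with constants. *)
Definition hf k x := eOr (eEq (get1 21 x) (ECst k.*2)) (eEq (get1 21 x) (ECst k.*2.+1)).
Definition od x := eOr (eEq (get1 21 x) (ECst 1)) (eOr (eEq (get1 21 x) (ECst 3))
  (eOr (eEq (get1 21 x) (ECst 5)) (eOr (eEq (get1 21 x) (ECst 7)) (eEq (get1 21 x) (ECst 9))))).
Definition gam1_e x y := eAnd (eLt (EVar x) (EVar y)) (eAnd (eLt (EVar y) (bc 5))
  (eOr (eAnd (hf 1 x) (hf 2 y)) (eOr (eAnd (hf 3 x) (hf 4 y))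
     (eAnd (eEq (EVar y) (EAdd (EVar x) (ECst 1))) (od y))))).
Definition mat_e := eIf (cell 2) (eOr (gam1_e 20 21) (gam1_e 21 20)) (eB (eA 20 21)).
Definition mat_s := nest [:: 20; 21] (bc 6) (SSet 4 (ix2 6 20 21) mat_e).

Definition main_s := SSeq setup1 (SSeq rest1 (SSeq cellsA (SSeq pow_s (SSeq cellsB
  (SSeq mat_s eval_stm))))).

Lemma gam1_eP env st K x y : st 1 5 = size K ->
  (forall p, p < size K -> st 21 p = val (nth (ord0 : letter) K p)) ->
  tt env st (gam1_e x y) = gam1 [seq val c | c <- K] (env x) (env y).
Proof.
move=> h5 h21; rewrite /gam1_e !ttAnd !ttLt !evVar evbc h5 /gam1 size_map.
case: ltnP => //= xy; case: ltnP => //= yK.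
have xK := ltn_trans xy yK.
have hv x' k : env x' < size K -> tt env st (hf k x') = ((nth 0 [seq val c | c <- K] (env x'))./2 == k).
  move=> h; rewrite /hf ttOr !ttEq !evGet !evVar !evCst h21 // (nth_map ord0) //.
  by move: (val _) => v; lia.
have ho : tt env st (od y) = odd (nth 0 [seq val c | c <- K] (env y)).
  rewrite /od !ttOr !ttEq !evGet !evVar !evCst h21 // (nth_map ord0) //.
  by case: (nth ord0 K _) => v /=; do 10!case: v => // v.
by rewrite !ttOr !ttAnd !hv // ho ttEq evAdd !evVar evCst addn1.
Qed.

Lemma powP env st E B : st 1 3 = E -> 0 < E -> st 1 6 = B ->
  let s := exec env st pow_s in
  [/\ s 2 11 = B ^ E, s 2 10 = B ^ E.-1,
   forall T j, T != 2 -> s T j = st T j & forall j, j < 10 -> s 2 j = st 2 j].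
Proof.
move=> h3 E0 h6; rewrite /pow_s !exec_seq !exec_set !evCst.
set s1 := setst _ 2 11 1.
pose Q v (s : store) := [/\ s 2 11 = B ^ v, s 2 10 = B ^ v.-1,
   forall T j, T != 2 -> s T j = st T j & forall j, j < 10 -> s 2 j = st 2 j].
have eE : ev env s1 (bc 3) = E by rewrite evbc /s1 /setst /=.
suff : Q (ev env s1 (bc 3)) (exec env s1 (SFor 0 (bc 3)
  (SSeq (SSet 2 (ECst 10) (cell 11)) (SSet 2 (ECst 11) (eMul (bc 6) (cell 11)))))) by rewrite eE.
apply: for_ind.
  split=> // [T j hT|j hj]; rewrite /s1 /setst; first by rewrite (negbTE hT).
  by rewrite !(ltn_eqF (leq_trans hj _)) ?andbF.
move=> v s _ [q1 q2 q3 q4]; rewrite exec_seq !exec_set evMulE // evbc !evGet !evCst.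
split.
- by rewrite /setst /= q3 // h6 q1 -expnS.
- by rewrite /setst /= q1.
- by move=> T j hT; rewrite /setst (negbTE hT) /= q3.
- by move=> j hj; rewrite /setst !(ltn_eqF (leq_trans hj _)) ?andbF //= q4.
Qed.

Lemma bnds_seq B env st s s' : bnds B env st s -> bnds B env (exec env st s) s' ->
  bnds B env st (SSeq s s').
Proof. by []. Qed.

Section Main.
Variables (n : nat) (a : nat -> nat -> bool) (phi : sentence).
Let E := size (encode_fo phi).
Hypothesis aout : forall x y, ~~ ((x < n) && (y < n)) -> a x y = false.
Hypothesis airr : forall x, a x x = false.
Hypothesis asym : forall x y, a x y = a y x.

Definition noguess := forall g0 g1 g2 g3 g4 g5, g0 <= n -> g1 <= n -> g2 <= n ->
  g3 <= n -> g4 <= n -> g5 <= n -> ~~ chk n a g0 g1 g2 g3 g4 g5 (2 ^ E.+1).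

(** The matrix is described for any later store [s'] that agrees on the tables it depends on,
    because its dimensions are put into table 1 only afterwards. *)
Lemma rest1P env st v :
  [/\ st 1 1 = n, st 1 2 = n.+1, st 1 3 = E & st 1 4 = kbase n] ->
  (forall x y, x < n -> y < n -> st 0 (n * x + y + 1) = a x y) ->
  exists N a', let s := exec env st rest1 in
  [/\ s 2 4 = N, satn N a' phi v = satn n a phi v,
      N <= #|Ty E| \/ N = n /\ noguess,
      forall s' env', (forall T j, T \in [:: 3; 21] -> s' T j = s T j) -> s' 2 2 = s 2 2 ->
        s' 1 2 = n.+1 -> s' 1 5 = N -> forall x y, x <= N -> y <= N ->
        ev (upd (upd env' 20 x) 21 y) s' mat_e = a' x y &
      [/\ s 2 1 = st 2 1, forall j, s 0 j = st 0 j & forall j, s 1 j = st 1 j]].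
Proof.
move=> hc hin; rewrite /rest1 !exec_seq.
have [f1 f2 f3 f4 [f5 f6]] := @setup2P env st n E a hc hin aout.
set s1 := exec env st setup2 in f1 f2 f3 f4 f5 f6 *.
have ks j : exec env s1 search_s 1 j = s1 1 j by apply: (@simps_keep predT); vm_compute.
have [g1 g2 g3 g4] := @searchP n a (2 ^ E.+1) env s1 f1 f3 f2.
set s2 := exec env s1 search_s in ks g1 g2 g3 g4 *.
have c3 : s2 1 3 = E by rewrite ks f6; case: hc.
have [[b1 b2 b4] [h3 _]] := g1.
rewrite /select_s exec_if evGet evCst.
case: g4 => [[d [x0 [x1 [x2 [x3 [x4 [x5 [hchk hw]]]]]]]]|[d ng]]; last first.
  rewrite ifF; last by rewrite d.
  rewrite exec_set evCst evbc b1.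
  exists n, a; split=> //.
  - by right.
  - move=> s' env' e1 e2 e3 e5 x y hx hy.
    have e22 : s' 2 2 = 0 by rewrite e2 /setst /= d.
    have e3' p : s' 3 p = s2 3 p by rewrite e1.
    rewrite /mat_e evIf // ifF; last by rewrite /tt evGet evCst e22.
    rewrite ev01_B ttB /tt /eA evGet evAdd evMulE // evbc e3 !evVar e3'.
    rewrite (_ : upd (upd env' 20 x) 21 y 20 = x) // upd_same h3 //.
    by case: (a x y).
  - by split=> [|j|j]; rewrite /setst /= ?g3 ?f4 ?g2 ?f5 ?ks ?f6.
rewrite ifT; last by rewrite d.
pose w := mkseq (fun p => inord (wl n a x0 x1 x2 x3 x4 x5 p) : letter) n.
have [wl10 Es] := @parse_sound n a x0 x1 x2 x3 x4 x5 airr asym (2 ^ E.+1) E 0 phi v hchk erefl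
  (qrank_size phi) (leqnn _).
have sw : size w = n by rewrite size_mkseq.
have vw : [seq val c | c <- w] = mkseq (wl n a x0 x1 x2 x3 x4 x5) n.
  by rewrite /w /mkseq -map_comp; apply: eq_map => p /=; rewrite inordK.
have kf : facts s2 (kbase_facts n E w).
  split; first by rewrite b1 b2 c3.
  split=> // p hp; rewrite hw 1?ltnW // nth_mkseq //= inordK //.
have [[K [K1 K2 K3 K4]] [K5 K6]] := @kernelP n E w sw env s2 kf.
set s := exec env s2 kernel_s in K3 K4 K5 K6 *.
exists (size K), (gam [seq val c | c <- K]); split=> //.
- by rewrite Es -vw -sw; apply: (word_equiv (q := E)) => //; exact: qrank_size.
- by left.
- move=> s' env' e1 e2 e3 e5 x y hx hy.
  have e22 : s' 2 2 = 1 by rewrite e2 K6.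
  rewrite /mat_e evIf // ifT; last by rewrite /tt evGet evCst e22.
  rewrite ev01_Or ttOr.
  have h21 p : p < size K -> s' 21 p = val (nth (ord0 : letter) K p).
    by move=> hp; rewrite e1 // K4.
  by rewrite !(gam1_eP _ _ _ e5 h21).
- by split=> [|j|j]; [rewrite K6 // g3 // f4|rewrite K5 // g2 f5|rewrite K5 // ks f6].
Qed.

(** Either [N] is at most the number of types, or every guess fails on the graph; both cases will
    bound [N] in terms of the formula. *)
Theorem main_sP env st v :
  st 0 0 = n -> st 1 0 = n * n + 1 + E ->
  (forall x y, x < n -> y < n -> st 0 (n * x + y + 1) = a x y) ->
  (forall i, i < E -> st 0 (n * n + 1 + i) = nth 0 (encode_fo phi) i) ->
  exec env st main_s 2 0 = satn n a phi v /\
  exists2 N, N <= #|Ty E| \/ N = n /\ noguess &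
    forall B, kbase n <= B -> E <= B -> N.+1 <= B -> N.+1 ^ E <= B -> bnds B env st main_s.
Proof.
move=> h0 h1 hin hF.
have [c1 c2 c3 c4] := @setup1P env st n E h0 h1.
rewrite /main_s; set s1 := exec env st setup1 in c1 c2 c3 c4.
have hin1 x y : x < n -> y < n -> s1 0 (n * x + y + 1) = a x y by move=> *; rewrite c3 hin.
have [N [a' [r1 r2 r3 r4 [r5 r6 r7]]]] := @rest1P env s1 v c1 hin1.
set s2 := exec env s1 rest1 in r1 r4 r5 r6 r7.
pose s3 := exec env s2 cellsA.
have t3 T j : (T, j) != (1, 5) -> (T, j) != (1, 6) -> s3 T j = s2 T j.
  by rewrite !xpair_eqE /s3 /cellsA /= /setst => /negbTE -> /negbTE ->.
have t35 : s3 1 5 = N by rewrite /s3 /cellsA /= /setst /= r1.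
have t36 : s3 1 6 = N.+1 by rewrite /s3 /cellsA /= /setst /= r1 addn1.
have t33 : s3 1 3 = E by rewrite t3 // r7; case: c1.
have E0 : 0 < E := size_encode_gt0 phi.
have [p1 p2 p3 p4] := @powP env s3 E N.+1 t33 E0 t36.
set s4 := exec env s3 pow_s in p1 p2 p3 p4.
pose s5 := exec env s4 cellsB.
have t5 T j : (T, j) != (1, 7) -> (T, j) != (1, 9) -> s5 T j = s4 T j.
  by rewrite !xpair_eqE /s5 /cellsB /= /setst => /negbTE -> /negbTE ->.
have t57 : s5 1 7 = N.+1 ^ E by rewrite /s5 /cellsB /= /setst /= p1.
have t59 : s5 1 9 = N.+1 ^ E.-1 by rewrite /s5 /cellsB /= /setst /= p2.
have ck : cells_ok N E s5 by split; rewrite // t5 // p3.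
have t52 : s5 1 2 = n.+1 by rewrite t5 // p3 // t3 // r7; case: c1.
pose s6 := exec env s5 mat_s.
have [m1 m2] := @fill2P 4 6 mat_e env s5 isT isT 20 21 isT isT.
rewrite -/mat_s -/s6 in m1 m2.
have e56 : s5 1 6 = N.+1 by case: ck.
rewrite e56 in m2.
have ck6 : cells_ok N E s6 by case: ck => *; split; rewrite m1.
have z0 j : s6 0 j = st 0 j by rewrite m1 // t5 // p3 // t3 // r6 c3.
have z21 : s6 2 1 = n * n + 1 by rewrite m1 // t5 // p4 // t3 // r5.
split.
  rewrite (exec_seq env st setup1) -/s1 (exec_seq env s1 rest1) -/s2 (exec_seq env s2 cellsA) -/s3.
  rewrite (exec_seq env s3 pow_s) -/s4 (exec_seq env s4 cellsB) -/s5 (exec_seq env s5 mat_s) -/s6.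
  rewrite -r2.
  apply: evalP => //.
    by move=> i hi; rewrite z21 z0 hF.
  move=> x y hx hy; rewrite m2 //; apply: r4 => //.
  - by move=> T j; rewrite !inE => /orP[] /eqP ->; rewrite t5 // p3 // t3.
  - by rewrite t5 // p4 // t3.
  - by case: ck.
exists N; first exact: r3.
move=> B hk hE hN hP.
have kb : kbase n = 4 * n + 8 by [].
have B0 : 0 < B by lia.
have [cc1 cc2 cc3 cc4] := c1; have [k3 k5 k6 k7 k9] := ck.
apply: bnds_seq; first by apply: c4; lia.
rewrite -/s1; apply: bnds_seq.
  have sm : simps (fun k => (k == 1) || (k == 2) || (k == 3) || (k == 4)) rest1 by vm_compute.
  apply: (simps_bnd _ sm B0).
  by move=> k /orP[/orP[/orP[]|]|] /eqP ->; lia.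
rewrite -/s2; apply: bnds_seq; first by [].
rewrite -/s3; apply: bnds_seq.
  have sm : simps (fun k => (k == 3) || (k == 6)) pow_s by vm_compute.
  apply: (simps_bnd _ sm B0).
  by move=> k /orP[] /eqP ->; lia.
rewrite -/s4; apply: bnds_seq; first by [].
rewrite -/s5; apply: bnds_seq.
  have sm : simps (fun k => (k == 2) || (k == 6)) mat_s by vm_compute.
  apply: (simps_bnd _ sm B0).
  by move=> k /orP[] /eqP ->; lia.
rewrite -/s6.
have sm : simps (fun k => (k == 3) || (k == 5) || (k == 6) || (k == 7) || (k == 9)) eval_stm by vm_compute.
apply: (simps_bnd _ sm B0).
have pl : N.+1 ^ E.-1 <= N.+1 ^ E by apply: leq_pexp2l => //; lia.
case: ck6 => q3 q5 q6 q7 q9.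
by move=> k /orP[/orP[/orP[/orP[]|]|]|] /eqP ->; lia.
Qed.

End Main.

(** * Twin-width *)

Section Sequences.
Variable G : sgraph.
Notation V := 'I_(nv G).

Lemma merge_partition (P Q : {set {set V}}) : partition P [set: V] -> merge_two P Q ->
  partition Q [set: V] /\ #|Q| = #|P|.-1.
Proof.
move=> pP /exists_inP [X XP /exists_inP [Y YP /andP[XY /eqP ->]]].
have tr := partition_trivIset pP; have cv := cover_partition pP.
have YPX : Y \in P :\ X by rewrite !inE YP eq_sym XY.
have ne Z : Z \in P -> Z != set0 by apply: partition_neq0 pP.
have notin : X :|: Y \notin P :\ X :\ Y.
  apply/negP; rewrite !inE => /and3P[h1 h2 h3].
  have /set0Pn [x xX] := ne X XP.
  have e1 := def_pblock tr h3 (_ : x \in X :|: Y); rewrite inE xX in e1.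
  have e2 := def_pblock tr XP xX; rewrite e1 // in e2.
  by rewrite e2 eqxx in h2.
split.
  apply/and3P; split.
  - rewrite eqEsubset subsetT /=; apply/subsetP => x _.
    have : x \in cover P by rewrite cv inE.
    case/bigcupP => Z ZP xZ; apply/bigcupP.
    case: (boolP ((Z == X) || (Z == Y))) => [h|].
      exists (X :|: Y); first by rewrite !inE eqxx.
      by case/orP: h => /eqP <-; rewrite inE xZ ?orbT.
    by rewrite negb_or => /andP[h1 h2]; exists Z => //; rewrite !inE h1 h2 ZP orbT.
  - apply/trivIsetP => A B hA hB AB.
    have d Z W : Z \in P -> W \in P -> Z != W -> [disjoint Z & W] := (trivIsetP tr) Z W.
    move: hA hB; rewrite !inE => /orP[/eqP eA|/and3P[a1 a2 a3]] /orP[/eqP e|/and3P[b1 b2 b3]].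
    + by rewrite eA e eqxx in AB.
    + by rewrite eA -setI_eq0 setIUl setU_eq0 !setI_eq0 !d // eq_sym.
    + by rewrite e disjoint_sym -setI_eq0 setIUl setU_eq0 !setI_eq0 !d // eq_sym.
    + exact: d.
  - rewrite !inE !negb_or negb_and negb_and !negbK; apply/andP; split.
      have /set0Pn [x xX] := ne X XP; apply/eqP => /setP /(_ x); by rewrite !inE xX.
    by rewrite (negbTE (_ : set0 \notin P)) ?andbF ?orbF ?orbT //; by case/and3P: pP.
rewrite cardsU1 notin (cardsD1 X P) XP (cardsD1 Y (P :\ X)) YPX /=; lia.
Qed.

Lemma singletons_partition : partition (singletons G) [set: V].
Proof.
apply/and3P; split.
- rewrite eqEsubset subsetT; apply/subsetP => x _; apply/bigcupP; exists [set x].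
    exact: imset_f.
  by rewrite inE.
- apply/trivIsetP => A B /imsetP [x _ ->] /imsetP [y _ ->] ne.
  rewrite disjoints1 inE; apply: contraNneq ne => ->; exact: eqxx.
- by apply/negP => /imsetP [x _] /setP /(_ x); rewrite !inE eqxx.
Qed.

Lemma contraction_exists (P : {set {set V}}) : partition P [set: V] -> 0 < #|P| ->
  exists2 s, path (@merge_two G) P s & last P s == [set [set: V]].
Proof.
move: {2}#|P| (leqnn #|P|) => m; elim: m P => [|m ih] P hm pP P0.
  by move: hm; rewrite leqn0 => /eqP h; rewrite h in P0.
case: (leqP #|P| 1) => hP.
  have /eqP /cards1P [X eP] : #|P| = 1 by lia.
  exists [::] => //=; rewrite eP; have := cover_partition pP.
  by rewrite eP cover1 => ->.
have /card_gt1P [X [Y [XP YP XY]]] : 1 < #|P| by [].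
pose Q := (X :|: Y) |: (P :\ X :\ Y).
have mQ : merge_two P Q.
  by apply/exists_inP; exists X => //; apply/exists_inP; exists Y => //; rewrite XY eqxx.
have [pQ cQ] := merge_partition pP mQ.
have [||s ps ls] := ih Q _ pQ; try by rewrite cQ; lia.
by exists (Q :: s) => //=; rewrite mQ.
Qed.

Lemma is_tww_exists : 0 < nv G -> exists w, is_tww G w.
Proof.
move=> n0.
have [|s ps ls] := contraction_exists singletons_partition.
  by apply/card_gt0P; exists [set Ordinal n0]; exact: imset_f.
have cs : contraction_sequence s by rewrite /contraction_sequence ps ls.
suff H : forall w s0, @contraction_sequence G s0 -> contraction_width s0 <= w ->
    exists w, is_tww G w.
  exact: H cs (leqnn _).
elim=> [|w ih] s0 cs0 hw.
  exists 0; split=> [|s1 _ //]; exists s0 => //; by move: hw; rewrite leqn0 => /eqP.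
case: (boolP (contraction_width s0 <= w)) => [|nw]; first exact: ih.
have ew : contraction_width s0 = w.+1 by lia.
case: (Classical_Prop.classic (exists2 s1, @contraction_sequence G s1 & contraction_width s1 <= w)).
  by case=> s1 cs1 h1; exact: ih cs1 h1.
move=> no; exists w.+1; split; first by exists s0.
move=> s1 cs1; rewrite ltnNge; apply/negP => h; by apply: no; exists s1.
Qed.

Lemma error_degree_ge (P : {set {set V}}) X (S : {set {set V}}) : X \in P -> S \subset P ->
  (forall Y, Y \in S -> (Y != X) && nonhomogeneous X Y) -> #|S| <= error_degree P.
Proof.
move=> XP SP h; apply: leq_trans (leq_bigmax_cond _ XP).
by apply: subset_leq_card; apply/subsetP => Y YS; rewrite inE h // (subsetP SP).
Qed.

End Sequences.

Lemma pigeon (T U : finType) (S : {set T}) (f : T -> U) c m :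
  #|f @: S| <= c -> c * m < #|S| -> exists2 u, u \in f @: S &
    m < #|[set x in S | f x == u]|.
Proof.
move=> hc hS; apply/exists_inP; apply: contraT; rewrite negb_exists_in => /forall_inP h.
have : #|S| <= #|f @: S| * m.
  rewrite -sum1_card (partition_big_imset f) /= -sum_nat_const; apply: leq_sum => u uf.
  have := h u uf; rewrite -leqNgt; apply: leq_trans.
  rewrite -sum1_card; apply: eq_leq; apply: eq_bigl => x; by rewrite inE.
by rewrite leqNgt (leq_ltn_trans _ hS) // leq_mul2r hc orbT.
Qed.

(** * A lower bound on the error degree *)

Section Bound.
Variables (G : sgraph) (t l : nat).
Notation V := 'I_(nv G).
Variables (vL vR : 'I_t -> V) (w : 'I_t -> 'I_t -> nat -> V).
Hypothesis adjL : forall j s s', adj (vL j) (w s s' 0) = (s <= j).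
Hypothesis adjR : forall j s s', adj (vR j) (w s s' l) = (s' <= j).
Hypothesis adjW : forall s s' r r' d, d < l ->
  adj (w s s' d) (w r r' d.+1) = (s == r) && (s' == r').

(** Take the [t] wires with first index [j']: [vL j'] sees their starts and [vL j] sees none. At
    each of the [l + 1] depths, at least one wire in [D + 1] stays in the chosen part, which
    explains the power of [D + 1]; finally more than [D + 4] ends are together. *)
Lemma wire_bound (Q : {set {set V}}) D (j j' : 'I_t) : partition Q [set: V] ->
  error_degree Q <= D -> j < j' -> pblock Q (vL j) = pblock Q (vL j') ->
  (forall J : {set 'I_t}, #|J| <= #|[set pblock Q (vR i) | i in J]|.+1) ->
  (D.+1) ^ l.+1 * (D + 4) < t -> False.
Proof.
move=> pQ eQ jj eL hR ht.
have cv x : x \in cover Q by rewrite (cover_partition pQ) inE.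
have bl x : pblock Q x \in Q by rewrite pblock_mem.
have mb x : x \in pblock Q x by rewrite mem_pblock.
(* At most [D] parts are inhomogeneous to [X]; the additional one is [X] itself. *)
have deg (X : {set V}) (T : finType) (S : {set T}) (f : T -> {set V}) : X \in Q ->
    (forall i, i \in S -> f i \in Q) ->
    (forall i, i \in S -> f i != X -> nonhomogeneous X (f i)) -> #|f @: S| <= D.+1.
  move=> XQ fQ hf; apply: leq_trans (_ : #|(f @: S) :\ X|.+1 <= _).
    by rewrite (cardsD1 X (f @: S)) -add1n leq_add2r; case: (X \in _).
  rewrite ltnS; apply: leq_trans eQ; apply: error_degree_ge XQ _ _.
    by apply/subsetP => Y; rewrite inE => /andP[_ /imsetP [i iS ->]]; exact: fQ.
  by move=> Y; rewrite !inE => /andP[YX /imsetP [i iS E]]; rewrite YX E hf // -E.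
have main d m : d <= l -> 0 < m -> D.+1 ^ d.+1 * m < t ->
    exists Y (S : {set 'I_t}), [/\ Y \in Q, m < #|S| &
      forall i, i \in S -> w j' i d \in Y].
  elim: d m => [|d ih] m hd m0 hm.
    have h1 : #|[set pblock Q (w j' i 0) | i in [set: 'I_t]]| <= D.+1.
      apply: (deg (pblock Q (vL j))) => // i _ ne; apply/andP; split.
        apply/exists_inP; exists (vL j'); first by rewrite eL.
        by apply/exists_inP; exists (w j' i 0); rewrite // adjL.
      apply/exists_inP; exists (vL j) => //.
      by apply/exists_inP; exists (w j' i 0); rewrite // adjL -ltnNge.
    have [|Y] := pigeon h1 (m := m); first by rewrite cardsT card_ord -(expn1 D.+1).
    case/imsetP => i _ -> hS; exists (pblock Q (w j' i 0)); eexists; split; [done|exact: hS|].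
    by move=> k; rewrite inE => /andP[_ /eqP <-].
  have [||Y [S [YQ hS hY]]] := ih (D.+1 * m) (ltnW hd).
  - by rewrite muln_gt0 m0.
  - by rewrite mulnA -expnSr.
  have S1 : 1 < #|S| by apply: leq_ltn_trans hS; rewrite muln_gt0 m0.
  have h1 : #|[set pblock Q (w j' i d.+1) | i in S]| <= D.+1.
    apply: (deg Y) => // i iS ne; apply/andP; split.
      apply/exists_inP; exists (w j' i d); first exact: hY.
      by apply/exists_inP; exists (w j' i d.+1); rewrite // adjW // !eqxx.
    (* A second wire through [Y] supplies the non-edge. *)
    have [k kS ki] : exists2 k, k \in S & k != i.
      have : 0 < #|S :\ i| by move: S1; rewrite (cardsD1 i S) iS.
      by case/card_gt0P => k; rewrite !inE => /andP[ki kS]; exists k.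
    apply/exists_inP; exists (w j' k d); first exact: hY.
    by apply/exists_inP; exists (w j' i d.+1); rewrite // adjW // eqxx (negbTE ki).
  have [//|Z] := pigeon h1 (m := m).
  case/imsetP => i iS -> hZ; exists (pblock Q (w j' i d.+1)); eexists; split; [done|exact: hZ|].
  by move=> k; rewrite inE => /andP[_ /eqP <-].
have [|Y [S [YQ hS hY]]] := main l (D + 4) (leqnn _) _ ht; first by rewrite addn4.
have /card_gt0P [i0 i0S] : 0 < #|S| by apply: leq_ltn_trans hS.
case: (arg_minnP (P := mem S) (fun i : 'I_t => val i) i0S) => lo loS lomin.
case: (arg_maxnP (P := mem S) (fun i : 'I_t => val i) i0S) => hi hiS himax.
(* Every right vertex with index in [S] other than [hi] sees the end with index [lo] and misses the
   one with index [hi]. *)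
have h1 : #|[set pblock Q (vR i) | i in S :\ hi]| <= D.+1.
  apply: (deg Y) => // i; rewrite !inE => /andP[ihi iS] ne; apply/andP; split.
    apply/exists_inP; exists (w j' lo l); first exact: hY.
    by apply/exists_inP; exists (vR i); rewrite // adj_sym adjR; exact: lomin.
  apply/exists_inP; exists (w j' hi l); first exact: hY.
  apply/exists_inP; exists (vR i); rewrite // adj_sym adjR -ltnNge ltn_neqAle ihi.
  exact: himax.
have := hR (S :\ hi); have := cardsD1 hi S; rewrite (_ : hi \in S = true) //; move: hS h1; lia.
Qed.

End Bound.

Section FirstTime.
Variable G : sgraph.
Notation V := 'I_(nv G).

Lemma first_bad (bad : pred {set {set V}}) s (P0 : {set {set V}}) :
  partition P0 [set: V] -> path (@merge_two G) P0 s -> ~~ bad P0 -> bad (last P0 s) ->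
  exists P Q, [/\ partition P [set: V], merge_two P Q, ~~ bad P, bad Q & Q \in s].
Proof.
elim: s P0 => [|Q s ih] P0 pP /=; first by move=> _ /negbTE ->.
case/andP=> m hp nb hb; case: (boolP (bad Q)) => bQ.
  by exists P0, Q; split=> //; rewrite inE eqxx.
have [pQ _] := merge_partition pP m.
have [P [Q' [h1 h2 h3 h4 h5]]] := ih Q pQ hp bQ hb.
by exists P, Q'; split=> //; rewrite inE h5 orbT.
Qed.

(** A merge identifies one pair of parts, so at most one part is lost. *)
Lemma merge_blocks t (P Q : {set {set V}}) (v : 'I_t -> V) : partition P [set: V] ->
  merge_two P Q -> (forall i j, i != j -> pblock P (v i) != pblock P (v j)) ->
  forall J : {set 'I_t}, #|J| <= #|[set pblock Q (v i) | i in J]|.+1.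
Proof.
move=> pP m inj J; have [pQ _] := merge_partition pP m.
case/exists_inP: m => X XP /exists_inP [Y YP /andP[XY /eqP eQ]].
have cP x : x \in cover P by rewrite (cover_partition pP) inE.
have trP := partition_trivIset pP; have trQ := partition_trivIset pQ.
pose g (Z : {set V}) := if (Z == X) || (Z == Y) then X :|: Y else Z.
have gE x : pblock Q x = g (pblock P x).
  apply: def_pblock trQ _ _; rewrite /g.
    rewrite eQ; case: ifP => [_|/negbT]; first by rewrite !inE eqxx.
    by rewrite negb_or => /andP[h1 h2]; rewrite !inE h1 h2 pblock_mem // orbT.
  case: ifP => [/orP[] /eqP <-|_]; rewrite ?inE mem_pblock cP ?orbT //.
pose J' := [set i in J | pblock P (v i) != X].
have J'J : #|J| <= #|J'|.+1.
  have -> : #|J| = #|J'| + #|[set i in J | pblock P (v i) == X]|.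
    rewrite -cardsUI addnC (_ : _ :&: _ = set0) ?cards0 ?add0n.
      by apply: eq_card => i; rewrite !inE; case: (i \in J) => //=; case: (_ == X).
    by apply/setP => i; rewrite !inE; case: (_ == X); rewrite ?andbF.
  rewrite -addn1 leq_add2l; apply: contraT; rewrite -ltnNge => /card_gt1P [i [k []]].
  rewrite !inE => /andP[_ /eqP e1] /andP[_ /eqP e2] ne.
  by have := inj i k ne; rewrite e1 e2 eqxx.
apply: leq_trans J'J _; rewrite ltnS.
have -> : #|J'| = #|[set pblock Q (v i) | i in J']|.
  rewrite card_in_imset // => i k; rewrite !inE !gE => /andP[_ h1] /andP[_ h2].
  move=> e; apply/eqP; apply: contraT => /inj ne; exfalso; move: ne.
  have nXY : X :|: Y \notin P :\ X :\ Y.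
    apply/negP; rewrite !inE => /and3P[a1 a2 a3].
    have /set0Pn [x xX] := partition_neq0 pP XP.
    have e1 := def_pblock trP a3 (_ : x \in X :|: Y); rewrite inE xX in e1.
    have e2 := def_pblock trP XP xX; rewrite e1 // in e2.
    by rewrite e2 eqxx in a2.
  have nin Z : Z \in P -> Z != X -> Z != Y -> Z != X :|: Y.
    by move=> ZP z1 z2; apply/eqP => E; move: nXY; rewrite -E !inE z1 z2 ZP.
  move: e; rewrite /g (negbTE h1) (negbTE h2) /=.
  case: eqP => [->|/eqP n1]; case: eqP => [->|/eqP n2]; rewrite ?eqxx //.
  - move=> E; have := nin _ (pblock_mem (cP (v k))) h2 n2; by rewrite -E eqxx.
  - move=> E; have := nin _ (pblock_mem (cP (v i))) h1 n1; by rewrite E eqxx.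
  - by move=> ->; rewrite eqxx.
apply: subset_leq_card; apply: imsetS; apply/subsetP => i; by rewrite inE => /andP[].
Qed.

End FirstTime.

(** The first bad partition is one merge away from a partition that separates both sides, so
    [merge_blocks] controls the side on which no two vertices need have met. *)
Theorem tww_bound (G : sgraph) t l (vL vR : 'I_t -> 'I_(nv G))
    (w : 'I_t -> 'I_t -> nat -> 'I_(nv G)) D (s : seq {set {set 'I_(nv G)}}) :
  injective vL -> injective vR ->
  (forall j s s', adj (vL j) (w s s' 0) = (s <= j)) ->
  (forall j s s', adj (vR j) (w s s' l) = (s' <= j)) ->
  (forall s s' r r' d, d < l -> adj (w s s' d) (w r r' d.+1) = (s == r) && (s' == r')) ->
  D.+1 ^ l.+1 * (D + 4) < t -> contraction_sequence s -> D < contraction_width s.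
Proof.
move=> iL iR aL aR aW ht /andP[ps /eqP ls]; rewrite ltnNge; apply/negP => hD.
pose same (v : 'I_t -> 'I_(nv G)) (P : {set {set 'I_(nv G)}}) :=
  [exists i, exists j, (i != j) && (pblock P (v i) == pblock P (v j))].
pose bad P := same vL P || same vR P.
have p0 := singletons_partition G.
have sing v : injective v -> ~~ same v (singletons G).
  move=> iv; apply/existsP => -[i /existsP [j /andP[ij]]].
  have b x : pblock (singletons G) x = [set x].
    by apply: def_pblock; [exact: partition_trivIset p0|exact: imset_f|rewrite inE].
  by rewrite !b => /eqP /set1_inj /iv e; rewrite e eqxx in ij.
have t2 : 1 < t by apply: leq_ltn_trans ht; rewrite muln_gt0 expn_gt0 addn4.
have lastbad : bad (last (singletons G) s).
  rewrite ls /bad; apply/orP; left; apply/existsP; exists (Ordinal (ltnW t2)).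
  apply/existsP; exists (Ordinal t2); apply/andP; split=> //; apply/eqP.
  have b x : pblock [set [set: 'I_(nv G)]] x = [set: 'I_(nv G)].
    apply: def_pblock; rewrite ?inE //.
    by apply/trivIsetP => A B; rewrite !inE => /eqP -> /eqP ->; rewrite eqxx.
  by rewrite !b.
have nb0 : ~~ bad (singletons G) by rewrite /bad negb_or !sing.
have [P [Q [pP mPQ nbP bQ Qs]]] := first_bad p0 ps nb0 lastbad.
have [pQ _] := merge_partition pP mPQ.
have eQ : error_degree Q <= D.
  apply: leq_trans hD; rewrite /contraction_width big_cons leq_max; apply/orP; right.
  by apply: (leq_bigmax_seq (F := fun P => error_degree P)).
move: nbP; rewrite /bad negb_or => /andP[nL nR].
have injb v : ~~ same v P -> forall i j, i != j -> pblock P (v i) != pblock P (v j).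
  move=> h i j ij; apply: contraNneq h => e; apply/existsP; exists i; apply/existsP.
  by exists j; rewrite ij e eqxx.
have wlog_lt v : same v Q -> exists i j : 'I_t, i < j /\ pblock Q (v i) = pblock Q (v j).
  case/existsP => i /existsP [j /andP[ij /eqP e]].
  case: (ltngtP i j) => h; [by exists i, j|by exists j, i|].
  by case/eqP: ij; exact: val_inj.
case/orP: bQ => /wlog_lt [i [j [ij e]]].
  apply: (@wire_bound G t l vL vR w aL aR aW Q D i j) => //.
  exact: merge_blocks pP mPQ (injb vR nR).
(* The mirror image: wires are read backwards, with their indices exchanged. *)
apply: (@wire_bound G t l vR vL (fun s s' d => w s' s (l - d)) _ _ _ Q D i j) => //.
- by move=> k r r'; rewrite subn0 aR.
- by move=> k r r'; rewrite subnn aL.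
- move=> r r' q q' d hd; rewrite adj_sym.
  have -> : l - d = (l - d.+1).+1 by lia.
  by rewrite aW; [rewrite andbC eq_sym [r' == _]eq_sym|lia].
- exact: merge_blocks pP mPQ (injb vL nL).
Qed.

(** * Grids and their layouts *)

Inductive label := LV of nat | LU of nat | LW of nat & nat & nat.

Definition ladj l (p q : label) : bool :=
  match p, q with
  | LV j, LW s s' d => (d == 0) && (s <= j)
  | LU j, LW s s' d => (d == l) && (s' <= j)
  | LW s s' d, LW r r' e => [&& s == r, s' == r' & e == d.+1]
  | _, _ => false
  end.

Definition adjl l p q := ladj l p q || ladj l q p.

Definition okl t l (p : label) : bool :=
  match p with
  | LV j => j < t
  | LU j => j < t
  | LW s s' d => [&& s < t, s' < t & d <= l]
  end.

Definition represents t l (G : sgraph) (h : 'I_(nv G) -> label) : Prop :=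
  [/\ injective h, forall x, okl t l (h x) & forall x y, adj x y = adjl l (h x) (h y)].

Lemma adjlC l p q : adjl l p q = adjl l q p.
Proof. by rewrite /adjl orbC. Qed.

(** Excludes three segments through a common point. *)
Lemma adjl_triangle l p q r : 0 < l -> adjl l p q -> adjl l q r -> adjl l p r -> False.
Proof.
rewrite /adjl; move: p q r => [j|j|s s' d] [j'|j'|r r' e] [j''|j''|u u' f] //=; lia.
Qed.

Lemma pair_inj t s s' r r' : s' < t -> r' < t -> s * t + s' = r * t + r' -> s = r /\ s' = r'.
Proof.
move=> h h' e.
have e1 : (s * t + s') %/ t = (r * t + r') %/ t by rewrite e.
have e2 : (s * t + s') %% t = (r * t + r') %% t by rewrite e.
move: e1 e2; have t0 : 0 < t by apply: leq_ltn_trans h.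
by rewrite !divnMDl // !divn_small // !addn0 !modnMDl !modn_small.
Qed.

(** The second index only breaks ties: each wire gets its own place in a linear order, and the
    threshold [t * j.+1] cuts that order exactly by the first index. *)
Lemma pair_lt t s s' j : s' < t -> (s * t + s' < t * j.+1) = (s <= j).
Proof.
move=> h; apply/idP/idP => k; last first.
  apply: leq_trans (_ : s.+1 * t <= _); first by rewrite mulSnr ltn_add2l.
  by rewrite [t * _]mulnC leq_mul2r ltnS k orbT.
rewrite leqNgt; apply/negP => k'; move: k; apply/negP; rewrite -leqNgt.
apply: leq_trans (leq_addr _ _); by rewrite [t * _]mulnC leq_mul2r k' orbT.
Qed.

(* A wire [LW s s' d] is laid out through the two numbers [s * t + s'] and
   [s' * t + s], which order the wires as their left and right ends require. *)
Section Layout.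
Variables (D : Type) (cr sp : D -> D -> Prop) (t l : nat).
Hypotheses (crC : forall x y, cr x y -> cr y x) (spC : forall x y, sp x y -> sp y x).
Variables (dV : nat -> D) (dU : nat -> nat -> D) (dW : nat -> nat -> nat -> D).

Definition lay (p : label) : D :=
  match p with
  | LV j => dV (t * j.+1)
  | LU j => dU (t * j.+1) j
  | LW s s' d => dW (s * t + s') (s' * t + s) d
  end.

Let T := t * t.
Hypothesis hVV : forall a b, 0 < a <= T -> 0 < b <= T -> a <> b -> sp (dV a) (dV b).
Hypothesis hVU : forall a b j, 0 < a <= T -> 0 < b <= T -> j < t -> sp (dV a) (dU b j).
Hypothesis hUU : forall a b i j, 0 < a <= T -> 0 < b <= T -> i < t -> j < t -> i <> j ->
  sp (dU a i) (dU b j).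
Hypothesis hVW : forall a x y d, 0 < a <= T -> x < T -> y < T -> d <= l ->
  if (d == 0) && (x < a) then cr (dV a) (dW x y d) else sp (dV a) (dW x y d).
Hypothesis hUW : forall a j x y d, 0 < a <= T -> j < t -> x < T -> y < T -> d <= l ->
  if (d == l) && (y < a) then cr (dU a j) (dW x y d) else sp (dU a j) (dW x y d).
Hypothesis hWW : forall x y d x' y' d', x < T -> y < T -> x' < T -> y' < T -> d <= l -> d' <= l ->
  (y = y' <-> x = x') -> (y = y' -> d <> d') -> odd d <= odd d' ->
  if (y == y') && ((d' == d.+1) || (d == d'.+1)) then cr (dW x y d) (dW x' y' d')
  else sp (dW x y d) (dW x' y' d').

(** Reduces a layout to one check per pair of kinds; by symmetry the pair is ordered by kind and,
    for wires, by parity of the depth. *)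
Lemma lay_pairs p q : okl t l p -> okl t l q -> p <> q ->
  if adjl l p q then cr (lay p) (lay q) else sp (lay p) (lay q).
Proof.
pose rk p := match p with LV _ => 0 | LU _ => 1 | LW _ _ d => 2 + odd d end.
wlog : p q / rk p <= rk q.
  move=> H hp hq ne; case: (leqP (rk p) (rk q)) => h; first exact: H.
  have := H q p (ltnW h) hq hp (fun e => ne (esym e)); rewrite adjlC.
  by case: ifP => _; [exact: crC|exact: spC].
have th j : j < t -> 0 < t * j.+1 <= T.
  by move=> h; rewrite muln_gt0 (leq_ltn_trans _ h) //= leq_mul2l h orbT.
have xl s s' : s < t -> s' < t -> s * t + s' < T.
  move=> h h'; apply: leq_trans (_ : s.+1 * t <= _); first by rewrite mulSnr ltn_add2l.
  by rewrite leq_mul2r h orbT.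
case: p => [j|j|s s' d]; case: q => [i|i|r r' e] //= hk.
- move=> hj hi ne; apply: hVV; try exact: th.
  move=> /eqP; rewrite eqn_mul2l; case/orP=> [/eqP h|/eqP [h]]; last by apply: ne; rewrite h.
  by rewrite h in hj.
- by move=> hj hi _; apply: hVU => //; exact: th.
- move=> hj /and3P[h1 h2 h3] _; rewrite /adjl /= orbF.
  have := @hVW (t * j.+1) (r * t + r') (r' * t + r) e (th j hj) (xl _ _ h1 h2) (xl _ _ h2 h1) h3.
  by rewrite pair_lt.
- move=> hj hi ne; apply: hUU => //; try exact: th.
  by move=> h; apply: ne; rewrite h.
- move=> hj /and3P[h1 h2 h3] _; rewrite /adjl /= orbF.
  have := @hUW (t * j.+1) j (r * t + r') (r' * t + r) e (th j hj) hj (xl _ _ h1 h2) (xl _ _ h2 h1) h3.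
  by rewrite pair_lt.
- move=> /and3P[h1 h2 h3] /and3P[k1 k2 k3] ne.
  have ee : (s' * t + s = r' * t + r) <-> (s * t + s' = r * t + r').
    by split=> /pair_inj [] // -> ->.
  have := @hWW (s * t + s') (s' * t + s) d (r * t + r') (r' * t + r) e
    (xl _ _ h1 h2) (xl _ _ h2 h1) (xl _ _ k1 k2) (xl _ _ k2 k1) h3 k3 ee.
  have -> : adjl l (LW s s' d) (LW r r' e) =
      (s' * t + s == r' * t + r) && ((e == d.+1) || (d == e.+1)).
    rewrite /adjl /=; case: (eqVneq s r) => [->|n1]; case: (eqVneq s' r') => [->|n2];
      rewrite ?eqxx /= ?[r == s]eq_sym ?[r' == s']eq_sym ?(negbTE n1) ?(negbTE n2) ?orbF /= ?andbF //.
    + by apply/esym/negbTE; apply: contra n2 => /andP[/eqP /pair_inj [] // -> _].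
    + by apply/esym/negbTE; apply: contra n1 => /andP[/eqP /pair_inj [] // _ ->].
    + by apply/esym/negbTE; apply: contra n1 => /andP[/eqP /pair_inj [] // _ ->].
  apply; last by move: hk; rewrite leq_add2l.
  by move=> /pair_inj [] // e1 e2 e3; apply: ne; rewrite e1 e2 e3.
Qed.
End Layout.

(** * Layouts with integer coordinates *)

Inductive nseg := NV of nat & nat & nat | NH of nat & nat & nat.

(** Crossing in interior points. Its counterpart [nsep] puts parallel segments on different lines,
    as general position requires; [nmeet] also admits touching and overlap, for the degenerate
    layout. *)
Definition ncross (g g' : nseg) : bool :=
  match g, g' with
  | NV c lo hi, NH c' lo' hi' | NH c' lo' hi', NV c lo hi => (lo' < c < hi') && (lo < c' < hi)
  | _, _ => false
  end.
Definition nsep (g g' : nseg) : bool :=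
  match g, g' with
  | NV c lo hi, NV c' _ _ | NH c lo hi, NH c' _ _ => c != c'
  | NV c lo hi, NH c' lo' hi' | NH c' lo' hi', NV c lo hi =>
      [|| c < lo', hi' < c, c' < lo | hi < c']
  end.
Definition nmeet (g g' : nseg) : bool :=
  match g, g' with
  | NV c lo hi, NV c' lo' hi' | NH c lo hi, NH c' lo' hi' => [&& c == c', lo <= hi' & lo' <= hi]
  | NV c lo hi, NH c' lo' hi' | NH c' lo' hi', NV c lo hi => (lo' <= c <= hi') && (lo <= c' <= hi)
  end.
Definition nwf (g : nseg) : bool := match g with NV _ lo hi | NH _ lo hi => lo < hi end.
Definition nlen (g : nseg) : nat := match g with NV _ lo hi | NH _ lo hi => hi - lo end.

Lemma ncrossC x y : ncross x y -> ncross y x.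
Proof. by case: x => ???; case: y. Qed.
Lemma nsepC x y : nsep x y -> nsep y x.
Proof. by case: x => ???; case: y => ??? //=; rewrite eq_sym. Qed.
Lemma nmeetC x y : nmeet x y = nmeet y x.
Proof. by case: x => ???; case: y => ??? //=; rewrite eq_sym [X in _ && X]andbC. Qed.

Section Unit.
Variable t : nat.
Let T := t * t.
Let M := 8 * T.
Variable l : nat.
(** A wire is a row of collinear segments of length [M], consecutive ones touching. It is shifted by
    [2 * x] along the row and lies at height [M + 2 * y], so the odd number [2 * a - 1] separates
    the wires below [a] from the others without ties. *)
Definition v1 a := NV (2 * a - 1) (4 * T) (12 * T).
Definition u1 a j := NV (l * M + 4 * T + j) (2 * a - 1) (M + (2 * a - 1)).
Definition w1 x y d := NH (M + 2 * y) (d * M + 2 * x) (d * M + 2 * x + M).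

Lemma unit_pairs p q : okl t l p -> okl t l q -> p <> q ->
  if adjl l p q then is_true (nmeet (lay t v1 u1 w1 p) (lay t v1 u1 w1 q))
  else is_true (~~ nmeet (lay t v1 u1 w1 p) (lay t v1 u1 w1 q)).
Proof.
have tT : forall j, j < t -> j < T by move=> j h; apply: leq_trans h _; rewrite /T; nia.
have mono : forall a b, a < b -> a * M + M <= b * M.
  by move=> a b h; rewrite -mulSnr leq_mul2r h orbT.
apply: (@lay_pairs nseg (fun x y => nmeet x y) (fun x y => ~~ nmeet x y)) => /=.
- by move=> x y; rewrite nmeetC.
- by move=> x y; rewrite nmeetC.
- move=> a b; rewrite -/T; lia.
- move=> a b j ha hb /tT hj; rewrite -/T in ha hb *; rewrite -/M; have : 0 <= l * M by []; lia.
- move=> a b i j ha hb /tT hi /tT hj ne; lia.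
- move=> a x y d ha hx hy hd; rewrite -/T -/M in ha hx hy *.
  case: d hd => [|d] hd /=; last by have := mono 0 d.+1; rewrite /M; lia.
  by case: ifP; rewrite /M; lia.
- move=> a j x y d ha /tT hj hx hy hd; rewrite -/T -/M in ha hx hy *.
  case: (eqVneq d l) => [->|nd] /=; first by case: ifP; rewrite /M; lia.
  have h : d < l by rewrite ltn_neqAle nd.
  by have := mono d l h; have : M = 8 * T by []; lia.
- move=> x y d x' y' d' hx hy hx' hy' hd hd' e ne _; rewrite -/T -/M in hx hy hx' hy' *.
  case: (eqVneq y y') => [ey|ny] /=; last by lia.
  have ex : x = x' by apply/e.
  have nd := ne ey; subst x' y'; rewrite eqxx /=.
  case: (ltngtP d d') => h; [| |by case: nd].
    rewrite (_ : d == d'.+1 = false) ?orbF; last by lia.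
    case: eqP => [->|h']; first by rewrite mulSnr; lia.
    by have := mono d.+1 d'; rewrite mulSnr; move: (hx); rewrite /M; lia.
  rewrite (_ : d' == d.+1 = false) /=; last by lia.
  case: eqP => [->|h']; first by rewrite mulSnr; lia.
  by have := mono d'.+1 d; rewrite mulSnr; move: (hx); rewrite /M; lia.
Qed.
End Unit.

Section TwoLengths.
Variables t m : nat.
Let T := t * t.
Let K := m.*2.+1.
Let P := T * K.
Let w := 8 * P.
Let L := w + 2.
(** Ascending staircases with horizontal steps of length [L] and vertical ones of length 6.
    Consecutive horizontal steps overlap by the two units in [w + 2], and the vertical one passes
    through the middle. Wire [y] uses the levels from [y * K] to [y * K + m], and [K > m] keeps
    wires apart. *)
Definition v2 a := NV (2 * a - 1) L (L + L).
Definition u2 a j := NV (m * w + 2 * T + 3 + 2 * j) (4 * (a * K)) (4 * (a * K) + L).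
Definition w2 x y d :=
  let b := d./2 in
  let c := L + 1 + 4 * (y * K + b) in
  if odd d then NV (b * w + w + 2 * x + 1) (c - 1) (c + 5)
  else NH c (b * w + 2 * x) (b * w + 2 * x + L).

Lemma two_pairs p q : 0 < m -> okl t m.*2 p -> okl t m.*2 q -> p <> q ->
  if adjl m.*2 p q then is_true (ncross (lay t v2 u2 w2 p) (lay t v2 u2 w2 q))
  else is_true (nsep (lay t v2 u2 w2 p) (lay t v2 u2 w2 q)).
Proof.
move=> m0.
have tT : forall j, j < t -> j < T by move=> j h; apply: leq_trans h _; rewrite /T; nia.
have mono : forall a b, a < b -> a * w + w <= b * w.
  by move=> a b h; rewrite -mulSnr leq_mul2r h orbT.
have monK : forall a b, a < b -> a * K + K <= b * K.
  by move=> a b h; rewrite -mulSnr leq_mul2r h orbT.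
have monK' : forall a b, a <= b -> a * K <= b * K.
  by move=> a b h; rewrite leq_mul2r h orbT.
have PT3 : 3 * T <= P by rewrite /P mulnC leq_mul2l /K; lia.
have KT a : a <= T -> a * K <= P by exact: monK'.
have hL : L = w + 2 by []. have hw : w = 8 * P by [].
have hK : K = m.*2.+1 by [].
apply: (@lay_pairs nseg (fun x y => ncross x y) (fun x y => nsep x y)) => /=.
- exact: ncrossC.
- exact: nsepC.
- move=> a b; rewrite -/T; lia.
- move=> a b j ha hb /tT hj; rewrite -/T in ha hb *.
  have : w <= m * w by rewrite -{1}(mul1n w) leq_mul2r m0 orbT.
  lia.
- move=> a b i j ha hb /tT hi /tT hj ne; lia.
- move=> a x y d ha hx hy hd; rewrite -/T in ha hx hy *.
  have k1 := monK y T hy; rewrite -/P in k1.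
  rewrite /w2; case od: (odd d) => /=.
    rewrite (_ : d == 0 = false); last by case: d od {hd}.
    have : 0 <= d./2 * w by []. by move=> _; apply/eqP; lia.
  have Ed : d = (d./2).*2 by rewrite -[LHS]odd_double_half od.
  case: (posnP d./2) => [h0|h1].
    rewrite Ed h0 /=; case: ifP => hxa; rewrite ?muln0 ?mul0n; lia.
  rewrite (_ : d == 0 = false) /=; last by lia.
  have := mono 0 d./2 h1; lia.
- move=> a j x y d ha /tT hj hx hy hd; rewrite -/T in ha hx hy *.
  have k1 := monK y T hy; rewrite -/P in k1.
  have k0 := KT a; have ha' : a <= T by lia.
  rewrite /w2; case od: (odd d) => /=.
    rewrite (_ : d == m.*2 = false); last by apply/eqP => E; rewrite E odd_double in od.
    have hb : d./2 < m by have := odd_double_half d; rewrite od; lia.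
    have := mono _ _ hb; apply: contraTneq; lia.
  have Ed : d = (d./2).*2 by rewrite -[LHS]odd_double_half od.
  case: (ltngtP d./2 m) => h; [|by lia|].
    rewrite (_ : d == m.*2 = false) /=; last by lia.
    have := mono _ _ h; lia.
  rewrite Ed h doubleK eqxx /=; case: ifP => hya.
    have := monK y a hya; have := KT a; lia.
  have := monK' a y; lia.
- move=> x y d x' y' d' hx hy hx' hy' hd hd' e ne; rewrite -/T in hx hy hx' hy' *.
  have Ed := odd_double_half d; have Ed' := odd_double_half d'.
  have k1 := monK y T hy; have k2 := monK y' T hy'; rewrite -/P in k1 k2.
  have hb : d./2 <= m by lia. have hb' : d'./2 <= m by lia.
  have n1 := monK y y'; have n2 := monK y' y.
  rewrite /w2; move: Ed Ed'; case: (odd d); case: (odd d') => //= Ed Ed' _.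
  + have -> : ((d' == d.+1) || (d == d'.+1)) = false by lia.
    rewrite andbF; apply/eqP => E.
    have [eb ex] : d./2 = d'./2 /\ x = x'.
      case: (ltngtP d./2 d'./2) => h; [have := mono _ _ h; lia|have := mono _ _ h; lia|].
      by split=> //; move: E; rewrite h; lia.
    by apply: ne; [apply/e|lia].
  + case: (eqVneq y y') => [ey|ny] /=.
      have ex : x = x' by apply/e.
      subst x' y'.
      have -> : (d' == d.+1) || (d == d'.+1) = (d./2 == d'./2) || (d./2 == d'./2.+1) by lia.
      case: (eqVneq d./2 d'./2) => [->|nb] /=; first by lia.
      case: eqP => [->|nb']; first by rewrite mulSnr; lia.
      by lia.
    case: (ltngtP y y') => h; [have := n1 h|have := n2 h|by rewrite h eqxx in ny]; lia.
  + have -> : ((d' == d.+1) || (d == d'.+1)) = false by lia.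
    rewrite andbF; apply/eqP => E.
    have ey : y = y' by case: (ltngtP y y') => h //; [have := n1 h|have := n2 h]; lia.
    apply: (ne ey); subst y'; lia.
Qed.
End TwoLengths.

Section AlmostUnit.
Variables t m M : nat.
Let T := t * t.
Hypothesis hM : 16 * T + 16 <= M.
(** Descending staircases, displaced by [4 * y] in both coordinates, that is, across the descent, so
    that different wires stay apart. Only the left end of the first step depends on [x]; lengths
    exceed [M] by at most [6 * T + 1]. *)
Definition v3 a := NV (2 * a - 1) (m * M + M - 1) (m * M + M + M - 1).
Definition u3 a j := NV (2 * T + m * M + 8 * T + 8 + j) (4 * a - 2) (M + (4 * a - 2)).
Definition w3 x y d :=
  let b := d./2 in
  if odd d then NV (2 * T + b * M + M + 4 * y) ((m - b) * M + 4 * y - 1) ((m - b) * M + M + 4 * y + 1)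
  else NH ((m - b) * M + M + 4 * y) (if b == 0 then 2 * x else 2 * T + b * M + 4 * y - 1)
    (2 * T + b * M + M + 4 * y + 1).

Lemma almost_pairs p q : 0 < m -> okl t m.*2 p -> okl t m.*2 q -> p <> q ->
  if adjl m.*2 p q then is_true (ncross (lay t v3 u3 w3 p) (lay t v3 u3 w3 q))
  else is_true (nsep (lay t v3 u3 w3 p) (lay t v3 u3 w3 q)).
Proof.
move=> m0.
have tT : forall j, j < t -> j < T by move=> j h; apply: leq_trans h _; rewrite /T; nia.
have mono : forall a b, a < b -> a * M + M <= b * M.
  by move=> a b h; rewrite -mulSnr leq_mul2r h orbT.
apply: (@lay_pairs nseg (fun x y => ncross x y) (fun x y => nsep x y)) => /=.
- exact: ncrossC.
- exact: nsepC.
- move=> a b; rewrite -/T; lia.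
- move=> a b j ha hb /tT hj; rewrite -/T in ha hb *; lia.
- move=> a b i j ha hb /tT hi /tT hj ne; lia.
- move=> a x y d ha hx hy hd; rewrite -/T in ha hx hy *.
  rewrite /w3; case od: (odd d) => /=.
    rewrite (_ : d == 0 = false); last by case: d od {hd}.
    by apply/eqP; lia.
  have Ed : d = (d./2).*2 by rewrite -[LHS]odd_double_half od.
  case: (posnP d./2) => [h0|h1].
    rewrite Ed h0 /= subn0; case: ifP => hxa; lia.
  rewrite (_ : d == 0 = false) /=; last by lia.
  have := mono 0 d./2 h1; lia.
- move=> a j x y d ha /tT hj hx hy hd; rewrite -/T in ha hx hy *.
  rewrite /w3; case od: (odd d) => /=.
    rewrite (_ : d == m.*2 = false); last by apply/eqP => E; rewrite E odd_double in od.
    have hb : d./2 < m by have := odd_double_half d; rewrite od; lia.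
    have := mono _ _ hb; apply: contraTneq; lia.
  have Ed : d = (d./2).*2 by rewrite -[LHS]odd_double_half od.
  case: (ltngtP d./2 m) => h; [|by lia|].
    rewrite (_ : d == m.*2 = false) /=; last by lia.
    have := mono 0 (m - d./2); lia.
  rewrite Ed h doubleK eqxx subnn /= (_ : m == 0 = false); last by lia.
  by case: ifP => hya; lia.
- move=> x y d x' y' d' hx hy hx' hy' hd hd' e ne; rewrite -/T in hx hy hx' hy' *.
  have Ed := odd_double_half d; have Ed' := odd_double_half d'.
  have hb : d./2 <= m by lia. have hb' : d'./2 <= m by lia.
  rewrite /w3; move: Ed Ed'; case: (odd d); case: (odd d') => //= Ed Ed' _.
  + have -> : ((d' == d.+1) || (d == d'.+1)) = false by lia.
    rewrite andbF; apply/eqP => E.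
    have eb : d./2 = d'./2.
      case: (ltngtP d./2 d'./2) => h; [have := mono _ _ h; lia|have := mono _ _ h; lia|by []].
    have ey : y = y' by move: E; rewrite eb; lia.
    by apply: (ne ey); lia.
  + have -> : (d' == d.+1) || (d == d'.+1) = (d./2 == d'./2) || (d./2 == d'./2.+1) by lia.
    have hbm : d'./2 < m by lia.
    set b := d./2 in hb *; set b' := d'./2 in hb' hbm *.
    have lo0 : (if b == 0 then 2 * x else 2 * T + b * M + 4 * y - 1) < 2 * T + b * M + 4 * y.
      by case: eqP => [->|_]; lia.
    case: (ltngtP b b') => h.
    * rewrite (_ : b == b'.+1 = false) ?andbF; last by lia.
      have := mono _ _ h; have := mono (m - b') (m - b); lia.
    * case: (eqVneq b b'.+1) => [eb|nb]; last first.
        rewrite andbF; have := mono b'.+1 b; rewrite mulSnr (_ : b == 0 = false); last by lia.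
        lia.
      have hq : m - b' = (m - b'.+1).+1 by lia.
      rewrite eb hq !mulSnr /= ?eqxx ?orbT ?andbT; move: (m - b'.+1) => z.
      by clear lo0 hq; case: (eqVneq y y') => [->|ny] /=; lia.
    * rewrite -h; case: (eqVneq y y') => [ey|ny] /=; last by lia.
      have ex : x = x' by apply/e.
      subst x' y'; rewrite ?eqxx /=; move: lo0; set lo := (if b == 0 then _ else _).
      by move: lo (m - b) => lo z; lia.
  + have -> : ((d' == d.+1) || (d == d'.+1)) = false by lia.
    rewrite andbF; apply/eqP => E.
    have eb : m - d./2 = m - d'./2.
      case: (ltngtP (m - d./2) (m - d'./2)) => h; [have := mono _ _ h; lia|have := mono _ _ h; lia|by []].
    have ey : y = y' by move: E; rewrite eb; lia.
    by apply: (ne ey); lia.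
Qed.
End AlmostUnit.

(** * The class of grids *)

Definition lk k := (k.+1).*2.
(** The least width that [tww_bound] admits for [D = k] and wires of length [lk k]. This length is
    even because the staircases begin and end with a horizontal step. *)
Definition tk k := (k.+1 ^ (lk k).+1 * (k + 4)).+1.
Definition grids (G : sgraph) : Prop :=
  exists k (h : 'I_(nv G) -> label), represents (tk k) (lk k) h.

Lemma grids_hereditary : hereditary grids.
Proof.
move=> G H [k [h [h1 h2 h3]]] [f fi fa]; exists k, (h \o f); split.
- exact: inj_comp.
- by move=> x; exact: h2.
- by move=> x y; rewrite -fa h3.
Qed.

Section FullGrid.
Variables (u l : nat).
Let t := u.+1.
Let T : finType := ('I_t + 'I_t + 'I_t * 'I_t * 'I_l.+1)%type.

Definition lab (x : T) : label :=
  match x with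
  | inl (inl j) => LV j
  | inl (inr j) => LU j
  | inr (s, s', d) => LW s s' d
  end.

Definition unlab (p : label) : T :=
  match p with
  | LV j => inl (inl (inord j))
  | LU j => inl (inr (inord j))
  | LW s s' d => inr (inord s, inord s', inord d)
  end.

Lemma lab_inj : injective lab.
Proof.
case=> [[j|j]|[[s s'] d]] [[i|i]|[[r r'] e]] //= [].
- by move/val_inj ->.
- by move/val_inj ->.
- by move=> /val_inj -> /val_inj -> /val_inj ->.
Qed.

Lemma unlabK p : okl t l p -> lab (unlab p) = p.
Proof.
by case: p => [j|j|s s' d] /=; [move=> h|move=> h|case/and3P=> h1 h2 h3]; rewrite !inordK.
Qed.

Lemma lab_ok x : okl t l (lab x).
Proof. by case: x => [[j|j]|[[s s'] d]] /=; rewrite ?ltn_ord //= -ltnS ltn_ord. Qed.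

Lemma represents_card (G : sgraph) (h : 'I_(nv G) -> label) : represents t l h ->
  nv G <= t + t + t * t * l.+1.
Proof.
case=> hi hok _.
have : injective (fun x => unlab (h x)).
  by move=> x y e; apply: hi; rewrite -(unlabK (hok x)) -(unlabK (hok y)) e.
by move/leq_card; rewrite card_ord /T !card_sum !card_prod !card_ord.
Qed.

Let fadj : 'I_#|T| -> 'I_#|T| -> bool := fun x y => adjl l (lab (enum_val x)) (lab (enum_val y)).

Lemma fadj_sym : symmetric fadj.
Proof. by move=> x y; exact: adjlC. Qed.
Lemma fadj_irr : irreflexive fadj.
Proof.
move=> x; rewrite /fadj /adjl; case: (lab _) => [j|j|s s' d] //=.
by rewrite !eqxx /= orbb; lia.
Qed.

Definition full_grid := SGraph fadj_sym fadj_irr.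

Lemma full_grid_represents : represents t l (fun x : 'I_(nv full_grid) => lab (enum_val x)).
Proof.
split=> //; last by move=> x; exact: lab_ok.
by move=> x y /lab_inj /enum_val_inj.
Qed.

Lemma full_grid_tww D : D.+1 ^ l.+1 * (D + 4) < t -> exists2 w, is_tww full_grid w & D < w.
Proof.
move=> hD.
have n0 : 0 < nv full_grid by apply/card_gt0P; exists (inl (inl ord0)).
have [w hw] := is_tww_exists n0; exists w => //.
have [[s hs <-] _] := hw.
pose vL (j : 'I_t) : 'I_(nv full_grid) := enum_rank (inl (inl j) : T).
pose vR (j : 'I_t) : 'I_(nv full_grid) := enum_rank (inl (inr j) : T).
pose vW (s s' : 'I_t) d : 'I_(nv full_grid) := enum_rank (inr (s, s', inord d) : T).
have ae (x y : T) : @adj full_grid (enum_rank x) (enum_rank y) = adjl l (lab x) (lab y).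
  by rewrite /= /fadj !enum_rankK.
apply: (@tww_bound full_grid t l vL vR vW D s) => //.
- by move=> i j /enum_rank_inj [].
- by move=> i j /enum_rank_inj [].
- by move=> j r r'; rewrite ae /adjl /= inordK // orbF.
- by move=> j r r'; rewrite ae /adjl /= inordK // eqxx orbF.
- move=> r r' q q' d hd; rewrite ae /adjl /= !inordK ?ltnS // ?(ltnW hd) //.
  rewrite eqxx andbT (_ : d == d.+2 = false) ?andbF ?orbF //; lia.
Qed.
End FullGrid.

Lemma grids_unbounded : unbounded_tww grids.
Proof.
move=> k; pose u := k.+1 ^ (lk k).+1 * (k + 4).
have [w hw kw] := @full_grid_tww u (lk k) k (ltnSn _).
exists (full_grid u (lk k)), w; split=> //.
by exists k, (fun x => lab (enum_val x)); exact: full_grid_represents.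
Qed.

(** * Tower bounds and the running time *)

Definition hfun x := 2 ^ (10 * x * x).
Definition Hf r := iter r hfun 2.

(** A type of rank [r.+1] is a set of triples with one of ten letters in the middle, which is where
    [hfun] comes from. *)
Lemma card_Ty r : #|Ty r| = Hf r.
Proof.
elim: r => [|r ih]; first by rewrite card_bool.
rewrite /= -cardsT -powersetT card_powerset cardsT !card_prod card_ord ih /hfun.
by congr (2 ^ _); lia.
Qed.

Lemma hfun_mono x y : x <= y -> hfun x <= hfun y.
Proof. by move=> h; rewrite leq_exp2l // leq_mul // leq_mul2l h orbT. Qed.

Lemma hfun_gt x : x < hfun x.
Proof. by apply: leq_trans (ltn_expl x (ltnSn 1)) _; rewrite leq_exp2l //; nia. Qed.

Lemma Hf_gt r : r.+1 < Hf r.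
Proof. by elim: r => //= r ih; apply: leq_ltn_trans ih (hfun_gt _). Qed.

Lemma Hf_mono r s : r <= s -> Hf r <= Hf s.
Proof.
move=> /subnKC <-; elim: (s - r) => [|d ih]; rewrite ?addn0 // addnS /=.
by apply: leq_trans ih (ltnW (hfun_gt _)).
Qed.

(** The left side is the number of vertices of a full grid, see [represents_card]. *)
Lemma tk_bound k : tk k + tk k + tk k * tk k * (lk k).+1 <= hfun (k + 4).
Proof.
set y := k + 4; set e := 2 * k + 5.
have lE : (lk k).+1 = 2 * k + 3 by rewrite /lk -addnn; lia.
have e0 : 0 < e by rewrite /e; lia.
have p0 : 0 < y ^ (2 * k + 4) by rewrite expn_gt0 /y addn4.
have t1 : tk k <= 2 ^ (y * e).
  apply: leq_trans (_ : y ^ e <= _); last first.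
    by rewrite expnM (leq_exp2r _ _ e0) ltnW // ltn_expl.
  have hA : k.+1 ^ (2 * k + 3) * (k + 4) <= y ^ (2 * k + 4).
    rewrite (_ : 2 * k + 4 = (2 * k + 3).+1); last by lia.
    by rewrite expnSr; apply: leq_mul => //; rewrite leq_exp2r; [rewrite /y; lia|lia].
  have hB : 2 * y ^ (2 * k + 4) <= y ^ e.
    rewrite /e (_ : 2 * k + 5 = (2 * k + 4).+1); last by lia.
    by rewrite expnS leq_mul2r /y addn4 /= orbT.
  by rewrite /tk lE; lia.
apply: leq_trans (_ : tk k * tk k * e <= _).
  by rewrite lE /e; have : 0 < tk k by []; nia.
apply: leq_trans (_ : 2 ^ (y * e) * 2 ^ (y * e) * 2 ^ e <= _).
  by apply: leq_mul; [exact: leq_mul|exact: ltnW (ltn_expl e (ltnSn 1))].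
by rewrite -!expnD leq_exp2l // /e /y; nia.
Qed.

Lemma size_encode_le m (phi : fo m) : size (encode_fo phi) <= 3 * fo_size phi.
Proof.
by elim: phi => {m} //= [m p ih|m p ihp q ihq|m p ihp q ihq|m p ih|m p ih]; rewrite ?size_cat; lia.
Qed.

Lemma grids_guess k (G : sgraph) (h : 'I_(nv G) -> label) th : represents (tk k) (lk k) h ->
  th <= lk k -> exists g0 g1 g2 g3 g4 g5,
  [/\ g0 <= nv G, g1 <= nv G & g2 <= nv G] /\
  [/\ g3 <= nv G, g4 <= nv G, g5 <= nv G & chk (nv G) (adjn G) g0 g1 g2 g3 g4 g5 th].
Proof.
move=> [hi hok hadj] hth.
pose hh x := if insub x is Some y then h y else LV 0.
pose kd x := match hh x with LV _ => 0 | LU _ => 1 | LW _ _ _ => 2 end.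
pose p1 x := match hh x with LV j => j | LU j => j | LW s _ _ => s end.
pose p2 x := match hh x with LW _ s _ => s | _ => 0 end.
pose p3 x := match hh x with LW _ _ d => d | _ => 0 end.
have hhE x (hx : x < nv G) : hh x = h (Ordinal hx) by rewrite /hh insubT.
have labE x y : labadj (lk k) kd p1 p2 p3 x y = ladj (lk k) (hh x) (hh y).
  rewrite /labadj /kd /p1 /p2 /p3.
  by case: (hh x) => [j|j|s s' d]; case: (hh y) => [i|i|r r' e] /=; rewrite ?orbF.
apply: (@guess_complete (nv G) (lk k) (adjn G) kd p1 p2 p3 th) => //.
- move=> x y hx hy; rewrite !labE (hhE x hx) (hhE y hy).
  by rewrite -[x]/(val (Ordinal hx)) -[y]/(val (Ordinal hy)) adjnE hadj.
- by move=> x; rewrite /adjn insubF // ltnn.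
- move=> x hx; rewrite /kd /p3 (hhE x hx); have := hok (Ordinal hx).
  by case: (h _) => //= s s' d /and3P[].
- move=> x y hx hy; rewrite /kd /p1 /p2 /p3 (hhE x hx) (hhE y hy).
  move=> k1 k2 k3; suff /hi [] : h (Ordinal hx) = h (Ordinal hy) by [].
  case: (h _) (h _) k1 k2 k3 => [j|j|s s' d] [i|i|r r' e] //= _.
  + by move=> ->.
  + by move=> ->.
  + by move=> -> /(_ erefl) [-> ->].
Qed.

Lemma nth_allpairs (A B : Type) (f : A -> B -> nat) x0 y0 s r i j : i < size s -> j < size r ->
  nth 0 [seq f x y | x <- s, y <- r] (size r * i + j) = f (nth x0 s i) (nth y0 r j).
Proof.
elim: s i => [//|x s ih] [|i] hi hj.
  by rewrite allpairs_cons muln0 add0n nth_cat size_map hj (nth_map y0).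
rewrite allpairs_cons nth_cat size_map ltnNge mulnS -addnA leq_addr /= addKn.
exact: ih.
Qed.

(** The function [f] needs a machine of its own: cell 1 runs through the iterates of [hfun], each
    power being obtained by doublings. *)
Definition fast_s K : stm := seqs [:: SSet 2 (ECst 1) (ECst 2);
  SFor 0 (EAdd (EAdd (EAdd (EGet 0 (ECst 0)) (EGet 0 (ECst 0))) (EGet 0 (ECst 0))) (ECst 3))
   (seqs [:: SSet 2 (ECst 2) (ECst 1);
     SFor 1 (eMul (eMul (ECst 10) (cell 1)) (cell 1)) (SSet 2 (ECst 2) (EAdd (cell 2) (cell 2)));
     SSet 2 (ECst 1) (cell 2)]);
  SSet 2 (ECst 4) (ECst K);
  SFor 0 (ECst K) (SSet 2 (ECst 4) (eMul (eMul (ECst 9) (cell 1)) (cell 4)));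
  SSet 2 (ECst 0) (EAdd (EAdd (ECst 17) (eMul (ECst 10) (cell 1))) (cell 4))].

(** A formula of size [q] has a code of length at most [3 * q]. The parameter [K] will be the cost
    constant [ks main_s] of the compiled program. *)
Definition fast K q := 17 + 10 * Hf (3 * q + 3) + K * (9 * Hf (3 * q + 3)) ^ K.

Lemma fast_sP K env st : exec env st (fast_s K) 2 0 = fast K (st 0 0).
Proof.
rewrite /fast_s /seqs; cbn [foldr]; rewrite !exec_seq exec_skip.
set s1 := exec env st (SSet _ _ _).
set b1 := EAdd _ (ECst 3); set loop := SSeq (SSet 2 (ECst 2) (ECst 1)) _.
have eb : ev env s1 b1 = 3 * st 0 0 + 3 by rewrite /b1 !evAdd /s1 /= /setst /=; lia.
pose Q v (s : store) := s 2 1 = Hf v.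
have q1 : Q (ev env s1 b1) (exec env s1 (SFor 0 b1 loop)).
  apply: for_ind => // v s _; rewrite /Q /loop => hv.
  rewrite !exec_seq exec_skip.
  set s2 := exec _ s _; set b2 := eMul _ (cell 1).
  have e1 : s2 2 1 = Hf v by rewrite /s2 /= /setst /=.
  have e2 : ev (upd env 0 v) s2 b2 = 10 * Hf v * Hf v.
    by rewrite /b2 !evMulE // evCst evGet evCst e1.
  pose Q2 z (s : store) := s 2 2 = 2 ^ z.
  have : Q2 (ev (upd env 0 v) s2 b2) (exec (upd env 0 v) s2 (SFor 1 b2 (SSet 2 (ECst 2) (EAdd (cell 2) (cell 2))))).
    apply: for_ind => // z s' _; rewrite /Q2 exec_set evAdd !evGet !evCst /setst /= => ->.
    by rewrite addnn -mul2n -expnS.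
  by rewrite /Q2 e2 => h; rewrite exec_set evGet !evCst h /setst.
rewrite /Q eb in q1; set s2 := exec env s1 _ in q1 *.
rewrite exec_set !evCst; set s3 := setst s2 2 4 K.
set Z := Hf _ in q1.
pose Q3 v (s : store) := s 2 4 = K * (9 * Z) ^ v /\ s 2 1 = Z.
have [q2 q3] : Q3 (ev env s3 (ECst K)) (exec env s3 (SFor 0 (ECst K) (SSet 2 (ECst 4) (eMul (eMul (ECst 9) (cell 1)) (cell 4))))).
  apply: for_ind; first by split; rewrite ?muln1 // /s3 /setst.
  move=> v s _ [h1 h2]; rewrite exec_set !evMulE // !evGet !evCst h1 h2; split; last by rewrite /setst.
  by rewrite /setst /= expnS; rewrite mulnCA.
rewrite evCst in q2; rewrite exec_set !evAdd evMulE // !evGet !evCst q2 q3 /setst /=.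
by [].
Qed.

Lemma fast_computable K : computable (fast K).
Proof.
exists (program_of (fast_s K)) => q.
have [st [n [h1 _ h2 _]]] := @program_ofP (fast_s K) isT [:: q].
by exists n; have := h2 n (leqnn n); rewrite /out_tab fast_sP h1.
Qed.

Lemma time_bound K n E Z : E <= Z -> 0 < Z ->
  10 * (n * n + 1 + E) + 7 + K * ((4 * n + 8) * Z).+1 ^ K <=
  (17 + 10 * Z + K * (9 * Z) ^ K) * n.+1 ^ (K + 2).
Proof.
move=> hE Z0; rewrite [leqRHS]mulnDl; apply: leq_add.
  apply: leq_trans (_ : (17 + 10 * Z) * n.+1 ^ 2 <= _); last first.
    by rewrite leq_mul2l leq_pexp2l ?orbT // leq_addl.
  by rewrite -mulnn; nia.
rewrite -mulnA leq_mul2l; apply/orP; right.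
apply: leq_trans (_ : (9 * Z * n.+1) ^ K <= _).
  by case: K => // K; rewrite leq_exp2r //; nia.
by rewrite expnMn leq_mul2l leq_pexp2l ?orbT // leq_addr.
Qed.

Theorem grids_fpt : fo_model_checking_fpt grids.
Proof.
set K := ks main_s.
exists (program_of main_s), (fast K), (K + 2); split; first exact: fast_computable.
move=> G phi [k [h rep]].
set w := encode_graph G ++ encode_fo phi.
pose n := nv G; pose E := size (encode_fo phi).
have wm : wfs main_s by vm_compute.
have [st [N0 [s0 s1 hrun htime]]] := @program_ofP main_s wm w.
have sg : size (encode_graph G) = (n * n).+1 by rewrite /= size_allpairs size_enum_ord.
have h00 : st 0 0 = n by rewrite s0.
have h10 : st 1 0 = n * n + 1 + E by rewrite s1 size_cat sg addn1.
have hin x y : x < n -> y < n -> st 0 (n * x + y + 1) = adjn G x y.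
  move=> hx hy; rewrite s0 /w nth_cat sg addn1 ltnS.
  have hxy : n * x + y < n * n by nia.
  rewrite hxy /= -{1}(size_enum_ord n) (nth_allpairs _ (Ordinal hx) (Ordinal hy)) ?size_enum_ord //.
  by rewrite -adjnE !nth_enum_ord.
have hF i : i < E -> st 0 (n * n + 1 + i) = nth 0 (encode_fo phi) i.
  by move=> hi; rewrite s0 /w nth_cat sg addn1 ltnNge leq_addr /= addKn.
have aout x y : ~~ ((x < n) && (y < n)) -> adjn G x y = false.
  rewrite /adjn negb_and => /orP[] hx; first by rewrite insubF //; exact: negbTE.
  by case: insub => // ?; rewrite insubF //; exact: negbTE.
have airr x : adjn G x x = false.
  by rewrite /adjn; case: insub => // y; exact: adj_irr.
have asym x y : adjn G x y = adjn G y x.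
  by rewrite /adjn; case: insubP => [u hu eu|_]; case: insubP => [u' hu' eu'|_] //; exact: adj_sym.
pose v := (fun i : nat => nth 0 ([::] : seq nat) i).
have [hout [N hN hB]] := @main_sP n (adjn G) phi aout airr asym (fun _ => 0) st v h00 h10 hin hF.
have -> : nat_of_bool (models G phi) = exec (fun _ => 0) st main_s 2 0.
  by rewrite hout /models sat_satn; congr nat_of_bool; exact: satn_ext.
apply: hrun; set q := fo_size phi.
have E3 : E <= 3 * q := size_encode_le phi.
set z := Hf (3 * q + 2).
have zE : Hf (3 * q + 3) = hfun z by rewrite /z addnS.
(* Either the structure is a shortened word, or all guesses failed; then the wires are shorter than
   [2 ^ E.+1], which bounds [k] and with it the whole grid. *)
have hNz : N <= z.
  case: hN => [hN|[-> ng]].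
    by apply: leq_trans hN _; rewrite card_Ty; apply: Hf_mono; rewrite -/E; lia.
  have lkE : lk k < 2 ^ E.+1.
    rewrite ltnNge; apply/negP => hl.
    have [g0 [g1 [g2 [g3 [g4 [g5 [[b0 b1 b2] [b3 b4 b5 hc]]]]]]]] := grids_guess rep hl.
    by have := ng g0 g1 g2 g3 g4 g5 b0 b1 b2 b3 b4 b5; rewrite hc.
  apply: leq_trans (represents_card rep) _; apply: leq_trans (tk_bound k) _.
  apply: leq_trans (_ : hfun (hfun (Hf E)) <= _); last first.
    by rewrite -!/(Hf _.+1); apply: (@Hf_mono E.+2); rewrite addn2; lia.
  apply: hfun_mono; apply: leq_trans (_ : 2 ^ E.+2 <= _).
    have p0 : 0 < 2 ^ E by rewrite expn_gt0.
    by move: lkE; rewrite /lk -addnn !expnS; lia.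
  rewrite leq_exp2l //; have := Hf_gt E; nia.
have zz : 3 * q + 3 < z by have := Hf_gt (3 * q + 2); rewrite -/z; lia.
have hz := hfun_gt z.
(* The factor [4 * n + 8] covers the loops of the parser and [hfun z] those of the evaluation, up to
   [N.+1 ^ E]. *)
apply: leq_trans (htime ((4 * n + 8) * hfun z) _) _.
  have le1 x : x <= hfun z -> x <= (4 * n + 8) * hfun z.
    by move=> hx; apply: leq_trans hx _; apply: leq_pmull; rewrite addn_gt0 orbT.
  apply: hB.
  - by apply: leq_pmulr; rewrite expn_gt0.
  - by apply: le1; rewrite -/E; lia.
  - by apply: le1; lia.
  - apply: le1; apply: leq_trans (_ : (2 ^ z) ^ z <= _).
      apply: leq_trans (_ : (2 ^ z) ^ (size (encode_fo phi)) <= _).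
        rewrite leq_exp2r; last exact: size_encode_gt0.
        by apply: leq_ltn_trans hNz _; rewrite ltn_expl.
      by rewrite leq_pexp2l ?expn_gt0 // -/E; lia.
    by rewrite -expnM leq_exp2l //; nia.
have -> : size w = n * n + 1 + E by rewrite /w size_cat sg -/E addn1.
rewrite /fast zE; apply: time_bound; last by rewrite expn_gt0.
by lia.
Qed.

From mathcomp Require Import all_boot all_order all_algebra.
From mathcomp Require Import reals trigo.
From mathcomp Require Import ring lra.
Import Order.TTheory GRing.Theory Num.Theory.
Local Open Scope ring_scope.

(** * Segments *)

Section Geometry.
Variable R : realType.

(* A vertical segment [u = c], and segments on the lines [v = c], [v = c + u] and
   [v = c - u], before the axes are rescaled. *)
Inductive gseg := GV of R & R & R | GH of R & R & R | GU of R & R & R | GD of R & R & R.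

Definition wf (g : gseg) : bool :=
  match g with GV _ lo hi | GH _ lo hi | GU _ lo hi | GD _ lo hi => lo < hi end.

Definition gin (g : gseg) (u v : R) : Prop :=
  match g with
  | GV c lo hi => u = c /\ lo <= v <= hi
  | GH c lo hi => v = c /\ lo <= u <= hi
  | GU c lo hi => v = c + u /\ lo <= u <= hi
  | GD c lo hi => v = c - u /\ lo <= u <= hi
  end.

Definition gline (g : gseg) (u v : R) : Prop :=
  match g with
  | GV c _ _ => u = c
  | GH c _ _ => v = c
  | GU c _ _ => v = c + u
  | GD c _ _ => v = c - u
  end.

Definition gends (g : gseg) : (R * R) * (R * R) :=
  match g with
  | GV c lo hi => ((c, lo), (c, hi))
  | GH c lo hi => ((lo, c), (hi, c))
  | GU c lo hi => ((lo, c + lo), (hi, c + hi))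
  | GD c lo hi => ((lo, c - lo), (hi, c - hi))
  end.

(** The crossing point is interior to both segments. For [GU] and [GD] its first coordinate is half
    the difference of the constants, and the inequalities are doubled to avoid the division. *)
Definition cross (g g' : gseg) : Prop :=
  match g, g' with
  | GV c lo hi, GH c' lo' hi' | GH c' lo' hi', GV c lo hi =>
      lo' < c < hi' /\ lo < c' < hi
  | GV c lo hi, GU c' lo' hi' | GU c' lo' hi', GV c lo hi =>
      lo' < c < hi' /\ lo < c' + c < hi
  | GV c lo hi, GD c' lo' hi' | GD c' lo' hi', GV c lo hi =>
      lo' < c < hi' /\ lo < c' - c < hi
  | GU c lo hi, GD c' lo' hi' | GD c' lo' hi', GU c lo hi =>
      lo + lo < c' - c < hi + hi /\ lo' + lo' < c' - c < hi' + hi'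
  | _, _ => False
  end.

(** For parallel segments different lines are demanded, more than disjointness, because general
    position forbids collinear segments. *)
Definition sep (g g' : gseg) : Prop :=
  match g, g' with
  | GV c _ _, GV c' _ _ | GH c _ _, GH c' _ _ | GU c _ _, GU c' _ _ | GD c _ _, GD c' _ _ =>
      c <> c'
  | GV c lo hi, GH c' lo' hi' | GH c' lo' hi', GV c lo hi =>
      [\/ c < lo', hi' < c, c' < lo | hi < c']
  | GV c lo hi, GU c' lo' hi' | GU c' lo' hi', GV c lo hi =>
      [\/ c < lo', hi' < c, c' + c < lo | hi < c' + c]
  | GV c lo hi, GD c' lo' hi' | GD c' lo' hi', GV c lo hi =>
      [\/ c < lo', hi' < c, c' - c < lo | hi < c' - c]
  | GU c lo hi, GD c' lo' hi' | GD c' lo' hi', GU c lo hi =>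
      [\/ c' - c < lo + lo, hi + hi < c' - c, c' - c < lo' + lo' | hi' + hi' < c' - c]
  | _, _ => False
  end.

Lemma crossC g g' : cross g g' -> cross g' g.
Proof. by case: g => ???; case: g' => ???. Qed.

Lemma sepC g g' : sep g g' -> sep g' g.
Proof. by case: g => c ??; case: g' => c' ?? //= h e; apply: h. Qed.

Lemma cross_meet g g' : cross g g' -> exists u v, gin g u v /\ gin g' u v.
Proof.
case: g => c lo hi; case: g' => c' lo' hi' //= [/andP[h1 h2] /andP[h3 h4]].
- by exists c, c'; rewrite !ltW.
- by exists c, (c' + c); rewrite !ltW.
- by exists c, (c' - c); rewrite !ltW.
- by exists c', c; rewrite !ltW.
- by exists c', (c + c'); rewrite !ltW.
- by exists ((c' - c) / 2), ((c' + c) / 2); repeat split; try apply/andP; try split; lra.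
- by exists c', (c - c'); rewrite !ltW.
- by exists ((c - c') / 2), ((c' + c) / 2); repeat split; try apply/andP; try split; lra.
Qed.

Lemma sep_disjoint g g' u v : sep g g' -> gin g u v -> gin g' u v -> False.
Proof.
case: g => c lo hi; case: g' => c' lo' hi' //=.
all: try by move=> h [e1 _] [e2 _]; apply: h; lra.
all: by case=> h [e1 /andP[h1 h2]] [e2 /andP[h3 h4]]; lra.
Qed.

Lemma cross_ends g g' : cross g g' ->
  ~ gin g (gends g').1.1 (gends g').1.2 /\ ~ gin g (gends g').2.1 (gends g').2.2.
Proof.
case: g => c lo hi; case: g' => c' lo' hi' //= [/andP[h1 h2] /andP[h3 h4]].
all: by split=> -[e /andP[h5 h6]]; lra.
Qed.

Lemma gline_ends g g' : wf g' -> cross g g' \/ sep g g' ->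
  ~ (gline g (gends g').1.1 (gends g').1.2 /\ gline g (gends g').2.1 (gends g').2.2).
Proof.
case: g => c lo hi; case: g' => c' lo' hi' /= h [] //.
all: try by move=> _ [e1 e2]; lra.
all: by move=> n [e1 e2]; apply: n; lra.
Qed.

Section Scaled.
Variables (al be : R).
Hypotheses (al0 : 0 < al) (be0 : 0 < be).

(** Scaling the axes separately turns the slopes 1 and -1 into [be / al] and its negative. *)
Definition seg_of (g : gseg) : segment R :=
  ((al * (gends g).1.1, be * (gends g).1.2), (al * (gends g).2.1, be * (gends g).2.2)).

Lemma scaleP (z : point R) : z = (al * (z.1 / al), be * (z.2 / be)).
Proof. by case: z => x y /=; congr pair; field; rewrite gt_eqF. Qed.

Lemma cancel_al x y : al * x = al * y -> x = y.
Proof. by apply: mulfI; rewrite gt_eqF. Qed.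
Lemma cancel_be x y : be * x = be * y -> x = y.
Proof. by apply: mulfI; rewrite gt_eqF. Qed.

Lemma convex_param (lo hi u : R) : lo < hi -> lo <= u <= hi ->
  exists2 k : R, 0 <= k <= 1 & u = (1 - k) * lo + k * hi.
Proof.
move=> h /andP[h1 h2]; have d : 0 < hi - lo by lra.
exists ((u - lo) / (hi - lo)).
  apply/andP; split; first by apply: divr_ge0; lra.
  by rewrite ler_pdivrMr // mul1r; lra.
by field; rewrite gt_eqF.
Qed.

Lemma convex_range (lo hi k : R) : lo < hi -> 0 <= k <= 1 ->
  lo <= (1 - k) * lo + k * hi <= hi.
Proof. by move=> h /andP[h1 h2]; apply/andP; split; nra. Qed.

Lemma on_segP g u v : wf g -> on_segment (seg_of g) (al * u, be * v) <-> gin g u v.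
Proof.
move=> w; split.
  case=> k hk [] /= e1 e2.
  have E1 : u = (1 - k) * (gends g).1.1 + k * (gends g).2.1.
    by apply: cancel_al; rewrite e1; ring.
  have E2 : v = (1 - k) * (gends g).1.2 + k * (gends g).2.2.
    by apply: cancel_be; rewrite e2; ring.
  by case: g w E1 E2 {e1 e2} => c lo hi /= w -> ->; split; try ring;
    exact: convex_range.
case: g w => c lo hi /= w [e] /(convex_param w) [k hk E]; exists k => //=;
  by congr pair; rewrite ?e ?E; ring.
Qed.

Lemma on_lineP g u v : wf g -> on_line (seg_of g) (al * u, be * v) -> gline g u v.
Proof.
have al' : al != 0 by rewrite gt_eqF.
have be' : be != 0 by rewrite gt_eqF.
case: g => c lo hi /= w; rewrite /on_line /=.
- move=> e; apply/eqP; rewrite -subr_eq0; apply/eqP.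
  have : (al * be * (hi - lo)) * (u - c) = 0 by move: e; lra.
  move/eqP; rewrite !mulf_eq0 (negbTE al') (negbTE be') /=.
  by rewrite subr_eq0 (gt_eqF w) /= => /eqP.
- move=> e; apply/eqP; rewrite -subr_eq0; apply/eqP.
  have : (al * be * (hi - lo)) * (v - c) = 0 by move: e; lra.
  move/eqP; rewrite !mulf_eq0 (negbTE al') (negbTE be') /=.
  by rewrite subr_eq0 (gt_eqF w) /= => /eqP.
- move=> e; apply/eqP; rewrite -subr_eq0; apply/eqP.
  have : (al * be * (hi - lo)) * (v - (c + u)) = 0 by move: e; lra.
  move/eqP; rewrite !mulf_eq0 (negbTE al') (negbTE be') /=.
  by rewrite subr_eq0 (gt_eqF w) /= => /eqP.
- move=> e; apply/eqP; rewrite -subr_eq0; apply/eqP.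
  have : (al * be * (hi - lo)) * (v - (c - u)) = 0 by move: e; lra.
  move/eqP; rewrite !mulf_eq0 (negbTE al') (negbTE be') /=.
  by rewrite subr_eq0 (gt_eqF w) /= => /eqP.
Qed.

Lemma intersectP g g' : wf g -> wf g' ->
  intersect (seg_of g) (seg_of g') <-> exists u v, gin g u v /\ gin g' u v.
Proof.
move=> w w'; split.
  case=> z h h'; rewrite (scaleP z) in h h'; exists (z.1 / al), (z.2 / be).
  by rewrite -!on_segP.
by case=> u [v [h h']]; exists (al * u, be * v); rewrite on_segP.
Qed.

(** Adjacent segments cross in interior points, so no endpoint lies on another segment, and three
    segments through one point would give a triangle in the graph. *)
Lemma realise_general t l (G : sgraph) (h : 'I_(nv G) -> label) (g : label -> gseg) :
  (0 < l)%N -> represents t l h -> (forall p, okl t l p -> wf (g p)) ->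
  (forall p q, okl t l p -> okl t l q -> p <> q ->
     if adjl l p q then cross (g p) (g q) else sep (g p) (g q)) ->
  realises (fun x => seg_of (g (h x))) /\ general_position (fun x => seg_of (g (h x))).
Proof.
move=> l0 [hi hok hadj] hw hg.
have hne i j : i != j -> h i <> h j by move=> /eqP ne /hi.
have pr i j : i != j -> if adj i j then cross (g (h i)) (g (h j)) else sep (g (h i)) (g (h j)).
  by move=> ij; rewrite hadj; apply: hg => //; exact: hne.
have w i : wf (g (h i)) by exact: hw.
have rl : realises (fun x => seg_of (g (h x))).
  move=> i j; case: (eqVneq i j) => [->|ij]; first by rewrite adj_irr; split=> // -[].
  have := pr i j ij; case: (adj i j) => hc; split=> //.
    by split=> //; apply/intersectP => //; exact: cross_meet.
  by case=> _ /intersectP [] // u [v [g1 g2]]; case: (sep_disjoint hc g1 g2).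
split=> //; split.
- move=> i j ij [h1 h2].
  apply: (@gline_ends (g (h i)) (g (h j))) => //.
    by have := pr i j ij; case: (adj i j); [left|right].
  by split; apply: on_lineP.
- move=> i j ij; case E: (adj i j); last first.
    split=> hs.
      suff : adj i j by rewrite E.
      apply/rl; split=> //; exists (seg_of (g (h j))).1 => //.
      by exists 0; rewrite ?lexx ?ler01 //= !subr0 !mul1r !mul0r !addr0 -?surjective_pairing.
    suff : adj i j by rewrite E.
    apply/rl; split=> //; exists (seg_of (g (h j))).2 => //.
    by exists 1; rewrite ?lexx ?ler01 //= !subrr !mul1r !mul0r !add0r -?surjective_pairing.
  have := pr i j ij; rewrite E => hc; have [c1 c2] := cross_ends hc.
  by split; rewrite on_segP.
- move=> i j k z ij jk ik [z1 z2 z3].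
  have ad a b : a != b -> on_segment (seg_of (g (h a))) z -> on_segment (seg_of (g (h b))) z ->
    adjl l (h a) (h b) by move=> ab za zb; rewrite -hadj; apply/rl; split=> //; exists z.
  exact: (adjl_triangle l0 (ad i j ij z1 z2) (ad j k jk z2 z3) (ad i k ik z1 z3)).
Qed.

End Scaled.
End Geometry.

(** * The layout with three directions *)

Section ThreeDirections.
Variables (R : realType) (t m : nat) (La : R).
Variables (T C M w : nat).
Hypotheses (hT : (t * t)%N = T) (hC : (C = 2 * T + 12)%N)
  (hM : (M = 2 * (C * T) + 8 * T + 16)%N) (hw : (w + 2 = M)%N).
Hypothesis hLa : M%:R <= La.
(* Consecutive steps of a zigzag overlap by two units of [1 / M], so that their
   pieces cross properly. *)
Definition v4 a : gseg R := GV (2 * a - 1)%N%:R 0 La.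
(** The top is raised by [2 * j] because the segment meets the rising last steps [2 * j] further to
    the right. *)
Definition u4 a j : gseg R :=
  GV (m.*2 * w + 2 * T + 3 + 2 * j)%N%:R ((C * a + 4 + 2 * j)%N%:R - La) (C * a + 4 + 2 * j)%N%:R.
(** A zigzag that rises for even [d] and falls for odd [d]; steps of equal parity are parallel.
    Wires are [C] apart vertically, more than the shifts [2 * x] can compensate. *)
Definition w4 x y d : gseg R :=
  let st := (d * w + 2 * x)%N in
  if odd d then GD (1 + C * y + M + st)%N%:R st%:R (st + M)%N%:R
  else GU ((1 + C * y)%N%:R - st%:R) st%:R (st + M)%N%:R.

Lemma ltN (x y : nat) : (x < y)%N -> x%:R < y%:R :> R.
Proof. by rewrite ltr_nat. Qed.
Lemma leN (x y : nat) : (x <= y)%N -> x%:R <= y%:R :> R.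
Proof. by rewrite ler_nat. Qed.

Lemma three_pairs p q : (0 < m)%N -> okl t m.*2 p -> okl t m.*2 q -> p <> q ->
  if adjl m.*2 p q then cross (lay t v4 u4 w4 p) (lay t v4 u4 w4 q)
  else sep (lay t v4 u4 w4 p) (lay t v4 u4 w4 q).
Proof.
move=> m0.
have tT : forall j, (j < t -> j < T)%N by move=> j h; apply: leq_trans h _; rewrite -hT; nia.
have mono : forall a b, (a < b -> a * w + w <= b * w)%N.
  by move=> a b h; rewrite -mulSnr leq_mul2r h orbT.
have monC : forall a b, (a < b -> C * a + C <= C * b)%N.
  by move=> a b h; rewrite -mulnSr leq_mul2l h orbT.
have CT : (12 * T <= C * T)%N by rewrite leq_mul2r; apply/orP; right; lia.
have inj (x y : nat) : x%:R = y%:R :> R -> x = y by move/eqP; rewrite eqr_nat => /eqP.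
apply: (@lay_pairs (gseg R) (@cross R) (@sep R)) => /=.
- exact: crossC.
- exact: sepC.
- move=> a b; rewrite ?hT => ha hb ne /inj; lia.
- by move=> a b j ha hb /tT hj /inj; rewrite ?hT in ha hb *; lia.
- by move=> a b i j ha hb /tT hi /tT hj ne /inj; lia.
- move=> a x y d ha hx hy hd; rewrite ?hT in ha hx hy *.
  have k1 := monC y T hy.
  rewrite /w4; case od: (odd d) => /=.
    rewrite (_ : d == 0 = false)%N /=; last by case: d od {hd}.
    apply: Or41; apply: ltN; have := mono 0%N d; case: d od {hd} => // d _ /(_ isT); lia.
  case: d od hd => [|d] od hd /=; last first.
    by apply: Or41; apply: ltN; have := mono 0%N d.+1 isT; lia.
  rewrite mul0n add0n; case: ifP => hxa.
    split; first by rewrite !ltr_nat; lia.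
    have h1 : ((2 * x)%:R <= (1 + C * y + (2 * a - 1))%N%:R :> R) by apply: leN; lia.
    have h2 : ((1 + C * y + (2 * a - 1))%N%:R < (2 * x)%:R + M%:R :> R).
      by rewrite -natrD; apply: ltN; lia.
    have h3 : ((2 * x)%:R < (1 + C * y + (2 * a - 1))%N%:R :> R) by apply: ltN; lia.
    by move: h1 h2 h3 hLa; rewrite !natrD => h1 h2 h3 h4; apply/andP; split; lra.
  by apply: Or41; apply: ltN; lia.
- move=> a j x y d ha /tT hj hx hy hd; rewrite ?hT in ha hx hy *.
  have k1 := monC y T hy; have k2 : (C * a <= C * T)%N by rewrite leq_mul2l; lia.
  case: (eqVneq d m.*2) => [->|nd] /=; last first.
    have h : (d < m.*2)%N by rewrite ltn_neqAle nd.
    have := mono _ _ h => k.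
    by rewrite /w4; case: (odd d); apply: Or42; apply: ltN; lia.
  rewrite /w4 odd_double /=; set W := (m.*2 * w)%N.
  case: ifP => hya.
    have k3 := monC y a hya.
    split; first by rewrite !ltr_nat; lia.
    have h1 : ((1 + C * y + (2 * T + 3 + 2 * j))%N%:R < (C * a + 4 + 2 * j)%N%:R + (2 * x)%N%:R :> R).
      by rewrite -natrD; apply: ltN; lia.
    have h2 : ((C * a + 4 + 2 * j)%N%:R + (2 * x)%N%:R < M%:R + (1 + C * y + (2 * T + 3 + 2 * j))%N%:R :> R).
      by rewrite -!natrD; apply: ltN; lia.
    by move: h1 h2 hLa; rewrite !natrD => h1 h2 h3; apply/andP; split; lra.
  have k3 : (C * a <= C * y)%N by rewrite leq_mul2l; lia.
  apply: Or44.
  have h1 : ((C * a + 4 + 2 * j)%N%:R + (2 * x)%N%:R < (1 + C * y + (2 * T + 3 + 2 * j))%N%:R :> R).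
    by rewrite -natrD; apply: ltN; lia.
  by move: h1; rewrite !natrD => h1; lra.
- move=> x y d x' y' d' hx hy hx' hy' hd hd' e ne; rewrite ?hT in hx hy hx' hy' *.
  have k1 := monC y T hy; have k2 := monC y' T hy'.
  have n1 := monC y y'; have n2 := monC y' y.
  have md := mono d d'; have md' := mono d' d.
  rewrite /w4; case od: (odd d); case od': (odd d') => //= _.
  + rewrite (_ : ((d' == d.+1) || (d == d'.+1)) = false); last first.
      by apply/negbTE/negP => /orP[] /eqP E; move: od od'; rewrite E /=; case: (odd _).
    rewrite andbF => /inj E.
    have ed : d = d' by case: (ltngtP d d') => h //; [have := md h|have := md' h]; lia.
    subst d'; have ey : y = y' by case: (ltngtP y y') => h //; [have := n1 h|have := n2 h]; lia.
    exact: (ne ey).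
  + have nd : d <> d' by move=> E; rewrite E od' in od.
    case: (ltngtP d d') => h; [| |by case: nd].
      rewrite (_ : d == d'.+1 = false) ?orbF; last by lia.
      case: (eqVneq d' d.+1) => [E|nE]; last first.
        rewrite andbF; have := mono d.+1 d'; rewrite mulSnr => k; apply: Or43.
        have h1 : ((1 + C * y' + M + (d' * w + 2 * x') + (d * w + 2 * x))%N%:R <
            (1 + C * y)%N%:R + (d' * w + 2 * x')%N%:R + (d' * w + 2 * x')%N%:R :> R).
          by rewrite -!natrD; apply: ltN; lia.
        by move: h1; rewrite !natrD => h1; lra.
      rewrite E mulSnr andbT; set W := (d * w)%N; case: (eqVneq y y') => [ey|ny].
        have ex : x = x' by apply/e. 
        subst x' y'.
        have h0 : M%:R = w%:R + 2 :> R by rewrite -hw natrD.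
        have h1 : 16 <= M%:R :> R by rewrite (ler_nat _ 16); lia.
        by rewrite !natrD; split; apply/andP; split; lra.
      case: (ltngtP y y') => hy1; [| |by rewrite hy1 eqxx in ny].
        apply: Or42; have := n1 hy1 => k.
        have h1 : ((W + 2 * x + M + (W + 2 * x + M) + (1 + C * y))%N%:R <
            (1 + C * y' + M + (W + w + 2 * x') + (W + 2 * x))%N%:R :> R) by apply: ltN; lia.
        by move: h1; rewrite !natrD => h1; lra.
      apply: Or43; have := n2 hy1 => k.
      have h1 : ((1 + C * y' + M + (W + w + 2 * x') + (W + 2 * x))%N%:R <
        (W + w + 2 * x' + (W + w + 2 * x') + (1 + C * y))%N%:R :> R) by apply: ltN; lia.
      by move: h1; rewrite !natrD => h1; lra.
    rewrite (_ : d' == d.+1 = false) /=; last by lia.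
    case: (eqVneq d d'.+1) => [E|nE]; last first.
      rewrite andbF; have := mono d'.+1 d; rewrite mulSnr => k; apply: Or41.
      have h1 : ((1 + C * y' + M + (d' * w + 2 * x') + (d * w + 2 * x))%N%:R <
            ((1 + C * y) + (d * w + 2 * x) + (d * w + 2 * x))%N%:R :> R).
        by apply: ltN; lia.
      by move: h1; rewrite !natrD => h1; lra.
    rewrite E mulSnr andbT; set W := (d' * w)%N; case: (eqVneq y y') => [ey|ny].
      have ex : x = x' by apply/e. 
      subst x' y'.
      have h0 : M%:R = w%:R + 2 :> R by rewrite -hw natrD.
      have h1 : 16 <= M%:R :> R by rewrite (ler_nat _ 16); lia.
      by rewrite !natrD; split; apply/andP; split; lra.
    case: (ltngtP y y') => hy1; [| |by rewrite hy1 eqxx in ny].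
      apply: Or44; have := n1 hy1 => k.
      have h1 : ((W + 2 * x' + M + (W + 2 * x' + M) + (1 + C * y))%N%:R <
            (1 + C * y' + M + (W + 2 * x') + (W + w + 2 * x))%N%:R :> R) by apply: ltN; lia.
      by move: h1; rewrite !natrD => h1; lra.
    apply: Or41; have := n2 hy1 => k.
    have h1 : ((1 + C * y' + M + (W + 2 * x') + (W + w + 2 * x))%N%:R <
        (W + w + 2 * x + (W + w + 2 * x) + (1 + C * y))%N%:R :> R) by apply: ltN; lia.
    by move: h1; rewrite !natrD => h1; lra.
  + rewrite (_ : ((d' == d.+1) || (d == d'.+1)) = false); last first.
      by apply/negbTE/negP => /orP[] /eqP E; move: od od'; rewrite E /=; case: (odd _).
    rewrite andbF => E0.
    have E : (1 + C * y + (d' * w + 2 * x') = 1 + C * y' + (d * w + 2 * x))%N.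
      by apply: inj; move: E0; rewrite !natrD => E0; lra.
    have ed : d = d' by case: (ltngtP d d') => h //; [have := md h|have := md' h]; lia.
    subst d'; have ey : y = y' by case: (ltngtP y y') => h //; [have := n1 h|have := n2 h]; lia.
    exact: (ne ey).
Qed.
End ThreeDirections.

(** * The four realisations *)

Section Realise.
Variable R : realType.

Definition of_nseg (g : nseg) : gseg R :=
  match g with
  | NV c lo hi => GV c%:R lo%:R hi%:R
  | NH c lo hi => GH c%:R lo%:R hi%:R
  end.

Lemma ncross_cross g g' : ncross g g' -> cross (of_nseg g) (of_nseg g').
Proof. by case: g => ???; case: g' => ??? //= /andP[]; rewrite !ltr_nat. Qed.

Lemma nsep_sep g g' : nsep g g' -> sep (of_nseg g) (of_nseg g').
Proof.
case: g => c lo hi; case: g' => c' lo' hi' /=; rewrite ?ltr_nat.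
all: try by move=> h /eqP; rewrite eqr_nat (negbTE h).
all: by case/or4P => h; [apply: Or41|apply: Or42|apply: Or43|apply: Or44].
Qed.

Lemma nwf_wf g : nwf g -> wf (of_nseg g).
Proof. by case: g => ??? /=; rewrite ltr_nat. Qed.

Lemma axis_of_nseg (al be : R) g : axis_parallel (seg_of al be (of_nseg g)).
Proof. by case: g => ???; [right|left]. Qed.

Lemma length_nseg (M : nat) g : nwf g -> (0 < M)%N ->
  seg_length (seg_of M%:R^-1 M%:R^-1 (of_nseg g)) = (nlen g)%:R / M%:R.
Proof.
move=> w M0; have M0' : 0 < M%:R :> R by rewrite ltr0n.
have aux (lo hi : nat) : (lo < hi)%N ->
    Num.sqrt ((M%:R^-1 * hi%:R - M%:R^-1 * lo%:R) ^+ 2) = (hi - lo)%N%:R / M%:R :> R.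
  move=> h; rewrite -mulrBr sqrtr_sqr ger0_norm; last first.
    by rewrite mulr_ge0 ?invr_ge0 ?ler0n // subr_ge0 ler_nat ltnW.
  by rewrite natrB ?(ltnW h) // mulrC.
by case: g w => c lo hi /= w; rewrite /seg_length /= subrr expr0n /= ?add0r ?addr0 aux.
Qed.

Lemma nmeet_intersect (al be : R) g g' : 0 < al -> 0 < be -> nwf g -> nwf g' ->
  nmeet g g' <-> intersect (seg_of al be (of_nseg g)) (seg_of al be (of_nseg g')).
Proof.
move=> a0 b0 w w'; rewrite intersectP //; try exact: nwf_wf.
case: g w => c lo hi /= w; case: g' w' => c' lo' hi' /= w'; split.
- case/and3P=> /eqP -> h1 h2; exists c'%:R, (maxn lo lo')%:R.
  by rewrite !ler_nat leq_maxl leq_maxr !geq_max h1 h2 (ltnW w) (ltnW w').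
- case=> u [v [[-> /andP[h1 h2]] [/eqP h /andP[h3 h4]]]].
  move: h; rewrite eqr_nat => ->; rewrite -!(ler_nat R) /=.
  by apply/andP; split; lra.
- by case/andP=> /andP[h1 h2] /andP[h3 h4]; exists c%:R, c'%:R; rewrite !ler_nat h1 h2 h3 h4.
- case=> u [v [[eu k] [ev k']]]; move: k k'; rewrite eu ev !ler_nat => -> ->; by [].
- by case/andP=> /andP[h1 h2] /andP[h3 h4]; exists c'%:R, c%:R; rewrite !ler_nat h1 h2 h3 h4.
- case=> u [v [[eu k] [ev k']]]; move: k k'; rewrite eu ev !ler_nat => -> ->; by [].
- case/and3P=> /eqP -> h1 h2; exists (maxn lo lo')%:R, c'%:R.
  by rewrite !ler_nat leq_maxl leq_maxr !geq_max h1 h2 (ltnW w) (ltnW w').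
- case=> u [v [[-> /andP[h1 h2]] [/eqP h /andP[h3 h4]]]].
  move: h; rewrite eqr_nat => ->; rewrite -!(ler_nat R) /=.
  by apply/andP; split; lra.
Qed.

Lemma invM (M : nat) : (0 < M)%N -> 0 < M%:R^-1 :> R.
Proof. by move=> h; rewrite invr_gt0 ltr0n. Qed.

Variables (t m : nat).
Hypotheses (m0 : (0 < m)%N).
Variables (G : sgraph) (h : 'I_(nv G) -> label).
Hypothesis rep : represents t m.*2 h.

(** The mere existence of a vertex makes the scale positive. *)
Lemma nempty_t x : okl t m.*2 x -> (0 < t * t)%N.
Proof. by case: x => [j|j|s s' d] /=; [move=> hj|move=> hj|case/andP=> hj _]; rewrite muln_gt0 (leq_ltn_trans _ hj). Qed.

Theorem realise1 : unit_axis_parallel_graph R G.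
Proof.
have [hi hok hadj] := rep.
pose g x := lay t (v1 t) (u1 t m.*2) (w1 t) (h x).
have T0 (x : 'I_(nv G)) : (0 < t * t)%N := nempty_t (hok x).
have wg x : nwf (g x).
  by have := T0 x; rewrite /g; case: (h x) => [j|j|s s' d] /=; lia.
have lg x : nlen (g x) = (8 * (t * t))%N.
  by have := T0 x; rewrite /g; case: (h x) => [j|j|s s' d] /=; lia.
pose M := (8 * (t * t))%N.
exists (fun x => seg_of M%:R^-1 M%:R^-1 (of_nseg (g x))); split; last first.
  move=> x; have M0 : (0 < M)%N by rewrite /M; have := T0 x; lia.
  by split; [exact: axis_of_nseg|rewrite length_nseg // lg divff // pnatr_eq0 -lt0n].
move=> i j; have M0 : (0 < M)%N by rewrite /M; have := T0 i; lia.
case: (eqVneq i j) => [->|ij]; first by rewrite adj_irr; split=> // -[].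
have := @unit_pairs t m.*2 (h i) (h j) (hok i) (hok j); rewrite hadj.
have ne : h i <> h j by move=> /hi /eqP; rewrite (negbTE ij).
move=> /(_ ne); rewrite -/(g i) -/(g j).
case: (adjl _ _ _) => hm.
  by split=> // _; split=> //; apply/nmeet_intersect => //; exact: invM.
split=> // -[_ /nmeet_intersect] => /(_ (invM M0) (invM M0) (wg i) (wg j)).
by rewrite (negbTE hm).
Qed.

Theorem realise2 : two_lengths_axis_parallel_graph R G.
Proof.
have [hi hok hadj] := rep.
pose gg := lay t (v2 t m) (u2 t m) (w2 t m).
have wg p : okl t m.*2 p -> nwf (gg p).
  move=> /nempty_t T0; case: p => [j|j|s s' d] /=; try by lia.
  by rewrite /w2; case: (odd d) => /=; lia.
pose L := (8 * (t * t * m.*2.+1) + 2)%N.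
have lg p : okl t m.*2 p -> nlen (gg p) = L \/ nlen (gg p) = 6%N.
  move=> /nempty_t T0; case: p => [j|j|s s' d] /=; [left|left|]; rewrite ?/L; try by lia.
  by rewrite /w2; case: (odd d) => /=; [right|left]; rewrite ?/L; lia.
have [||rl gp] := @realise_general R 1 1 ltr01 ltr01 t m.*2 G h (fun p => of_nseg (gg p)) _ rep
  (fun p hp => nwf_wf (wg p hp)).
- by rewrite double_gt0.
- move=> p q hp hq ne; have := @two_pairs t m p q m0 hp hq ne; rewrite -/gg.
  by case: (adjl _ _ _) => hc; [exact: ncross_cross|exact: nsep_sep].
exists L%:R, 6, (fun x => seg_of 1 1 (of_nseg (gg (h x)))); split=> //.
- by rewrite ltr0n /L addn2.
- move=> x; split; first exact: axis_of_nseg.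
  have := @length_nseg 1 (gg (h x)) (wg _ (hok x)) isT; rewrite invr1 mulr1 => ->.
  by case: (lg _ (hok x)) => ->; [left|right].
Qed.

Theorem realise3 (eps : R) : 0 < eps -> almost_unit_axis_parallel_graph eps G.
Proof.
move=> e0; have [hi hok hadj] := rep.
pose T := (t * t)%N.
(* Chosen so that the excess [6 * T + 1] is at most [eps * M]. *)
pose k := (Num.truncn eps^-1).+1.
have hk : 1 <= k%:R * eps.
  have := truncnS_gt eps^-1; rewrite -/k => hk.
  by rewrite -ler_pdivrMr // mul1r ltW.
pose M := ((16 * T + 16) * k)%N.
have hM : (16 * T + 16 <= M)%N by rewrite /M leq_pmulr.
have M0 : (0 < M)%N by lia.
pose gg := lay t (v3 m M) (u3 t m M) (w3 t m M).
have ll p : okl t m.*2 p -> (M <= nlen (gg p) <= M + (6 * T + 1))%N && nwf (gg p).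
  move=> hp; have T0 := nempty_t hp.
  case: p hp => [j|j|s s' d] hp /=; rewrite /T; try by lia.
  have hx : (s * t + s' < T)%N.
    by case/and3P: hp => h1 h2 _; rewrite /T; nia.
  have hy : (s' * t + s < T)%N.
    by case/and3P: hp => h1 h2 _; rewrite /T; nia.
  rewrite /w3; case od: (odd d) => /=.
    have hb : (0 < m - d./2)%N.
      by case/and3P: hp => _ _ h3; have := odd_double_half d; rewrite od; lia.
    have : (M <= (m - d./2) * M)%N by rewrite leq_pmull.
    by rewrite -/T; lia.
  by case: ifP => /eqP b0; rewrite -/T; rewrite ?b0; lia.
have wg p : okl t m.*2 p -> nwf (gg p) by move=> /ll /andP[].
have iM := invM M0.
have [||rl gp] := @realise_general R _ _ iM iM t m.*2 G h (fun p => of_nseg (gg p)) _ rep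
  (fun p hp => nwf_wf (wg p hp)).
- by rewrite double_gt0.
- move=> p q hp hq ne; have := @almost_pairs t m M hM p q m0 hp hq ne; rewrite -/gg.
  by case: (adjl _ _ _) => hc; [exact: ncross_cross|exact: nsep_sep].
exists (fun x => seg_of M%:R^-1 M%:R^-1 (of_nseg (gg (h x)))); split=> //.
move=> x; split; first exact: axis_of_nseg.
rewrite length_nseg //; last exact: wg.
have /andP[/andP[l1 l2] _] := ll _ (hok x).
have M0' : 0 < M%:R :> R by rewrite ltr0n.
rewrite ler_pdivlMr // mul1r ler_nat l1 /= ler_pdivrMr //.
apply: le_trans (_ : (M + (6 * T + 1))%:R <= _); first by rewrite ler_nat.
rewrite natrD mulrDl mul1r lerD2l.
apply: le_trans (_ : (16 * T + 16)%:R <= _); first by rewrite ler_nat; lia.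
rewrite /M natrM [_ * k%:R]mulrC mulrA [eps * _]mulrC.
by rewrite ler_peMl.
Qed.

(** With the scales [cos eps / M] and [sin eps / M], a step of horizontal extent [M] becomes a unit
    vector at angle [eps] or [- eps]. A vertical unit segment has unscaled length [M / sin eps],
    which is at least [M], enough to reach all wires. *)
Theorem realise4 (eps : R) : 0 < eps < pi / 2 -> unit_three_directions_graph eps G.
Proof.
move=> /andP[e0 e1]; have [hi hok hadj] := rep.
have s0 : 0 < sin eps by apply: sin_gt0_pi; rewrite e0 /=; have := pi_gt0 R; lra.
have c0 : 0 < cos eps by apply: cos_gt0_pihalf; rewrite e1 andbT; lra.
pose T := (t * t)%N. pose C := (2 * T + 12)%N.
pose M := (2 * (C * T) + 8 * T + 16)%N.
have M0 : (0 < M)%N by rewrite /M; lia.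
have M0' : 0 < M%:R :> R by rewrite ltr0n.
pose La := M%:R / sin eps.
have hLa : M%:R <= La.
  by rewrite /La ler_pdivlMr // ler_piMr ?ler0n //; exact: sin_le1.
pose al := cos eps / M%:R. pose be := sin eps / M%:R.
have al0 : 0 < al by exact: divr_gt0.
have be0 : 0 < be by exact: divr_gt0.
pose w := (M - 2)%N. have hw : (w + 2 = M)%N by rewrite /w; lia.
pose gg := lay t (v4 La) (u4 m La T C w) (w4 R C M w).
have wg p : okl t m.*2 p -> wf (gg p).
  move=> _; have La0 : 0 < La by apply: lt_le_trans hLa.
  case: p => [j|j|s s' d] /=; [by []|by lra|].
  by rewrite /w4; case: (odd d) => /=; rewrite ltr_nat; lia.
have [||rl gp] := @realise_general R al be al0 be0 t m.*2 G h gg _ rep wg.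
- by rewrite double_gt0.
- by move=> p q hp hq ne; apply: (@three_pairs R t m La T C M w).
exists (fun x => seg_of al be (gg (h x))); split=> // x.
have beLa : be * La = 1 by rewrite /be /La; field; rewrite !gt_eqF.
have alM : al * M%:R = cos eps by rewrite /al; field; rewrite gt_eqF.
have beM : be * M%:R = sin eps by rewrite /be; field; rewrite gt_eqF.
case: (h x) => [j|j|s s' d]; rewrite /gg /=.
- split; last by apply: Or31.
  by rewrite /seg_length /= subrr expr0n add0r mulr0 subr0 beLa expr1n sqrtr1.
- split; last by apply: Or31.
  rewrite /seg_length /= subrr expr0n add0r -mulrBr opprB addrC subrK beLa expr1n.
  by rewrite sqrtr1.
- have sq : Num.sqrt (cos eps ^+ 2 + sin eps ^+ 2) = 1 by rewrite cos2Dsin2 sqrtr1.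
  rewrite /w4; case: (odd d); rewrite /seg_length /= -!mulrBr.
    set st := (_ * _ + _)%N.
    have E1 : al * ((st + M)%:R - st%:R) = cos eps by rewrite natrD addrAC subrr add0r.
    have E2 (c : R) : be * (c - (st + M)%:R - (c - st%:R)) = - sin eps.
      by rewrite -beM natrD; ring.
    rewrite E1 E2 sqrrN sq; split=> //; apply: Or33; exists 1.
    by rewrite /= -!mulrBr E1 E2 !mul1r cosN sinN.
  set st := (_ * _ + _)%N.
  have E1 : al * ((st + M)%:R - st%:R) = cos eps by rewrite natrD addrAC subrr add0r.
  have E2 (c : R) : be * (c - st%:R + (st + M)%:R - (c - st%:R + st%:R)) = sin eps.
    by rewrite -beM natrD; ring.
  rewrite E1 E2 sq; split=> //; apply: Or32; exists 1.
  by rewrite /= -!mulrBr E1 E2 !mul1r.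
Qed.

End Realise.

Theorem theorem2 (R : realType) :
  exists C : sgraph -> Prop,
    [/\ hereditary C,
        fo_model_checking_fpt C,
        unbounded_tww C &
        forall G : sgraph, C G ->
          [/\ unit_axis_parallel_graph R G,
              two_lengths_axis_parallel_graph R G,
              forall eps : R, 0 < eps -> almost_unit_axis_parallel_graph eps G &
              forall eps : R, 0 < eps < pi / 2 ->
                unit_three_directions_graph eps G]].
Proof.
exists grids; split.
- exact: grids_hereditary.
- exact: grids_fpt.
- exact: grids_unbounded.
- move=> G [k [h rep]]; split.
  + exact: realise1 rep.
  + exact: (@realise2 R (tk k) k.+1 isT G h rep).
  + exact: (@realise3 R (tk k) k.+1 isT G h rep).
  + exact: (@realise4 R (tk k) k.+1 isT G h rep).
Qed.
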